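(* Let $M$ be a smooth spin $n$-manifold with a possibly singular Riemannian metric $g$ as in the context, with spinor bundle $SM$. The expression $$\int_M\left(\langle D\eta,D\psi\rangle-\langle\nabla\eta,\nabla\psi\rangle\right)\mathrm{dvol}_g$$ is well defined for all $\eta,\psi\in C^\infty_c(SM)$ if and only if in local coordinates and with respect to local orthonormal frames, the following expressions are $L^1$ with respect to $\mathrm{dvol}_g$ (for all values of the free indices): (1) $e_c^{\ \mu}e_d^{\ \nu}-e_d^{\ \mu}e_c^{\ \nu}$; (2) $\left(e_a^{\ \mu}e_b^{\ \nu}-e_a^{\ \nu}e_b^{\ \mu}\right)\omega^{ab}_{\ \ \nu}$, $\;-e_a^{\ \mu}\omega_{b\ d}^{\ d}+e_b^{\ \mu}\omega_{a\ d}^{\ d}+e_c^{\ \mu}\omega^c_{\ ab}-e_c^{\ \mu}\omega^c_{\ ba}$, and $\mathrm{Alt}_{cdef}\left(e_c^{\ \mu}\omega_{efd}\right)$; (3) $e_a^{\ \mu}e_b^{\ \nu}\left(\omega^a_{\ c\mu}\omega^{cb}_{\ \ \nu}-\omega^a_{\ c\nu}\omega^{cb}_{\ \ \mu}\right)$ and $\mathrm{Alt}_{mnpq}\left(\omega_{m\ r}^{\ r}\,\omega_{pqn}-\omega_{pqr}\,\omega^r_{\ nm}+\omega_{mrp}\,\omega^r_{\ nq}\right)$.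
   Context: Einstein summation is used; Greek letters are coordinate indices, Latin letters are orthonormal frame indices, and Latin indices may be raised and lowered freely. $\mathrm{Alt}$ denotes antisymmetrization over the indicated indices, with normalization $\frac1{p!}$ for $p$ indices. $\omega_{abc}=\omega_{ab\mu}e_c^{\ \mu}$. Setting. Fix a smooth principal $\mathrm{Spin}(n)$-bundle $PSpin(M)\to M$ covering an $SO(n)$-reduction $PSO(M)$ of the frame bundle of $M$ (independent of any metric). The spinor bundle $SM$ is the Hermitian bundle associated to the spinor representation; its smooth sections and pointwise Hermitian inner product do not depend on $g$. A possibly singular Riemannian metric $g$ is specified by an $\mathbb R^n$-valued $1$-form $\tau$ on $PSO(M)$ that is $SO(n)$-equivariant, vanishes on vertical vectors, and induces isomorphisms of $T_fPSO(M)/T_f^VPSO(M)$ with $\mathbb R^n$. Pulling $\tau$ back by a smooth local section gives a local orthonormal coframe $\tau^i=e_\mu^{\ i}dx^\mu$, with dual frame $e_i=e_i^{\ \mu}\partial_\mu$, $g_{\mu\nu}=\sum_ie_\mu^{\ i}e_\nu^{\ i}$, $|g|=\det(g_{\mu\nu})$, $\mathrm{dvol}_g=\sqrt{|g|}\,dx^1\cdots dx^n$. Changes of frame are smooth. Standing regularity assumption: outside of a closed set $\mathcal S\subset M$ of measure zero, in local coordinates $e_\mu^{\ i}$ is locally $L^1$ and its first partial derivatives, defined distributionally, are measurable functions. The connection forms $\omega^i_{\ j}=\omega^i_{\ j\mu}dx^\mu$ are determined by $\omega^i_{\ j}+\omega^j_{\ i}=0$ and $d\tau^i+\omega^i_{\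 j}\wedge\tau^j=0$. Clifford matrices $\gamma^i$ are self-adjoint and satisfy $\gamma^i\gamma^j+\gamma^j\gamma^i=2\delta^{ij}$. $\nabla_\mu\psi=\partial_\mu\psi+\frac18\omega_{jk\mu}[\gamma^j,\gamma^k]\psi$, $\nabla_i=e_i^{\ \mu}\nabla_\mu$, $D\psi=-\sqrt{-1}\,\gamma^i\nabla_i\psi$, and $\langle\nabla\eta,\nabla\psi\rangle=\sum_i\langle\nabla_i\eta,\nabla_i\psi\rangle$. ''Well defined'' means that the almost-everywhere-defined function $\langle D\eta,D\psi\rangle-\langle\nabla\eta,\nabla\psi\rangle$ (the combined difference, not each term separately) is integrable with respect to $\mathrm{dvol}_g$. *)

(* Defs.v *)
From HB Require Import structures.
From mathcomp Require Import all_boot all_order all_algebra.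
From mathcomp Require Import perm.
From mathcomp Require Import complex.
From mathcomp Require Import all_classical all_reals all_analysis.

Set Implicit Arguments.
Unset Strict Implicit.
Unset Printing Implicit Defensive.
Import Order.TTheory GRing.Theory Num.Theory.
Import numFieldNormedType.Exports.

Local Open Scope classical_set_scope.
Local Open Scope ring_scope.

(* Lebesgue measure on R^n, by Caratheodory's construction from boxes. The    *)
(* explicit empty box None matters for n = 0 only, where every box            *)
(* [a, b[ is the whole space and has volume 1.                                *)
Section lebesgue_outer.
Variables (R : realType) (n : nat).
Implicit Types (B : option ('rV[R]_n * 'rV[R]_n)) (A : set 'rV[R]_n).

Definition box B : set 'rV[R]_n :=
  if B is Some ab then
    [set x | forall i, ab.1 ord0 i <= x ord0 i < ab.2 ord0 i]
  else set0.

Definition box_volume B : R :=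
  if B is Some ab then \prod_i Num.max 0 (ab.2 ord0 i - ab.1 ord0 i) else 0.

Definition box_cover A : set (nat -> option ('rV[R]_n * 'rV[R]_n)) :=
  [set B | A `<=` \bigcup_k box (B k)].

Local Open Scope ereal_scope.

Definition lebesgue_outer A : \bar R :=
  ereal_inf [set \sum_(k <oo) (box_volume (B k))%:E | B in box_cover A].

Let vol_ge0 B : 0 <= (box_volume B)%:E.
Proof.
rewrite lee_fin; case: B => [ab|]//=; apply: prodr_ge0 => i _.
by rewrite le_max lexx.
Qed.

Lemma lebesgue_outer_ge0 A : 0 <= lebesgue_outer A.
Proof.
apply: le_ereal_inf_tmp => x [B _ <-{x}].
by apply: nneseries_ge0 => k _ _; exact: vol_ge0.
Qed.

Lemma le_lebesgue_outer :
  {homo lebesgue_outer : A B / A `<=` B >-> A <= B}.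
Proof.
move=> A B AB; apply/ereal_inf_le_tmp => x [C BC <-{x}].
by exists C => //; exact: subset_trans AB BC.
Qed.

Lemma lebesgue_outer0 : lebesgue_outer set0 = 0.
Proof.
apply/eqP; rewrite eq_le lebesgue_outer_ge0 andbT.
apply: ereal_inf_lbound; exists (fun=> None) => //=.
by rewrite eseries0.
Qed.

Lemma lebesgue_outer_sigma_subadditive : sigma_subadditive lebesgue_outer.
Proof.
move=> A; have [[i ioo]|] := pselect (exists i, lebesgue_outer (A i) = +oo).
  rewrite (eseries_pinfty _ _ ioo) ?leey// => k _.
  by rewrite -ltNye (lt_le_trans _ (lebesgue_outer_ge0 _)).
rewrite -forallNE => Aoo.
suff add2e (e : {posnum R}) : lebesgue_outer (\bigcup_k A k) <=
    \sum_(i <oo) lebesgue_outer (A i) + e%:num%:E.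
  by apply/lee_addgt0Pr => _/posnumP[].
rewrite (le_trans _ (epsilon_trick _ _ _))//; last first.
  by move=> k; exact: lebesgue_outer_ge0.
pose P k (B : nat -> option _) := box_cover (A k) B /\
  \sum_(j <oo) (box_volume (B j))%:E <= lebesgue_outer (A k) + (e%:num / (2 ^ k.+1)%:R)%:E.
have [G PG] : {G & forall k, P k (G k)}.
  apply: (@choice _ _ P) => k; rewrite /P /lebesgue_outer.
  set S := (X in ereal_inf X); move infS : (ereal_inf S) => iS.
  case: iS infS => [r Sr|Soo|Soo].
  - have en1 : (0 < e%:num / (2 ^ k.+1)%:R)%R by [].
    have /(lb_ereal_inf_adherent en1) : ereal_inf S \is a fin_num by rewrite Sr.
    move=> [x [B AB muBx] xS].
    by exists B; split => //; rewrite muBx -Sr; exact/ltW.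
  - by have := Aoo k; rewrite /lebesgue_outer Soo.
  - suff : lbound S 0 by move/le_ereal_inf_tmp; rewrite Soo.
    by move=> /= _ [B AB <-]; exact: nneseries_ge0.
pose vol B : \bar R := (box_volume B)%:E.
have muG_ge0 x : 0 <= (vol \o uncurry G) x by exact: vol_ge0.
apply: (@le_trans _ _ (\esum_(i in setT) (vol \o uncurry G) i)).
  apply: ereal_inf_lbound => /=.
  have /card_esym/ppcard_eqP[f] := card_nat2.
  exists (uncurry G \o f).
    apply: (@subset_trans _  (\bigcup_k \bigcup_j box (G k j))) => [t [i _]|].
      by move=> /(PG i).1 [j _ ?]; exists i => //; exists j.
    move=> t [i _ [j _ Bijt]]; exists (f^-1%FUN (i, j)) => //=.
    by rewrite invK ?inE.
  rewrite -(esum_pred_image (vol \o uncurry G) _ xpredT) ?[fun=> _]set_true//.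
  by rewrite image_eq.
rewrite (_ : esum _ _ = \sum_(i <oo) \sum_(j <oo ) vol (G i j)); last first.
  pose J : nat -> set (nat * nat) := fun i => [set (i, j) | j in setT].
  rewrite (_ : setT = \bigcup_k J k); last first.
    by rewrite predeqE => -[a b]; split => // _; exists a => //; exists b.
  rewrite esum_bigcupT /=; last 2 first.
    - apply/trivIsetP => i j _ _ ij.
      rewrite predeqE => -[k m] /=; split => //= -[] [_] _ [<-{k} _].
      by move=> [m' _] [] /esym/eqP; rewrite (negbTE ij).
    - by move=> /= [k m]; exact: vol_ge0.
  rewrite -(image_id [set: nat]) -fun_true esum_pred_image//; last first.
    by move=> k _; apply: esum_ge0 => q _; exact: muG_ge0.
  apply: eq_eseriesr => /= j _.
  rewrite -(esum_pred_image (vol \o uncurry G) (pair j) predT)//; last first.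
    by move=> ? ? _ _; exact: (@can_inj _ _ _ snd).
  by congr esum; rewrite predeqE => -[a b]; split; move=> [i _ <-]; exists i.
apply: lee_lim.
- apply: is_cvg_nneseries => k *.
  by apply: nneseries_ge0 => m *; exact: (muG_ge0 (k, m)).
- apply: is_cvg_nneseries => k *.
  by apply: adde_ge0 => //; exact: lebesgue_outer_ge0.
- by near=> k; apply: lee_sum => i _; exact: (PG i).2.
Unshelve. all: by end_near. Qed.

HB.instance Definition _ := isOuterMeasure.Build R 'rV[R]_n lebesgue_outer
  lebesgue_outer0 lebesgue_outer_ge0 le_lebesgue_outer
  lebesgue_outer_sigma_subadditive.

End lebesgue_outer.
Arguments lebesgue_outer {R n}.

Notation Rn_leb R n := (caratheodory_type (@lebesgue_outer R n)).

HB.instance Definition _ (R : realType) (n : nat) :=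
  isMeasure.Build _ (Rn_leb R n) R (@lebesgue_outer R n : set (Rn_leb R n) -> _)
    (@caratheodory_measure0 _ _ _) (@caratheodory_measure_ge0 _ _ _)
    (@caratheodory_measure_sigma_additive _ _ _).

Definition lebesgue_Rn (R : realType) (n : nat) :
  {measure set (Rn_leb R n) -> \bar R} :=
  (@lebesgue_outer R n : set (Rn_leb R n) -> \bar R).
Arguments lebesgue_Rn {R n}.

Section smooth_functions.
Variables (R : realType) (n : nat).
Implicit Types (U : set 'rV[R]_n) (f : 'rV[R]_n -> R).

Definition partial (i : 'I_n) f : 'rV[R]_n -> R :=
  fun y => 'D_(delta_mx ord0 i) f y.

(* C^k functions on an open set U; nothing is asked of f outside of U. *)
Fixpoint Ck_on (k : nat) U f : Prop :=
  {in U, continuous f} /\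
  if k is k'.+1 then
    forall i, {in U, forall y, derivable f y (delta_mx ord0 i)} /\
              Ck_on k' U (partial i f)
  else True.

Definition smooth_on U f := forall k, Ck_on k U f.

Definition test_function U f :=
  smooth_on setT f /\
  exists K, [/\ compact K, K `<=` U & forall y, ~ K y -> f y = 0].

Definition locally_integrable U f :=
  forall K, compact K -> K `<=` U ->
    lebesgue_Rn.-integrable (K : set (Rn_leb R n)) (EFin \o f).

(* The distributional derivative of f in the i-th coordinate on the open set  *)
(* U is the measurable function h. Integrability of h * phi for all test      *)
(* functions phi says that h defines a distribution.                          *)
Definition weak_partial U (i : 'I_n) f (h : 'rV[R]_n -> R) :=
  measurable_fun (U : set (Rn_leb R n)) h /\
  forall phi : 'rV[R]_n -> R, test_function U phi ->
    lebesgue_Rn.-integrable (U : set (Rn_leb R n))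
      (EFin \o (fun y => h y * phi y)) /\
    \int[lebesgue_Rn]_(y in (U : set (Rn_leb R n))) (f y * partial i phi y) =
    - \int[lebesgue_Rn]_(y in (U : set (Rn_leb R n))) (h y * phi y).

End smooth_functions.

Section manifolds.
Variables (R : realType) (n : nat).

Record chart (T : topologicalType) := Chart {
  dom : set T;
  coord : T -> 'rV[R]_n;
  icoord : 'rV[R]_n -> T;
  _ : open dom;
  _ : open (coord @` dom);
  _ : {in dom, cancel coord icoord};
  _ : {in dom, continuous coord};
  _ : {in coord @` dom, continuous icoord} }.

Definition smooth_transition (T : topologicalType) (c d : chart T) :=
  forall i, smooth_on (coord c @` (dom c `&` dom d))
                      (fun y => coord d (icoord c y) ord0 i).

Definition compatible (T : topologicalType) (c d : chart T) :=
  smooth_transition c d /\ smooth_transition d c.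

(* Smooth n-manifolds, with a maximal atlas. *)
Record manifold := Manifold {
  msort :> ptopologicalType;
  _ : hausdorff_space msort;
  _ : @second_countable msort;
  atlas : set (chart msort);
  _ : forall x, exists2 c, atlas c & dom c x;
  _ : forall c d, atlas c -> atlas d -> compatible c d;
  _ : forall c, (forall d, atlas d -> compatible c d) -> atlas c }.

Variable M : manifold.
Implicit Types (c d : chart M) (V N : set M) (x : M).

Definition smooth_fun V (f : M -> R) :=
  forall c, atlas c -> smooth_on (coord c @` (V `&` dom c)) (f \o icoord c).

Definition smooth_cfun V (f : M -> R[i]) :=
  smooth_fun V (@complex.Re R \o f) /\ smooth_fun V (@complex.Im R \o f).

(* Jacobian of the change of coordinates from c to d. With the row vector     *)
(* convention of mathcomp, the components of a tangent vector transform as    *)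
(* v |-> v *m jac c d x, and entry (mu, nu) is d x_d^nu / d x_c^mu.           *)
Definition jac c d x : 'M[R]_n := 'J (coord d \o icoord c) (coord c x).

Definition null_set N :=
  forall c, atlas c -> lebesgue_outer (coord c @` (N `&` dom c)) = 0%E.

Definition ae_on V (P : M -> Prop) := null_set [set x | V x /\ ~ P x].

(* These generate the sigma-algebra of Lebesgue measurable sets of M. *)
Definition chart_measurable : set (set M) :=
  [set A | exists c, [/\ atlas c, A `<=` dom c &
     measurable ((coord c @` A) : set (Rn_leb R n))]].

End manifolds.

Notation mleb M := (g_sigma_algebraType (@chart_measurable _ _ M)).

Section principal_bundles.
Variables (R : realType) (n : nat) (M : manifold R n).

(* A smooth principal G-bundle, where G is a group of matrices over K and     *)
(* smooth_K says what smooth K-valued functions are. The smooth structure is  *)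
(* given by a covering family of local sections with smooth transition        *)
(* functions.                                                                 *)
Record principal_bundle (K : pzRingType) (m : nat) (G : set 'M[K]_m)
    (smooth_K : set M -> (M -> K) -> Prop) := PrincipalBundle {
  total :> Type;
  proj : total -> M;
  act : total -> 'M[K]_m -> total;
  triv : set (set M * (M -> total));
  _ : forall p g, G g -> proj (act p g) = proj p;
  _ : forall p, act p 1%:M = p;
  _ : forall p g h, G g -> G h -> act (act p g) h = act p (g *m h);
  _ : forall p q, proj p = proj q -> exists! g, G g /\ q = act p g;
  _ : forall Vs, triv Vs ->
        open Vs.1 /\ forall x, Vs.1 x -> proj (Vs.2 x) = x;
  _ : forall x, exists2 Vs, triv Vs & Vs.1 x;
  _ : forall Vs Ws, triv Vs -> triv Ws ->
        exists g : M -> 'M[K]_m,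
          (forall x, Vs.1 x -> Ws.1 x ->
             G (g x) /\ Ws.2 x = act (Vs.2 x) (g x)) /\
          forall i j, smooth_K (Vs.1 `&` Ws.1) (fun x => g x i j) }.

Definition smooth_section (K : pzRingType) (m : nat) (G : set 'M[K]_m) smooth_K
    (P : principal_bundle G smooth_K) (V : set M) (s : M -> P) :=
  [/\ open V, forall x, V x -> proj (s x) = x &
   forall Ws, triv Ws ->
     exists g : M -> 'M[K]_m,
       (forall x, V x -> Ws.1 x -> G (g x) /\ s x = act (Ws.2 x) (g x)) /\
       forall i j, smooth_K (V `&` Ws.1) (fun x => g x i j)].

Definition SO : set 'M[R]_n := [set A | A *m A^T = 1%:M /\ \det A = 1].

(* An SO(n)-reduction of the frame bundle: a principal SO(n)-bundle with an   *)
(* equivariant bundle map to the frame bundle of M. A point f maps to a basis *)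
(* of the tangent space at proj f, whose vectors have as components in a      *)
(* chart c the rows of frame f c; the right action is                         *)
(* (f A)_j = \sum_i f_i A_ij.                                                 *)
Record SO_reduction := SOReduction {
  PSO :> principal_bundle SO (@smooth_fun R n M);
  frame : PSO -> chart R n M -> 'M[R]_n;
  _ : forall f c d, atlas c -> atlas d -> dom c (proj f) -> dom d (proj f) ->
        frame f d = frame f c *m jac c d (proj f);
  _ : forall f c, atlas c -> dom c (proj f) -> frame f c \in unitmx;
  _ : forall f A c, SO A -> atlas c -> dom c (proj f) ->
        frame (act f A) c = A^T *m frame f c;
  _ : forall V s c, smooth_section V s -> atlas c -> V `<=` dom c ->
        forall i mu, smooth_fun V (fun x => frame (s x) c i mu) }.

End principal_bundles.

Section spin.
Variables (R : realType) (n : nat).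

(* Rank of the (complex) spinor representation. *)
Definition spinor_dim := (2 ^ n./2)%N.

Definition is_clifford (gamma : 'I_n -> 'M[R[i]]_spinor_dim) :=
  (forall i, map_mx conjc (gamma i)^T = gamma i) /\
  forall i j, gamma i *m gamma j + gamma j *m gamma i = ((i == j)%:R *+ 2)%:M.

Variable gamma : 'I_n -> 'M[R[i]]_spinor_dim.

Definition clifford_mul (v : 'rV[R]_n) : 'M[R[i]]_spinor_dim :=
  \sum_i real_complex R (v ord0 i) *: gamma i.

(* Spin(n), as the group of products of an even number of unit vectors. These *)
(* are taken in End of the spinor space rather than in the Clifford algebra,  *)
(* as the spinor representation of the even Clifford algebra is faithful; the *)
(* spinor representation is then the inclusion.                               *)
Definition Spin : set 'M[R[i]]_spinor_dim :=
  [set s | exists vs : seq 'rV[R]_n,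
     [/\ ~~ odd (size vs), forall v, v \in vs -> v *m v^T = 1%:M &
         s = \prod_(v <- vs) clifford_mul v]].

(* The covering Spin(n) -> SO(n), as a relation: s (v . gamma) s^-1 =         *)
(* (A v) . gamma for all vectors v.                                           *)
Definition spin_covers (s : 'M[R[i]]_spinor_dim) (A : 'M[R]_n) :=
  forall j, s *m gamma j = (\sum_i real_complex R (A i j) *: gamma i) *m s.

Variables (M : manifold R n) (P : SO_reduction M).

Record spin_structure := SpinStructure {
  PSpin :> principal_bundle Spin (@smooth_cfun R n M);
  cov : PSpin -> P;
  _ : forall p, proj (cov p) = proj p;
  _ : forall p s A, Spin s -> SO A -> spin_covers s A ->
        cov (act p s) = act (cov p) A;
  _ : forall V s, smooth_section V s -> smooth_section V (cov \o s) }.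

Variable S : spin_structure.

(* Smooth compactly supported sections of the associated bundle SM, as        *)
(* equivariant functions on PSpin(M).                                         *)
Definition compact_spinor (psi : S -> 'cV[R[i]]_spinor_dim) :=
  [/\ forall p s, Spin s -> s *m psi (act p s) = psi p,
      forall V (s : M -> S), smooth_section V s ->
        forall k, smooth_cfun V (fun x => psi (s x) k ord0) &
      compact (closure [set x | exists2 p, proj p = x & psi p <> 0])].

End spin.

Section singular_metrics.
Variables (R : realType) (n : nat) (M : manifold R n) (P : SO_reduction M).

(* A 1-form on PSO(M) vanishing on vertical vectors amounts, at every point f *)
(* of PSO(M), to a linear map from T_f PSO(M) / T_f^V PSO(M), that is from    *)
(* the tangent space of M at proj f, to R^n. Entry (mu, i) of tau f c is the  *)
(* component e_mu^i in the chart c. Equivariance is R_A^* tau = A^-1 tau.     *)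
Record singular_metric := SingularMetric {
  tau : P -> chart R n M -> 'M[R]_n;
  sing : set M;
  _ : forall f c d, atlas c -> atlas d -> dom c (proj f) -> dom d (proj f) ->
        tau f c = jac c d (proj f) *m tau f d;
  _ : forall f A c, SO A -> atlas c -> dom c (proj f) ->
        (tau (act f A) c)^T = invmx A *m (tau f c)^T;
  _ : forall f c, atlas c -> dom c (proj f) -> tau f c \in unitmx;
  _ : closed sing;
  _ : null_set sing;
  _ : forall c V (s : M -> P), atlas c -> smooth_section V s -> V `<=` dom c ->
        forall mu i,
        let e := fun y => tau (s (icoord c y)) c mu i in
        locally_integrable (coord c @` (V `\` sing)) e /\
        forall nu, exists h, weak_partial (coord c @` (V `\` sing)) nu e h }.

Variable g : singular_metric.
Implicit Types (c : chart R n M) (V : set M) (s : M -> P).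

(* e_mu^i and e_i^mu for the local section s of PSO(M) in the chart c. *)
Definition coframe c s (x : M) (mu i : 'I_n) : R := tau g (s x) c mu i.
Definition dual_frame c s (x : M) (i mu : 'I_n) : R :=
  invmx (tau g (s x) c) i mu.

Definition metric_mx c s (x : M) : 'M[R]_n :=
  \matrix_(mu, nu) \sum_i coframe c s x mu i * coframe c s x nu i.

(* w x i j mu are the components omega^i_(j mu) of the connection forms, a.e. *)
(* on V: they are antisymmetric and d tau^i + omega^i_j /\ tau^j = 0, where   *)
(* de nu mu i is the distributional derivative of e_mu^i in the direction nu. *)
Definition connection_forms c V s (w : M -> 'I_n -> 'I_n -> 'I_n -> R) :=
  exists de : 'I_n -> 'I_n -> 'I_n -> M -> R,
    (forall nu mu i, weak_partial (coord c @` (V `\` sing g)) nu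
       (fun y => coframe c s (icoord c y) mu i) (de nu mu i \o icoord c)) /\
    ae_on V (fun x =>
      (forall i j mu, w x i j mu + w x j i mu = 0) /\
      forall i mu nu,
        de mu nu i x - de nu mu i x +
        \sum_j (w x i j mu * coframe c s x nu j -
                w x i j nu * coframe c s x mu j) = 0).

(* omega_abc = omega_ab mu e_c^mu *)
Definition omega_fr c s (w : M -> 'I_n -> 'I_n -> 'I_n -> R)
    (x : M) (a b d : 'I_n) : R :=
  \sum_mu w x a b mu * dual_frame c s x d mu.

(* mu is the measure dvol_g, i.e. it is sqrt |g| dx^1 ... dx^n in coordinates *)
Definition is_dvol (mu : {measure set (mleb M) -> \bar R}) :=
  forall c V s (A : set M), atlas c -> smooth_section V s -> V `<=` dom c ->
    A `<=` V -> measurable ((coord c @` A) : set (Rn_leb R n)) ->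
    mu A = (\int[lebesgue_Rn]_(y in ((coord c @` A) : set (Rn_leb R n)))
              (Num.sqrt (\det (metric_mx c s (icoord c y))))%:E)%E.

(* L^1 with respect to mu for a function defined a.e. on the open set V only  *)
(* through the choice of coordinates and of a frame.                          *)
Definition L1loc (mu : {measure set (mleb M) -> \bar R}) V (h : M -> R) :=
  forall K : set M, compact K -> K `<=` V ->
    mu.-integrable (K : set (mleb M)) (EFin \o h).

End singular_metrics.

Definition Alt4 (R : realType) (n : nat)
    (T : 'I_n -> 'I_n -> 'I_n -> 'I_n -> R) (a b c d : 'I_n) : R :=
  let k := tnth [tuple a; b; c; d] in
  (4`!%:R)^-1 * \sum_(s : 'S_4) (-1) ^+ s *
    T (k (s (inord 0))) (k (s (inord 1))) (k (s (inord 2))) (k (s (inord 3))).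

Section dirac.
Variables (R : realType) (n : nat).
Variables (gamma : 'I_n -> 'M[R[i]]_(spinor_dim n)).
Variables (M : manifold R n) (P : SO_reduction M) (S : spin_structure gamma P).
Variable g : singular_metric P.
Implicit Types (c : chart R n M) (V : set M) (s : M -> S).
Implicit Types (w : M -> 'I_n -> 'I_n -> 'I_n -> R).
Implicit Types (psi eta : S -> 'cV[R[i]]_(spinor_dim n)).

Definition cpartial c (mu : 'I_n) (u : M -> R[i]) (x : M) : R[i] :=
  Complex (partial mu (fun y => complex.Re (u (icoord c y))) (coord c x))
          (partial mu (fun y => complex.Im (u (icoord c y))) (coord c x)).

Definition nabla_coord c s w psi (mu : 'I_n) (x : M) :
    'cV[R[i]]_(spinor_dim n) :=
  \col_k cpartial c mu (fun z => psi (s z) k ord0) x +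
  8%:R^-1 *: \sum_j \sum_k real_complex R (w x j k mu) *:
     ((gamma j *m gamma k - gamma k *m gamma j) *m psi (s x)).

Definition nabla c s w psi (i : 'I_n) (x : M) : 'cV[R[i]]_(spinor_dim n) :=
  \sum_mu real_complex R (dual_frame g c (@cov _ _ _ _ _ S \o s) x i mu) *:
    nabla_coord c s w psi mu x.

Definition dirac c s w psi (x : M) : 'cV[R[i]]_(spinor_dim n) :=
  - Complex 0 1 *: \sum_i gamma i *m nabla c s w psi i x.

Definition herm (u v : 'cV[R[i]]_(spinor_dim n)) : R[i] :=
  \sum_k conjc (u k ord0) * v k ord0.

Definition integrand c s w eta psi (x : M) : R[i] :=
  herm (dirac c s w eta x) (dirac c s w psi x) -
  \sum_i herm (nabla c s w eta i x) (nabla c s w psi i x).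

(* The a.e. defined function <D eta, D psi> - <nabla eta, nabla psi>, which F *)
(* represents if it agrees a.e. with the expression in any local coordinates  *)
(* and frames, is integrable.                                                 *)
Definition well_defined (mu : {measure set (mleb M) -> \bar R}) eta psi :=
  exists F : M -> R[i],
    [/\ forall c V s w, atlas c -> smooth_section V s -> V `<=` dom c ->
          connection_forms g c V (@cov _ _ _ _ _ S \o s) w ->
          ae_on V (fun x => F x = integrand c s w eta psi x),
        mu.-integrable setT (EFin \o (@complex.Re R \o F)) &
        mu.-integrable setT (EFin \o (@complex.Im R \o F))].

End dirac.

(* Main.v *)
(* In an orthonormal frame, <D eta, D psi> - <nabla eta, nabla psi> is the sum   *)
(* over mu, nu of <nabla_mu eta, Q^(mu nu) nabla_nu psi>, where Q^(mu nu) is the  *)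
(* sum of e_a^mu e_b^nu gamma^a gamma^b over a != b. Here nabla_mu = d_mu + Om_mu *)
(* with Om_mu = 1/4 omega_(jk mu) gamma^j gamma^k skew-adjoint, so that the       *)
(* integrand is a quadratic form in the smooth quantities eta, psi, d_mu eta,     *)
(* d_mu psi, with coefficient matrices Q^(mu nu), C^mu = sum_nu Q^(mu nu) Om_nu   *)
(* and W = sum_(mu nu) Om_mu Q^(mu nu) Om_nu.                                     *)
(*                                                                                *)
(* If these are L^1, then so is the integrand. Conversely, in a smooth local      *)
(* frame of the spinor bundle, insert eta, psi = chi u and chi x^mu u, for u      *)
(* constant and chi a cut-off: polarization recovers Q, C and W on the set where  *)
(* chi = 1. A frame of PSO(M) that does not lift to PSpin(M) differs locally from *)
(* one that does by a smooth rotation, which adds smooth terms to Om_mu and       *)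
(* rotates the gamma^a.                                                           *)
(*                                                                                *)
(* Finally, Q, C and W are expanded in the linearly independent products of       *)
(* distinct gamma matrices, the coefficients being read off by traces. Q has      *)
(* degree 2 and gives (1); C has parts of degree 0, 2 and 4, which are the three  *)
(* expressions (2); W has parts of degree 0 and 4, which are the expressions (3), *)
(* and no part of degree 2, because it is self-adjoint.                           *)
(*                                                                                *)
(* The connection forms are only measurable: that they exist and transform as     *)
(* usual rests on the chain rule for distributional derivatives, which is         *)
(* obtained by duality from the change of variables formula. For the transition   *)
(* maps of M the latter is contained in the existence of the measure dvol_g.      *)

(* The integrand is a sesquilinear form in the values and first derivatives of two spinors. Testing
   it on enough spinors recovers its coefficient matrices, so the theorem amounts to computing these
   matrices in the basis of products of distinct gamma matrices. The matrices Q, C and W above are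
   [Qm], [Clin] and [Wquad] below.

   Algebra. [quadE] cancels the diagonal of the Dirac term against the second term, and [quad_split]
   sorts the rest by the number of connection factors. The Clifford relations bring C and W to
   normal order ([G2_mul], [Wquad_normal]); the outcome is [Clin_explicit] and [Wquad_explicit],
   where the degree 2 part of W is absent because W is self-adjoint ([Wquad_clif]). Conversely,
   distinct basis elements are orthogonal for the trace form, which gives back the coefficients
   ([tr_G2_clif024], [alt_tr]).

   Necessity is local. [local_box] supplies a cut-off function, [test_spinor] the spinors that are
   constant or linear in a lifted frame, and [sesq_integrable] isolates the three matrices. A frame
   of PSO(M) is compared with a lifted one by [adapted_spin_section]; the error terms are smooth,
   hence bounded on compact sets, and are subtracted in [mcint_Clin_of] and [mcint_Wquad_of]. This
   gives [forward_local], and [coefs_local] passes to compact sets by a finite cover.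

   Sufficiency. By [integrand_split] the integrand is a combination of integrable coefficients with
   bounded factors, near every point. A finite cover of the support of one spinor is glued in
   [well_defined_of_coefs], which requires that the integrand depend neither on the chart nor on the
   frame ([integrand_represents]).

   That independence has two sources. Connection forms are unique a.e. and transform as usual
   ([connection_unique], [connection_change]); since the coframe is only weakly differentiable, this
   uses the chain rule [weak_pullback], which comes from the Piola identity and the change of
   variables formula. And the derivative of a lifted rotation is determined by that of the rotation
   ([spin_rigidity], [spin_derivative]), so the inhomogeneous terms cancel in
   [nabla_coord_change]. *)
Require Import Defs.
From HB Require Import structures.
From mathcomp Require Import all_boot all_order all_algebra.
From mathcomp Require Import perm.
From mathcomp Require Import complex.
From mathcomp Require Import all_classical all_reals all_analysis.
From mathcomp Require Import measurable_realfun.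
From mathcomp Require Import ring lra.

Set Implicit Arguments.
Unset Strict Implicit.
Unset Printing Implicit Defensive.
Import Order.TTheory GRing.Theory Num.Theory.
Import numFieldNormedType.Exports.

Local Open Scope classical_set_scope.
Local Open Scope ring_scope.

(** * Clifford algebra and normal ordering *)

Section clifford.
Variables (C : numFieldType) (cj : {rmorphism C -> C}) (cjK : involutive cj).
Variables (n N : nat) (g : 'I_n -> 'M[C]_N).

Definition adjmx m p (A : 'M[C]_(m, p)) : 'M[C]_(p, m) := map_mx cj A^T.

Lemma adjmxM m p q (A : 'M[C]_(m, p)) (B : 'M[C]_(p, q)) :
  adjmx (A *m B) = adjmx B *m adjmx A.
Proof. by rewrite /adjmx trmx_mul map_mxM. Qed.

Lemma adjmxD m p (A B : 'M[C]_(m, p)) : adjmx (A + B) = adjmx A + adjmx B.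
Proof. by rewrite /adjmx linearD /= map_mxD. Qed.

Lemma adjmxN m p (A : 'M[C]_(m, p)) : adjmx (- A) = - adjmx A.
Proof. by rewrite /adjmx linearN /= map_mxN. Qed.

Lemma adjmx0 m p : adjmx (0 : 'M[C]_(m, p)) = 0.
Proof. by rewrite /adjmx trmx0 map_mx0. Qed.

Lemma adjmx_sum m p I (r : seq I) (P : pred I) (F : I -> 'M[C]_(m, p)) :
  adjmx (\sum_(i <- r | P i) F i) = \sum_(i <- r | P i) adjmx (F i).
Proof. by apply: (big_morph _ (@adjmxD m p)); exact: adjmx0. Qed.

Lemma adjmxZ m p a (A : 'M[C]_(m, p)) : adjmx (a *: A) = cj a *: adjmx A.
Proof. by rewrite /adjmx linearZ /= map_mxZ. Qed.

Lemma adjmxK m p (A : 'M[C]_(m, p)) : adjmx (adjmx A) = A.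
Proof. by apply/matrixP => i j; rewrite !mxE cjK. Qed.

Lemma adjmx1 m : adjmx (1%:M : 'M[C]_m) = 1%:M.
Proof. by rewrite /adjmx trmx1 map_mx1. Qed.

Hypothesis adj_g : forall i, adjmx (g i) = g i.
Hypothesis acg : forall i j, g i *m g j + g j *m g i = ((i == j)%:R *+ 2)%:M.

Lemma gg i : g i *m g i = 1%:M.
Proof.
apply: (@scalerI _ _ 2); first by rewrite pnatr_eq0.
by rewrite scale_scalar_mx mulr1 scaler_nat mulr2n acg eqxx.
Qed.

Lemma gN i j : i != j -> g i *m g j = - (g j *m g i).
Proof.
by move=> ij; apply/eqP; rewrite -addr_eq0 acg (negbTE ij) mul0rn raddf0.
Qed.

Definition gprod (s : seq 'I_n) : 'M[C]_N :=
  foldr (fun i X => g i *m X) 1%:M s.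

Lemma gprod_cat s t : gprod (s ++ t) = gprod s *m gprod t.
Proof. by elim: s => [|i s IH]/=; rewrite ?mul1mx// IH mulmxA. Qed.

Lemma gprod1 i : gprod [:: i] = g i.
Proof. by rewrite /= mulmx1. Qed.

Lemma adj_gprod s : adjmx (gprod s) = gprod (rev s).
Proof.
elim: s => [|i s IH]; first by rewrite /= adjmx1.
by rewrite rev_cons -cats1 gprod_cat gprod1 /= adjmxM IH adj_g.
Qed.

Lemma gprod_revK s : gprod (rev s) *m gprod s = 1%:M.
Proof.
elim: s => [|i s IH]; first by rewrite /= mulmx1.
rewrite rev_cons -cats1 gprod_cat gprod1 /= -mulmxA (mulmxA (g i)).
by rewrite gg mul1mx.
Qed.

(** Moving [g i] through the product costs a sign for every factor other than [g i]; the exponent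
    has the parity of the number of these factors. *)
Lemma gprod_comm i s :
  g i *m gprod s = (-1) ^+ (size s + count_mem i s) *: (gprod s *m g i).
Proof.
elim: s => [|j s IH]; first by rewrite /= scale1r mul1mx mulmx1.
have E : g i *m g j = (-1) ^+ (1 + (j == i)) *: (g j *m g i).
  case: (eqVneq j i) => [->|ij]; first by rewrite sqrrN expr1n scale1r.
  by rewrite addn0 expr1 scaleN1r gN// eq_sym.
rewrite /= mulmxA E -scalemxAl -mulmxA IH -scalemxAr scalerA -exprD mulmxA.
by rewrite addnACA add1n.
Qed.

(** In this case [g i] anticommutes with the product, while conjugation by [g i] preserves
    traces. *)
Lemma tr_gprod0 i s : ~~ odd (size s) -> odd (count_mem i s) ->
  \tr (gprod s) = 0.
Proof.
move=> es os; apply/eqP; rewrite -eqNr; apply/eqP/esym.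
rewrite -{1}[gprod s]mul1mx -(gg i) -mulmxA gprod_comm.
rewrite -signr_odd oddD os addbT es expr1 scaleN1r mulmxN linearN/=.
by rewrite mulmxA mxtrace_mulC mulmxA gg mul1mx.
Qed.

(** Distinct generators anticommute, so their products are alternating as they stand; to
    antisymmetrize it is enough to put 0 where an index is repeated. *)
Definition G2 a b := if a == b then 0 else gprod [:: a; b].
Definition G4 a b c d :=
  if uniq [:: a; b; c; d] then gprod [:: a; b; c; d] else 0.

Lemma G2E a b : g a *m g b = (a == b)%:R%:M + G2 a b.
Proof.
rewrite /G2; case: eqVneq => [->|ab]; first by rewrite gg addr0.
by rewrite raddf0 add0r /= mulmx1.
Qed.

Lemma G2C a b : G2 b a = - G2 a b.
Proof.
rewrite /G2 eq_sym; case: eqVneq => [|ab]; first by rewrite oppr0.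
by rewrite /= !mulmx1 gN// eq_sym.
Qed.

Lemma adj_G2 a b : adjmx (G2 a b) = - G2 a b.
Proof.
rewrite -G2C /G2 (eq_sym b); case: ifP => _; first exact: adjmx0.
by rewrite adj_gprod.
Qed.

Lemma mul_gl a b (X : 'M[C]_N) : a != b -> g a *m (g b *m X) = - (g b *m (g a *m X)).
Proof. by move=> ab; rewrite mulmxA gN// mulNmx mulmxA. Qed.

Lemma mul_gg a (X : 'M[C]_N) : g a *m (g a *m X) = X.
Proof. by rewrite mulmxA gg mul1mx. Qed.

Lemma G4_swap01 a b c d : G4 b a c d = - G4 a b c d.
Proof.
rewrite /G4 (perm_uniq (_ : perm_eq _ [:: a; b; c; d])); last first.
  by rewrite (perm_catCA [:: b] [:: a]).
case: ifP => [|_]; last by rewrite oppr0.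
by rewrite /= !inE !negb_or => /andP[/andP[ab _] _]; rewrite mul_gl ?opprK 1?eq_sym.
Qed.

Lemma G4_swap12 a b c d : G4 a c b d = - G4 a b c d.
Proof.
rewrite /G4 (perm_uniq (_ : perm_eq _ [:: a; b; c; d])); last first.
  by rewrite perm_cons (perm_catCA [:: c] [:: b]).
case: ifP => [|_]; last by rewrite oppr0.
rewrite /= !inE !negb_or => /and4P[_ /andP[bc _] _ _].
by rewrite (mul_gl _ (_ : c != b)) 1?eq_sym// mulmxN.
Qed.

Lemma G4_swap23 a b c d : G4 a b d c = - G4 a b c d.
Proof.
rewrite /G4 (perm_uniq (_ : perm_eq _ [:: a; b; c; d])); last first.
  by rewrite !perm_cons (perm_catCA [:: d] [:: c]).
case: ifP => [|_]; last by rewrite oppr0.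
rewrite /= !inE !negb_or => /and4P[_ _ cd _].
by rewrite (mul_gl _ (_ : d != c)) 1?eq_sym// !mulmxN.
Qed.

Lemma adj_G4 a b c d : adjmx (G4 a b c d) = G4 a b c d.
Proof.
rewrite {1}(_ : G4 a b c d = G4 d c b a); last first.
  rewrite (G4_swap23 d c a b) (G4_swap12 d a c b) (G4_swap01 a d c b).
  rewrite (G4_swap23 a d b c) (G4_swap12 a b d c) (G4_swap23 a b c d) !opprK.
  by [].
rewrite /G4 -(rev_uniq [:: d; c; b; a]); case: ifP => _; last exact: adjmx0.
by rewrite adj_gprod.
Qed.

(** Wick's rule: each index shared by the two factors is contracted. No contraction leaves degree 4,
    one leaves degree 2, two leave a scalar. The proof runs through the possible coincidences. *)
Lemma G2_mul a b c d : G2 a b *m G2 c d =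
  G4 a b c d + ((b == c)%:R *: G2 a d - (b == d)%:R *: G2 a c
              - (a == c)%:R *: G2 b d + (a == d)%:R *: G2 b c)
  + ((b == c)%:R * (a == d)%:R - (b == d)%:R * (a == c)%:R)%:M.
Proof.
have G2n x y : x != y -> G2 x y = g x *m g y.
  by move=> xy; rewrite /G2 (negbTE xy) /= mulmx1.
have G2x x : G2 x x = 0 by rewrite /G2 eqxx.
have [<-|ab] := eqVneq a b.
  rewrite G2x mul0mx /G4 /= inE eqxx /= add0r (mulrC (_ == _)%:R) subrr.
  by rewrite raddf0 addr0 -addrA addrACA subrr addNr addr0.
have [<-|cd] := eqVneq c d.
  rewrite G2x mulmx0 /G4 /= !inE eqxx /= !andbF add0r !subrr raddf0 addr0.
  by rewrite sub0r addNr.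
rewrite !(G2n a b) ?(G2n c d)//.
have [bc|bc] := eqVneq b c.
  subst c; rewrite -mulmxA mul_gg /G4 /= !inE eqxx /= andbF add0r G2E scale1r.
  rewrite (negbTE ab) scale0r subr0 (negbTE cd) ?scale0r.
  by rewrite subr0 G2x scaler0 addr0 mul1r mul0r subr0 addrC.
have bcdb : g b *m (g c *m g b) = - g c.
  by rewrite mulmxA gN// mulNmx -mulmxA gg mulmx1.
have [<-|bd] := eqVneq b d.
  rewrite -mulmxA bcdb mulmxN G2E /G4 /= !inE eqxx !orbT andbF /= add0r.
  rewrite (negbTE ab) !(mulr0, mul0r, mul1r, scale0r) G2x scaler0 !addr0 scale1r.
  by rewrite sub0r subr0 sub0r raddfN opprD addrC.
have [ac|ac] := eqVneq a c.
  subst c.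
  have -> : g a *m g b *m (g a *m g d) = - (g b *m g d).
    by rewrite -mulmxA (mul_gl _ (_ : b != a)) 1?eq_sym// mulmxN mul_gg.
    rewrite G2E /G4 /= !inE eqxx !orbT /= (negbTE bd) (negbTE cd).
  by rewrite !scale0r !mul0r scale1r !subrr !raddf0 !add0r !addr0 ?subr0 ?add0r.
have [<-|ad] := eqVneq a d.
  have -> : g a *m g b *m (g c *m g a) = g b *m g c.
    rewrite (gN (_ : c != a)) 1?eq_sym// mulmxN -mulmxA.
    by rewrite (mul_gl _ (_ : b != a)) 1?eq_sym// mulmxN mul_gg opprK.
  rewrite G2E /G4 /= !inE eqxx !orbT /= (negbTE bc).
  by rewrite !(mul0r, scale0r, oppr0, addr0, add0r, scale1r, raddf0).
rewrite /G4 /= !inE !negb_or ab ac ad bc bd cd /=.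
by rewrite !scale0r !mul0r !subr0 !addr0 !raddf0 !addr0 !mulmx1 !mulmxA.
Qed.

Definition i0 : 'I_4 := inord 0.
Definition i1 : 'I_4 := inord 1.
Definition i2 : 'I_4 := inord 2.
Definition i3 : 'I_4 := inord 3.

(** Quadruples as functions on ['I_4], on which permutations act by precomposition. *)
Definition G4f (t : {ffun 'I_4 -> 'I_n}) := G4 (t i0) (t i1) (t i2) (t i3).

Lemma I4P (i : 'I_4) : [\/ i = i0, i = i1, i = i2 | i = i3].
Proof.
by case: i => -[|[|[|[|//]]]] ?; [constructor 1|constructor 2|constructor 3|
  constructor 4]; apply/val_inj; rewrite /= inordK.
Qed.

Lemma I4_uniq : uniq [:: i0; i1; i2; i3].
Proof. by rewrite -(map_inj_uniq val_inj) /= !inordK. Qed.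

(** Every transposition is a product of one, three or five of the adjacent swaps treated above. *)
Lemma G4f_tperm (t : {ffun 'I_4 -> 'I_n}) i j : i != j ->
  G4f [ffun k => t (tperm i j k)] = - G4f t.
Proof.
wlog : i j / (i < j)%N => [H ij|].
  case: (ltngtP i j) => [|ji|/val_inj/eqP]; [by move/H; exact| |].
    by rewrite tpermC H// eq_sym.
  by rewrite (negbTE ij).
rewrite /G4f !ffunE.
have /andP[] := I4_uniq; rewrite !inE !negb_or => /and3P[d1 d2 d3].
rewrite /= => /and3P[/andP[d4 d5] d6 _].
have D (x y z : 'I_4) : x != z -> y != z -> tperm x y z = z.
  by move=> xz yz; rewrite tpermD.
have S := (eq_sym i0, eq_sym i1, eq_sym i2).
case: (I4P i) => ->; case: (I4P j) => ->; rewrite ?ltnn// /i0 /i1 /i2 /i3 ?inordK//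
  -/i0 -/i1 -/i2 -/i3 => _ _; rewrite ?(tpermL, tpermR) !D // 1?eq_sym//.
- exact: G4_swap01.
- rewrite (G4_swap01 (t i1) (t i2)) (G4_swap12 (t i1)) (G4_swap01 (t i0)).
  by rewrite opprK.
- rewrite (G4_swap01 (t i1) (t i3)) (G4_swap12 (t i1)) (G4_swap23 (t i1) (t i2)).
  by rewrite (G4_swap12 (t i1)) (G4_swap01 (t i0)) !opprK.
- exact: G4_swap12.
- rewrite (G4_swap12 _ (t i2)) (G4_swap23 _ (t i2)) (G4_swap12 _ (t i1)).
  by rewrite opprK.
- exact: G4_swap23.
Qed.

Lemma G4f_perm (t : {ffun 'I_4 -> 'I_n}) (s : 'S_4) :
  G4f [ffun k => t (s k)] = (-1) ^+ s *: G4f t.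
Proof.
have [ts -> dts] := prod_tpermP s.
elim: ts t dts => [|[i j] ts IH] t /=.
  move=> _; rewrite big_nil odd_perm1 scale1r; congr G4f.
  by apply/ffunP => k; rewrite ffunE perm1.
move=> /andP[ij dts]; rewrite big_cons odd_mul_tperm ij signr_addb.
pose u := [ffun k => t ((\prod_(t <- ts) tperm t.1 t.2)%g k)].
have -> : [ffun k => t ((tperm i j * \prod_(t <- ts) tperm t.1 t.2)%g k)] =
    [ffun k => u (tperm i j k)].
  by apply/ffunP => k; rewrite !ffunE permM.
by rewrite G4f_tperm// IH// expr1 mulN1r scaleNr.
Qed.

Lemma tr_G2 a b : \tr (G2 a b) = 0.
Proof.
rewrite /G2; case: eqVneq => [_|ab]; first exact: mxtrace0.
by apply: (@tr_gprod0 a); rewrite //= eqxx (negbTE (_ : b != a)) // eq_sym.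
Qed.

Lemma count_uniq_notin (s t : seq 'I_n) : uniq t -> (size s < size t)%N ->
  exists2 i, i \in t & i \notin s.
Proof.
move=> ut st; apply/allPn; apply: contraL st => /allP H.
by rewrite -leqNgt; exact: uniq_leq_size.
Qed.

Lemma tr_gprodM0 (s t : seq 'I_n) i :
  ~~ odd (size s) -> ~~ odd (size t) -> uniq t -> i \in t -> i \notin s ->
  \tr (gprod (rev s) *m gprod t) = 0.
Proof.
move=> os ot ut it si; rewrite -gprod_cat; apply: (@tr_gprod0 i).
  by rewrite size_cat size_rev oddD (negbTE os) (negbTE ot).
by rewrite count_cat count_rev (count_uniq_mem _ ut) it (count_memPn si).
Qed.

Lemma tr_G4 a b c d : \tr (G4 a b c d) = 0.
Proof.
rewrite /G4; case: ifP => [u|]; last by move=> _; exact: mxtrace0.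
by rewrite -[gprod _]mul1mx (@tr_gprodM0 [::] _ a) // mem_head.
Qed.

Lemma tr_adjmx (A : 'M[C]_N) : \tr (adjmx A) = cj (\tr A).
Proof. by rewrite /adjmx trace_map_mx mxtrace_tr. Qed.

Lemma tr_G2G4 a b c d e f : \tr (adjmx (G2 a b) *m G4 c d e f) = 0.
Proof.
rewrite /G2; case: eqVneq => [|ab]; first by rewrite adjmx0 mul0mx mxtrace0.
rewrite /G4; case: ifP => [u|]; last by rewrite mulmx0 mxtrace0.
have [i it si] := @count_uniq_notin [:: a; b] _ u isT.
by rewrite adj_gprod (tr_gprodM0 _ _ u it si).
Qed.

Lemma tr_G4G2 a b c d e f : \tr (adjmx (G4 c d e f) *m G2 a b) = 0.
Proof.
by rewrite -[G2 a b]adjmxK -adjmxM tr_adjmx tr_G2G4 rmorph0.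
Qed.

Lemma tr_G2G2 a b c d : a != b -> \tr (adjmx (G2 a b) *m G2 c d) =
  N%:R * ((a == c)%:R * (b == d)%:R - (a == d)%:R * (b == c)%:R).
Proof.
move=> ab; rewrite adj_G2 mulNmx G2_mul !linearN /= !linearD /= mxtrace_scalar.
rewrite tr_G4 !linearN /= !mxtraceZ !tr_G2 !mulr0 !oppr0 !addr0 add0r.
by rewrite -mulNrn -[LHS]mulr_natl opprB (mulrC (b == d)%:R) (mulrC (b == c)%:R).
Qed.

(** An injective [t] with all its values among those of [u] is a permutation of [u]. Otherwise [t]
    has an index foreign to [u], which occurs exactly once in the product, and [tr_gprodM0]
    applies. *)
Lemma tr_G4G4 (u t : {ffun 'I_4 -> 'I_n}) : injective u ->
  (forall s : 'S_4, t <> [ffun k => u (s k)]) ->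
  \tr (adjmx (G4f u) *m G4f t) = 0.
Proof.
move=> uinj tu; rewrite /G4f /G4.
have E (v : {ffun 'I_4 -> 'I_n}) : [:: v i0; v i1; v i2; v i3] = map v [:: i0; i1; i2; i3] by [].
case: ifPn => [uu|]; last by rewrite adjmx0 mul0mx mxtrace0.
case: ifPn => [ut|]; last by rewrite mulmx0 mxtrace0.
rewrite adj_gprod.
have tinj : injective t.
  have al i : i \in [:: i0; i1; i2; i3].
    by rewrite !inE; case: (I4P i) => ->; rewrite eqxx ?orbT.
  move=> i j; have := ut; rewrite /= !inE !negb_or.
  move=> /and4P[/and3P[d1 d2 d3] /andP[d4 d5] d6 _].
  by case: (I4P i) => ->; case: (I4P j) => -> // /eqP; rewrite
    ?(negbTE d1, negbTE d2, negbTE d3, negbTE d4, negbTE d5, negbTE d6)//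
    1?eq_sym ?(negbTE d1, negbTE d2, negbTE d3, negbTE d4, negbTE d5, negbTE d6).
have [/allP H|/allPn[i it si]] := boolP (all (mem [:: u i0; u i1; u i2; u i3]) [:: t i0; t i1; t i2; t i3]); last first.
  exact: (@tr_gprodM0 _ _ i).
exfalso.
have {}H i : exists j, t i = u j.
  have : t i \in [:: t i0; t i1; t i2; t i3].
    by case: (I4P i) => ->; rewrite !inE eqxx ?orbT.
  move/H; rewrite !inE => /or4P[] /eqP ->; by eexists.
have [h hP] := @choice _ _ _ H.
have hinj : injective h by move=> i j hij; apply: tinj; rewrite !hP hij.
apply: (tu (perm hinj)); apply/ffunP => k; by rewrite ffunE permE hP.
Qed.

(** * Reading off coefficients by traces *)

Section extraction.
Variables (x0 : C) (A : 'I_n -> 'I_n -> C)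
  (T : 'I_n -> 'I_n -> 'I_n -> 'I_n -> C).

(** The shape shared by Q, C and W. The coefficients are not assumed to be alternating, so that
    traces recover their antisymmetrizations. *)
Definition clif024 : 'M[C]_N := x0%:M + \sum_a \sum_b A a b *: G2 a b
  + \sum_a \sum_b \sum_c \sum_d T a b c d *: G4 a b c d.

Let Tf (t : {ffun 'I_4 -> 'I_n}) := T (t i0) (t i1) (t i2) (t i3).

Lemma sum_I4 (V : nmodType) (F : 'I_n -> 'I_n -> 'I_n -> 'I_n -> V) :
  \sum_a \sum_b \sum_c \sum_d F a b c d =
  \sum_(t : {ffun 'I_4 -> 'I_n}) F (t i0) (t i1) (t i2) (t i3).
Proof.
rewrite pair_bigA /= pair_bigA /= pair_bigA /=.
pose h (p : 'I_n * 'I_n * 'I_n * 'I_n) : {ffun 'I_4 -> 'I_n} :=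
  [ffun k : 'I_4 => nth p.2 [:: p.1.1.1; p.1.1.2; p.1.2; p.2] k].
pose h' (t : {ffun 'I_4 -> 'I_n}) := (t i0, t i1, t i2, t i3).
rewrite (reindex h'); first by [].
exists h => [t _|[[[a b] c] d] _]; last first.
  by rewrite /h' /h !ffunE /= /i0 /i1 /i2 /i3 !inordK.
apply/ffunP => k; rewrite ffunE /=.
by case: (I4P k) => ->; rewrite inordK.
Qed.

Lemma tr_clif024 : \tr clif024 = x0 *+ N.
Proof.
rewrite /clif024 !raddfD /= mxtrace_scalar !raddf_sum /= big1 ?addr0 => [|a _].
  rewrite big1 ?addr0// => a _; rewrite raddf_sum big1// => b _.
  rewrite raddf_sum big1// => c _; rewrite raddf_sum big1// => d _.
  by rewrite /= mxtraceZ tr_G4 mulr0.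
by rewrite raddf_sum big1// => b _; rewrite /= mxtraceZ tr_G2 mulr0.
Qed.

Lemma tr_G2_clif024 a b : a != b ->
  \tr (adjmx (G2 a b) *m clif024) = (A a b - A b a) *+ N.
Proof.
move=> ab; rewrite /clif024 !mulmxDr !raddfD /= mul_mx_scalar mxtraceZ.
rewrite tr_adjmx tr_G2 rmorph0 mulr0 add0r.
rewrite [X in _ + X](_ : _ = 0) ?addr0; last first.
  rewrite !(mulmx_sumr, raddf_sum) big1// => c _.
  rewrite !(mulmx_sumr, raddf_sum) big1// => d _.
  rewrite !(mulmx_sumr, raddf_sum) big1// => e _.
  rewrite !(mulmx_sumr, raddf_sum) big1// => f _.
  by rewrite -scalemxAr /= mxtraceZ tr_G2G4 mulr0.
have H c d : \tr (adjmx (G2 a b) *m (A c d *: G2 c d)) = N%:R * (A c d *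
   ((a == c)%:R * (b == d)%:R - (a == d)%:R * (b == c)%:R)).
  by rewrite -scalemxAr mxtraceZ tr_G2G2// mulrCA.
rewrite mulmx_sumr raddf_sum /=.
under eq_bigr => c _.
  rewrite mulmx_sumr raddf_sum /=.
  under eq_bigr do rewrite H.
  over.
under eq_bigr do rewrite -mulr_sumr.
rewrite -mulr_sumr mulr_natl; congr (_ *+ _).
rewrite (bigD1 a)//= (bigD1 b)//= eqxx eqxx (negbTE ab) mul0r subr0 !mulr1.
rewrite big1 ?addr0 => [|i ib]; last first.
  by rewrite (eq_sym b) (negbTE ib) !mulr0 (eq_sym b) (negbTE ab) mulr0 subrr mulr0.
have ba : b != a by rewrite eq_sym.
congr (_ + _); rewrite (bigD1 b)//= (bigD1 a)//= !eqxx (negbTE ab).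
rewrite mul0r !mulr1 sub0r mulrN1 [X in _ + X]big1 ?addr0; last first.
  move=> i /andP[ia ib]; rewrite big1// => j _.
  by rewrite (eq_sym a) (negbTE ia) (eq_sym b i) (negbTE ib) mul0r mulr0 subrr mulr0.
rewrite [X in _ + X]big1 ?addr0// => i ia.
by rewrite mul0r (eq_sym a) (negbTE ia) mul0r subrr mulr0.
Qed.

Lemma tr_G4_clif024 (u : {ffun 'I_4 -> 'I_n}) : injective u ->
  \tr (adjmx (G4f u) *m clif024) =
  (\sum_(s : 'S_4) (-1) ^+ s * Tf [ffun k => u (s k)]) *+ N.
Proof.
move=> uinj; rewrite /clif024 !mulmxDr !raddfD /= mul_mx_scalar mxtraceZ.
rewrite tr_adjmx tr_G4 rmorph0 mulr0 add0r.
rewrite [X in X + _](_ : _ = 0) ?add0r; last first.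
  rewrite !(mulmx_sumr, raddf_sum) big1// => c _.
  rewrite !(mulmx_sumr, raddf_sum) big1// => d _.
  by rewrite -scalemxAr /= mxtraceZ tr_G4G2 mulr0.
rewrite (sum_I4 (fun a b c d => T a b c d *: G4 a b c d)).
pose h (s : 'S_4) : {ffun 'I_4 -> 'I_n} := [ffun k => u (s k)].
have hinj : injective h.
  move=> s s' /ffunP ss'; apply/permP => k; apply: uinj.
  by have := ss' k; rewrite !ffunE.
have u1 : adjmx (G4f u) *m G4f u = 1%:M.
  rewrite /G4f /G4.
  have uu : uniq [:: u i0; u i1; u i2; u i3].
    by have := map_inj_uniq uinj [:: i0; i1; i2; i3]; rewrite I4_uniq.
  by rewrite uu adj_gprod gprod_revK.
(* Only the permutations of [u] pair nontrivially with [u]; [h] parametrizes them without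
   repetition. *)
rewrite mulmx_sumr raddf_sum /= (bigID (mem (h @: [set: 'S_4]%SET))) /=.
rewrite [X in _ + X]big1 ?addr0 => [|t tnh]; last first.
  rewrite -scalemxAr mxtraceZ -/(G4f t) tr_G4G4 ?mulr0// => s ts.
  by move: tnh; rewrite ts imset_f// inE.
rewrite big_imset /=; last by move=> ? ? _ _; exact: hinj.
rewrite -sumrMnl; apply: eq_big => [s|s _]; first by rewrite inE.
rewrite -scalemxAr mxtraceZ -/(G4f (h s)) G4f_perm -scalemxAr mxtraceZ u1.
by rewrite mxtrace1 mulrA mulr_natr mulrC.
Qed.

End extraction.

Lemma sum_anti (A : 'I_n -> 'I_n -> C) :
  \sum_a \sum_b A a b *: G2 a b =
  \sum_a \sum_b (2^-1 * (A a b - A b a)) *: G2 a b.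
Proof.
apply: (@scalerI _ _ 2); first by rewrite pnatr_eq0.
rewrite scaler_nat mulr2n {2}exchange_big /= -big_split /= scaler_sumr.
apply: eq_bigr => a _; rewrite -big_split scaler_sumr /=; apply: eq_bigr => b _.
rewrite scalerA mulrA mulfV ?pnatr_eq0// mul1r scalerBl; congr (_ + _).
by rewrite (G2C b a) scalerN opprK.
Qed.

(** [Alt4] with values in [C]; see [rc_Alt4]. *)
Definition alt (T : 'I_n -> 'I_n -> 'I_n -> 'I_n -> C) (a b c d : 'I_n) : C :=
  let k := tnth [tuple a; b; c; d] in
  (4`!%:R)^-1 * \sum_(s : 'S_4) (-1) ^+ s *
    T (k (s i0)) (k (s i1)) (k (s i2)) (k (s i3)).

(** [G4] is alternating: reindexing by the inverse moves a permutation from the coefficient to the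
    basis element, where its sign cancels the one in [alt]. So each of the 4! terms of the average
    contributes the same sum. *)
Lemma sum_alt (T : 'I_n -> 'I_n -> 'I_n -> 'I_n -> C) :
  \sum_a \sum_b \sum_c \sum_d T a b c d *: G4 a b c d =
  \sum_a \sum_b \sum_c \sum_d alt T a b c d *: G4 a b c d.
Proof.
rewrite (sum_I4 (fun a b c d => T a b c d *: G4 a b c d)).
rewrite (sum_I4 (fun a b c d => alt T a b c d *: G4 a b c d)).
pose Tf (t : {ffun 'I_4 -> 'I_n}) := T (t i0) (t i1) (t i2) (t i3).
have altE (t : {ffun 'I_4 -> 'I_n}) : alt T (t i0) (t i1) (t i2) (t i3) =
    (4`!%:R)^-1 * \sum_(s : 'S_4) (-1) ^+ s * Tf [ffun k => t (s k)].
  rewrite /alt; congr (_ * _); apply: eq_bigr => s _; congr (_ * _).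
  have K i : tnth [tuple t i0; t i1; t i2; t i3] i = t i.
    by rewrite (tnth_nth (t i)); case: (I4P i) => -> /=; rewrite inordK.
  by rewrite /Tf !ffunE !K.
have f4 : (4`!%:R : C) != 0 by rewrite pnatr_eq0.
apply: (scalerI f4); rewrite !scaler_sumr.
under [RHS]eq_bigr do rewrite altE scalerA mulrA mulfV// mul1r scaler_suml.
rewrite exchange_big /= -scaler_sumr scaler_nat.
rewrite -[4`!]card_Sn -sumr_const; apply: eq_big => [s|s _]; first by rewrite inE.
rewrite [RHS](reindex (fun t : {ffun 'I_4 -> 'I_n} => [ffun k => t ((s^-1)%g k)])) /=.
  apply: eq_bigr => t _; rewrite -/(G4f [ffun k => t ((s^-1)%g k)]) G4f_perm.
  rewrite odd_permV scalerA mulrAC -signr_addb addbb mul1r; congr (_ *: _).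
  by rewrite /Tf !ffunE !permK.
exists (fun t : {ffun 'I_4 -> 'I_n} => [ffun k => t (s k)]) => t _;
  by apply/ffunP => k; rewrite !ffunE (permK, permKV).
Qed.

Lemma clif024_alt x0 A T : clif024 x0 A T =
  clif024 x0 (fun a b => 2^-1 * (A a b - A b a)) (alt T).
Proof. by rewrite /clif024 sum_anti sum_alt. Qed.

Lemma alt_tr x0 A T a b c d : uniq [:: a; b; c; d] ->
  \tr (adjmx (G4 a b c d) *m clif024 x0 A T) = (4`!%:R * alt T a b c d) *+ N.
Proof.
move=> u; pose t : {ffun 'I_4 -> 'I_n} := [ffun k => tnth [tuple a; b; c; d] k].
have tE : [/\ t i0 = a, t i1 = b, t i2 = c & t i3 = d].
  by rewrite /t !ffunE !(tnth_nth a) /= !inordK.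
have tinj : injective t.
  move=> i j; rewrite !ffunE => /eqP.
  rewrite !(tnth_nth a) nth_uniq//; first by move/eqP/val_inj.
have := tr_G4_clif024 x0 A T tinj; rewrite /G4f; case: tE => -> -> -> -> ->.
rewrite /alt mulrA mulfV ?pnatr_eq0// mul1r; congr (_ *+ _).
by apply: eq_bigr => s _; rewrite /t !ffunE.
Qed.

Lemma alt_nuniq T a b c d : ~~ uniq [:: a; b; c; d] -> alt T a b c d = 0.
Proof.
move=> nu; rewrite /alt; set k := tnth _; set S := \sum_(s : _) _.
suff -> : S = 0 by rewrite mulr0.
have [i [j [ij kij]]] : exists i j, i != j /\ k i = k j.
  have /injectivePn[i [j ij kij]] : ~~ injectiveb k.
    apply: contra nu => /injectiveP kinj.
    have := map_inj_uniq kinj [:: i0; i1; i2; i3].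
    by rewrite I4_uniq /= /k !(tnth_nth a) /= !inordK.
  by exists i, j.
apply/eqP; rewrite -eqNr; apply/eqP.
rewrite /S [RHS](reindex_inj (mulIg (tperm i j))) /= -sumrN.
apply: eq_bigr => s _; rewrite -mulNr; congr (_ * _).
  by rewrite odd_permM odd_tperm ij signr_addb mulrC expr1 mulN1r.
have K x : k ((s * tperm i j)%g x) = k (s x).
  by rewrite permM; case: tpermP => [->|->|//].
by rewrite !K.
Qed.

(** Exchanging the first pair of slots with the second is an even permutation. *)
Lemma alt_swap T a b c d :
  alt (fun m k p q => T p q m k) a b c d = alt T a b c d.
Proof.
rewrite /alt; congr (_ * _).
have [p [op p0 p1 p2 p3]] : exists p : 'S_4,
    [/\ odd_perm p = false, p i0 = i2, p i1 = i3, p i2 = i0 & p i3 = i1].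
  have := I4_uniq; rewrite /= !inE !negb_or.
  move=> /and4P[/and3P[d1 d2 d3] /andP[d4 d5] d6 _].
  exists (tperm i0 i2 * tperm i1 i3)%g.
  rewrite odd_permM !odd_tperm d2 d5 !permM tpermL tpermR; split=> //.
  - by rewrite tpermD// eq_sym.
  - by rewrite (@tpermD _ i0 i2 i1) ?tpermL// eq_sym.
  - by rewrite tpermD// eq_sym.
  - by rewrite (@tpermD _ i0 i2 i3) ?tpermR// eq_sym.
rewrite [RHS](reindex_inj (mulgI p)) /=; apply: eq_bigr => s _.
by rewrite odd_permM op !permM p0 p1 p2 p3.
Qed.

Lemma sum_deltal (V : lmodType C) (F : 'I_n -> V) c :
  \sum_b (b == c)%:R *: F b = F c.
Proof.
rewrite (bigD1 c)//= eqxx scale1r big1 ?addr0// => b bc.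
by rewrite (negbTE bc) scale0r.
Qed.

Lemma sum_deltar (V : lmodType C) (F : 'I_n -> V) c :
  \sum_b (c == b)%:R *: F b = F c.
Proof. by under eq_bigr do rewrite eq_sym; exact: sum_deltal. Qed.

Lemma sum_G2G2 (k : 'I_n -> 'I_n -> 'I_n -> 'I_n -> C) :
  \sum_a \sum_b \sum_c \sum_d k a b c d *: (G2 a b *m G2 c d) =
  clif024 (\sum_a \sum_b (k a b b a - k a b a b))
    (fun a d => \sum_b (k a b b d - k a b d b - k b a b d + k b a d b)) k.
Proof.
have E a b c d : k a b c d *: (G2 a b *m G2 c d) =
    (b == c)%:R *: ((a == d)%:R *: (k a b c d)%:M)
    - (b == d)%:R *: ((a == c)%:R *: (k a b c d)%:M)
    + ((b == c)%:R *: (k a b c d *: G2 a d)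
    - (b == d)%:R *: (k a b c d *: G2 a c)
    - (a == c)%:R *: (k a b c d *: G2 b d)
    + (a == d)%:R *: (k a b c d *: G2 b c))
    + k a b c d *: G4 a b c d.
  have sc x (v : 'M[C]_N) : k a b c d *: (x *: v) = x *: (k a b c d *: v).
    by rewrite scalerA mulrC -scalerA.
  rewrite G2_mul !scalerDr !scalerN !sc scale_scalar_mx.
  rewrite [RHS]addrC -[LHS]addrA; congr (_ + _); rewrite addrC; congr (_ + _).
  by rewrite !scale_scalar_mx -raddfB; congr (_%:M); ring.
under eq_bigr do under eq_bigr do under eq_bigr do under eq_bigr do rewrite E.
under eq_bigr do under eq_bigr do under eq_bigr do rewrite !(big_split, sumrN) /=.
under eq_bigr do under eq_bigr do rewrite !(big_split, sumrN) /=.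
under eq_bigr do rewrite !(big_split, sumrN) /=.
rewrite !(big_split, sumrN) /= /clif024; congr (_ + _ + _).
- rewrite [RHS]raddf_sum -sumrB; apply: eq_bigr => a _.
  rewrite [RHS]raddf_sum -sumrB; apply: eq_bigr => b _.
  rewrite [RHS]raddfB /=; congr (_ - _).
    under eq_bigr do rewrite -scaler_sumr sum_deltar.
    by rewrite sum_deltar.
  under eq_bigr do rewrite sum_deltar.
  by rewrite sum_deltar.
- under [RHS]eq_bigr do under eq_bigr do rewrite !(big_split, sumrN) /= !scalerDl !scaleNr.
  under [RHS]eq_bigr do rewrite !(big_split, sumrN) /=.
  rewrite !(big_split, sumrN) /=; congr (_ - _ - _ + _).
  + apply: eq_bigr => a _.
    under eq_bigr do rewrite exchange_big /=.
    rewrite exchange_big /=; apply: eq_bigr => d _.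
    by rewrite scaler_suml; apply: eq_bigr => b _; rewrite sum_deltar.
  + apply: eq_bigr => a _.
    rewrite exchange_big /=; apply: eq_bigr => c _.
    by rewrite scaler_suml; apply: eq_bigr => b _; rewrite sum_deltar.
  + rewrite exchange_big /=; apply: eq_bigr => b _.
    under eq_bigr do rewrite exchange_big /=.
    rewrite exchange_big /=; apply: eq_bigr => d _.
    by rewrite scaler_suml; apply: eq_bigr => a _; rewrite sum_deltar.
  + rewrite exchange_big /=; apply: eq_bigr => b _.
    rewrite exchange_big /=; apply: eq_bigr => c _.
    by rewrite scaler_suml; apply: eq_bigr => a _; rewrite sum_deltar.
Qed.

(** * The spin connection and the term quadratic in it *)

Section connection.
Variable om : 'I_n -> 'I_n -> 'I_n -> C.
Hypothesis omN : forall a b c, om a b c = - om b a c.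

Lemma omxx a c : om a a c = 0.
Proof. by apply/eqP; rewrite -eqNr -omN. Qed.

(** The connection matrix of the spinor bundle in the direction of the frame vector [a]. For
    antisymmetric [om] the commutator of gammas may be replaced by twice their product, which turns
    1/8 into 1/4. *)
Definition Om (a : 'I_n) : 'M[C]_N :=
  4^-1 *: \sum_c \sum_d om c d a *: (g c *m g d).

Lemma OmE a : Om a = 4^-1 *: \sum_c \sum_d om c d a *: G2 c d.
Proof.
rewrite /Om; congr (_ *: _); apply: eq_bigr => c _; apply: eq_bigr => d _.
rewrite G2E; case: (eqVneq c d) => [->|_]; first by rewrite omxx !scale0r.
by rewrite raddf0 add0r.
Qed.

Lemma ggg c d b : (g c *m g d) *m g b - g b *m (g c *m g d) =
  (d == b)%:R *: (2 *: g c) - (c == b)%:R *: (2 *: g d).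
Proof.
have E x y : g x *m g y = ((x == y)%:R *+ 2)%:M - g y *m g x.
  by rewrite -(acg x y) addrK.
rewrite -[X in X - _]mulmxA (E d b) mulmxBr [g c *m (g b *m g d)]mulmxA (E c b).
rewrite mulmxBl mul_mx_scalar mul_scalar_mx -[g b *m g c *m g d]mulmxA opprB.
by rewrite addrA addrAC addrK !scalerA !mulr_natr.
Qed.

(** The spin representation of the Lie algebra so(n): on the generators, the commutator with [Om]
    acts as the matrix [om]. *)
Lemma Om_g a b : Om a *m g b - g b *m Om a = \sum_c om c b a *: g c.
Proof.
rewrite /Om -scalemxAl -scalemxAr -scalerBr !(mulmx_suml, mulmx_sumr) -sumrB.
under eq_bigr => c _.
  rewrite !(mulmx_suml, mulmx_sumr) -sumrB.
  under eq_bigr do rewrite -scalemxAl -scalemxAr -scalerBr ggg scalerBr !(scalerA (om _ _ _)) !(mulrC (om _ _ _)) -!(scalerA _ (om _ _ _)).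
  rewrite sumrB sum_deltal.
  over.
rewrite sumrB exchange_big /=.
have -> : \sum_j \sum_i (i == b)%:R *: (om i j a *: (2 *: g j)) =
    - \sum_c om c b a *: (2 *: g c).
  rewrite -sumrN; apply: eq_bigr => c _.
  by rewrite sum_deltal omN scaleNr.
rewrite opprK -big_split /= scaler_sumr; apply: eq_bigr => c _.
rewrite -scalerDr -scalerDl scalerA [_ * om _ _ _]mulrC -scalerA scalerA.
rewrite scalerA; congr (_ *: _); rewrite -mulrA.
have -> : 4^-1 * (2 + 2) = 1 :> C by rewrite -natrD mulVf ?pnatr_eq0.
by rewrite mulr1.
Qed.

(** The commutator with [Om a] is a derivation, so [Om_g] applies to both factors of each product in
    [Om b]. The two resulting sums differ by a relabelling and antisymmetry, and together they form
    [G2]. *)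
Lemma Om_Om a b : Om a *m Om b - Om b *m Om a =
  2^-1 *: \sum_c \sum_f (\sum_e om c e a * om e f b) *: G2 c f.
Proof.
have E e f : Om a *m (g e *m g f) - (g e *m g f) *m Om a =
    \sum_c om c e a *: (g c *m g f) + \sum_c om c f a *: (g e *m g c).
  have H1 : (Om a *m g e - g e *m Om a) *m g f = \sum_c om c e a *: (g c *m g f).
    by rewrite Om_g mulmx_suml; apply: eq_bigr => c _; rewrite scalemxAl.
  have H2 : g e *m (Om a *m g f - g f *m Om a) = \sum_c om c f a *: (g e *m g c).
    by rewrite Om_g mulmx_sumr; apply: eq_bigr => c _; rewrite scalemxAr.
  by rewrite -H1 -H2 mulmxBl mulmxBr !mulmxA addrA subrK.
move: (Om a) E => X E; rewrite /Om -(scalemxAl 4^-1) -(scalemxAr 4^-1) -scalerBr !(mulmx_suml, mulmx_sumr) -sumrB.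
have -> : \sum_(e < n) (X *m (\sum_d om e d b *: (g e *m g d)) -
      (\sum_d om e d b *: (g e *m g d)) *m X) =
    \sum_e \sum_f \sum_c om e f b *: (om c e a *: (g c *m g f))
    + \sum_e \sum_f \sum_c om e f b *: (om c f a *: (g e *m g c)).
  rewrite -big_split; apply: eq_bigr => e _ /=.
  rewrite mulmx_sumr mulmx_suml -sumrB -big_split; apply: eq_bigr => f _ /=.
  by rewrite -(scalemxAl (om e f b)) -(scalemxAr (om e f b)) -scalerBr E scalerDr !scaler_sumr.
have -> : \sum_e \sum_f \sum_c om e f b *: (om c e a *: (g c *m g f)) =
    \sum_c \sum_f (\sum_e om c e a * om e f b) *: (g c *m g f).
  rewrite exchange_big /=; under eq_bigr do rewrite exchange_big /=.
  rewrite exchange_big /=; apply: eq_bigr => c _; apply: eq_bigr => f _.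
  by rewrite scaler_suml; apply: eq_bigr => e _; rewrite scalerA mulrC.
have -> : \sum_e \sum_f \sum_c om e f b *: (om c f a *: (g e *m g c)) =
    - \sum_c \sum_f (\sum_e om c e a * om e f b) *: (g f *m g c).
  rewrite exchange_big /= -sumrN.
  under eq_bigr do rewrite exchange_big /=.
  rewrite exchange_big /=; apply: eq_bigr => c _.
  rewrite exchange_big /= -sumrN; apply: eq_bigr => f _.
  rewrite -scaleNr -sumrN scaler_suml; apply: eq_bigr => e _.
  by rewrite scalerA (omN f e) mulNr mulrC.
rewrite -sumrB (_ : 2^-1 = 4^-1 * 2 :> C); last by field.
rewrite -scalerA; congr (_ *: _); rewrite scaler_sumr; apply: eq_bigr => c _.
rewrite -sumrB scaler_sumr; apply: eq_bigr => f _.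
rewrite -scalerBr scalerA [2 * _]mulrC -scalerA; congr (_ *: _).
by rewrite !G2E (G2C c f) eq_sym opprD opprK addrACA subrr add0r scaler_nat mulr2n.
Qed.

(** The matrix W of the overview once coordinate indices have been contracted with the frame; see
    [Wquad_contract]. *)
Definition Wquad := \sum_a \sum_b Om a *m G2 a b *m Om b.

(** [Om a] is moved to the right past both gammas by means of [Om_g]. What remains is
    [g a *m g b *m (Om a *m Om b)], where antisymmetry in [a], [b] produces the commutator computed
    in [Om_Om], and two terms [B], [U] with a single [Om]. *)
Lemma Wquad_normal : Wquad = \sum_a \sum_b \sum_c \sum_d
  (4^-1 * (\sum_e om c e a * om e d b + \sum_r om b r a * om c d r
   + \sum_r om a r r * om c d b)) *: (G2 a b *m G2 c d).
Proof.
have gOm a b : Om a *m g b = g b *m Om a + \sum_c om c b a *: g c.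
  by rewrite -Om_g addrC subrK.
have G2g a b : G2 a b = g a *m g b - (a == b)%:R%:M by rewrite G2E addrC addKr.
pose B := \sum_a \sum_b \sum_c om c b a *: (g a *m g c *m Om b).
pose U := \sum_a \sum_b \sum_c om c a a *: (g c *m g b *m Om b).
(* [Q] is the diagonal that [G2 a b] omits from [g a *m g b]. It enters [W1] and [W2] with opposite
   signs. *)
pose Q := \sum_a Om a *m Om a.
have W1 : Wquad = \sum_a \sum_b g a *m g b *m (Om a *m Om b) + B + U - Q.
  rewrite /Wquad /B /U /Q -!big_split -sumrB /=; apply: eq_bigr => a _.
  have -> : Om a *m Om a = \sum_b (a == b)%:R *: (Om a *m Om b).
    by rewrite sum_deltar.
  rewrite -!big_split -sumrB /=; apply: eq_bigr => b _.
  rewrite G2g mulmxBr mulmxBl mul_mx_scalar -(scalemxAl (a == b)%:R).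
  congr (_ - _); rewrite [Om a *m (g a *m _)]mulmxA gOm.
  rewrite (mulmxDl _ _ (g b)) (mulmxDl _ _ (Om b)); congr (_ + _); last first.
    by rewrite !mulmx_suml; apply: eq_bigr => c _; rewrite -!(scalemxAl (om _ _ _)).
  rewrite -[g a *m Om a *m g b]mulmxA gOm mulmxDr mulmxDl; congr (_ + _).
    by rewrite !mulmxA.
  rewrite mulmx_sumr mulmx_suml; apply: eq_bigr => c _.
  by rewrite -(scalemxAr (om _ _ _)) -(scalemxAl (om _ _ _)).
have W2 : \sum_a \sum_b g a *m g b *m (Om a *m Om b) =
    2^-1 *: \sum_a \sum_b G2 a b *m (Om a *m Om b - Om b *m Om a) + Q.
  have -> : \sum_a \sum_b g a *m g b *m (Om a *m Om b) =
      \sum_a \sum_b G2 a b *m (Om a *m Om b) + Q.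
    rewrite /Q -big_split; apply: eq_bigr => a _ /=.
    have -> : Om a *m Om a = \sum_b (a == b)%:R *: (Om a *m Om b).
      by rewrite sum_deltar.
    rewrite -big_split; apply: eq_bigr => b _ /=.
    by rewrite G2E mulmxDl mul_scalar_mx addrC.
  congr (_ + _); apply: (@scalerI _ _ 2); first by rewrite pnatr_eq0.
  rewrite scalerA mulfV ?pnatr_eq0// scale1r scaler_nat mulr2n.
  rewrite {2}exchange_big /= -big_split; apply: eq_bigr => a _ /=.
  rewrite -big_split; apply: eq_bigr => b _ /=.
  by rewrite (G2C a b) mulNmx mulmxBr.
have W3 : 2^-1 *: \sum_a \sum_b G2 a b *m (Om a *m Om b - Om b *m Om a) =
    4^-1 *: \sum_a \sum_b \sum_c \sum_d
       (\sum_e om c e a * om e d b) *: (G2 a b *m G2 c d).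
  rewrite (_ : 4^-1 = 2^-1 * 2^-1 :> C); last by field.
  rewrite -scalerA; congr (_ *: _); rewrite scaler_sumr; apply: eq_bigr => a _.
  rewrite scaler_sumr; apply: eq_bigr => b _.
  rewrite Om_Om -(scalemxAr 2^-1); congr (_ *: _).
  rewrite mulmx_sumr; apply: eq_bigr => c _.
  by rewrite mulmx_sumr; apply: eq_bigr => d _; rewrite -scalemxAr.
have OmG (X : 'M[C]_N) b : X *m Om b =
    4^-1 *: \sum_c \sum_d om c d b *: (X *m G2 c d).
  rewrite OmE -(scalemxAr 4^-1); congr (_ *: _).
  rewrite mulmx_sumr; apply: eq_bigr => c _.
  by rewrite mulmx_sumr; apply: eq_bigr => d _; rewrite -scalemxAr.
have sum3 (x : 'I_n -> C) (y : 'I_n -> 'I_n -> 'I_n -> C) (Y : 'I_n -> 'I_n -> 'M[C]_N) :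
    \sum_r x r *: (\sum_c \sum_d y c d r *: Y c d) =
    \sum_c \sum_d (\sum_r x r * y c d r) *: Y c d.
  transitivity (\sum_r \sum_c \sum_d (x r * y c d r) *: Y c d).
    apply: eq_bigr => r _; rewrite scaler_sumr; apply: eq_bigr => c _.
    by rewrite scaler_sumr; apply: eq_bigr => d _; rewrite scalerA.
  rewrite exchange_big; apply: eq_bigr => c _ /=.
  by rewrite exchange_big; apply: eq_bigr => d _ /=; rewrite scaler_suml.
(* The diagonal contributions of [B] and [U], which cancel each other. *)
pose D := \sum_a \sum_b om a b b *: Om a.
have B1 : B = 4^-1 *: \sum_a \sum_b \sum_c \sum_d
    (\sum_r om b r a * om c d r) *: (G2 a b *m G2 c d) - D.
  have -> : B = \sum_a \sum_b \sum_c om c b a *: (G2 a c *m Om b) - D.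
    rewrite /B /D -sumrN exchange_big /=.
    have -> : \sum_b \sum_a \sum_c om c b a *: (g a *m g c *m Om b) =
      \sum_b (\sum_a \sum_c om c b a *: (G2 a c *m Om b) - \sum_a om b a a *: Om b).
      apply: eq_bigr => b _; rewrite -sumrB; apply: eq_bigr => a _.
      rewrite -[om b a a *: Om b](sum_deltar (fun c => om b c a *: Om b) a) -sumrB.
      apply: eq_bigr => c _; rewrite G2E mulmxDl scalerDr addrC; congr (_ + _).
      by rewrite mul_scalar_mx scalerA mulrC -scalerA (omN c b) scaleNr scalerN.
    by rewrite sumrB exchange_big sumrN.
  congr (_ - _).
  under eq_bigr do under eq_bigr do under eq_bigr do rewrite OmG scalerA mulrC -scalerA.
  rewrite scaler_sumr; apply: eq_bigr => a _.
  rewrite exchange_big /= scaler_sumr; apply: eq_bigr => b _.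
  rewrite -scaler_sumr; congr (_ *: _).
  exact: sum3.
have U1 : U = 4^-1 *: \sum_a \sum_b \sum_c \sum_d
    (\sum_r om a r r * om c d b) *: (G2 a b *m G2 c d) + D.
  have -> : U = \sum_b \sum_c \sum_a om c a a *: (g c *m g b *m Om b).
    rewrite /U exchange_big /=; apply: eq_bigr => b _; exact: exchange_big.
  have -> : \sum_b \sum_c \sum_a om c a a *: (g c *m g b *m Om b) =
    \sum_b \sum_c \sum_a om c a a *: (G2 c b *m Om b) + D.
    rewrite /D -big_split; apply: eq_bigr => b _ /=.
    have -> : \sum_a om b a a *: Om b = \sum_c (c == b)%:R *: (\sum_a om c a a *: Om b).
      by rewrite sum_deltal.
    rewrite -big_split; apply: eq_bigr => c _ /=.
    rewrite scaler_sumr -big_split; apply: eq_bigr => a _ /=.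
    rewrite G2E mulmxDl scalerDr addrC mul_scalar_mx; congr (_ + _).
    by rewrite scalerA mulrC -scalerA.
  congr (_ + _).
  under eq_bigr do under eq_bigr do under eq_bigr do rewrite OmG scalerA mulrC -scalerA.
  rewrite exchange_big /= scaler_sumr; apply: eq_bigr => a _.
  rewrite scaler_sumr; apply: eq_bigr => b _.
  rewrite -scaler_sumr; congr (_ *: _).
  exact: sum3.
rewrite W1 W2 W3 B1 U1.
have AC (x y z q d : 'M[C]_N) : x + q + (y - d) + (z + d) - q = x + y + z.
  by apply/matrixP => i j; rewrite !mxE; ring.
rewrite AC -!scalerDr -!big_split /= scaler_sumr; apply: eq_bigr => a _.
rewrite -!big_split /= scaler_sumr; apply: eq_bigr => b _.
rewrite -!big_split /= scaler_sumr; apply: eq_bigr => c _.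
rewrite -!big_split /= scaler_sumr; apply: eq_bigr => d _.
by rewrite -!scalerDl scalerA.
Qed.

Let kW a b c d := 4^-1 * (\sum_e om c e a * om e d b + \sum_r om b r a * om c d r
   + \sum_r om a r r * om c d b).

Let TW m k p q := \sum_r (om m r r * om p q k - om p q r * om r k m
                        + om m r p * om r k q).

(** The commutator term of [kW] has its pairs of slots in the other order, which [alt_swap]
    corrects; the remaining terms agree by antisymmetry of [om]. *)
Lemma alt_kW a b c d : alt kW a b c d = 4^-1 * alt TW a b c d.
Proof.
have altD (T1 T2 : 'I_n -> 'I_n -> 'I_n -> 'I_n -> C) :
    alt (fun a b c d => T1 a b c d + T2 a b c d) a b c d = alt T1 a b c d + alt T2 a b c d.
  rewrite /alt -mulrDr -big_split; congr (_ * _); apply: eq_bigr => s _.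
  by rewrite /= mulrDr.
have altZ x (T1 : 'I_n -> 'I_n -> 'I_n -> 'I_n -> C) :
    alt (fun a b c d => x * T1 a b c d) a b c d = x * alt T1 a b c d.
  rewrite /alt [RHS]mulrCA [X in _ = _ * X]mulr_sumr; congr (_ * _); apply: eq_bigr => s _.
  by rewrite mulrCA.
have altE (T1 T2 : 'I_n -> 'I_n -> 'I_n -> 'I_n -> C) :
    (forall a b c d, T1 a b c d = T2 a b c d) -> alt T1 a b c d = alt T2 a b c d.
  by move=> TE; rewrite /alt; congr (_ * _); apply: eq_bigr => s _; rewrite TE.
pose T1 a b c d := \sum_e om a e c * om e b d.
pose T2 a b c d := \sum_r om b r a * om c d r + \sum_r om a r r * om c d b.
rewrite (altE kW (fun a b c d => 4^-1 * (T1 c d a b + T2 a b c d))); last first.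
  by move=> *; rewrite /kW /T1 /T2 addrA.
rewrite altZ (altD (fun a b c d => T1 c d a b)) alt_swap -altD; congr (_ * _).
apply: altE => m k p q; rewrite /T1 /T2 /TW -!big_split /=; apply: eq_bigr => r _.
by rewrite (omN k r); ring.
Qed.

(** Up to relabelling and antisymmetry, the six double contractions are [P] or [U] with a sign; they
    add up to [U - P]. *)
Lemma scalar_kW : \sum_a \sum_b (kW a b b a - kW a b a b) =
  4^-1 * \sum_a \sum_b \sum_c (om a c a * om c b b - om a c b * om c b a).
Proof.
have -> : \sum_a \sum_b (kW a b b a - kW a b a b) = 4^-1 * (
    (\sum_a \sum_b \sum_e om b e a * om e a b - \sum_a \sum_b \sum_e om a e a * om e b b)
    + (\sum_a \sum_b \sum_e om b e a * om b a e - \sum_a \sum_b \sum_e om b e a * om a b e)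
    + (\sum_a \sum_b \sum_e om a e e * om b a b - \sum_a \sum_b \sum_e om a e e * om a b b)).
  rewrite -!sumrB -!big_split mulr_sumr /=; apply: eq_bigr => a _.
  rewrite -!sumrB -!big_split mulr_sumr /=; apply: eq_bigr => b _.
  by rewrite /kW -mulrBr; congr (_ * _); ring.
congr (_ * _).
pose P := \sum_a \sum_b \sum_c om a c b * om c b a.
pose U := \sum_a \sum_b \sum_c om a c a * om c b b.
have -> : \sum_a \sum_b \sum_e om b e a * om e a b = P.
  by rewrite /P exchange_big.
have -> : \sum_a \sum_b \sum_e om a e a * om e b b = U by [].
have t3 : \sum_a \sum_b \sum_e om b e a * om b a e = - P.
  rewrite /P [X in - X]exchange_big /= -sumrN; apply: eq_bigr => b _.
  rewrite [X in - X]exchange_big /= -sumrN; apply: eq_bigr => c _.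
  by rewrite -sumrN; apply: eq_bigr => a _; rewrite (omN a c) mulNr opprK.
have -> : \sum_a \sum_b \sum_e om b e a * om a b e = P.
  rewrite -[P]opprK -t3 -sumrN; apply: eq_bigr => a _.
  rewrite -sumrN; apply: eq_bigr => b _; rewrite -sumrN.
  by apply: eq_bigr => e _; rewrite (omN a b) mulrN.
have -> : \sum_a \sum_b \sum_e om a e e * om b a b = U.
  rewrite exchange_big; apply: eq_bigr => a _ /=; rewrite [RHS]exchange_big.
  by apply: eq_bigr => c _; apply: eq_bigr => b _; rewrite mulrC.
have -> : \sum_a \sum_b \sum_e om a e e * om a b b = - U.
  rewrite /U; under [X in - X]eq_bigr do rewrite exchange_big /=.
  rewrite [X in - X]exchange_big /= -sumrN; apply: eq_bigr => c _.
  rewrite exchange_big /= -sumrN; apply: eq_bigr => a _; rewrite -sumrN.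
  by apply: eq_bigr => b _; rewrite (omN a c) mulNr opprK.
have -> : \sum_a \sum_b \sum_c (om a c a * om c b b - om a c b * om c b a) = U - P.
  rewrite -sumrB; apply: eq_bigr => a _.
  rewrite -sumrB; apply: eq_bigr => b _; rewrite -sumrB.
  by [].
rewrite t3; ring.
Qed.

Definition scal_om := \sum_a \sum_b \sum_c (om a c a * om c b b - om a c b * om c b a).

Lemma WquadE : exists A, Wquad = clif024 (4^-1 * scal_om) A kW.
Proof.
by rewrite Wquad_normal sum_G2G2 scalar_kW; eexists.
Qed.

Lemma tr_G4_Wquad a b c d : uniq [:: a; b; c; d] ->
  \tr (adjmx (G4 a b c d) *m Wquad) = 4`!%:R * (4^-1 * alt TW a b c d) *+ N.
Proof. by move=> u; have [A ->] := WquadE; rewrite alt_tr// alt_kW. Qed.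

Hypothesis om_real : forall a b c, cj (om a b c) = om a b c.

Lemma adj_Om a : adjmx (Om a) = - Om a.
Proof.
rewrite OmE adjmxZ fmorphV rmorph_nat -scalerN; congr (_ *: _).
rewrite adjmx_sum -sumrN; apply: eq_bigr => c _.
rewrite adjmx_sum -sumrN; apply: eq_bigr => d _.
by rewrite adjmxZ om_real adj_G2 scalerN.
Qed.

(** W is self-adjoint, since [Om] and [G2] are skew-adjoint and [G2] is antisymmetric. With real
    coefficients, degrees 0 and 4 are self-adjoint and degree 2 is skew-adjoint; so the degree 2
    part equals its own negative. *)
Lemma Wquad_clif : Wquad =
  clif024 (4^-1 * scal_om) (fun _ _ => 0) (fun a b c d => 4^-1 * alt TW a b c d).
Proof.
have adjW : adjmx Wquad = Wquad.
  rewrite {1}/Wquad exchange_big adjmx_sum; apply: eq_bigr => a _ /=.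
  rewrite adjmx_sum; apply: eq_bigr => b _.
  rewrite !adjmxM !adj_Om adj_G2 -G2C mulmxN mulNmx mulmxN opprK.
  by rewrite mulmxA.
have cjk a b c d : cj (kW a b c d) = kW a b c d.
  by rewrite /kW rmorphM fmorphV rmorph_nat !rmorphD !rmorph_sum /=; congr (_ * (_ + _ + _));
    apply: eq_bigr => e _; rewrite rmorphM /= !om_real.
have cjx : cj (4^-1 * scal_om) = 4^-1 * scal_om.
  rewrite -scalar_kW rmorph_sum; apply: eq_bigr => a _.
  by rewrite rmorph_sum; apply: eq_bigr => b _; rewrite rmorphB /= !cjk.
move: Wquad_normal; rewrite sum_G2G2 scalar_kW; set A := (X in clif024 _ X _) => WE.
have cjA a b : cj (A a b) = A a b.
  by rewrite /A rmorph_sum; apply: eq_bigr => c _; rewrite rmorphD !rmorphB /= !cjk.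
have A0 : \sum_a \sum_b A a b *: G2 a b = 0.
  have : adjmx Wquad = clif024 (4^-1 * scal_om) (fun a b => - A a b) kW.
    rewrite WE /clif024 !adjmxD; congr (_ + _ + _).
    - by rewrite -scalemx1 adjmxZ cjx adjmx1.
    - rewrite adjmx_sum; apply: eq_bigr => a _; rewrite adjmx_sum; apply: eq_bigr => b _.
      by rewrite adjmxZ cjA adj_G2 scalerN scaleNr.
    - rewrite adjmx_sum; apply: eq_bigr => a _; rewrite adjmx_sum; apply: eq_bigr => b _.
      rewrite adjmx_sum; apply: eq_bigr => c _; rewrite adjmx_sum; apply: eq_bigr => d _.
      by rewrite adjmxZ cjk adj_G4.
  rewrite adjW WE /clif024 => /addIr/addrI.
  under [RHS]eq_bigr do under eq_bigr do rewrite scaleNr.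
  under [RHS]eq_bigr do rewrite sumrN.
  rewrite sumrN => /eqP; rewrite -subr_eq0 opprK -mulr2n -scaler_nat scaler_eq0.
  by rewrite pnatr_eq0 => /eqP.
rewrite WE /clif024 A0 sum_alt; congr (_ + _ + _).
  by rewrite big1// => a _; rewrite big1// => b _; rewrite scale0r.
apply: eq_bigr => a _; apply: eq_bigr => b _; apply: eq_bigr => c _.
by apply: eq_bigr => d _; rewrite alt_kW.
Qed.

End connection.

Section linear_part.
Variables (om : 'I_n -> 'I_n -> 'I_n -> C) (E : 'I_n -> C).
Hypothesis omN : forall a b c, om a b c = - om b a c.

Definition Clin := \sum_a \sum_b E a *: (G2 a b *m Om om b).

Definition Mlin a b := - (\sum_d E a * om b d d) + \sum_d E b * om a d d
  + \sum_c E c * om c a b - \sum_c E c * om c b a.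

(** The normal order is [sum_G2G2] for a coefficient that is a product. Its degree 2 part is
    antisymmetrized by [clif024_alt], and antisymmetry of [om] merges the contractions into
    [Mlin]. *)
Lemma ClinE : Clin = clif024 (- 2^-1 * \sum_a \sum_b E a * om a b b)
  (fun a b => 4^-1 * Mlin a b) (alt (fun a b c d => 4^-1 * (E a * om c d b))).
Proof.
have -> : Clin = \sum_a \sum_b \sum_c \sum_d
    (4^-1 * (E a * om c d b)) *: (G2 a b *m G2 c d).
  apply: eq_bigr => a _; apply: eq_bigr => b _.
  rewrite OmE// -(scalemxAr 4^-1) mulmx_sumr !scaler_sumr; apply: eq_bigr => c _.
  rewrite mulmx_sumr !scaler_sumr; apply: eq_bigr => d _.
  by rewrite -scalemxAr !scalerA mulrCA mulrA.
rewrite sum_G2G2 clif024_alt /clif024; congr (_ + _ + _).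
  congr (_%:M); rewrite mulr_sumr; apply: eq_bigr => a _.
  rewrite mulr_sumr; apply: eq_bigr => b _.
  by rewrite (omN b a b); field.
apply: eq_bigr => a _; apply: eq_bigr => b _; congr (_ *: _).
rewrite /Mlin -!sumrN -!big_split /= !mulr_sumr; apply: eq_bigr => c _.
rewrite (omN c b c) (omN a c b) (omN c a c) (omN b c a).
by field.
Qed.

End linear_part.

End clifford.

(** * Lebesgue measure on R^n *)

Section lebesgue_Rn_theory.
Variables (R : realType) (n : nat).
Local Notation T := (Rn_leb R n).
Local Notation lam := (@lebesgue_Rn R n).
Implicit Types (A B U K : set 'rV[R]_n) (x y : 'rV[R]_n).

Lemma box_volume_ge0 (B : option ('rV[R]_n * 'rV[R]_n)) : 0 <= box_volume B.
Proof.
by case: B => [ab|]//=; apply: prodr_ge0 => i _; rewrite le_max lexx.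
Qed.

Lemma lebesgue_outer_box (B : option ('rV[R]_n * 'rV[R]_n)) :
  (lebesgue_outer (box B) <= (box_volume B)%:E)%E.
Proof.
apply: ereal_inf_lbound; exists (fun k : nat => if k == 0%N then B else None).
  by move=> x Bx; exists 0%N.
rewrite (nneseries_split 0 1)//=; last by move=> k _; rewrite lee_fin; exact: box_volume_ge0.
by rewrite add0n big_nat1 eseries0 ?adde0// => -[].
Qed.

(** A hyperplane cuts each box of a cover into two boxes [lo] and [hi] with the same total volume,
    so every cover splits into covers of the two parts, as Caratheodory's criterion demands. *)
Lemma measurable_halfspace i (c : R) : measurable ([set x | x ord0 i < c] : set T).
Proof.
apply: (@le_caratheodory_measurable _ _ (@lebesgue_outer R n)) => X.
set H := [set x | _].
apply: le_ereal_inf_tmp => _ [B XB <-].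
pose lo (B : option ('rV[R]_n * 'rV[R]_n)) := if B is Some ab then
  Some (ab.1, \row_j (if j == i then Num.min (ab.2 ord0 i) c else ab.2 ord0 j)) else None.
pose hi (B : option ('rV[R]_n * 'rV[R]_n)) := if B is Some ab then
  Some (\row_j (if j == i then Num.max (ab.1 ord0 i) c else ab.1 ord0 j), ab.2) else None.
have volE C : box_volume C = box_volume (lo C) + box_volume (hi C).
  case: C => [[a b]|]; last by rewrite /= addr0.
  rewrite /box_volume /lo /hi (bigD1 i)//= [X in _ = X + _](bigD1 i)//=.
  rewrite [X in _ = _ + X](bigD1 i)//= !mxE eqxx.
  have -> : \prod_(j < n | j != i) Num.max 0 ((\row_j (if j == i then Num.min (b ord0 i) c else b ord0 j)) ord0 j - a ord0 j)
    = \prod_(j < n | j != i) Num.max 0 (b ord0 j - a ord0 j).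
    by apply: eq_bigr => j ji; rewrite mxE (negbTE ji).
  have -> : \prod_(j < n | j != i) Num.max 0 (b ord0 j - (\row_j (if j == i then Num.max (a ord0 i) c else a ord0 j)) ord0 j)
    = \prod_(j < n | j != i) Num.max 0 (b ord0 j - a ord0 j).
    by apply: eq_bigr => j ji; rewrite mxE (negbTE ji).
  rewrite -mulrDl; congr (_ * _).
  move: (a ord0 i) (b ord0 i) => u v.
  rewrite /Num.max /Num.min; case: (ltP v c); case: (ltP u c) => ? ?;
    do ?case: ltP => ?; lra.
have loP C x : box C x -> H x -> box (lo C) x.
  case: C => [[a b]|]//= Cx Hx j; have /andP[ax xb] := Cx j.
  rewrite ax mxE; case: eqP => [ji|//]; move: xb Hx; rewrite /H ji /= => xb Hx.
  by rewrite lt_min xb Hx.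
have hiP C x : box C x -> ~ H x -> box (hi C) x.
  case: C => [[a b]|]//= Cx Hx j; have /andP[ax xb] := Cx j.
  rewrite xb mxE andbT; case: eqP => [ji|//]; move: ax Hx; rewrite /H ji /= => ax /negP.
  by rewrite -leNgt ge_max ax.
apply: (@le_trans _ _ (\sum_(k <oo) (box_volume (lo (B k)))%:E + \sum_(k <oo) (box_volume (hi (B k)))%:E)%E).
  apply: leeD; apply: ereal_inf_lbound.
  - exists (lo \o B) => // x [/XB[k _ Bx] Hx]; exists k => //; exact: loP.
  - exists (hi \o B) => // x [/XB[k _ Bx] Hx]; exists k => //; exact: hiP.
rewrite -nneseriesD; last 2 first.
- by move=> k _ _; rewrite lee_fin; exact: box_volume_ge0.
- by move=> k _ _; rewrite lee_fin; exact: box_volume_ge0.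
by rewrite le_eqVlt; apply/orP; left; apply/eqP/eq_eseriesr => k _ /=; rewrite -EFinD -volE.
Qed.

Lemma measurable_box (B : option ('rV[R]_n * 'rV[R]_n)) : measurable (box B : set T).
Proof.
case: B => [[a b]|]; last exact: measurable0.
rewrite (_ : box _ = \bigcap_(i in [set: 'I_n]) ((~` [set x | x ord0 i < a ord0 i]) `&`
    [set x | x ord0 i < b ord0 i])).
  apply: (@fin_bigcap_measurable _ T); first exact: finite_finset.
  move=> i _; apply: measurableI; last exact: measurable_halfspace.
  by apply: measurableC; exact: measurable_halfspace.
apply/seteqP; split => x /= H i; first by move=> _; have /andP[? ?] := H i; split => //=; apply/negP; rewrite -leNgt.
by have [/= /negP ? ?] := H i I; rewrite leNgt; apply/andP.
Qed.

Lemma ball_rat_box x (e : R) : 0 < e -> exists q : 'rV[rat]_n * 'rV[rat]_n,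
  box (Some (map_mx ratr q.1, map_mx ratr q.2)) x /\
  forall y, box (Some (map_mx ratr q.1, map_mx ratr q.2)) y -> ball x e y.
Proof.
move=> e0.
have lo (i : 'I_n) : exists q : rat, ratr q \in `]x ord0 i - e, x ord0 i[%R.
  by apply: rat_in_itvoo; rewrite ltrBlDr ltrDl.
have hi (i : 'I_n) : exists q : rat, ratr q \in `]x ord0 i, x ord0 i + e[%R.
  by apply: rat_in_itvoo; rewrite ltrDl.
have [f fP] := choice lo; have [h hP] := choice hi.
exists (\row_i f i, \row_i h i); split => [i|y By].
  by rewrite /= !mxE; have := fP i; have := hP i; rewrite !in_itv /= => /andP[-> _] /andP[_ /ltW ->].
split => // i j; rewrite (ord1 i); have := By j; rewrite /= !mxE => /andP[f1 h1].
have := fP j; have := hP j; rewrite !in_itv /= => /andP[_ h2] /andP[f2 _].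
rewrite -ball_normE /= ltr_distlC; apply/andP; split; lra.
Qed.

Lemma open_bigcup_box U : open U -> U = \bigcup_(q in [set q : 'rV[rat]_n * 'rV[rat]_n |
   box (Some (map_mx ratr q.1, map_mx ratr q.2)) `<=` U])
   box (Some (map_mx ratr q.1, map_mx ratr q.2)).
Proof.
move=> oU; apply/seteqP; split => [x Ux|x [q qU]]; last exact: qU.
have /nbhs_ballP[e e0 eU] := open_nbhs_nbhs (conj oU Ux).
have [q [qx qe]] := ball_rat_box x e0.
by exists q => // y /= /qe; exact: eU.
Qed.

Lemma measurable_open U : open U -> measurable (U : set T).
Proof.
move=> /open_bigcup_box ->; rewrite bigcup_mkcond.
apply: (@countable_bigcupT_measurable _ T); first exact: countableP.
by move=> q; case: ifP => _; [exact: measurable_box|exact: measurable0].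
Qed.

Lemma measurable_closed K : closed K -> measurable (K : set T).
Proof.
move=> cK; rewrite -[K]setCK; apply: measurableC; apply: measurable_open.
exact: closed_openC.
Qed.

Lemma hausdorff_rV : hausdorff_space 'rV[R]_n.
Proof. exact: norm_hausdorff. Qed.

Lemma measurable_compact K : compact K -> measurable (K : set T).
Proof. move=> cK; apply: measurable_closed; exact: compact_closed hausdorff_rV cK. Qed.

Lemma null_measurable A : lebesgue_outer A = 0%E -> measurable (A : set T).
Proof.
move=> A0; apply: (@le_caratheodory_measurable _ _ (@lebesgue_outer R n)) => X.
rewrite -[leRHS]add0e; apply: leeD; last by apply: le_lebesgue_outer => y [].
by rewrite -A0; apply: le_lebesgue_outer => y [].
Qed.

Lemma null_subset A B : A `<=` B -> lebesgue_outer B = 0%E -> lebesgue_outer A = 0%E.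
Proof.
move=> AB B0; apply/eqP; rewrite eq_le lebesgue_outer_ge0 andbT -B0.
exact: le_lebesgue_outer.
Qed.

Lemma null_bigcup I (D : set I) (F : I -> set 'rV[R]_n) : countable D ->
  (forall i, D i -> lebesgue_outer (F i) = 0%E) ->
  lebesgue_outer (\bigcup_(i in D) F i) = 0%E.
Proof.
move=> cD F0; have [->|/set0P[d0 Dd0]] := eqVneq D set0.
  by rewrite bigcup_set0 lebesgue_outer0.
have [h [hD Dh]] : exists h : nat -> I, (forall k, D (h k)) /\ forall i, D i -> exists k, h k = i.
  have /countable_injP[f finj] := cD.
  pose h k := if pselect (exists2 i, D i & f i = k) is left H then projT1 (cid2 H) else d0.
  exists h; split => [k|i Di].
    by rewrite /h; case: pselect => // H; case: cid2.
  exists (f i); rewrite /h; case: pselect => [H|]; last by case; exists i.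
  by case: cid2 => j Dj fj /=; apply: finj => //; rewrite inE.
apply/eqP; rewrite eq_le lebesgue_outer_ge0 andbT.
apply: (@le_trans _ _ (lebesgue_outer (\bigcup_k F (h k)))).
  by apply: le_lebesgue_outer => x [i Di Fx]; have [k hk] := Dh _ Di; exists k; rewrite ?hk.
apply: (le_trans (lebesgue_outer_sigma_subadditive (fun k => F (h k)))).
by rewrite eseries0// => k _ _; rewrite F0.
Qed.

Lemma null_setU A B : lebesgue_outer A = 0%E -> lebesgue_outer B = 0%E ->
  lebesgue_outer (A `|` B) = 0%E.
Proof.
move=> A0 B0; rewrite -bigcup2inE.
apply: null_bigcup => [|k _]; first exact: countableP.
by rewrite /bigcup2; case: ifP => //; case: ifP.
Qed.

(** Countably many rational boxes are enough to cover [A] by null pieces. *)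
Lemma null_local A : (forall x, A x -> exists W : set 'rV[R]_n, [/\ open W, W x &
  lebesgue_outer (A `&` W) = 0%E]) -> lebesgue_outer A = 0%E.
Proof.
move=> Aloc.
pose bx (q : 'rV[rat]_n * 'rV[rat]_n) := box (Some (map_mx (@ratr R) q.1, map_mx ratr q.2)).
apply: (@null_subset _ (\bigcup_(q in [set q | lebesgue_outer (A `&` bx q) = 0%E]) (A `&` bx q))).
  move=> x Ax; have [W [oW Wx W0]] := Aloc _ Ax.
  have /nbhs_ballP[e e0 eU] := open_nbhs_nbhs (conj oW Wx).
  have [q [qx qe]] := ball_rat_box x e0; exists q; last by split.
  by apply: null_subset W0 => y [Ay /qe /eU].
by apply: null_bigcup => //; exact: countableP.
Qed.

Definition ae_in U (P : 'rV[R]_n -> Prop) :=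
  lebesgue_outer [set y | U y /\ ~ P y] = 0%E.

Lemma ae_in_impl U P Q : (forall y, U y -> P y -> Q y) -> ae_in U P -> ae_in U Q.
Proof. by move=> PQ; apply: null_subset => y [Uy nQ]; split=> // /(PQ _ Uy). Qed.

Lemma ae_in_ae (U : set T) (P : T -> Prop) : ae_in U P ->
  {ae lam, forall y, U y -> P y}.
Proof.
move=> aP; exists [set y | U y /\ ~ P y]; split => //.
- exact: null_measurable.
- by move=> y /= /not_implyP.
Qed.

Lemma measurable_continuous (U : set 'rV[R]_n) (D : set T) (f : 'rV[R]_n -> R) :
  open U -> {in U, continuous f} -> D `<=` U -> measurable_fun D (f : T -> R).
Proof.
move=> oU cf DU mD; move: (mD).
apply: (measurability _ (RGenOInfty.measurableE R)).
move=> _ [_ [a ->] <-].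
rewrite (_ : D `&` _ = D `&` (U `&` f @^-1` [set` Interval (BRight a) (BInfty R false)])).
  apply: measurableI => //; apply: measurable_open.
  rewrite openE => x [Ux fx]; rewrite /interior; near=> y; split.
  - by near: y; apply: open_nbhs_nbhs.
  - near: y; apply: (cf x); first by rewrite inE.
    by apply: open_nbhs_nbhs; split => //; exact: interval_open.
rewrite setIA; congr (_ `&` _); apply/seteqP; split => x; [move=> Dx|by case].
by split => //; exact: DU.
Unshelve. all: by end_near. Qed.

Lemma compact_box K : compact K -> exists2 M : R, 0 < M & forall x, K x -> forall i, `|x ord0 i| < M.
Proof.
move=> /compact_bounded[M [Mr MP]].
have M1 : M < `|M| + 1 by rewrite (le_lt_trans (ler_norm _))// ltrDl.
exists (`|M| + 2); first by rewrite ltr_wpDl.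
move=> x Kx i; have H : `|x| <= `|M| + 1 by exact: (MP _ M1 _ Kx).
apply: (@le_lt_trans _ _ (`|M| + 1)); last by rewrite ltrD2l ltr1n.
move: H; rewrite {1}/Num.norm /= mx_normrE => /bigmax_leP[_].
by move=> /(_ (ord0, i) isT).
Qed.

Lemma lam_compact_lty K : compact K -> (lam K < +oo)%E.
Proof.
move=> /compact_box[M M0 KM].
apply: (@le_lt_trans _ _ (lebesgue_outer (box (Some (\row__ - M, \row__ M))))).
  apply: le_lebesgue_outer => x /KM xM i /=; rewrite !mxE.
  by have := xM i; rewrite ltr_norml => /andP[/ltW -> ->].
by apply: le_lt_trans (lebesgue_outer_box _) _; rewrite ltry.
Qed.

Lemma continuous_bounded U K (f : 'rV[R]_n -> R) : open U -> {in U, continuous f} ->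
  compact K -> K `<=` U -> exists M, forall x, K x -> `|f x| <= M.
Proof.
move=> oU cf cK KU.
have : compact (f @` K).
  apply: continuous_compact => //; apply: continuous_in_subspaceT => x.
  by rewrite inE => /KU Ux; apply: cf; rewrite inE.
move=> /compact_bounded[M [Mr MP]]; exists (`|M| + 1) => x Kx.
by apply: MP; [rewrite (le_lt_trans (ler_norm _))// ltrDl|exists x].
Qed.

Lemma integrable_bounded (D : set T) (f : T -> R) M : measurable D -> (lam D < +oo)%E ->
  measurable_fun D f -> (forall x, D x -> `|f x| <= M) -> lam.-integrable D (EFin \o f).
Proof.
move=> mD Doo mf fM; apply: measurable_bounded_integrable => //.
exists M; split; first exact: num_real.
by move=> N MN x Dx; exact: le_trans (fM _ Dx) (ltW MN).
Qed.

Lemma integrable_bounded_mul (D : set T) (f h : T -> R) M : measurable D ->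
  lam.-integrable D (EFin \o f) ->
  measurable_fun D h -> (forall x, D x -> `|h x| <= M) ->
  lam.-integrable D (EFin \o (fun x => f x * h x)).
Proof.
move=> mD fi mh hM.
apply: (@le_integrable _ _ _ lam D mD _ (fun x => `|M|%:E * (EFin \o f) x)%E).
- apply/measurable_EFinP; apply: measurable_funM => //.
  by apply/measurable_EFinP; exact: measurable_int fi.
- move=> x Dx; rewrite /= lee_fin !normrM normr_id mulrC ler_wpM2r//.
  by apply: le_trans (hM _ Dx) (ler_norm _).
- exact: integrableZl.
Qed.

End lebesgue_Rn_theory.

Lemma differentiable_littleo (R : numFieldType) (V W : normedModType R) (f : V -> W)
    (L : {linear V -> W}) (x : V) :
  continuous L -> f \o shift x = cst (f x) + L +o_0 id -> differentiable f x.
Proof.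
move=> cL H; have dE : 'd f x = L :> (V -> W) by exact: diff_unique cL H.
by apply/diff_locallyP; rewrite dE; split.
Qed.

Lemma near_forall (T : topologicalType) (I : finType) (x : T) (P : I -> T -> Prop) :
  (forall i, \forall y \near x, P i y) -> \forall y \near x, forall i, P i y.
Proof. by move=> H; apply: filter_forall => i; exact: H. Qed.

(** * Smooth functions *)

Section smooth.
Variables (R : realType) (n : nat).
Local Notation X := 'rV[R]_n.
Implicit Types (U V : set X) (f h : X -> R).
Local Notation e_ i := (delta_mx ord0 i : X).

Lemma is_derive_line f (v y : X) (s : R) : derivable f (s *: v + y) v ->
  is_derive s 1 (fun t : R => f (t *: v + y)) ('D_v f (s *: v + y)).
Proof.
move=> df.
have E : (fun t : R => f (t *: v + y)) \o shift s = fun t : R => f (t *: v + (s *: v + y)).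
  by apply/funext => t /=; rewrite scalerDl addrA.
split.
  apply/derivable1P.
  have -> : (fun h0 : R => f ((h0 *: 1 + s) *: v + y)) = fun t : R => f (t *: v + (s *: v + y)).
    by apply/funext => t; rewrite scalerDl addrA [_ *: 1]mulr1.
  by have /derivable1P := df.
have E2 : (fun u : R => u^-1 *: (((fun t : R => f (t *: v + y)) \o shift s) (u *: (1 : R^o)) - f (s *: v + y))) =
    (fun u : R => u^-1 *: ((f \o shift (s *: v + y)) (u *: v) - f (s *: v + y))).
  by apply/funext => t /=; rewrite scalerDl addrA [_ *: 1]mulr1.
by rewrite /derive E2.
Qed.

Lemma continuous_sumR (I : Type) (r : seq I) (F : I -> X -> R) (x : X) :
  (forall i, {for x, continuous (F i)}) ->
  {for x, continuous (fun y => \sum_(i <- r) F i y)}.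
Proof.
move=> cF; elim: r => [|i r IH].
  rewrite (_ : (fun y => _) = cst 0); first exact: cst_continuous.
  by apply/funext => y; rewrite big_nil.
rewrite (_ : (fun y => _) = F i \+ (fun y => \sum_(i <- r) F i y)).
  exact: continuousD.
by apply/funext => y; rewrite big_cons.
Qed.

Lemma mvt_dir f (v y : X) (t : R) :
  (forall s : R, `|s| <= `|t| -> derivable f (s *: v + y) v) ->
  exists2 s : R, `|s| <= `|t| & f (t *: v + y) - f y = t * 'D_v f (s *: v + y).
Proof.
move=> df; pose g s := f (s *: v + y).
have gd (s : R) : `|s| <= `|t| -> is_derive s 1 g ('D_v f (s *: v + y)).
  by move=> st; apply: is_derive_line; exact: df.
have cg (a b : R) : (forall s : R, s \in `[a, b] -> `|s| <= `|t|) -> {within `[a, b], continuous g}.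
  move=> ab; apply: derivable_within_continuous => s sab.
  by have [] := gd _ (ab _ sab).
have g0 : g 0 = f y by rewrite /g scale0r add0r.
have [t0|t0] := leP 0 t.
  have I (s : R) : s \in `[0, t] -> `|s| <= `|t|.
    by rewrite in_itv /= => /andP[s0 st]; rewrite !ger0_norm.
  have [s st H] : exists2 s : R, s \in `[0, t] & g t - g 0 = 'D_v f (s *: v + y) * (t - 0).
    apply: (@MVT_segment _ g (fun s : R => 'D_v f (s *: v + y))) => //; last exact: cg.
    by move=> s sI; apply/gd/I; apply: subset_itv_oo_cc sI.
  by exists s; [exact: I|rewrite -g0 -/(g t) H subr0 mulrC].
have I (s : R) : s \in `[t, 0] -> `|s| <= `|t|.
  rewrite in_itv /= => /andP[st s0]; rewrite !ler0_norm ?lerN2//.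
  exact: ltW.
have [s st H] : exists2 s : R, s \in `[t, 0] & g 0 - g t = 'D_v f (s *: v + y) * (0 - t).
  apply: (@MVT_segment _ g (fun s : R => 'D_v f (s *: v + y))); [exact: ltW| |exact: cg].
  by move=> s sI; apply/gd/I; apply: subset_itv_oo_cc sI.
exists s; first exact: I.
by rewrite -g0 -/(g t) -opprB H sub0r mulrN opprK mulrC.
Qed.

Lemma ball_rV (x y : X) (e : R) : 0 < e -> ball x e y <-> forall i, `|y ord0 i - x ord0 i| < e.
Proof.
move=> e0; split => [[_ H] i|H].
  by have := H ord0 i; rewrite -ball_normE /= distrC.
by split => // i j; rewrite (ord1 i) -ball_normE /= distrC.
Qed.

Lemma rV_norm_ge (x : X) i : `|x ord0 i| <= `|x|.
Proof.
have : `|x| <= `|x| by [].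
rewrite {1}/Num.norm /= mx_normrE => /bigmax_leP[_].
by move=> /(_ (ord0, i) isT).
Qed.

(** The increment of [f] is telescoped along a path parallel to the axes, and the mean value theorem
    is applied to each segment. *)
Lemma C1_differentiable f (x : X) :
  (\forall y \near x, forall i, derivable f y (e_ i)) ->
  (forall i, {for x, continuous (partial i f)}) ->
  differentiable f x.
Proof.
move=> df cf.
pose L (v : X) : R := \sum_i v ord0 i * partial i f x.
have linL : linear L.
  move=> a u v; rewrite /L scaler_sumr -big_split; apply: eq_bigr => i _ /=.
  by rewrite !mxE mulrDl -mulrA.
pose Ll : {linear X -> R} := HB.pack L (GRing.isLinear.Build _ _ _ _ L linL).
have cL : continuous Ll.
  move=> v; apply: continuous_sumR => i.
  apply: continuousM; last exact: cst_continuous.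
  exact: coord_continuous.
apply: (differentiable_littleo cL).
  apply/eqaddoP => _/posnumP[eps].
  (* The error is distributed over the [n] segments; [n.+1] keeps the denominator positive for
     [n = 0]. *)
  have [d d0 dP] : exists2 d : R, 0 < d & forall y, ball x d y ->
      (forall i, derivable f y (e_ i)) /\
      (forall i, `|partial i f y - partial i f x| <= eps%:num / n.+1%:R).
    have H1 : \forall y \near x, forall i, `|partial i f y - partial i f x| <= eps%:num / n.+1%:R.
      apply: near_forall => i.
      have e0 : 0 < eps%:num / n.+1%:R by rewrite divr_gt0.
      have /cvgrPdist_le/(_ _ e0) := cf i.
      by apply: filterS => y; rewrite distrC.
    have H2 : nbhs x (fun y => (forall i, derivable f y (e_ i)) /\
        (forall i, `|partial i f y - partial i f x| <= eps%:num / n.+1%:R)) by exact: filterI.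
    have /nbhs_ballP[d /= d0 dP] := H2.
    by exists d => // y /dP [].
  apply/nbhs_ballP; exists d => // v; rewrite -ball_normE /= sub0r normrN => vd.
  (* The vertices of the path: at [P k] the first [k] coordinates have been moved. *)
  pose P (k : nat) : X := \row_i (if (i < k)%N then v ord0 i else 0) + x.
  have Pn : P n = v + x by congr (_ + _); apply/rowP => i; rewrite mxE ltn_ord.
  have P0 : P 0%N = x.
    by rewrite /P (_ : \row_i _ = 0) ?add0r//; apply/rowP => i; rewrite !mxE.
  have PS (i : 'I_n) : P i.+1 = v ord0 i *: e_ i + P i.
    rewrite /P addrA; congr (_ + _); apply/rowP => j; rewrite !mxE eqxx /=.
    rewrite ltnS leq_eqVlt; have [->|ji] := eqVneq j i.
      by rewrite eqxx ltnn mulr1 addr0.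
    by rewrite (negbTE (_ : val j != val i)) ?mulr0 ?add0r.
  have in_ball (i : 'I_n) s : `|s| <= `|v ord0 i| -> ball x d (s *: e_ i + P i).
    move=> sv; apply/ball_rV => // j; rewrite !mxE eqxx /= addrA addrK.
    have [->|ji] := eqVneq j i.
      by rewrite ltnn mulr1 addr0 (le_lt_trans sv)// (le_lt_trans (rV_norm_ge _ _)).
    rewrite mulr0 add0r; case: ifP => _; last by rewrite normr0.
    exact: (le_lt_trans (rV_norm_ge _ _)).
  have step (i : 'I_n) : `|f (P i.+1) - f (P i) - v ord0 i * partial i f x|
      <= eps%:num / n.+1%:R * `|v|.
    have [s sv ->] : exists2 s, `|s| <= `|v ord0 i| &
        f (P i.+1) - f (P i) = v ord0 i * partial i f (s *: e_ i + P i).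
      rewrite PS; apply: mvt_dir => s sv.
      by have [] := dP _ (in_ball i s sv).
    rewrite -mulrBr normrM mulrC ler_pM ?rV_norm_ge//.
    by have [_] := dP _ (in_ball i s sv).
  have -> : (f \o shift x - (cst (f x) + Ll)) v = f (v + x) - (f x + L v) by [].
  rewrite -Pn -{1}P0 /L opprD addrA.
  have -> : f (P n) - f (P 0%N) = \sum_(i < n) (f (P i.+1) - f (P i)).
    by rewrite -(big_mkord xpredT (fun i => f (P i.+1) - f (P i))) telescope_sumr.
  rewrite -sumrB (le_trans (ler_norm_sum _ _ _))//.
  apply: (@le_trans _ _ (\sum_(i < n) (eps%:num / n.+1%:R * `|v|))).
    by apply: ler_sum => i _; exact: step.
  rewrite sumr_const card_ord -[leLHS]mulr_natl mulrA ler_wpM2r//.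
  by rewrite mulrCA ler_piMr// ler_pdivrMr// mul1r ler_nat.
Qed.

Lemma Ck_on_continuous k U f : Ck_on k U f -> {in U, continuous f}.
Proof. by case: k => [|k] []. Qed.

Lemma Ck_on_sub k U V f : V `<=` U -> Ck_on k U f -> Ck_on k V f.
Proof.
elim: k f => [|k IH] f VU /= [cf H]; split => //.
- by move=> x /[1!inE] /VU Ux; apply: cf; rewrite inE.
- by move=> x /[1!inE] /VU Ux; apply: cf; rewrite inE.
move=> i; have [df kf] := H i; split; last exact: IH.
by move=> x /[1!inE] /VU Ux; apply: df; rewrite inE.
Qed.

Lemma Ck_onW k U f : Ck_on k.+1 U f -> Ck_on k U f.
Proof.
elim: k f => [|k IH] f; first by case.
move=> [cf H]; split => // i; have [df kf] := H i; split => //.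
exact: IH.
Qed.

Lemma Ck_on_local k U f :
  (forall x, U x -> exists2 V, V x & Ck_on k V f) -> Ck_on k U f.
Proof.
elim: k f => [|k IH] f loc; split => //.
- by move=> x /[1!inE] /loc[V Vx [cf _]]; apply: cf; rewrite inE.
- by move=> x /[1!inE] /loc[V Vx [cf _]]; apply: cf; rewrite inE.
move=> i; split.
  by move=> x /[1!inE] /loc[V Vx [_ H]]; have [df _] := H i; apply: df; rewrite inE.
by apply: IH => x /loc[V Vx [_ H]]; exists V => //; have [] := H i.
Qed.

Lemma near_in U (x : X) (P : X -> Prop) : open U -> U x -> (forall y, U y -> P y) ->
  \forall y \near x, P y.
Proof.
by move=> oU Ux UP; apply: filterS UP _; apply: open_nbhs_nbhs.
Qed.

Lemma continuous_ext U f h (x : X) : open U -> U x -> (forall y, U y -> f y = h y) ->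
  {for x, continuous f} -> {for x, continuous h}.
Proof.
move=> oU Ux fh cf; rewrite /prop_for /continuous_at -(fh _ Ux).
have E : \forall y \near x, f y = h y by exact: near_in oU Ux fh.
by apply: (cvg_trans _ cf); apply: near_eq_cvg; [exact: nbhs_filter|exact: E].
Qed.

Lemma partial_ext U f h i : open U -> (forall y, U y -> f y = h y) ->
  forall y, U y -> partial i f y = partial i h y.
Proof.
move=> oU fh y Uy; apply: near_eq_derive.
exact: near_in oU Uy fh.
Qed.

Lemma Ck_on_ext k U f h : open U -> (forall y, U y -> f y = h y) ->
  Ck_on k U f -> Ck_on k U h.
Proof.
move=> oU; elim: k f h => [|k IH] f h fh [cf H]; split => //.
- move=> x /[1!inE] Ux; apply: continuous_ext fh _ => //.
  by apply: cf; rewrite inE.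
- move=> x /[1!inE] Ux; apply: continuous_ext fh _ => //.
  by apply: cf; rewrite inE.
move=> i; have [df kf] := H i; split.
  move=> x /[1!inE] Ux; apply: near_eq_derivable; last by apply: df; rewrite inE.
  exact: near_in oU Ux fh.
by apply: IH kf; exact: partial_ext.
Qed.

Lemma Ck_on_cst k U (c : R) : Ck_on k U (cst c).
Proof.
elim: k c => [|k IH] c; split => //; try by move=> x _; exact: cst_continuous.
move=> i; split; first by move=> x _; exact: derivable_cst.
rewrite (_ : partial i _ = cst 0)//.
by apply/funext => y; rewrite /partial derive_cst.
Qed.

Lemma Ck_onD k U f h : open U -> Ck_on k U f -> Ck_on k U h -> Ck_on k U (f \+ h).
Proof.
move=> oU; elim: k f h => [|k IH] f h [cf Hf] [ch Hh].
  by split => // x xU; apply: continuousD; [exact: cf|exact: ch].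
split; first by move=> x xU; apply: continuousD; [exact: cf|exact: ch].
move=> i; have [df kf] := Hf i; have [dh kh] := Hh i; split.
  by move=> x xU; apply: derivableD; [exact: df|exact: dh].
apply: Ck_on_ext oU _ (IH _ _ kf kh) => y Uy.
by rewrite /partial deriveD//; [apply: df; rewrite inE|apply: dh; rewrite inE].
Qed.

Lemma Ck_onM k U f h : open U -> Ck_on k U f -> Ck_on k U h -> Ck_on k U (f \* h).
Proof.
move=> oU; elim: k f h => [|k IH] f h Cf Ch; have [cf Hf] := Cf; have [ch Hh] := Ch.
  by split => // x xU; apply: continuousM; [exact: cf|exact: ch].
split; first by move=> x xU; apply: continuousM; [exact: cf|exact: ch].
move=> i; have [df kf] := Hf i; have [dh kh] := Hh i; split.
  by move=> x xU; apply: derivableM; [exact: df|exact: dh].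
apply: Ck_on_ext oU _ (Ck_onD oU (IH _ _ (Ck_onW Cf) kh) (IH _ _ (Ck_onW Ch) kf)) => y Uy.
by rewrite /partial deriveM//; [apply: df; rewrite inE|apply: dh; rewrite inE].
Qed.

Lemma Ck_on_sum k U (I : Type) (r : seq I) (F : I -> X -> R) : open U ->
  (forall i, Ck_on k U (F i)) -> Ck_on k U (fun y => \sum_(i <- r) F i y).
Proof.
move=> oU CF; elim: r => [|i r IH].
  by apply: (Ck_on_ext oU _ (Ck_on_cst k U 0)) => y _; rewrite big_nil.
by apply: (Ck_on_ext oU _ (Ck_onD oU (CF i) IH)) => y _; rewrite big_cons.
Qed.

Lemma Ck_on_prod k U (I : Type) (r : seq I) (F : I -> X -> R) : open U ->
  (forall i, Ck_on k U (F i)) -> Ck_on k U (fun y => \prod_(i <- r) F i y).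
Proof.
move=> oU CF; elim: r => [|i r IH].
  by apply: (Ck_on_ext oU _ (Ck_on_cst k U 1)) => y _; rewrite big_nil.
by apply: (Ck_on_ext oU _ (Ck_onM oU (CF i) IH)) => y _; rewrite big_cons.
Qed.

Lemma Ck_onN k U f : open U -> Ck_on k U f -> Ck_on k U (fun y => - f y).
Proof.
move=> oU Cf; apply: (Ck_on_ext oU _ (Ck_onM oU (Ck_on_cst k U (-1)) Cf)) => y _.
by rewrite /= mulN1r.
Qed.

Lemma is_derive_coord (j : 'I_n) (v x : X) :
  is_derive x v (fun y : X => y ord0 j) (v ord0 j).
Proof.
have dc : differentiable (fun y : X => y ord0 j) x by exact: differentiable_coord.
have lin : linear (fun y : X => y ord0 j) by move=> a u w; rewrite !mxE.
pose c : {linear X -> R} := HB.pack (fun y : X => y ord0 j) (GRing.isLinear.Build _ _ _ _ _ lin).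
split; first exact: diff_derivable.
rewrite deriveE// -[fun y : X => y ord0 j]/(c : X -> R) diff_lin//.
exact: coord_continuous.
Qed.

Lemma Ck_on_coord k U (j : 'I_n) : Ck_on k U (fun y => y ord0 j).
Proof.
case: k => [|k]; first by split => // x _; exact: coord_continuous.
split; first by move=> x _; exact: coord_continuous.
move=> i; split; first by move=> x _; apply/diff_derivable/differentiable_coord.
rewrite (_ : partial i _ = cst (e_ i ord0 j)); first exact: Ck_on_cst.
by apply/funext => y; rewrite /partial; have [_ ->] := is_derive_coord j (e_ i) y.
Qed.

Lemma Ck_on_differentiable k U f x : open U -> Ck_on k.+1 U f -> U x -> differentiable f x.
Proof.
move=> oU [cf H] Ux; apply: C1_differentiable.
  apply: near_in oU Ux _ => y Uy i; have [df _] := H i.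
  by apply: df; rewrite inE.
by move=> i; have [_ /Ck_on_continuous] := H i; apply; rewrite inE.
Qed.

Lemma Ck_on_inv k U f : open U -> (forall y, U y -> f y != 0) ->
  Ck_on k U f -> Ck_on k U (fun y => (f y)^-1).
Proof.
move=> oU f0; elim: k => [|k IH] Cf.
  split => // x xU; apply: continuousV; last by have [cf _] := Cf; exact: cf.
  by apply: f0; move: xU; rewrite inE.
have [cf H] := Cf; split.
  move=> x xU; apply: continuousV; last exact: cf.
  by apply: f0; move: xU; rewrite inE.
have CV := IH (Ck_onW Cf); move=> i; have [df kf] := H i; split.
  move=> x xU; apply: derivableV; last exact: df.
  by apply: f0; move: xU; rewrite inE.
apply: Ck_on_ext oU _ (Ck_onN oU (Ck_onM oU (Ck_onM oU CV CV) kf)) => y Uy.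
rewrite /partial deriveV ?f0//; last by apply: df; rewrite inE.
by rewrite -exprVn expr2 scaleNr.
Qed.

(** [D m] is the [m]-th derivative of [D 0]. The induction on [k] needs all [m] at once, because the
    derivative of [D m \o f] contains [D m.+1 \o f]. *)
Lemma Ck_on_comp1 k U f (D : nat -> R -> R) : open U ->
  (forall m (t : R), is_derive t 1 (D m) (D m.+1 t)) ->
  Ck_on k U f -> forall m, Ck_on k U (D m \o f).
Proof.
move=> oU dD.
have cD m : continuous (D m).
  move=> t; apply/differentiable_continuous/derivable1_diffP.
  by have [] := dD m t.
elim: k f => [|k IH] f Cf m.
  by split=> // x xU; apply: continuous_comp; [have [cf _] := Cf; exact: cf|exact: cD].
have [cf H] := Cf; split.
  by move=> x xU; apply: continuous_comp; [exact: cf|exact: cD].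
have dc i y : U y -> is_derive y (e_ i) (D m \o f) (D m.+1 (f y) * partial i f y).
  move=> Uy; have df := Ck_on_differentiable oU Cf Uy.
  have dm : differentiable (D m) (f y) by apply/derivable1_diffP; have [] := dD m (f y).
  split; first exact/diff_derivable/differentiable_comp.
  rewrite deriveE; last exact: differentiable_comp.
  rewrite diff_comp//= deriv1E; last by have [] := dD m (f y).
  rewrite -deriveE// derive1E; have [_ ->] := dD m (f y).
  by rewrite /partial [LHS]mulrC.
move=> i; split; first by move=> x /[1!inE] Ux; have [] := dc i x Ux.
have [_ kf] := H i.
apply: Ck_on_ext oU _ (Ck_onM oU (IH _ (Ck_onW Cf) m.+1) kf) => y Uy.
by have [_ H1] := dc i y Uy; rewrite /partial H1.
Qed.

End smooth.

Lemma continuous_rV (R : realType) (m : nat) (T : topologicalType) (psi : T -> 'rV[R]_m) (y : T) :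
  (forall a, {for y, continuous (fun z => psi z ord0 a)}) -> {for y, continuous psi}.
Proof.
move=> cpsi; apply/cvg_ballP => e e0.
have : \forall z \near y, forall a, `|psi z ord0 a - psi y ord0 a| < e.
  apply: filter_forall => a; have /cvgrPdist_lt/(_ _ e0) := cpsi a.
  by apply: filterS => z; rewrite distrC.
by apply: filterS => z H; apply/ball_rV.
Qed.

Section smooth_comp.
Variables (R : realType) (n m : nat).

Lemma partial_comp (U : set 'rV[R]_n) (V : set 'rV[R]_m) (psi : 'rV[R]_n -> 'rV[R]_m)
    (f : 'rV[R]_m -> R) (i : 'I_n) (y : 'rV[R]_n) :
  open U -> open V -> (forall a, Ck_on 1 U (fun z => psi z ord0 a)) ->
  Ck_on 1 V f -> U y -> V (psi y) ->
  derivable (f \o psi) y (delta_mx ord0 i) /\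
  partial i (f \o psi) y = \sum_a partial i (fun z => psi z ord0 a) y * partial a f (psi y).
Proof.
move=> oU oV Cpsi Cf Uy Vy.
have df : differentiable f (psi y) := Ck_on_differentiable oV Cf Vy.
have dpsi_a a : differentiable (fun z => psi z ord0 a) y := Ck_on_differentiable oU (Cpsi a) Uy.
have psiE : psi = fun z => \sum_a psi z ord0 a *: (delta_mx ord0 a : 'rV[R]_m).
  by apply/funext => z; rewrite {1}[psi z]row_sum_delta.
have dpsi : differentiable psi y.
  rewrite psiE -fct_sumE; apply: differentiable_sum => a.
  exact: differentiableZl.
split; first exact/diff_derivable/differentiable_comp.
rewrite /partial deriveE; last exact: differentiable_comp.
rewrite diff_comp//= -[X in 'd f _ X](deriveE _ dpsi).
have -> : 'D_(delta_mx ord0 i) psi y =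
    \sum_a partial i (fun z => psi z ord0 a) y *: (delta_mx ord0 a : 'rV[R]_m).
  rewrite [LHS]row_sum_delta; apply: eq_bigr => a _; congr (_ *: _).
  rewrite /partial.
  have dy : derivable psi y (delta_mx ord0 i) by exact: diff_derivable.
  by rewrite (derive_mx dy) mxE.
rewrite raddf_sum; apply: eq_bigr => a _.
have Z : 'd f (psi y) (partial i (fun z => psi z ord0 a) y *: (delta_mx ord0 a : 'rV[R]_m)) =
  partial i (fun z => psi z ord0 a) y * 'd f (psi y) (delta_mx ord0 a) by exact: linearZ.
by rewrite [RHS](_ : _ = partial i (fun z => psi z ord0 a) y * 'd f (psi y) (delta_mx ord0 a)) ?(deriveE _ df).
Qed.

Lemma Ck_on_comp k (U : set 'rV[R]_n) (V : set 'rV[R]_m) (psi : 'rV[R]_n -> 'rV[R]_m)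
    (f : 'rV[R]_m -> R) :
  open U -> open V -> (forall y, U y -> V (psi y)) ->
  (forall a, Ck_on k U (fun z => psi z ord0 a)) ->
  Ck_on k V f -> Ck_on k U (f \o psi).
Proof.
move=> oU oV UV; elim: k f => [|k IH] f Cpsi Cf.
  split => // x xU; apply: continuous_comp.
    by apply: continuous_rV => a; have [cp _] := Cpsi a; exact: cp.
  by have [cf _] := Cf; apply: cf; move: xU; rewrite !inE; exact: UV.
have [cf H] := Cf; split.
  move=> x xU; apply: continuous_comp.
    by apply: continuous_rV => a; have [cp _] := Cpsi a; exact: cp.
  by apply: cf; move: xU; rewrite !inE; exact: UV.
have C1 p (W : set 'rV[R]_p) (h : 'rV[R]_p -> R) : Ck_on k.+1 W h -> Ck_on 1 W h.
  by elim: (k) => // j IHj /Ck_onW; exact: IHj.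
have cp y i := @partial_comp U V psi f i y oU oV (fun a => C1 _ _ _ (Cpsi a)) (C1 _ _ _ Cf).
move=> i; split.
  move=> x xU; have Ux : U x by move: xU; rewrite inE.
  by have [] := cp x i Ux (UV _ Ux).
have S : Ck_on k U (fun y => \sum_a partial i (fun z => psi z ord0 a) y * partial a f (psi y)).
  apply: Ck_on_sum => // a; apply: Ck_onM => //.
    by have [_ /(_ i) []] := Cpsi a.
  apply: IH => [b|]; first exact: Ck_onW.
  by have [] := H a.
apply: Ck_on_ext oU _ S => y Uy.
by have [_ ->] := cp y i Uy (UV _ Uy).
Qed.

End smooth_comp.

Section schwarz.
Variables (R : realType) (n : nat).
Local Notation X := 'rV[R]_n.
Local Notation e_ i := (delta_mx ord0 i : X).

(** The mean value theorem twice, first in direction [i] and then in direction [j]. The radius is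
    the midpoint of [|s| + |t|] and [d]: strictly larger than the former, and still within the ball
    where [f] is known. *)
Lemma second_difference (U : set X) (f : X -> R) (i j : 'I_n) (x : X) (d : R) (s t : R) :
  (forall y, ball x d y -> U y) -> Ck_on 2 U f -> 0 < d -> `|s| + `|t| < d ->
  exists2 y, ball x (`|s| + `|t| + (d - `|s| - `|t|) / 2) y &
   f (s *: e_ i + (t *: e_ j + x)) - f (t *: e_ j + x) - f (s *: e_ i + x) + f x
     = s * t * partial j (partial i f) y.
Proof.
move=> dU Cf d0 std.
have [cf /(_ i) [di [ci /(_ j) [dji _]]]] := Cf.
have Ub (a b : R) : `|a| <= `|s| -> `|b| <= `|t| ->
    ball x (`|s| + `|t| + (d - `|s| - `|t|) / 2) (a *: e_ i + (b *: e_ j + x)).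
  move=> as_ bt; apply/ball_rV => [|k]; first by have := normr_ge0 s; have := normr_ge0 t; lra.
  rewrite !mxE !eqxx /= addrA addrK.
  apply: (@le_lt_trans _ _ (`|a| + `|b|)); last by lra.
  apply: (le_trans (ler_normD _ _)); apply: lerD; rewrite normrM ler_piMr//;
    by case: eqP; rewrite ?normr1 ?normr0.
have bd y : ball x (`|s| + `|t| + (d - `|s| - `|t|) / 2) y -> U y.
  by move=> b; apply: dU; apply: le_ball b; lra.
pose F y := f (t *: e_ j + y) - f y.
have dF a : `|a| <= `|s| -> is_derive (a *: e_ i + x) (e_ i) F
    (partial i f (t *: e_ j + (a *: e_ i + x)) - partial i f (a *: e_ i + x)).
  move=> as_.
  have U1 : U (t *: e_ j + (a *: e_ i + x)) by rewrite addrCA; exact/bd/Ub.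
  have U2 : U (a *: e_ i + x).
    by have := Ub a 0 as_; rewrite normr0 scale0r add0r => /(_ (normr_ge0 _)) /bd.
  have D1 : is_derive (a *: e_ i + x) (e_ i) (fun y => f (t *: e_ j + y)) (partial i f (t *: e_ j + (a *: e_ i + x))).
    have E : (fun y => f (t *: e_ j + y)) \o shift (a *: e_ i + x) = f \o shift (t *: e_ j + (a *: e_ i + x)).
      by apply/funext => y /=; rewrite addrCA.
    have := di (t *: e_ j + (a *: e_ i + x)); rewrite inE => /(_ U1) H.
    split; first by move: H; rewrite /derivable E.
    by rewrite /partial /derive E.
  apply: is_deriveB.
  by split; [apply: di; rewrite inE|].
have [a as_ H1] : exists2 a : R, `|a| <= `|s| & F (s *: e_ i + x) - F x = s * 'D_(e_ i) F (a *: e_ i + x).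
  by apply: mvt_dir => a as_; have [] := dF a as_.
have [_ H2] := dF a as_.
have [b bt H3] : exists2 b : R, `|b| <= `|t| &
    partial i f (t *: e_ j + (a *: e_ i + x)) - partial i f (a *: e_ i + x) =
    t * 'D_(e_ j) (partial i f) (b *: e_ j + (a *: e_ i + x)).
  apply: mvt_dir => b bt; apply: dji; rewrite inE addrCA; exact/bd/Ub.
exists (b *: e_ j + (a *: e_ i + x)); first by rewrite addrCA; exact: Ub.
rewrite -mulrA -[partial j _ _]/('D_(e_ j) (partial i f) _) -H3 -H2 -H1 /F.
by rewrite (addrCA (t *: _)); ring.
Qed.

(** The second difference is symmetric in the two directions. So the two mixed derivatives agree at
    two points arbitrarily close to [x], and continuity brings them to [x]. *)
Lemma schwarz (U : set X) (f : X -> R) (i j : 'I_n) (x : X) : open U -> U x -> Ck_on 2 U f ->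
  partial j (partial i f) x = partial i (partial j f) x.
Proof.
have ar (u : R) : 0 < u -> u / 4 + u / 4 + (u - u / 4 - u / 4) / 2 <= u by move=> ?; lra.
move=> oU Ux Cf.
have cij (k l : 'I_n) : {for x, continuous (partial k (partial l f))}.
  by have [_ /(_ l) [_ [_ /(_ k) [_ ]]]] := Cf; move=> [H _]; apply: H; rewrite inE.
have /nbhs_ballP[d /= d0 dU] := open_nbhs_nbhs (conj oU Ux).
apply/eqP; rewrite -subr_eq0 -normr_le0; apply/ler_addgt0Pr => eps eps0; rewrite add0r.
have e2 : 0 < eps / 2 by rewrite divr_gt0.
have [r r0 rP] : exists2 r : R, 0 < r & forall y, ball x r y ->
    `|partial j (partial i f) x - partial j (partial i f) y| < eps / 2 /\
    `|partial i (partial j f) x - partial i (partial j f) y| < eps / 2.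
  have : \forall y \near x, `|partial j (partial i f) x - partial j (partial i f) y| < eps / 2 /\
    `|partial i (partial j f) x - partial i (partial j f) y| < eps / 2.
    apply: filterI.
      by have /cvgrPdist_lt/(_ _ e2) := cij j i.
    by have /cvgrPdist_lt/(_ _ e2) := cij i j.
  by move=> /nbhs_ballP[r /= r0 rP]; exists r.
pose d' := Num.min d r.
have d'0 : 0 < d' by rewrite lt_min d0 r0.
pose s := d' / 4.
have s0 : 0 < s by rewrite divr_gt0.
have ss : `|s| + `|s| < d' by rewrite gtr0_norm// /s; lra.
have dU' y : ball x d' y -> U y by move=> b; apply: dU; apply: le_ball b; rewrite ge_min lexx.
have [y yb Hy] := second_difference i j dU' Cf d'0 ss.
have [z zb Hz] := second_difference j i dU' Cf d'0 ss.
have br w : ball x (`|s| + `|s| + (d' - `|s| - `|s|) / 2) w -> ball x r w.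
  apply: le_ball; apply: (@le_trans _ _ d'); last by rewrite ge_min lexx orbT.
  by rewrite gtr0_norm//; exact: ar.
have E : partial j (partial i f) y = partial i (partial j f) z.
  have /mulfI : s * s != 0 by rewrite mulf_neq0// gt_eqF.
  apply; move: Hy Hz; rewrite (addrCA (s *: e_ j)).
  move: (f (s *: e_ i + (s *: e_ j + x))) (f (s *: e_ j + x)) (f (s *: e_ i + x)) (f x).
  move: (s * s) (partial j (partial i f) y) (partial i (partial j f) z).
  by move=> S A B a b c d1 <- <-; rewrite (addrAC a).
have [H1 _] := rP _ (br _ yb); have [_ H2] := rP _ (br _ zb).
move: E H1 H2; move: (partial j (partial i f) x) (partial i (partial j f) x).
move: (partial j (partial i f) y) (partial i (partial j f) z) => A1 A2 A3 A4 -> H1 H2.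
rewrite (_ : A3 - A4 = (A3 - A2) - (A4 - A2)); last by rewrite opprB addrA subrK.
apply: (le_trans (ler_normB _ _)).
by rewrite (splitr eps); apply: lerD; exact: ltW.
Qed.

End schwarz.

(** * Cut-off functions *)

Section flat.
Variable R : realType.

(** The derivative of p(1/t) exp(-1/t) is t^-2 (p - p')(1/t) exp(-1/t); this is the recursion in the
    variable 1/t. *)
Fixpoint flat_poly (m : nat) : {poly R} :=
  if m is k.+1 then 'X^2 * (flat_poly k - (flat_poly k)^`()) else 1.

(* The derivatives of exp (- 1 / t), extended by 0 to t <= 0. *)
Definition flat (m : nat) (t : R) : R :=
  if 0 < t then (flat_poly m).[t^-1] * expR (- t^-1) else 0.

Lemma expR_ge_pow (k : nat) (u : R) : 0 <= u -> u ^+ k <= k`!%:R * expR u.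
Proof.
case: k => [|k] u0; first by rewrite expr0 fact0 mul1r (le_trans _ (expR_ge1Dx _))// lerDl.
rewrite mulrC -ler_pdivrMr ?ltr0n ?fact_gt0//.
by apply: le_trans (expR_ge1Dxn k u0); rewrite lerDr.
Qed.

Lemma horner_le_expR (p : {poly R}) : exists2 C : R, 0 <= C &
  forall u, 0 <= u -> `|p.[u]| <= C * expR u.
Proof.
exists (\sum_(i < size p) `|p`_i| * i`!%:R).
  by apply: sumr_ge0 => i _; rewrite mulr_ge0.
move=> u u0; rewrite horner_coef mulr_suml (le_trans (ler_norm_sum _ _ _))//.
apply: ler_sum => i _; rewrite normrM -mulrA ler_wpM2l// normrX ger0_norm//.
exact: expR_ge_pow.
Qed.

(** The exponential dominates u^2 p(u) at u = 1/t. A quadratic bound is what makes the difference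
    quotient at 0 tend to 0. *)
Lemma flat_bound (m : nat) : exists2 C : R, 0 <= C & forall t, `|flat m t| <= C * t ^+ 2.
Proof.
have [C C0 HC] := horner_le_expR ('X^2 * flat_poly m).
exists C => // t; rewrite /flat; case: ifPn => [t0|_]; last by rewrite normr0 mulr_ge0 ?sqr_ge0.
have ti0 : 0 <= t^-1 by rewrite invr_ge0 ltW.
rewrite normrM (ger0_norm (expR_ge0 _)) expRN ler_pdivrMr ?expR_gt0//.
have := HC _ ti0; rewrite hornerM hornerXn normrM normrX (ger0_norm ti0) => H.
rewrite mulrAC -ler_pdivrMr ?exprn_gt0//; apply: le_trans H.
by rewrite mulrC exprVn.
Qed.

Lemma is_derive_flat (m : nat) (t : R) : is_derive t 1 (flat m) (flat m.+1 t).
Proof.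
have [t0|t0|->] := ltgtP t 0.
- have E : \forall y \near t, (fun _ : R => 0 : R) y = flat m y.
    have o : nbhs t [set y : R | y < 0] by exact: lt_nbhsl.
    by apply: filterS o => y /= y0; rewrite /flat ltNge (ltW y0).
  have -> : flat m.+1 t = 0 by rewrite /flat ltNge (ltW t0).
  split; first exact: (near_eq_derivable E (derivable_cst _ _ _)).
  by rewrite -(near_eq_derive _ E) derive_cst.
- have E : \forall y \near t, (fun y : R => (flat_poly m).[y^-1] * expR (- y^-1)) y = flat m y.
    have o : nbhs t [set y : R | 0 < y] by exact: lt_nbhsr.
    by apply: filterS o => y /= y0; rewrite /flat y0.
  have tn0 : t != 0 by rewrite gt_eqF.
  have dV : is_derive t 1 (fun y : R => y^-1) (- t ^- 2).
    have := @is_deriveV R id t 1 1 tn0 (is_derive_id _ _).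
    by rewrite [_ *: _]mulr1.
  have dp : is_derive t^-1 1 (horner (flat_poly m)) ((flat_poly m)^`().[t^-1]).
    by have := is_derive_poly (flat_poly m) t^-1.
  have d1 := is_derive1_comp dp dV.
  have d2 := is_derive1_comp (is_derive_expR _) (is_deriveN dV).
  have H : is_derive t 1 (fun y : R => (flat_poly m).[y^-1] * expR (- y^-1)) (flat m.+1 t).
    have H0 : is_derive t 1 (fun y : R => (flat_poly m).[y^-1] * expR (- y^-1)) _ :=
      is_deriveM d1 d2.
    apply: (is_derive_eq H0); rewrite /flat t0 /= hornerM hornerXn hornerD hornerN /=.
    rewrite /GRing.scale /= exprVn; ring.
  exact: (@near_eq_is_derive R R^o R^o _ _ t 1 _ E H).
- rewrite {2}/flat ltxx.
  have [C C0 HC] := flat_bound m.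
  have f0 : flat m 0 = 0 by rewrite /flat ltxx.
  have L : (fun h : R => h^-1 *: ((flat m \o shift 0) (h *: 1) - flat m 0)) @ 0^' --> (0 : R).
    apply/cvgrPdist_le => eps eps0; near=> h.
    have h0 : h != 0 by near: h; exact: nbhs_dnbhs_neq.
    rewrite sub0r normrN f0 subr0 /= addr0 [h%:A]mulr1 normrM normfV.
    rewrite ler_pdivrMl ?normr_gt0//; apply: (le_trans (HC _)).
    rewrite -real_normK ?num_real// expr2 mulrA [leRHS]mulrC ler_wpM2r//.
    apply: (@le_trans _ _ ((C + 1) * `|h|)).
      by rewrite ler_wpM2r// lerDl.
    rewrite -ler_pdivlMl ?ltr_wpDl// mulrC.
    by near: h; apply: dnbhs0_le; rewrite divr_gt0// ltr_wpDl.
  split; first by apply/cvg_ex; exists 0.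
  exact/cvg_lim.
Unshelve. all: by end_near. Qed.

(** The smooth step, 0 for [t <= 0] and 1 for [t >= 1]. *)
Definition ramp (t : R) : R := flat 0 t / (flat 0 t + flat 0 (1 - t)).

Lemma flat0_ge0 t : 0 <= flat 0 t.
Proof. by rewrite /flat; case: ifP => // _; rewrite hornerC mul1r expR_ge0. Qed.

Lemma flat0_gt0 t : 0 < t -> 0 < flat 0 t.
Proof. by move=> t0; rewrite /flat t0 hornerC mul1r expR_gt0. Qed.

Lemma ramp_den t : 0 < flat 0 t + flat 0 (1 - t).
Proof.
have [t0|t0] := ltP 0 t; first by rewrite ltr_wpDr ?flat0_ge0 ?flat0_gt0.
by rewrite ltr_wpDl ?flat0_ge0 ?flat0_gt0//; lra.
Qed.

Lemma ramp_ge0 t : 0 <= ramp t.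
Proof. by rewrite divr_ge0 ?flat0_ge0// ltW ?ramp_den. Qed.

Lemma ramp_le1 t : ramp t <= 1.
Proof. by rewrite ler_pdivrMr ?ramp_den// mul1r lerDl flat0_ge0. Qed.

Lemma ramp0 t : t <= 0 -> ramp t = 0.
Proof. by move=> t0; rewrite /ramp /flat ltNge t0 mul0r. Qed.

Lemma ramp1 t : 1 <= t -> ramp t = 1.
Proof.
move=> t1; have t0 : 0 < t by rewrite (lt_le_trans ltr01).
rewrite /ramp; have -> : flat 0 (1 - t) = 0 by rewrite /flat subr_gt0 ltNge t1.
by rewrite addr0 mulfV// gt_eqF// flat0_gt0.
Qed.

Lemma Ck_on_ramp n k (U : set 'rV[R]_n) f : open U -> Ck_on k U f -> Ck_on k U (ramp \o f).
Proof.
move=> oU Cf.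
have C0 := Ck_on_comp1 oU is_derive_flat Cf 0.
have C1 : Ck_on k U (flat 0 \o (fun y => 1 - f y)).
  apply: (Ck_on_comp1 oU is_derive_flat _ 0).
  exact: Ck_onD oU (Ck_on_cst _ _ 1) (Ck_onN oU Cf).
apply: (Ck_onM oU C0); apply: (Ck_on_inv oU _ (Ck_onD oU C0 C1)) => y _ /=.
by rewrite gt_eqF// ramp_den.
Qed.

End flat.

Section cutoff.
Variables (R : realType) (n : nat).
Local Notation X := 'rV[R]_n.
Implicit Types (a b x y : X) (U K : set X).

(** [c] is the steepness, and [l], [r] shift the two flanks. With [c = d^-1] and [l = r = 1] the
    function is 1 on the closed box and 0 off its enlargement by [d] ([test_plateau]). With [l = 1],
    [r = 0] and [c] tending to infinity it converges to the indicator of the half-open box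
    ([cutoff_cvg]). *)
Definition cutoff a b (c : R) (l r : R) y : R :=
  \prod_i (ramp (c * (y ord0 i - a ord0 i) + l) * ramp (c * (b ord0 i - y ord0 i) + r)).

Definition cbox a b : set X := [set y | forall i, a ord0 i <= y ord0 i <= b ord0 i].

Lemma cbox_compact a b : compact (cbox a b).
Proof.
have -> : cbox a b = [set v : X | forall i, `[a ord0 i, b ord0 i]%classic (v ord0 i)].
  by apply/seteqP; split => v /= H i; have := H i; rewrite in_itv.
by apply: (@rV_compact R n (fun i => `[a ord0 i, b ord0 i]%classic)) => i; exact: segment_compact.
Qed.

Lemma cutoff_smooth a b c l r : smooth_on setT (cutoff a b c l r).
Proof.
move=> k; apply: Ck_on_prod => [|i]; first exact: openT.
apply: Ck_onM; first exact: openT.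
- apply: Ck_on_ramp; first exact: openT.
  apply: Ck_onD; [exact: openT| |exact: Ck_on_cst].
  apply: Ck_onM; [exact: openT|exact: Ck_on_cst|].
  by apply: Ck_onD; [exact: openT|exact: Ck_on_coord|exact: Ck_on_cst].
- apply: Ck_on_ramp; first exact: openT.
  apply: Ck_onD; [exact: openT| |exact: Ck_on_cst].
  apply: Ck_onM; [exact: openT|exact: Ck_on_cst|].
  apply: Ck_onD; [exact: openT|exact: Ck_on_cst|].
  by apply: Ck_onN; [exact: openT|exact: Ck_on_coord].
Qed.

Lemma cutoff_ge0 a b c l r y : 0 <= cutoff a b c l r y.
Proof. by apply: prodr_ge0 => i _; rewrite mulr_ge0 ?ramp_ge0. Qed.

Lemma cutoff_le1 a b c l r y : cutoff a b c l r y <= 1.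
Proof.
apply: (@le_trans _ _ (\prod_(i < n) (1 : R))); last by rewrite big1_eq.
apply: ler_prod => i _.
by rewrite mulr_ge0 ?ramp_ge0// mulr_ile1 ?ramp_ge0 ?ramp_le1.
Qed.

Lemma cutoff_eq0 a b c l r y i :
  c * (y ord0 i - a ord0 i) + l <= 0 \/ c * (b ord0 i - y ord0 i) + r <= 0 ->
  cutoff a b c l r y = 0.
Proof.
move=> H; rewrite /cutoff (bigD1 i)//=.
by case: H => /ramp0 ->; rewrite ?mulr0 ?mul0r.
Qed.

Lemma cutoff_eq1 a b c l r y :
  (forall i, 1 <= c * (y ord0 i - a ord0 i) + l /\ 1 <= c * (b ord0 i - y ord0 i) + r) ->
  cutoff a b c l r y = 1.
Proof.
by move=> H; rewrite /cutoff big1// => i _; have [/ramp1 -> /ramp1 ->] := H i; rewrite mulr1.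
Qed.

Lemma test_plateau U a b (d : R) : 0 < d ->
  cbox (\row_i (a ord0 i - d)) (\row_i (b ord0 i + d)) `<=` U ->
  test_function U (cutoff a b d^-1 1 1) /\
  forall y, cbox a b y -> cutoff a b d^-1 1 1 y = 1.
Proof.
move=> d0 abU; split; last first.
  move=> y aby; apply: cutoff_eq1 => i; have /andP[ay yb] := aby i.
  by rewrite !lerDr !mulr_ge0 ?subr_ge0 ?invr_ge0// ltW.
split; first exact: cutoff_smooth.
exists (cbox (\row_i (a ord0 i - d)) (\row_i (b ord0 i + d))); split => //.
  exact: cbox_compact.
move=> y /existsNP[i /negP]; rewrite !mxE negb_and -!ltNge => H.
apply: (@cutoff_eq0 _ _ _ _ _ _ i); case/orP : H => H; [left|right];
  by rewrite -lerBrDr sub0r ler_pdivrMl// mulrN1; lra.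
Qed.

Lemma open_cbox U x : open U -> U x -> exists2 d : R, 0 < d &
  cbox (\row_i (x ord0 i - d)) (\row_i (x ord0 i + d)) `<=` U.
Proof.
move=> oU Ux; have /nbhs_ballP[e /= e0 eU] := open_nbhs_nbhs (conj oU Ux).
exists (e / 2); first by rewrite divr_gt0.
move=> y H; apply: eU; apply/ball_rV => // i; have := H i; rewrite !mxE => /andP[h1 h2].
by rewrite ltr_distl; apply/andP; split; lra.
Qed.

End cutoff.

Lemma integral_measure_preserving d (T : measurableType d) (R : realType)
    (mu : {measure set T -> \bar R}) (tau : T -> T) (f : T -> R) :
  measurable_fun setT tau ->
  (forall A, measurable A -> mu (tau @^-1` A) = mu A) ->
  measurable_fun setT f -> mu.-integrable setT (EFin \o (f \o tau)) ->
  \int[mu]_y f (tau y) = \int[mu]_y f y.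
Proof.
move=> mtau tauE mf fi; rewrite /Rintegral; congr (fine _).
transitivity (\int[pushforward mu tau]_y (EFin \o f) y)%E; last first.
  by apply: eq_measure_integral => A mA _; exact: tauE.
rewrite integral_pushforward ?preimage_setT//; exact/measurable_EFinP.
Qed.

(** * Test functions and weak derivatives *)

Section test_functions.
Variables (R : realType) (n : nat).
Local Notation X := 'rV[R]_n.
Local Notation T := (Rn_leb R n).
Local Notation lam := (@lebesgue_Rn R n).
Local Notation e_ i := (delta_mx ord0 i : X).
Implicit Types (U K : set X) (f phi a : X -> R).

Lemma compact_closed_rV K : compact K -> closed K.
Proof. exact: compact_closed (@hausdorff_rV R n). Qed.

Lemma continuous_inT f : continuous f -> {in [set: X], continuous f}.
Proof. by move=> cf y _; exact: cf. Qed.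

Lemma measurable_cont (D : set T) f : continuous f -> measurable_fun D (f : T -> R).
Proof.
move=> cf; apply: (measurable_continuous openT (continuous_inT cf)).
exact: subsetT.
Qed.

Lemma test_mul U a phi : open U -> test_function U phi -> smooth_on U a ->
  test_function U (fun y => a y * phi y).
Proof.
move=> oU [sphi [K [cK KU K0]]] sa; split; last first.
  by exists K; split => // y /K0 ->; rewrite mulr0.
move=> k; apply: Ck_on_local => y _; have [Ky|nKy] := pselect (K y).
  exists U; first exact: KU.
  by apply: Ck_onM => //; apply: Ck_on_sub (sphi k).
have oK : open (~` K) := closed_openC (compact_closed_rV cK).
exists (~` K) => //.
by apply: (Ck_on_ext oK _ (Ck_on_cst k _ 0)) => z /K0 ->; rewrite /= mulr0.
Qed.

Lemma partial_off K f i : closed K -> (forall y, ~ K y -> f y = 0) ->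
  forall y, ~ K y -> partial i f y = 0.
Proof.
move=> cK K0 y nKy.
have oK : open (~` K) by exact: closed_openC.
rewrite (@partial_ext _ _ (~` K) f (cst 0) i oK)//.
by rewrite /partial derive_cst.
Qed.

Lemma test_partial U phi i : test_function U phi -> test_function U (partial i phi).
Proof.
move=> [sphi [K [cK KU K0]]]; split.
  by move=> k; have [_ /(_ i)[]] := sphi k.+1.
by exists K; split => //; apply: partial_off => //; exact: compact_closed_rV.
Qed.

Lemma test_sub U V phi : U `<=` V -> test_function U phi -> test_function V phi.
Proof.
move=> UV [sphi [K [cK KU K0]]]; split => //; exists K; split => //.
exact: subset_trans KU UV.
Qed.

Lemma smooth_continuous phi : smooth_on setT phi -> continuous phi.
Proof. by move=> /(_ 0%N)[c _] y; apply: c; rewrite inE. Qed.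

Lemma test_bounded U phi : test_function U phi -> exists M, forall y, `|phi y| <= M.
Proof.
move=> [sphi [K [cK KU K0]]].
have [M HM] := @continuous_bounded R n setT K phi openT (continuous_inT (smooth_continuous sphi)) cK (@subsetT _ _).
exists (Num.max 0 M) => y; have [Ky|nKy] := pselect (K y).
  by rewrite le_max HM ?orbT.
by rewrite K0// normr0 le_max lexx.
Qed.

Lemma supp_integrable (D E : set T) (f : T -> R) : measurable D -> measurable E ->
  (forall y, D y -> ~ E y -> f y = 0) -> lam.-integrable (D `&` E) (EFin \o f) ->
  lam.-integrable D (EFin \o f).
Proof.
move=> mD mE f0 fi; apply/(integrable_mkcond _ mD).
rewrite (_ : _ \_ D = (EFin \o f) \_ (D `&` E)).
  by apply/(integrable_mkcond _ (measurableI _ _ mD mE)).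
apply/funext => y; rewrite !patchE; case: ifPn => yD; case: ifPn => yE //.
  rewrite /= f0//; first by move: yD; rewrite inE.
  by move=> Ey; move: yE; rewrite notin_setE; apply; split => //; move: yD; rewrite inE.
by move: yE yD; rewrite inE notin_setE => -[].
Qed.

Lemma supp_integral (D E : set T) (f : T -> R) :
  (forall y, D y -> ~ E y -> f y = 0) ->
  \int[lam]_(y in D) f y = \int[lam]_(y in D `&` E) f y.
Proof.
move=> f0; rewrite [LHS]Rintegral_mkcond [RHS]Rintegral_mkcond.
congr (Rintegral _ _ _); apply/funext => y; rewrite !patchE; case: ifPn => yD; case: ifPn => yE //.
  rewrite f0//; first by move: yD; rewrite inE.
  by move=> Ey; move: yE; rewrite notin_setE; apply; split => //; move: yD; rewrite inE.
by move: yE yD; rewrite inE notin_setE => -[].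
Qed.

Lemma cont_compact_integrable U K f : open U -> {in U, continuous f} -> compact K -> K `<=` U ->
  lam.-integrable (K : set T) (EFin \o f).
Proof.
move=> oU cf cK KU; have [M HM] := continuous_bounded oU cf cK KU.
apply: (@integrable_bounded _ _ _ f M) => //.
- exact: measurable_compact.
- exact: lam_compact_lty.
- exact: (measurable_continuous oU).
Qed.

Lemma test_integrable U (D : set T) phi : test_function U phi -> measurable D ->
  lam.-integrable D (EFin \o phi).
Proof.
move=> [sphi [K [cK KU K0]]] mD.
apply: (@supp_integrable D K) => //; first exact: measurable_compact.
  by move=> y _ /K0.
apply: (@integrableS _ _ _ lam K) => //; first exact: measurable_compact.
  by apply: measurableI => //; exact: measurable_compact.
apply: (cont_compact_integrable openT) => //.
by apply: continuous_inT; exact: smooth_continuous.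
Qed.

Lemma loc_test_integrable U f phi : open U -> Defs.locally_integrable U f -> test_function U phi ->
  lam.-integrable (U : set T) (EFin \o (fun y => f y * phi y)).
Proof.
move=> oU lf [sphi [K [cK KU K0]]].
apply: (@supp_integrable U K).
- exact: measurable_open.
- exact: measurable_compact.
- by move=> y _ /K0 ->; rewrite mulr0.
have [M HM] := @continuous_bounded R n setT K phi openT (continuous_inT (smooth_continuous sphi)) cK (@subsetT _ _).
rewrite setIC setIidl//; apply: integrable_bounded_mul HM.
- exact: measurable_compact.
- exact: lf.
by apply: measurable_cont; exact: smooth_continuous.
Qed.

Lemma lebesgue_outer_shift (t : X) (A : set X) :
  lebesgue_outer [set y | A (y + t)] = lebesgue_outer A.
Proof.
have H (s : X) (B : set X) : (lebesgue_outer [set y | B (y + s)%R] <= lebesgue_outer B)%E.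
  apply: le_ereal_inf_tmp => _ [C BC <-].
  pose sh (b : option (X * X)) := if b is Some ab then Some (ab.1 - s, ab.2 - s) else None.
  apply: ereal_inf_lbound; exists (sh \o C).
    move=> y /BC [k _ Ck]; exists k => //=; case: (C k) Ck => [[u v]|]//= Ck i.
    by have := Ck i; rewrite !mxE lerBlDr ltrBrDr.
  apply: eq_eseriesr => k _ /=; case: (C k) => [[u v]|]//=; congr (_%:E).
  by apply: eq_bigr => i _; rewrite !mxE opprD addrACA subrr addr0.
apply/eqP; rewrite eq_le H /=.
have := H (- t) [set y | A (y + t)]; congr (lebesgue_outer _ <= _)%E.
by apply/seteqP; split => y /=; rewrite subrK.
Qed.

Lemma measurable_shift (t : X) : measurable_fun [set: T] (fun y : T => (y : X) + t : T).
Proof.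
move=> _ A mA; rewrite setTI.
suff H : caratheodory_measurable (@lebesgue_outer R n) [set y | A (y + t)] by [].
have cA : caratheodory_measurable (@lebesgue_outer R n) A := mA.
move=> Y; rewrite -(lebesgue_outer_shift (- t) Y) (cA [set y | Y (y - t)]).
rewrite -(lebesgue_outer_shift t (_ `&` A)) -(lebesgue_outer_shift t (_ `&` ~` A)).
have -> : [set y | ([set y0 | Y (y0 - t)] `&` A) (y + t)] = Y `&` [set y | A (y + t)].
  by apply/seteqP; split => y /=; rewrite addrK.
have -> : [set y | ([set y0 | Y (y0 - t)] `&` ~` A) (y + t)] = Y `&` ~` [set y | A (y + t)].
  by apply/seteqP; split => y /=; rewrite addrK.
by [].
Qed.

Lemma integral_shift (t : X) f : measurable_fun [set: T] (f : T -> R) ->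
  lam.-integrable [set: T] (EFin \o (fun y => f (y + t))) ->
  \int[lam]_y f (y + t) = \int[lam]_y f y.
Proof.
move=> mf fi.
apply: (integral_measure_preserving (measurable_shift t) _ mf fi) => A mA.
exact: lebesgue_outer_shift.
Qed.

(** Integration by parts without iterated integrals: difference quotients integrate to 0 by
    translation invariance, and they converge dominatedly to the derivative. *)
Lemma integral_partial phi i : test_function setT phi -> \int[lam]_y partial i phi y = 0.
Proof.
move=> tphi; have [sphi [K [cK _ K0]]] := tphi.
have tp := test_partial i tphi.
have [M HM] := test_bounded tp.
have cphi := smooth_continuous sphi.
have mphi : measurable_fun [set: T] (phi : T -> R).
  exact: measurable_cont.
pose sh k (y : X) := y + k.+1%:R^-1 *: e_ i.
pose q k y := k.+1%:R * (phi (sh k y) - phi y).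
have csh k y : {for y, continuous (sh k)}.
  by apply: (@continuousD _ _ _ id (cst _) y); [exact: cvg_id|exact: cst_continuous].
have mq k : measurable_fun [set: T] (q k : T -> R).
  have ms : measurable_fun [set: T] (fun y => phi (sh k y)).
    by apply: measurable_cont => y; apply: continuous_comp; [exact: csh|exact: cphi].
  exact: (measurable_funM (measurable_cst _) (measurable_funB ms mphi)).
have [A A0 KA] := compact_box cK.
(* The shifts are by at most 1, so one enlarged box contains the supports of all quotients. *)
pose B : set X := cbox (const_mx (- (A + 1))) (const_mx (A + 1)).
have cB : compact B by exact: cbox_compact.
have k1 k : 0 <= (k.+1%:R^-1 : R) <= 1.
  by rewrite invr_ge0 ler0n invf_le1 ?ltr0Sn// ler1n.
have KB y k : K (sh k y) \/ K y -> B y.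
  move=> H j; rewrite !mxE -ler_norml; have /andP[h0 h1] := k1 k.
  case: H => /KA /(_ j) H; last by rewrite (le_trans (ltW H))// lerDl.
  move: H; rewrite /sh !mxE eqxx /= => H.
  have : `|y ord0 j| <= `|y ord0 j + k.+1%:R^-1 * (j == i)%:R| + `|k.+1%:R^-1 * (j == i)%:R|.
    by rewrite -{1}(addrK (k.+1%:R^-1 * (j == i)%:R) (y ord0 j)) ler_normB.
  move=> /le_trans; apply; apply: lerD; first exact: ltW.
  by rewrite normrM (ger0_norm h0) mulr_ile1// ?normr_ge0//; case: eqP; rewrite ?normr1 ?normr0.
have qB y k : ~ B y -> q k y = 0.
  move=> nB; rewrite /q K0; last by move=> H; apply: nB; apply: (KB _ k); left.
  by rewrite K0 ?subrr ?mulr0// => H; apply: nB; apply: (KB _ 0%N); right.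
have dphi y : derivable phi y (e_ i).
  by have [_ /(_ i)[d _]] := sphi 1%N; apply: d; rewrite inE.
have qM k y : `|q k y| <= M.
  have [s _ E] : exists2 s : R, `|s| <= `|k.+1%:R^-1| &
     phi (k.+1%:R^-1 *: e_ i + y) - phi y = k.+1%:R^-1 * 'D_(e_ i) phi (s *: e_ i + y).
    by apply: mvt_dir.
  have -> : q k y = k.+1%:R * (phi (k.+1%:R^-1 *: e_ i + y) - phi y).
    by rewrite /q /sh [y + _]addrC.
  by rewrite E mulrA mulfV ?mul1r ?HM// pnatr_eq0.
have qcvg y : q ^~ y @ \oo --> partial i phi y.
  have L : (fun h : R => h^-1 *: ((phi \o shift y) (h *: e_ i) - phi y)) @ 0^' --> partial i phi y.
    exact: dphi.
  have hk : (fun k : nat => k.+1%:R^-1 : R) @ \oo --> 0^'.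
    have h0 : (fun k : nat => k.+1%:R^-1 : R) @ \oo --> (0 : R) by exact: cvg_harmonic.
    move=> S [/= e e0 eS]; have /cvgrPdist_lt/(_ _ e0) := h0.
    have k0 k : k.+1%:R^-1 != 0 :> R by rewrite invr_eq0 pnatr_eq0.
    by apply: filterS => k /= H; apply: eS => //=; exact: k0.
  have := cvg_comp _ _ hk L.
  apply: cvg_trans; apply: near_eq_cvg; near=> k.
  by rewrite /= /q /sh invrK [_ *: e_ i + y]addrC.
have Moo : lam.-integrable [set: T] (EFin \o (fun y => `|M| * \1_B y)).
  apply: (@supp_integrable setT B) => //; first exact: measurable_compact.
    by move=> y _ nB; rewrite indicE memNset ?mulr0.
  rewrite setTI; apply: (@integrable_bounded _ _ _ _ `|M|).
  - exact: measurable_compact.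
  - exact: lam_compact_lty.
  - apply: measurable_funM => //; apply: measurable_indic; exact: measurable_compact.
  - by move=> y By; rewrite indicE mem_set// mulr1 normr_id.
have C := @dominated_cvg _ _ _ lam setT measurableT (fun k => EFin \o q k)
  (EFin \o partial i phi) (EFin \o (fun y => `|M| * \1_B y)).
have shi k : lam.-integrable [set: T] (EFin \o (fun y => phi (sh k y))).
  apply: (@supp_integrable setT B) => //; first exact: measurable_compact.
    by move=> y _ nB; apply: K0 => H; apply: nB; apply: (KB _ k); left.
  rewrite setTI; apply: (cont_compact_integrable openT) => //.
  by move=> y _; apply: continuous_comp; [exact: csh|exact: cphi].
have phii : lam.-integrable [set: T] (EFin \o phi) := test_integrable tphi measurableT.
have qi k : lam.-integrable [set: T] (EFin \o q k).
  apply: (@supp_integrable setT B) => //; first exact: measurable_compact.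
    by move=> y _; exact: qB.
  rewrite setTI; apply: (@integrable_bounded _ _ _ _ M) => //.
  - exact: measurable_compact.
  - exact: lam_compact_lty.
  - exact: measurable_funS (mq k).
have q0 k : \int[lam]_y q k y = 0.
  rewrite /q RintegralZl//; last exact: (integrableB measurableT (shi k) phii).
  by rewrite RintegralB// (integral_shift mphi (shi k)) subrr mulr0.
have {}C : (\int[lam]_y (EFin \o q k) y)%E @[k --> \oo] --> (\int[lam]_y (EFin \o partial i phi) y)%E.
  apply: C.
  - by move=> k; exact/measurable_EFinP.
  - by move=> y _; apply: cvg_EFin; [exact: nearW|exact: qcvg].
  - by [].
  - exact: Moo.
  - move=> k y _; rewrite /= lee_fin; have [By|nBy] := pselect (B y).
      by rewrite indicE mem_set// mulr1 (le_trans (qM k y))// ler_norm.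
    by rewrite qB// normr0 mulr_ge0.
have E0 k : (\int[lam]_y (EFin \o q k) y = 0)%E.
  by rewrite -[LHS]fineK ?integrable_fin_num//; have := q0 k; rewrite /Rintegral => ->.
have : (\int[lam]_y (EFin \o partial i phi) y = 0)%E.
  rewrite -(cvg_lim _ C)//; apply: lim_near_cst => //.
  by apply: nearW => k; exact: E0.
by rewrite /Rintegral => ->.
Unshelve. all: by end_near. Qed.

End test_functions.

(** * Borel hulls and the fundamental lemma of the calculus of variations *)

Lemma integral_generated_eq0 d (T : measurableType d) (R : realType)
    (mu : {measure set T -> \bar R}) (G : set (set T)) (Q : set T) (h : T -> \bar R) :
  G `<=` measurable -> setI_closed G -> measurable Q -> mu.-integrable Q h ->
  (\int[mu]_(x in Q) h x = 0)%E ->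
  (forall B, G B -> (\int[mu]_(x in Q `&` B) h x = 0)%E) ->
  forall S : set T, <<s G >> S -> measurable S /\ (\int[mu]_(x in Q `&` S) h x = 0)%E.
Proof.
move=> Gm GI mQ ih hQ hG S GS.
have sub A : <<s G >> A -> measurable A.
  by apply: smallest_sub => //; exact: sigma_algebra_measurable.
split; first exact: sub.
have ihI A : measurable A -> mu.-integrable (Q `&` A) h.
  by move=> mA; apply: (integrableS mQ) => //; exact: measurableI.
move: S GS; apply: (@dynkin_induction _ (g_sigma_algebraType G) G
  (fun S : set T => (\int[mu]_(x in Q `&` S) h x = 0)%E)) => //.
- by rewrite setIT.
- move=> A /sub mA HA.
  have E : Q = (Q `&` A) `|` (Q `&` ~` A) by rewrite -setIUr setUv setIT.
  have := hQ; rewrite {1}E integral_setU//.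
  + by rewrite HA add0e.
  + exact: measurableI.
  + by apply: measurableI => //; exact: measurableC.
  + by rewrite -E; case/integrableP : ih.
  + by apply/disj_setPS; rewrite setIACA setICr setI0.
- move=> F mF tF HF; rewrite setI_bigcupr integral_bigcup//.
  + by rewrite eseries0// => k _ _; exact: HF.
  + exact: trivIset_setIl.
  + by move=> k; apply: measurableI mQ _; exact: sub (mF k).
  + by rewrite -setI_bigcupr; apply: ihI; apply: bigcup_measurable => k _; exact: sub (mF k).
Qed.

Section hull.
Variables (R : realType) (n : nat).
Local Notation X := 'rV[R]_n.
Local Notation T := (Rn_leb R n).
Local Notation lam := (@lebesgue_Rn R n).
Implicit Types A U : set X.

Definition boxes : set (set T) := [set box B | B in setT].

Lemma boxes_setI : setI_closed boxes.
Proof.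
move=> _ _ [[[a b]|] _ <-] [[[u v]|] _ <-]; last 3 first.
- by exists None => //=; rewrite setI0.
- by exists None => //=; rewrite set0I.
- by exists None => //=; rewrite set0I.
exists (Some (\row_i Num.max (a ord0 i) (u ord0 i), \row_i Num.min (b ord0 i) (v ord0 i))) => //.
apply/seteqP; split => y /=.
  move=> H; split => i; have := H i; rewrite !mxE ge_max lt_min;
    by move=> /andP[/andP[h1 h2] /andP[h3 h4]]; rewrite ?h1 ?h2 ?h3 ?h4.
by move=> [H1 H2] i; rewrite !mxE ge_max lt_min; have /andP[-> ->] := H1 i; have /andP[-> ->] := H2 i.
Qed.

Lemma boxes_measurable : boxes `<=` measurable.
Proof. by move=> _ [B _ <-]; exact: measurable_box. Qed.

(** Outer regularity: intersect countable covers by boxes whose volumes exceed the outer measure by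
    at most [1/(k+1)]. It reduces Lebesgue measurable sets to Borel sets up to null sets. *)
Lemma lebesgue_hull A : (lebesgue_outer A < +oo)%E ->
  exists S : set T, [/\ <<s boxes >> S, A `<=` S & lebesgue_outer S = lebesgue_outer A].
Proof.
move=> Aoo.
have Afin : lebesgue_outer A \is a fin_num by rewrite ge0_fin_numE// lebesgue_outer_ge0.
have /choice[C HC] : forall k : nat, exists B : nat -> option (X * X), A `<=` \bigcup_j box (B j) /\
   (lebesgue_outer (\bigcup_j box (B j)) <= lebesgue_outer A + (k.+1%:R^-1)%:E)%E.
  move=> k; have k0 : 0 < (k.+1%:R^-1 : R) by rewrite invr_gt0 ltr0n.
  have [_ [B AB <-] lt] := lb_ereal_inf_adherent k0 Afin.
  exists B; split => //; apply: le_trans (ltW lt).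
  apply: le_trans (outer_measure_sigma_subadditive (@lebesgue_outer R n) _) _.
  by apply: lee_nneseries => j _; rewrite ?lebesgue_outer_ge0// lebesgue_outer_box.
exists (\bigcap_k \bigcup_j box (C k j)); split.
- have sa := smallest_sigma_algebra [set: T] boxes.
  apply: (@bigcap_measurable _ (g_sigma_algebraType boxes)) => // k _.
  apply: (@bigcup_measurable _ (g_sigma_algebraType boxes)) => j _.
  by apply: sub_sigma_algebra; exists (C k j).
- by move=> y Ay k _; apply: (HC k).1.
apply/eqP; rewrite eq_le; apply/andP; split; last first.
  by apply: le_lebesgue_outer => y Ay k _; apply: (HC k).1.
apply/lee_addgt0Pr => e e0.
have [k ke] : exists k : nat, k.+1%:R^-1 < e.
  have := near_infty_natSinv_lt (PosNum e0) => -[k _ /(_ k (leqnn k)) /= H].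
  by exists k.
apply: (@le_trans _ _ (lebesgue_outer (\bigcup_j box (C k j)))).
  by apply: le_lebesgue_outer => y /(_ k I).
by apply: (le_trans (HC k).2); rewrite leeD2l// lee_fin ltW.
Qed.

Lemma lebesgue_sigma_finite : exists F : nat -> set T, [/\ forall k, measurable (F k),
  forall k, (lam (F k) < +oo)%E & forall y, exists k, F k y].
Proof.
exists (fun k => cbox (const_mx (- k%:R)) (const_mx k%:R)); split.
- by move=> k; apply: measurable_compact; exact: cbox_compact.
- by move=> k; apply: lam_compact_lty; exact: cbox_compact.
move=> y; have [M M0 HM] := compact_box (@compact_set1 X y).
exists (Num.trunc M).+1 => i; rewrite !mxE -ler_norml.
by apply: (le_trans (ltW (HM y erefl i))); rewrite ltW// truncnS_gt.
Qed.

End hull.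

Section fundamental_lemma.
Variables (R : realType) (n : nat).
Local Notation X := 'rV[R]_n.
Local Notation T := (Rn_leb R n).
Local Notation lam := (@lebesgue_Rn R n).
Implicit Types U : set X.

Lemma cutoff_cvg (p q y : X) :
  cutoff p q k.+1%:R 1 0 y @[k --> \oo] --> (\1_(box (Some (p, q))) y : R).
Proof.
rewrite indicE.
have big (t : R) : 0 < t -> \forall k \near \oo, 1 <= k.+1%:R * t.
  move=> t0; have /= := near_infty_natSinv_lt (PosNum t0).
  by apply: filterS => k /= /ltW H; rewrite -ler_pdivrMl ?ltr0n// mulr1.
have [Hy|/asboolPn/existsp_asboolPn[i /negP]] := pselect (forall i, p ord0 i <= y ord0 i < q ord0 i).
  rewrite mem_set//; apply: cvg_near_cst.
  have : \forall k \near \oo, forall i : 'I_n, 1 <= k.+1%:R * (q ord0 i - y ord0 i).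
    by apply: filter_forall => i; apply: big; have /andP[_] := Hy i; rewrite subr_gt0.
  apply: filterS => k H; apply: cutoff_eq1 => i; rewrite addr0 H lerDr; split => //.
  by rewrite mulr_ge0// subr_ge0; have /andP[] := Hy i.
rewrite negb_and -leNgt -ltNge => Hi.
rewrite memNset; last by move=> /(_ i) /=; rewrite leNgt; case/orP : Hi => [->//|]; rewrite leNgt => /negPf ->; rewrite andbF.
apply: cvg_near_cst; case/orP : Hi => Hi.
  have /big : 0 < p ord0 i - y ord0 i by rewrite subr_gt0.
  apply: filterS => k H; apply: (@cutoff_eq0 _ _ _ _ _ _ _ _ i); left.
  by rewrite -[y _ _ - _]opprB mulrN addrC subr_le0.
apply: nearW => k; apply: (@cutoff_eq0 _ _ _ _ _ _ _ _ i); right.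
by rewrite addr0 mulr_ge0_le0// subr_le0.
Qed.

(** Near each point the integral of [h] vanishes over boxes, by approximation of indicators with
    test functions, then over Borel sets by Dynkin's theorem, then over measurable sets by means of
    Borel hulls. Hence [h] is 0 a.e. there. *)
Lemma fundamental_lemma U (h : X -> R) : open U -> measurable_fun (U : set T) (h : T -> R) ->
  (forall phi, test_function U phi ->
     lam.-integrable (U : set T) (EFin \o (fun y => h y * phi y)) /\
     \int[lam]_(y in (U : set T)) (h y * phi y) = 0) ->
  ae_in U (fun y => h y = 0).
Proof.
move=> oU mh H; apply: null_local => x [Ux _].
have [d d0 dU] := open_cbox oU Ux.
have d2 : 0 < d / 2 by rewrite divr_gt0.
pose a : X := \row_i (x ord0 i - d / 2); pose b : X := \row_i (x ord0 i + d / 2).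
(* Multiplication by a plateau function supported in [U] makes [h] integrable on the box [Q] without
   changing it there. *)
have [tchi chi1] : test_function U (cutoff a b (d / 2)^-1 1 1) /\
    forall y, cbox a b y -> cutoff a b (d / 2)^-1 1 1 y = 1.
  apply: test_plateau => // y Hy; apply: dU => i; have := Hy i; rewrite !mxE.
  by move=> /andP[h1 h2]; apply/andP; split; lra.
set chi := cutoff a b _ 1 1 in tchi chi1.
pose Q : set T := box (Some (a, b)).
have mQ : measurable Q by exact: measurable_box.
have Qab y : Q y -> cbox a b y by move=> Qy i; have /andP[-> /ltW ->] := Qy i.
have QU : Q `<=` U.
  move=> y Qy; apply: contrapT => nU; have := chi1 _ (Qab _ Qy).
  have [_ [K [_ KU K0]]] := tchi; rewrite K0 => [/esym/eqP|/KU//].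
  by rewrite oner_eq0.
exists [set y | forall i, a ord0 i < y ord0 i < b ord0 i]; split.
- have E : ball x (d / 2) = [set y : X | forall i, a ord0 i < y ord0 i < b ord0 i].
    apply/seteqP; split => y /=.
      by move=> /(ball_rV _ _ d2) Hy i; have := Hy i; rewrite !mxE ltr_distl.
    by move=> Hy; apply/ball_rV => // i; have := Hy i; rewrite !mxE ltr_distl.
  by have := @ball_open _ _ x (d / 2); rewrite E; exact.
- by move=> i; rewrite !mxE; apply/andP; split; lra.
have mU : measurable (U : set T) by exact: measurable_open.
have mchi : measurable_fun (U : set T) (chi : T -> R).
  by apply: measurable_cont; apply: smooth_continuous; case: tchi.
have ihU : lam.-integrable (U : set T) (EFin \o (fun y => h y * chi y)) by have [] := H _ tchi.
have ih : lam.-integrable Q (EFin \o h).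
  have i1 : lam.-integrable Q (EFin \o (fun y => h y * chi y)) by exact: integrableS ihU.
  apply: eq_integrable i1 => // y; rewrite inE => Qy /=.
  by rewrite (chi1 _ (Qab _ Qy)) mulr1.
have boxQ (p q : X) : box (Some (p, q)) `<=` Q ->
    (\int[lam]_(y in box (Some (p, q))) (h y)%:E = 0)%E.
  move=> BQ.
  have mB : measurable (box (Some (p, q)) : set T) by exact: measurable_box.
  pose f k y := h y * (cutoff p q k.+1%:R 1 0 y * chi y).
  have tk k : test_function U (fun y => cutoff p q k.+1%:R 1 0 y * chi y).
    by apply: test_mul => //; move=> m; apply: Ck_on_sub (cutoff_smooth _ _ _ _ _ m).
  pose f0 : T -> \bar R := EFin \o (fun y => h y * (\1_(box (Some (p, q))) y * chi y)).
  have C := @dominated_cvg _ _ _ lam _ mU (fun k => EFin \o f k) f0 (fun y => `|h y * chi y|%:E).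
  have {}C := C _ _ (fun _ _ => erefl) (integrable_abse ihU) _.
  have p1 k : measurable_fun (U : set T) (EFin \o f k).
    apply/measurable_EFinP; apply: (measurable_funM mh).
    by apply: measurable_cont; apply: smooth_continuous; case: (tk k).
  have p2 (y : T) : (U : set T) y -> (EFin \o f k) y @[k --> \oo] --> f0 y.
    move=> _; apply: cvg_EFin; first exact: nearW.
    apply: cvgM; first exact: cvg_cst.
    by apply: cvgM; [exact: cutoff_cvg|exact: cvg_cst].
  have p3 k (y : T) : (U : set T) y -> (`|(EFin \o f k) y| <= `|h y * chi y|%:E)%E.
    move=> _; rewrite /= lee_fin /f mulrCA normrM ger0_norm ?cutoff_ge0//.
    by rewrite -[leRHS]mul1r ler_wpM2r// cutoff_le1.
  have {}C := C p1 p2 p3.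
  have E0 k : (\int[lam]_(y in (U : set T)) (EFin \o f k) y = 0)%E.
    have [fi fi0] := H _ (tk k).
    by rewrite -[LHS]fineK ?integrable_fin_num//; have := fi0; rewrite /Rintegral /f /= => ->.
  transitivity (integral lam (U : set T) f0).
    have BU : box (Some (p, q)) `<=` U by exact: subset_trans QU.
    rewrite integral_mkcond [RHS]integral_mkcond; apply: eq_integral => y _; rewrite !patchE.
    case: ifPn => yB; case: ifPn => yU //=.
    - by rewrite indicE yB mul1r chi1 ?mulr1//; apply: Qab; apply: BQ; move: yB; rewrite inE.
    - by move: yU yB; rewrite inE notin_setE => nU /BU.
    - by rewrite indicE (negbTE yB) mul0r mulr0.
  rewrite -(cvg_lim _ C)//; apply: lim_near_cst => //.
  by apply: nearW => k; exact: E0.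
have [F [mF Foo Fall]] := @lebesgue_sigma_finite R n.
have G0 : forall S : set T, <<s @boxes R n >> S ->
    measurable S /\ (\int[lam]_(x in Q `&` S) (EFin \o h) x = 0)%E.
  apply: integral_generated_eq0 => //.
  - exact: boxes_measurable.
  - exact: boxes_setI.
  - exact: boxQ.
  move=> B GB; have [C _ CE] := boxes_setI (ex_intro2 _ _ (Some (a, b)) I erefl) GB.
  have QBQ : Q `&` B `<=` Q by move=> y [].
  move: CE QBQ; rewrite -/Q => <-; case: C => [[p q]|] CQ; first exact: boxQ.
  by rewrite integral_set0.
(* The hull [S] of [E] differs from [E] inside [Q] by a null set, so that the integrals over [E] and
   over [Q] and [S] agree. *)
have E0 (E : set T) : E `<=` Q -> measurable E ->
    (\int[lam]_(y in E) (EFin \o h) y = \int[lam]_(y in E) (cst 0%E : T -> \bar R) y)%E.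
  move=> EQ mE; rewrite integral_cst// mul0e.
  have Eoo : (lam E < +oo)%E.
    apply: (@le_lt_trans _ _ (lam (cbox a b))).
      by apply: le_lebesgue_outer => y /EQ /Qab.
    by apply: lam_compact_lty; exact: cbox_compact.
  have [S [GS ES SE]] := lebesgue_hull Eoo.
  have [mS S0] := G0 _ GS.
  have mQS : measurable (Q `&` S) by exact: measurableI.
  have D0 : lam ((Q `&` S) `\` E) = 0%E.
    have le : (lam (Q `&` S) <= lam E)%E.
      by rewrite [leRHS](esym SE); apply: le_lebesgue_outer => y [].
    apply/eqP; rewrite eq_le measure_ge0 andbT measureD//.
      have -> : Q `&` S `&` E = E.
        by apply/seteqP; split => y; [case|move=> Ey; split => //; split; [exact: EQ|exact: ES]].
      by rewrite (le_trans (leeB le (lexx _)))// subee// ge0_fin_numE.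
    exact: le_lt_trans le Eoo.
  have iQS : lam.-integrable (Q `&` S) (EFin \o h) by exact: integrableS ih.
  have mD : measurable ((Q `&` S) `\` E) by exact: measurableD.
  have := @negligible_integral _ _ _ lam _ _ _ mD mQS iQS D0; rewrite S0 => ->.
  congr (integral _ _ _); apply/seteqP; split => y.
    by move=> Ey; split; [split; [exact: EQ|exact: ES]|case].
  by move=> [QSy /not_andP[//|]]; exact: contrapT.
have := @integral_ae_eq _ _ _ lam Q mQ (cst 0%E) (EFin \o h) ih (measurable_cst _) E0.
move=> [N [mN N0 NE]].
apply: (@null_subset _ _ _ N _ N0) => y [[Uy hy] Wy]; apply: NE => /= K.
apply: hy; have : Q y by move=> i; have /andP[/ltW -> ->] := Wy i.
by move=> /K[].
Qed.

End fundamental_lemma.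

(** * Calculus of weak derivatives *)

Section weak_derivatives.
Variables (R : realType) (n : nat).
Local Notation X := 'rV[R]_n.
Local Notation T := (Rn_leb R n).
Local Notation lam := (@lebesgue_Rn R n).
Implicit Types (U V K : set X) (f h phi a : X -> R).

Lemma open_bigcup_cbox U : open U -> U = \bigcup_(q in [set q : 'rV[rat]_n * 'rV[rat]_n |
   cbox (map_mx ratr q.1) (map_mx ratr q.2) `<=` U])
   cbox (map_mx ratr q.1 : X) (map_mx ratr q.2).
Proof.
move=> oU; apply/seteqP; split; last by move=> y [q /= qU /qU].
move=> x Ux; have [d d0 dU] := open_cbox oU Ux.
have /choice[p Hp] : forall i : 'I_n, exists q : rat * rat,
    x ord0 i - d < ratr q.1 < x ord0 i /\ x ord0 i < ratr q.2 < x ord0 i + d.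
  move=> i; have [q1] := @rat_in_itvoo R (x ord0 i - d) (x ord0 i) ltac:(by rewrite ltrBlDr ltrDl).
  have [q2] := @rat_in_itvoo R (x ord0 i) (x ord0 i + d) ltac:(by rewrite ltrDl).
  by rewrite !in_itv /= => h2 h1; exists (q1, q2).
exists (\row_i (p i).1, \row_i (p i).2) => /=; last first.
  by move=> i; rewrite !mxE; have [/andP[_ /ltW ->] /andP[/ltW -> _]] := Hp i.
apply: subset_trans dU => y Hy i; have := Hy i; rewrite !mxE.
have [/andP[h1 _] /andP[_ h2]] := Hp i => /andP[h3 h4].
by rewrite (le_trans (ltW h1) h3) (le_trans h4 (ltW h2)).
Qed.

(** An open set is a countable union of compact boxes, on each of which [f] is integrable, hence
    measurable. *)
Lemma loc_int_measurable U f : open U -> Defs.locally_integrable U f ->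
  measurable_fun (U : set T) (f : T -> R).
Proof.
move=> oU lf mU B mB; rewrite {1}(open_bigcup_cbox oU) setI_bigcupl bigcup_mkcond.
apply: (@countable_bigcupT_measurable _ T); first exact: countableP.
move=> q; case: ifPn => [|_]; last exact: measurable0.
rewrite inE /= => qU.
have cq : compact (cbox (map_mx ratr q.1 : X) (map_mx ratr q.2)) by exact: cbox_compact.
have /integrableP[/measurable_EFinP mf _] := lf _ cq qU.
by apply: mf => //; apply: measurable_compact; exact: cbox_compact.
Qed.

Lemma loc_int_ext U f h : (forall y, U y -> f y = h y) ->
  Defs.locally_integrable U f -> Defs.locally_integrable U h.
Proof.
move=> fh lf K cK KU; apply: eq_integrable (lf _ cK KU) => //.
  exact: measurable_compact.
by move=> y; rewrite inE => Ky /=; rewrite fh//; exact: KU.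
Qed.

Lemma loc_intM U f a : open U -> Defs.locally_integrable U f -> {in U, continuous a} ->
  Defs.locally_integrable U (fun y => a y * f y).
Proof.
move=> oU lf ca K cK KU; have [M HM] := continuous_bounded oU ca cK KU.
have mK : measurable (K : set T) by exact: measurable_compact.
have ma : measurable_fun (K : set T) (a : T -> R) by exact: (measurable_continuous oU ca).
have i1 := integrable_bounded_mul mK (lf _ cK KU) ma HM.
by apply: eq_integrable i1 => // y _ /=; rewrite mulrC.
Qed.

Lemma loc_intD U f h : Defs.locally_integrable U f -> Defs.locally_integrable U h ->
  Defs.locally_integrable U (fun y => f y + h y).
Proof.
move=> lf lh K cK KU; have mK := measurable_compact cK.
exact: (integrableD mK (lf _ cK KU) (lh _ cK KU)).
Qed.

Lemma loc_int_continuous U f : open U -> {in U, continuous f} -> Defs.locally_integrable U f.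
Proof. by move=> oU cf K cK KU; exact: (cont_compact_integrable oU cf). Qed.

Lemma Rintegral_ext (D : set T) (f h : T -> R) : (forall y, D y -> f y = h y) ->
  \int[lam]_(y in D) f y = \int[lam]_(y in D) h y.
Proof.
by move=> fh; apply: eq_Rintegral => y; rewrite inE => /fh.
Qed.

Lemma weak_partial_unique U i f h h' : open U -> weak_partial U i f h -> weak_partial U i f h' ->
  ae_in U (fun y => h y = h' y).
Proof.
move=> oU [mh Hh] [mh' Hh'].
have mU : measurable (U : set T) by exact: measurable_open.
apply: (@ae_in_impl _ _ _ (fun y => h y - h' y = 0)).
  by move=> y _ /eqP; rewrite subr_eq0 => /eqP.
apply: (fundamental_lemma oU (measurable_funB mh mh')) => phi tphi.
have [i1 e1] := Hh _ tphi; have [i2 e2] := Hh' _ tphi.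
have i3 := integrableB mU i1 i2.
split; first by apply: eq_integrable i3 => // y _ /=; rewrite mulrBl.
rewrite (@Rintegral_ext U _ (fun y => h y * phi y - h' y * phi y)) => [|y _]; last by rewrite mulrBl.
by rewrite RintegralB//; apply/eqP; rewrite subr_eq0 -eqr_opp -e1 -e2.
Qed.

Lemma weak_partial_ext U i f f' h h' : open U -> (forall y, U y -> f y = f' y) ->
  (forall y, U y -> h y = h' y) -> weak_partial U i f h -> weak_partial U i f' h'.
Proof.
move=> oU ff hh [mh Hh].
have mU : measurable (U : set T) by exact: measurable_open.
split; first by apply: eq_measurable_fun mh => y; rewrite inE => /hh.
move=> phi tphi; have [i1 e1] := Hh _ tphi; split.
  by apply: eq_integrable i1 => // y; rewrite inE /= => /hh ->.
rewrite (@Rintegral_ext U _ (fun y => f y * partial i phi y)) => [|y /ff -> //].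
by rewrite e1; congr (- _); apply: Rintegral_ext => y /hh ->.
Qed.

Lemma weak_partial_sub U V i f h : open U -> open V -> V `<=` U -> weak_partial U i f h ->
  weak_partial V i f h.
Proof.
move=> oU oV VU [mh Hh].
have mU : measurable (U : set T) by exact: measurable_open.
have mV : measurable (V : set T) by exact: measurable_open.
split; first exact: measurable_funS mh.
move=> phi tphi; have [i1 e1] := Hh _ (test_sub VU tphi); split; first exact: integrableS i1.
have [_ [K [cK KV K0]]] := tphi.
have [_ [K' [cK' KV' K0']]] := test_partial i tphi.
have UV : (U : set T) `&` V = V by rewrite setIidr.
have E (F p : X -> R) : (forall y, U y -> ~ V y -> p y = 0) ->
    \int[lam]_(y in (U : set T)) (F y * p y) = \int[lam]_(y in (V : set T)) (F y * p y).
  move=> p0; rewrite (@supp_integral _ _ _ V); first by rewrite UV.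
  by move=> y Uy nV; rewrite p0 ?mulr0.
rewrite -!E//.
  by move=> y _ nV; apply: K0 => /KV.
by move=> y _ nV; apply: K0' => /KV'.
Qed.

Lemma weak_partial_smooth U i a : open U -> smooth_on U a -> weak_partial U i a (partial i a).
Proof.
move=> oU sa.
have mU : measurable (U : set T) by exact: measurable_open.
have [ca Ca] := sa 1%N; have [da [cpa _]] := Ca i.
have spa : smooth_on U (partial i a) by move=> k; have [_ /(_ i)[]] := sa k.+1.
split; first exact: (measurable_continuous oU cpa).
move=> phi tphi.
have t1 := test_mul oU tphi spa.
have t2 := test_mul oU (test_partial i tphi) sa.
have t3 := test_mul oU tphi sa.
split; first exact: test_integrable t1 mU.
apply/eqP; rewrite -addr_eq0 -RintegralD//; last 2 first.
- exact: test_integrable t2 mU.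
- exact: test_integrable t1 mU.
have [sphi [K [cK KU K0]]] := tphi.
apply/eqP; transitivity (\int[lam]_(y in (U : set T)) partial i (fun y => a y * phi y) y).
  apply: Rintegral_ext => y Uy; rewrite /partial deriveM.
  - by rewrite /GRing.scale /= addrC [X in X + _]mulrC [in RHS]addrC; congr (_ + _); rewrite mulrC.
  - by apply: da; rewrite inE.
  - by have [_ /(_ i)[d _]] := sphi 1%N; apply: d; rewrite inE.
rewrite -(integral_partial i (test_sub (@subsetT _ U) t3)).
have [_ [K' [cK' KV' K0']]] := test_partial i t3.
rewrite [RHS](@supp_integral _ _ setT U) ?setTI// => y _ nU; apply: K0' => /KV'; exact: nU.
Qed.

(** Test the derivative of [f] against [a * phi], and expand the derivative of this product. *)
Lemma weak_partialM U i a f h : open U -> smooth_on U a -> Defs.locally_integrable U f ->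
  weak_partial U i f h ->
  weak_partial U i (fun y => a y * f y) (fun y => a y * h y + partial i a y * f y).
Proof.
move=> oU sa lf [mh Hh].
have mU : measurable (U : set T) by exact: measurable_open.
have mf := loc_int_measurable oU lf.
have [ca Ca] := sa 1%N; have [da [cpa _]] := Ca i.
have spa : smooth_on U (partial i a) by move=> k; have [_ /(_ i)[]] := sa k.+1.
have ma : measurable_fun (U : set T) (a : T -> R) by exact: (measurable_continuous oU ca).
have mpa : measurable_fun (U : set T) (partial i a : T -> R).
  exact: (measurable_continuous oU cpa).
split; first exact: (measurable_funD (measurable_funM ma mh) (measurable_funM mpa mf)).
move=> phi tphi.
have t1 := test_mul oU tphi spa.
have t2 := test_mul oU (test_partial i tphi) sa.
have t3 := test_mul oU tphi sa.
have [i3 e3] := Hh _ t3.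
have i1 := loc_test_integrable oU lf t1.
have i2 := loc_test_integrable oU lf t2.
have [sphi _] := tphi.
split.
  apply: eq_integrable (integrableD mU i3 i1) => // y _ /=; congr EFin; ring.
have E y : U y -> f y * partial i (fun y => a y * phi y) y =
    f y * (a y * partial i phi y) + f y * (partial i a y * phi y).
  move=> Uy; rewrite /partial deriveM.
  - by rewrite /GRing.scale /= [phi y * _]mulrC mulrDr.
  - by apply: da; rewrite inE.
  - by have [_ /(_ i)[d _]] := sphi 1%N; apply: d; rewrite inE.
rewrite (Rintegral_ext E) RintegralD// in e3.
rewrite (@Rintegral_ext U _ (fun y => f y * (a y * partial i phi y))); last by move=> y _; ring.
rewrite (@Rintegral_ext U (fun y => (a y * h y + partial i a y * f y) * phi y)
  (fun y => h y * (a y * phi y) + f y * (partial i a y * phi y))); last by move=> y _; ring.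
rewrite RintegralD// opprD -e3; ring.
Qed.

Lemma weak_partialD U i f1 h1 f2 h2 : open U -> Defs.locally_integrable U f1 ->
  Defs.locally_integrable U f2 -> weak_partial U i f1 h1 -> weak_partial U i f2 h2 ->
  weak_partial U i (fun y => f1 y + f2 y) (fun y => h1 y + h2 y).
Proof.
move=> oU l1 l2 [m1 H1] [m2 H2].
have mU : measurable (U : set T) by exact: measurable_open.
split; first exact: (measurable_funD m1 m2).
move=> phi tphi; have [i1 e1] := H1 _ tphi; have [i2 e2] := H2 _ tphi.
have j1 := loc_test_integrable oU l1 (test_partial i tphi).
have j2 := loc_test_integrable oU l2 (test_partial i tphi).
split; first by apply: eq_integrable (integrableD mU i1 i2) => // y _ /=; rewrite mulrDl.
rewrite (@Rintegral_ext U _ (fun y => f1 y * partial i phi y + f2 y * partial i phi y)); last first.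
  by move=> y _; rewrite mulrDl.
rewrite (@Rintegral_ext U (fun y => (h1 y + h2 y) * phi y) (fun y => h1 y * phi y + h2 y * phi y)); last first.
  by move=> y _; rewrite mulrDl.
by rewrite !RintegralD// e1 e2 opprD.
Qed.

Lemma weak_partial_sum U i (I : finType) (f h : I -> X -> R) : open U ->
  (forall j, Defs.locally_integrable U (f j)) -> (forall j, weak_partial U i (f j) (h j)) ->
  weak_partial U i (fun y => \sum_j f j y) (fun y => \sum_j h j y).
Proof.
move=> oU lf Hw.
suff [] : Defs.locally_integrable U (fun y => \sum_(j <- index_enum I) f j y) /\
  weak_partial U i (fun y => \sum_(j <- index_enum I) f j y) (fun y => \sum_(j <- index_enum I) h j y) by [].
elim: (index_enum I) => [|j r [IH1 IH2]].
  split.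
    apply: (@loc_int_ext _ (cst 0)) => [y _|]; first by rewrite big_nil.
    by apply: loc_int_continuous => // y _; exact: cst_continuous.
  have s0 : smooth_on U (cst 0 : X -> R) by move=> k; exact: Ck_on_cst.
  apply: (weak_partial_ext oU _ _ (weak_partial_smooth i oU s0)) => y _; rewrite big_nil//.
  by rewrite /partial derive_cst.
split.
  apply: (@loc_int_ext _ (fun y => f j y + \sum_(j <- r) f j y)) => [y _|].
    by rewrite big_cons.
  exact: loc_intD.
by apply: (weak_partial_ext oU _ _ (weak_partialD oU (lf j) IH1 (Hw j) IH2)) => y _; rewrite big_cons.
Qed.

End weak_derivatives.
Import HBNNSimple.

(** * Integrals with densities *)

Section density.
Context d1 d2 (T1 : measurableType d1) (T2 : measurableType d2) (R : realType).
Variables (mu : {measure set T1 -> \bar R}) (psi : T1 -> T2) (D1 : set T1) (D2 : set T2).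
Variable r : T1 -> R.
Hypotheses (mD1 : measurable D1) (mD2 : measurable D2).
Hypothesis psiD : forall x, D1 x -> D2 (psi x).
Hypothesis mpsi : forall B, measurable B -> B `<=` D2 -> measurable (D1 `&` psi @^-1` B).
Hypotheses (mr : measurable_fun D1 r) (r0 : forall x, D1 x -> 0 <= r x).

Lemma integral_nnsfun_density (h : {nnsfun T2 >-> R}) :
  (\int[mu]_(x in D1) (h (psi x) * r x)%:E =
   \sum_(y \in range h) y%:E * \int[mu]_(x in D1 `&` psi @^-1` (D2 `&` h @^-1` [set y])) (r x)%:E)%E.
Proof.
have mh y : measurable (D2 `&` h @^-1` [set y]) by exact: measurableI.
have sub y : D2 `&` h @^-1` [set y] `<=` D2 by move=> z [].
have mA y := mpsi (mh y) (@sub y).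
transitivity (\int[mu]_(x in D1) (\sum_(y \in range h)
    ((y * \1_(h @^-1` [set y]) (psi x))%:E * (r x)%:E)))%E.
  apply: eq_integral => x /[!inE] Dx.
  rewrite -ge0_mule_fsuml => [|y]; last exact: nnfun_muleindic_ge0.
  by rewrite fsumEFin// -(fimfunE h (psi x)) EFinM.
pose A y := D1 `&` psi @^-1` (D2 `&` h @^-1` [set y]).
have E y x : D1 x -> ((y * \1_(h @^-1` [set y]) (psi x))%:E * (r x)%:E =
    y%:E * ((fun x => (r x)%:E) \_ (A y)) x)%E.
  move=> Dx; rewrite EFinM -muleA; congr (_ * _)%E.
  rewrite patchE indicE; case: ifPn => xA.
    by rewrite (_ : _ \in _) ?mul1e//; move: xA; rewrite !inE => -[_ []].
  rewrite (_ : (_ \in _) = false) ?mul0e//; apply/negbTE; move: xA; rewrite !notin_setE.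
  by move=> nA Ax; apply: nA; split => //; split => //; exact: psiD.
have mpatch y : measurable_fun D1 ((fun x => (r x)%:E) \_ (A y)).
  apply/(measurable_restrict (fun x => (r x)%:E) (mA y) mD1).
  have mE : measurable_fun D1 (EFin \o r) by exact/measurable_EFinP.
  by apply: measurable_funS mE => // x [].
rewrite ge0_integral_fsum//; last 2 first.
- move=> y; apply: (@eq_measurable_fun _ _ _ _ D1 (fun x => y%:E *
    ((fun x => (r x)%:E) \_ (A y)) x)%E).
    by move=> x /[!inE] /E ->.
  by apply: emeasurable_funM => //; exact: measurable_cst.
- by move=> y x Dx; rewrite mule_ge0 ?lee_fin ?r0// -lee_fin nnfun_muleindic_ge0.
apply: eq_fsbigr => y; rewrite inE => -[z _ hz].
have y0 : 0 <= y by rewrite -hz.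
have -> : D1 `&` psi @^-1` (D2 `&` h @^-1` [set y]) = D1 `&` A y by rewrite /A setIA setIid.
rewrite integral_mkcondr -ge0_integralZl_EFin//.
  by apply: eq_integral => x /[!inE] /E.
by move=> x Dx; rewrite patchE; case: ifP => //; rewrite lee_fin r0.
Qed.

(** Monotone convergence along simple functions. The right-hand side sees [mu], [psi] and [r] only
    through the integrals of [r] over preimages of subsets of [D2]; [change_of_density] compares
    exactly these. *)
Lemma integral_density (f : T2 -> \bar R) (mf : measurable_fun D2 f) :
  (forall y, D2 y -> 0 <= f y)%E ->
  (\int[mu]_(x in D1) (f (psi x) * (r x)%:E) =
   lim ((\sum_(y \in range (nnsfun_approx mD2 mf n)) y%:E *
      \int[mu]_(x in D1 `&` psi @^-1` (D2 `&` (nnsfun_approx mD2 mf n) @^-1` [set y])) (r x)%:E)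
     @[n --> \oo]))%E.
Proof.
move=> f0; set h := nnsfun_approx mD2 mf.
transitivity (lim ((\int[mu]_(x in D1) (h n (psi x) * r x)%:E)%E @[n --> \oo])).
  have fE x : D1 x -> (f (psi x) * (r x)%:E)%E = lim ((h n (psi x) * r x)%:E @[n --> \oo]).
    move=> Dx; apply/esym/cvg_lim => //; under eq_cvg do rewrite EFinM.
    apply: cvgeZr => //.
    by apply: (@cvg_nnsfun_approx _ _ _ _ mD2 _ mf f0); exact: psiD.
  under eq_integral => x /[!inE] /fE -> //.
  apply: monotone_convergence => //.
  - move=> n; apply/measurable_EFinP; apply: measurable_funM => // _ B mB.
    have := mpsi (measurableI _ _ mD2 (measurable_sfunP (h n) mB)) (@subIsetl _ _ _).
    congr (measurable _); apply/seteqP; split => x /=; last by move=> [Dx Hx]; split => //; split => //; exact: psiD.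
    by move=> [Dx [_ Hx]].
  - by move=> n x Dx; rewrite lee_fin mulr_ge0 ?r0.
  - by move=> x Dx a b ab; rewrite lee_fin ler_wpM2r ?r0//; exact/lefP/nd_nnsfun_approx.
by congr (limn _); apply/funext => n /=; rewrite integral_nnsfun_density.
Qed.

End density.

Lemma change_of_density d1 d2 (T1 : measurableType d1) (T2 : measurableType d2) (R : realType)
    (mu1 : {measure set T1 -> \bar R}) (mu2 : {measure set T2 -> \bar R})
    (psi : T1 -> T2) (D1 : set T1) (D2 : set T2) (r1 : T1 -> R) (r2 : T2 -> R)
    (f : T2 -> \bar R) :
  measurable D1 -> measurable D2 -> (forall x, D1 x -> D2 (psi x)) ->
  (forall B, measurable B -> B `<=` D2 -> measurable (D1 `&` psi @^-1` B)) ->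
  measurable_fun D1 r1 -> (forall x, D1 x -> 0 <= r1 x) ->
  measurable_fun D2 r2 -> (forall x, D2 x -> 0 <= r2 x) ->
  (forall B, measurable B -> B `<=` D2 ->
    \int[mu1]_(x in D1 `&` psi @^-1` B) (r1 x)%:E = \int[mu2]_(y in B) (r2 y)%:E)%E ->
  measurable_fun D2 f -> (forall y, D2 y -> 0 <= f y)%E ->
  (\int[mu1]_(x in D1) (f (psi x) * (r1 x)%:E) = \int[mu2]_(y in D2) (f y * (r2 y)%:E))%E.
Proof.
move=> mD1 mD2 psiD mpsi mr1 r10 mr2 r20 HE mf f0.
rewrite (integral_density mu1 mD1 mD2 psiD mpsi mr1 r10 mf f0).
rewrite (@integral_density _ _ _ _ _ mu2 id D2 D2 r2 mD2 mD2)//; last first.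
  by move=> B mB BD; rewrite preimage_id; exact: measurableI.
congr (limn _); apply/funext => n /=; apply: eq_fsbigr => y _; congr (_ * _)%E.
rewrite HE; [|exact: measurableI|by move=> z []].
by rewrite preimage_id setIA setIid.
Qed.

Lemma measurable_funV_gt0 d (T : measurableType d) (R : realType) (D : set T) (f : T -> R) :
  measurable_fun D f -> (forall x, D x -> 0 < f x) -> measurable_fun D (fun x => (f x)^-1).
Proof.
move=> mf f0; apply: (@eq_measurable_fun _ _ _ _ D (fun x => expR (- ln (f x)))).
  by move=> x; rewrite inE => Dx; rewrite expRN lnK// posrE f0.
apply: measurableT_comp; first exact: measurable_expR.
by apply: measurableT_comp => //; apply: measurableT_comp => //; exact: measurable_ln.
Qed.

(** * Change of variables *)

Section meas_diffeo.
Variables (R : realType) (n : nat).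
Local Notation X := 'rV[R]_n.
Local Notation T := (Rn_leb R n).
Local Notation lam := (@lebesgue_Rn R n).
Implicit Types U V : set X.

Definition jacmx (psi : X -> X) (y : X) : 'M[R]_n :=
  \matrix_(m, a) partial m (fun z => psi z ord0 a) y.

(* The densities r and r' stand for sqrt |g| in two charts; clause md_E is all  *)
(* that is needed to derive the change of variables formula below.             *)
Record meas_diffeo U V (psi kap : X -> X) (r r' : X -> R) : Prop := MeasDiffeo {
  md_oU : open U; md_oV : open V;
  md_psi : forall y, U y -> V (psi y); md_kap : forall z, V z -> U (kap z);
  md_psiK : forall y, U y -> kap (psi y) = y; md_kapK : forall z, V z -> psi (kap z) = z;
  md_spsi : forall a, smooth_on U (fun y => psi y ord0 a);
  md_skap : forall a, smooth_on V (fun z => kap z ord0 a);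
  md_mr : measurable_fun (U : set T) (r : T -> R);
  md_mr' : measurable_fun (V : set T) (r' : T -> R);
  md_r0 : forall y, U y -> 0 < r y; md_r0' : forall z, V z -> 0 < r' z;
  md_E : forall E : set X, E `<=` U -> measurable (E : set T) ->
    measurable (psi @` E : set T) ->
    (\int[lam]_(y in (E : set T)) (r y)%:E =
     \int[lam]_(z in (psi @` E : set T)) (r' z)%:E)%E;
  md_J : forall y, U y -> r y = `|\det (jacmx psi y)| * r' (psi y) }.

Section diffeo.
Variables (U V : set X) (psi kap : X -> X) (r r' : X -> R).
Hypothesis md : meas_diffeo U V psi kap r r'.

Lemma psi_continuous : {in U, continuous psi}.
Proof.
move=> y Uy; apply: continuous_rV => a.
exact: (Ck_on_continuous (md_spsi md a 0)).
Qed.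

Lemma jacmx_mul y : U y -> jacmx psi y *m jacmx kap (psi y) = 1%:M.
Proof.
move=> Uy; apply/matrixP => m b; rewrite !mxE.
have [_ E] := partial_comp m (md_oU md) (md_oV md) (fun a => md_spsi md a 1) (md_skap md b 1) Uy (md_psi md Uy).
transitivity (partial m ((fun z => kap z ord0 b) \o psi) y).
  by rewrite E; apply: eq_bigr => a _; rewrite !mxE.
rewrite (@partial_ext _ _ U _ (fun z => z ord0 b) m (md_oU md))//.
  rewrite /partial; apply: derive_val.
  rewrite (_ : (m == b)%:R = (delta_mx ord0 m : X) ord0 b); last by rewrite mxE eqxx eq_sym.
  exact: is_derive_coord.
by move=> z Uz /=; rewrite (md_psiK md).
Qed.

Lemma image_psi E : E `<=` U -> psi @` E = V `&` kap @^-1` E.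
Proof.
move=> EU; apply/seteqP; split => z /=.
  by move=> [y Ey <-]; split; [exact: md_psi md _ (EU _ Ey)|rewrite /= (md_psiK md)//; exact: EU].
by move=> [Vz Ez]; exists (kap z) => //; exact: md_kapK md _ Vz.
Qed.

(** Continuity of [kap] settles boxes, hence Borel sets. Lebesgue measurable sets also require the
    control of null sets that follows. *)
Lemma borel_kap (S : set T) : <<s @boxes R n >> S -> measurable (V `&` kap @^-1` S : set T).
Proof.
have mV : measurable (V : set T) by exact: measurable_open (md_oV md).
move: S; apply: smallest_sub.
  split => /=.
  - by rewrite preimage_set0 setI0; exact: measurable0.
  - move=> A mA; rewrite (_ : _ `&` _ = V `\` (V `&` kap @^-1` A)); first exact: measurableD.
    apply/seteqP; split => z /=; first by move=> [Vz [_ nA]]; split => // -[].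
    by move=> [Vz nA]; split => //; split => // Az; apply: nA.
  - move=> F mF; rewrite preimage_bigcup setI_bigcupr.
    by apply: bigcup_measurable => k _; exact: mF.
move=> _ [[[a b]|] _ <-] /=; last by rewrite preimage_set0 setI0; exact: measurable0.
rewrite (_ : _ `&` _ = (V : set T) `&` \bigcap_(i in [set: 'I_n])
   ((V : set T) `&` (fun z => kap z ord0 i) @^-1` `[a ord0 i, b ord0 i[)); last first.
  apply/seteqP; split => z /= [Vz Hz]; split => // i.
    by move=> _; split => //=; rewrite in_itv /=; exact: Hz.
  by have [] := Hz i I; rewrite /= in_itv.
apply: measurableI => //; apply: fin_bigcap_measurable; first exact: finite_finset.
move=> i _; apply: (measurable_continuous (md_oV md) _ (@subset_refl _ V)) => //.
exact: (Ck_on_continuous (md_skap md i 0)).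
Qed.

(** A Borel null hull of [N] has a measurable image, to which [md_E] applies: the integral of the
    positive function [r'] over that image is 0, so the image is null. *)
Lemma null_image N : N `<=` U -> lebesgue_outer N = 0%E -> lebesgue_outer (psi @` N) = 0%E.
Proof.
move=> NU N0; have [S [bS NS]] : exists S : set T, [/\ <<s @boxes R n >> S, N `<=` S & lebesgue_outer S = lebesgue_outer N].
  by apply: lebesgue_hull; rewrite N0.
rewrite N0 => S0; pose E : set X := S `&` U.
have EU : E `<=` U by move=> y [].
have E0 : lebesgue_outer E = 0%E by apply: null_subset S0 => y [].
have mpE : measurable (psi @` E : set T).
  rewrite (image_psi EU) (_ : _ `&` _ = V `&` kap @^-1` S); first exact: borel_kap.
  apply/seteqP; split => z /= [Vz]; first by case.
  by split => //; split => //; exact: md_kap md _ Vz.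
have mE : measurable (E : set T) by exact: null_measurable.
have pEV : psi @` E `<=` V by move=> _ [y /EU Uy <-]; exact: md_psi md _ Uy.
have := md_E md EU mE mpE.
have mrE : measurable_fun (E : set T) (EFin \o r : T -> \bar R).
  by apply/measurable_EFinP; apply: measurable_funS (md_mr md) => //; exact: measurable_open (md_oU md).
rewrite (@null_set_integral _ _ _ lam E (EFin \o r))// => /esym H.
have mr'E : measurable_fun (psi @` E : set T) (EFin \o r' : T -> \bar R).
  by apply/measurable_EFinP; apply: measurable_funS (md_mr' md) => //; exact: measurable_open (md_oV md).
have [N' [mN' N'0 N'E]] : ae_eq lam (psi @` E : set T) (EFin \o r') (cst 0%E).
  apply/(ae_eq_integral_abs lam mpE mr'E); rewrite -[RHS]H; apply: eq_integral => z.
  by rewrite inE => /pEV Vz; rewrite /= gtr0_norm// (md_r0' md).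
apply: (@null_subset _ _ _ N' _ N'0) => _ [y Ny <-]; apply: N'E => /= K.
have Uy := NU _ Ny; have Vy := md_psi md Uy.
have : r' (psi y) = 0.
  apply: EFin_inj; apply: K; exists y => //; split => //; exact: NS.
by apply/eqP; rewrite gt_eqF// (md_r0' md).
Qed.

(** After cutting [E] into pieces of finite measure, each piece is a Borel set minus a null set, and
    [borel_kap] and [null_image] treat the two. *)
Lemma measurable_image E : E `<=` U -> measurable (E : set T) -> measurable (psi @` E : set T).
Proof.
move=> EU mE; have [F [mF Foo Fall]] := @lebesgue_sigma_finite R n.
have -> : psi @` E = \bigcup_k psi @` (E `&` F k).
  rewrite -image_bigcup -setI_bigcupr (_ : \bigcup_k F k = setT) ?setIT//.
  by apply/seteqP; split => // y _; have [k] := Fall y; exists k.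
apply: (@bigcup_measurable _ T) => k _; set A := E `&` F k.
have mA : measurable (A : set T) by exact: measurableI.
have AU : A `<=` U by move=> y [/EU].
have Aoo : (lebesgue_outer A < +oo)%E.
  by apply: le_lt_trans (Foo k); apply: le_lebesgue_outer => y [].
have [S [bS AS SA]] := lebesgue_hull Aoo.
have mS : measurable S.
  move: S bS {AS SA}; apply: smallest_sub; last exact: boxes_measurable.
  exact: sigma_algebra_measurable.
pose N : set X := (S `&` U) `\` A.
have N0 : lebesgue_outer N = 0%E.
  apply: (@null_subset _ _ _ (S `\` A)); first by move=> y [[]].
  have := @measureD _ _ _ lam S A mS mA.
  rewrite /= SA => ->//; rewrite setIidr// subee// ge0_fin_numE//.
have pN0 : lebesgue_outer (psi @` N) = 0%E by apply: null_image N0 => y [[]].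
have -> : psi @` A = (V `&` kap @^-1` S) `\` (psi @` N).
  apply/seteqP; split => z.
    move=> [y Ay <-]; have Uy := AU _ Ay; split.
      by split; [exact: md_psi md _ Uy|rewrite /= (md_psiK md)//; exact: AS].
    by move=> [y' [[_ Uy'] nA]] /(congr1 kap); rewrite !(md_psiK md)// => yy; apply: nA; rewrite yy.
  move=> [[Vz Sz] nN]; exists (kap z); last exact: md_kapK md _ Vz.
  apply: contrapT => nA; apply: nN; exists (kap z); last exact: md_kapK md _ Vz.
  by split => //; split => //; exact: md_kap md _ Vz.
apply: measurableD; first exact: borel_kap.
exact: null_measurable.
Qed.

End diffeo.

Lemma meas_diffeo_sym U V psi kap r r' :
  meas_diffeo U V psi kap r r' -> meas_diffeo V U kap psi r' r.
Proof.
move=> md; case: (md) => oU oV pUV kVU pK kK sp sk mr mr' r0 r0' HE HJ.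
have imk E : E `<=` V -> psi @` (kap @` E) = E.
  move=> EV; apply/seteqP; split => z; first by move=> [_ [z' Ez' <-] <-]; rewrite kK//; exact: EV.
  by move=> Ez; exists (kap z); [exists z|rewrite kK//; exact: EV].
split => //.
- move=> E EV mE mkE; have := HE (kap @` E); rewrite imk// => -> //.
  by move=> _ [z /EV Vz <-]; exact: kVU.
- move=> z Vz; have := jacmx_mul md (kVU _ Vz); rewrite kK// => /(congr1 (fun A => `|\det A|)).
  rewrite det_mulmx normrM det1 normr1 => H.
  by rewrite (HJ _ (kVU _ Vz)) kK// mulrA [_ * `|_|]mulrC H mul1r.
Qed.

Section pullback.
Variables (U V : set X) (psi kap : X -> X) (r r' : X -> R).
Hypothesis md : meas_diffeo U V psi kap r r'.
Let md' := meas_diffeo_sym md.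

Lemma measurable_preimage_psi (B : set X) : B `<=` V -> measurable (B : set T) ->
  measurable (U `&` psi @^-1` B : set T).
Proof. by move=> BV mB; rewrite -(image_psi md' BV); exact: measurable_image md' _ BV mB. Qed.

Lemma measurable_fun_psi d (T' : measurableType d) (f : X -> T') :
  measurable_fun (V : set T) (f : T -> T') -> measurable_fun (U : set T) (f \o psi : T -> T').
Proof.
move=> mf mU B mB; rewrite (_ : _ `&` _ = U `&` psi @^-1` (V `&` f @^-1` B)).
  by apply: measurable_preimage_psi => [z []//|]; apply: mf => //; exact: measurable_open (md_oV md).
apply/seteqP; split => y /= [Uy]; last by case.
by split => //; split => //; exact: md_psi md _ Uy.
Qed.

Lemma jacmx_measurable : measurable_fun (U : set T) (fun y : T => `|\det (jacmx psi y)|).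
Proof.
have mr := md_mr md; have mr' := measurable_fun_psi (md_mr' md).
have mU : measurable (U : set T) by exact: measurable_open (md_oU md).
apply: (@eq_measurable_fun _ _ _ _ (U : set T) (fun y => r y / r' (psi y))).
  move=> y; rewrite inE => Uy; rewrite (md_J md Uy) mulfK// gt_eqF// (md_r0' md)//.
  exact: md_psi md _ Uy.
have rp0 y : U y -> 0 < r' (psi y) by move=> /(md_psi md); exact: md_r0' md _.
exact: (measurable_funM mr (measurable_funV_gt0 mr' rp0)).
Qed.

(** [md_E] says that the densities [r] and [r'] correspond under [psi]. Apply this to [f / r'] and
    use [md_J] to turn [r / r'] into the Jacobian. *)
Lemma change_of_variables_ge0 (f : X -> \bar R) : measurable_fun (V : set T) (f : T -> \bar R) ->
  (forall z, V z -> 0 <= f z)%E ->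
  (\int[lam]_(y in (U : set T)) (f (psi y) * `|\det (jacmx psi y)|%:E) =
   \int[lam]_(z in (V : set T)) f z)%E.
Proof.
move=> mf f0.
have mU : measurable (U : set T) by exact: measurable_open (md_oU md).
have mV : measurable (V : set T) by exact: measurable_open (md_oV md).
pose q (z : X) : \bar R := (f z * ((r' z)^-1)%:E)%E.
have mri : measurable_fun (V : set T) (fun z : T => (r' z)^-1) := measurable_funV_gt0 (md_mr' md) (md_r0' md).
have mq : measurable_fun (V : set T) (q : T -> \bar R).
  by apply: emeasurable_funM => //; exact/measurable_EFinP.
have q0 z : V z -> (0 <= q z)%E.
  by move=> Vz; rewrite mule_ge0 ?f0// lee_fin invr_ge0 ltW// (md_r0' md).
transitivity (\int[lam]_(y in (U : set T)) (q (psi y) * (r y)%:E))%E.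
  apply: eq_integral => y; rewrite inE => Uy; rewrite /q -muleA -EFinM; congr (_ * _%:E)%E.
  by rewrite (md_J md Uy) mulrCA mulVf ?mulr1// gt_eqF// (md_r0' md)//; exact: md_psi md _ Uy.
rewrite (@change_of_density _ _ _ _ _ lam lam psi U V r r' q)//.
- apply: eq_integral => z; rewrite inE => Vz; rewrite /q -muleA -EFinM mulVf ?mule1//.
  by rewrite gt_eqF// (md_r0' md).
- exact: md_psi md.
- by move=> B mB BV; exact: measurable_preimage_psi.
- exact: md_mr md.
- by move=> y Uy; rewrite ltW// (md_r0 md).
- exact: md_mr' md.
- by move=> z Vz; rewrite ltW// (md_r0' md).
move=> B mB BV; have := md_E md' BV mB.
rewrite (image_psi md' BV) => -> //; exact: measurable_preimage_psi.
Qed.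

Lemma change_of_variables_int (f : X -> R) : lam.-integrable (V : set T) (EFin \o f) ->
  lam.-integrable (U : set T) (EFin \o (fun y => f (psi y) * `|\det (jacmx psi y)|)) /\
  \int[lam]_(y in (U : set T)) (f (psi y) * `|\det (jacmx psi y)|) =
  \int[lam]_(z in (V : set T)) f z.
Proof.
move=> fi; have /integrableP[mf foo] := fi.
have mU : measurable (U : set T) by exact: measurable_open (md_oU md).
have mV : measurable (V : set T) by exact: measurable_open (md_oV md).
have mF : measurable_fun (U : set T) (EFin \o (fun y : T => f (psi y) * `|\det (jacmx psi y)|)).
  apply/measurable_EFinP; apply: (measurable_funM _ jacmx_measurable).
  exact/measurable_EFinP/(measurable_fun_psi mf).
have H (g : X -> \bar R) (G : X -> \bar R) : measurable_fun (V : set T) (g : T -> \bar R) ->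
    (forall z, 0 <= g z)%E -> (forall y, U y -> G y = g (psi y) * `|\det (jacmx psi y)|%:E)%E ->
    (\int[lam]_(y in (U : set T)) G y = \int[lam]_(z in (V : set T)) g z)%E.
  move=> mg g0 HG; rewrite -change_of_variables_ge0//.
  by apply: eq_integral => y; rewrite inE => /HG.
have ei : (\int[lam]_(y in (U : set T)) `|(EFin \o (fun y => f (psi y) * `|\det (jacmx psi y)|)%R) y| =
  \int[lam]_(z in (V : set T)) `|(EFin \o f) z|)%E.
  apply: H => [|//|y _]; first exact: measurableT_comp.
  by rewrite /= normrM normr_id EFinM.
split; first by apply/integrableP; split => //; rewrite ei.
rewrite /Rintegral; congr (fine _); rewrite integralE [RHS]integralE; congr (_ - _)%E.
  apply: (H (EFin \o f)^\+%E) => // [|y _]; first exact: measurable_funepos.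
  by rewrite !funeposE /= -!EFin_max -EFinM maxr_pMl// mul0r.
apply: (H (EFin \o f)^\-%E) => // [|y _]; first exact: measurable_funeneg.
by rewrite !funenegE /= -!EFin_max -EFinM maxr_pMl// mul0r mulNr.
Qed.

End pullback.
End meas_diffeo.

(** * The Piola identity and the chain rule for weak derivatives *)

Section piola.
Variables (R : realType) (n : nat).
Local Notation X := 'rV[R]_n.
Local Notation T := (Rn_leb R n).
Local Notation lam := (@lebesgue_Rn R n).
Implicit Types U V : set X.

Lemma open_preimage_in U (f : X -> R) (W : set R) : open U -> {in U, continuous f} -> open W ->
  open (U `&` f @^-1` W).
Proof.
move=> oU cf oW; rewrite openE => x [Ux Wx]; rewrite /interior.
apply: filterI; first exact: open_nbhs_nbhs.
have cfx : {for x, continuous f} by apply: cf; rewrite inE.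
by apply: cfx; exact: open_nbhs_nbhs.
Qed.

Lemma Ck_on_abs k U (f : X -> R) : open U -> (forall y, U y -> f y != 0) -> Ck_on k U f ->
  Ck_on k U (fun y => `|f y|).
Proof.
move=> oU f0 Cf; have cf := Ck_on_continuous Cf; apply: Ck_on_local => x Ux.
have [fx|fx] : 0 < f x \/ f x < 0 by have := f0 _ Ux; rewrite neq_lt => /orP[]; [right|left].
- have oV := open_preimage_in oU cf (@open_gt R 0).
  exists (U `&` f @^-1` [set t | 0 < t]); first by [].
  apply: (Ck_on_ext oV _ (Ck_on_sub _ Cf)) => [y [_ /= fy]|y []//].
  by rewrite gtr0_norm.
- have oV := open_preimage_in oU cf (@open_lt R 0).
  exists (U `&` f @^-1` [set t | t < 0]); first by [].
  apply: (Ck_on_ext oV _ (Ck_on_sub _ (Ck_onN oU Cf))) => [y [_ /= fy]|y []//].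
  by rewrite ltr0_norm.
Qed.

Lemma Ck_on_det k U m (F : X -> 'M[R]_m) : open U -> (forall i j, Ck_on k U (fun y => F y i j)) ->
  Ck_on k U (fun y => \det (F y)).
Proof.
move=> oU CF; apply: Ck_on_sum => // s.
by apply: Ck_onM => //; [exact: Ck_on_cst|exact: Ck_on_prod].
Qed.

Lemma Rintegral_sum (I : Type) (s : seq I) d (T' : measurableType d)
    (mu : {measure set T' -> \bar R}) (D : set T') (F : I -> T' -> R) : measurable D ->
  (forall i, mu.-integrable D (EFin \o F i)) ->
  mu.-integrable D (EFin \o (fun y => \sum_(i <- s) F i y)) /\
  \int[mu]_(y in D) (\sum_(i <- s) F i y) = \sum_(i <- s) \int[mu]_(y in D) F i y.
Proof.
move=> mD iF; elim: s => [|i s [IH1 IH2]].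
  have E : (fun y : T' => \sum_(i <- [::]) F i y) = cst 0 by apply/funext => y; rewrite big_nil.
  rewrite E big_nil; split; first exact: integrable0.
  by rewrite /Rintegral integral0.
have E : (fun y => \sum_(j <- i :: s) F j y) = (fun y => F i y + \sum_(j <- s) F j y).
  by apply/funext => y; rewrite big_cons.
rewrite E big_cons RintegralD// IH2; split => //.
exact: (integrableD mD (iF i) IH1).
Qed.

Section push.
Variables (U V : set X) (psi kap : X -> X) (r r' : X -> R).
Hypothesis md : meas_diffeo U V psi kap r r'.

(** Transport of test functions along the diffeomorphism, extended by 0. *)
Definition push (phi : X -> R) (z : X) : R := if `[< V z >] then phi (kap z) else 0.

Lemma push_psi phi y : U y -> push phi (psi y) = phi y.
Proof.
by move=> Uy; rewrite /push asboolT ?(md_psiK md)//; exact: md_psi md _ Uy.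
Qed.

Lemma compact_psi K : compact K -> K `<=` U -> compact (psi @` K) /\ psi @` K `<=` V.
Proof.
move=> cK KU; split; last by move=> _ [y /KU Uy <-]; exact: md_psi md _ Uy.
apply: continuous_compact => //; apply: continuous_in_subspaceT => y; rewrite inE => /KU Uy.
by apply: (psi_continuous md); rewrite inE.
Qed.

Lemma push_test phi : test_function U phi -> test_function V (push phi).
Proof.
move=> [sphi [K [cK KU K0]]]; have [cK' K'V] := compact_psi cK KU.
have K'0 z : ~ (psi @` K) z -> push phi z = 0.
  move=> nK; rewrite /push; case: ifPn => // /asboolP Vz; apply: K0 => Kz; apply: nK.
  by exists (kap z) => //; exact: md_kapK md _ Vz.
split; last by exists (psi @` K).
move=> k; apply: Ck_on_local => z _; have [Vz|nV] := pselect (V z).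
  exists V => //; have C : Ck_on k V (phi \o kap).
    by apply: (Ck_on_comp (md_oV md) (md_oU md) (md_kap md) (fun a => md_skap md a k)); exact: Ck_on_sub (sphi k).
  by apply: (Ck_on_ext (md_oV md) _ C) => y Vy; rewrite /push asboolT.
have oK : open (~` (psi @` K)) := closed_openC (compact_closed_rV cK').
exists (~` (psi @` K)); first by move=> /K'V.
by apply: (Ck_on_ext oK _ (Ck_on_cst k _ 0)) => y /K'0 ->.
Qed.

Lemma partial_push phi mu y : test_function U phi -> U y ->
  partial mu phi y = \sum_a jacmx psi y mu a * partial a (push phi) (psi y).
Proof.
move=> tphi Uy; have [sp _] := push_test tphi.
have [_ E] := partial_comp mu (md_oU md) openT (fun a => md_spsi md a 1) (sp 1%N) Uy I.
rewrite (@partial_ext _ _ U phi (push phi \o psi) mu (md_oU md)) => [|z Uz|//].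
  by rewrite E; apply: eq_bigr => a _; rewrite mxE.
by rewrite /= push_psi.
Qed.

Lemma jacmx_smooth m a : smooth_on U (fun y => jacmx psi y m a).
Proof.
move=> k; have [_ /(_ m)[_ C]] := md_spsi md a k.+1.
by apply: (Ck_on_ext (md_oU md) _ C) => y _; rewrite mxE.
Qed.

Lemma det_jacmx_neq0 y : U y -> \det (jacmx psi y) != 0.
Proof.
move=> Uy; apply: contra_eq_neq (jacmx_mul md Uy) => d0.
apply: contra_eq_neq d0 => /(congr1 determinant) E; apply/eqP => d0; move: E.
by rewrite det_mulmx d0 mul0r det1 => /esym/eqP; rewrite oner_eq0.
Qed.

Lemma abs_det_jacmx_smooth : smooth_on U (fun y => `|\det (jacmx psi y)|).
Proof.
move=> k; apply: (Ck_on_abs (md_oU md) det_jacmx_neq0).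
by apply: (Ck_on_det (md_oU md)) => i j; exact: jacmx_smooth.
Qed.

(** The change of variables gives integrability of [f \o psi] times the Jacobian, whose inverse is
    bounded on compact sets. *)
Lemma loc_int_psi f : Defs.locally_integrable V f -> Defs.locally_integrable U (f \o psi).
Proof.
move=> lf K cK KU; have [cK' K'V] := compact_psi cK KU.
have mK : measurable (K : set T) by exact: measurable_compact.
have mK' : measurable (psi @` K : set T) by exact: measurable_compact.
have mV : measurable (V : set T) by exact: measurable_open (md_oV md).
have mU : measurable (U : set T) by exact: measurable_open (md_oU md).
have i1 : lam.-integrable (V : set T) (EFin \o (fun z => f z * \1_(psi @` K) z)).
  apply: (@supp_integrable _ _ V (psi @` K)) => // [z _ nz|].
    by rewrite indicE memNset ?mulr0.
  rewrite setIidr//; apply: eq_integrable (lf _ cK' K'V) => // z zK /=.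
  by rewrite indicE zK mulr1.
have [i2 _] := change_of_variables_int md i1.
have i3 : lam.-integrable (K : set T) (EFin \o (fun y => f (psi y) * `|\det (jacmx psi y)|)).
  apply: eq_integrable (integrableS mU mK KU i2) => // y; rewrite inE => Ky /=.
  by rewrite indicE mem_set ?mulr1//; exists y.
have Ci : Ck_on 0 U (fun y => `|\det (jacmx psi y)|^-1).
  apply: (Ck_on_inv (md_oU md) _ (abs_det_jacmx_smooth 0)) => y Uy.
  by rewrite normr_eq0 det_jacmx_neq0.
have ci := Ck_on_continuous Ci.
have [M HM] := continuous_bounded (md_oU md) ci cK KU.
have mi : measurable_fun (K : set T) (fun y : T => `|\det (jacmx psi y)|^-1).
  exact: (measurable_continuous (md_oU md) ci).
apply: eq_integrable (integrable_bounded_mul mK i3 mi HM) => // y; rewrite inE => /KU Uy /=.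
by rewrite mulfK// normr_eq0 det_jacmx_neq0.
Qed.

(** The Piola transform of the coordinate field with index [mu]: the vector density on [V] that
    corresponds to it. *)
Definition piola (mu a : 'I_n) (z : X) : R := jacmx psi (kap z) mu a * `|\det (jacmx kap z)|.

End push.

Section weak_pullback.
Variables (U V : set X) (psi kap : X -> X) (r r' : X -> R).
Hypothesis md : meas_diffeo U V psi kap r r'.
Let md' := meas_diffeo_sym md.
Local Notation G := (piola psi kap).
Local Notation psh := (push V kap).

Lemma piola_smooth mu a : smooth_on V (G mu a).
Proof.
move=> k; apply: (Ck_onM (md_oV md)); last exact: abs_det_jacmx_smooth md' k.
exact: (Ck_on_comp (md_oV md) (md_oU md) (md_kap md) (fun b => md_skap md b k) (jacmx_smooth md mu a k)).
Qed.

Lemma piola_psi mu a y : U y -> G mu a (psi y) * `|\det (jacmx psi y)| = jacmx psi y mu a.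
Proof.
move=> Uy; rewrite /piola (md_psiK md)// -mulrA.
have := jacmx_mul md Uy => /(congr1 (fun A => `|\det A|)).
by rewrite det_mulmx normrM det1 normr1 mulrC => ->; rewrite mulr1.
Qed.

(** The divergence of a transported constant field vanishes. Tested against [phi], it becomes by
    change of variables the integral of a partial derivative of [phi \o psi], which is 0; the
    fundamental lemma concludes. *)
Lemma piola_identity mu : ae_in V (fun z => \sum_a partial a (G mu a) z = 0).
Proof.
have mV : measurable (V : set T) by exact: measurable_open (md_oV md).
have mU : measurable (U : set T) by exact: measurable_open (md_oU md).
have w a : weak_partial V a (G mu a) (partial a (G mu a)) := weak_partial_smooth a (md_oV md) (piola_smooth mu a).
have c1 : Ck_on 0 V (fun z => \sum_a partial a (G mu a) z).
  apply: (Ck_on_sum _ (md_oV md)) => a.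
  by have [_ /(_ a)[]] := piola_smooth mu a 1.
apply: (fundamental_lemma (md_oV md)).
  exact: (measurable_continuous (md_oV md) (Ck_on_continuous c1)).
move=> phi tphi.
have i1 a : lam.-integrable (V : set T) (EFin \o (fun z => partial a (G mu a) z * phi z)).
  by case: ((w a).2 _ tphi).
have [i2 e2] := Rintegral_sum (index_enum 'I_n) mV i1.
have E z : (\sum_a partial a (G mu a) z) * phi z = \sum_a partial a (G mu a) z * phi z.
  by rewrite mulr_suml.
split; first by apply: eq_integrable i2 => // z _ /=; rewrite E.
rewrite (Rintegral_ext (fun z _ => E z)) e2.
have i3 a : lam.-integrable (V : set T) (EFin \o (fun z => G mu a z * partial a phi z)).
  exact: test_integrable (test_mul (md_oV md) (test_partial a tphi) (piola_smooth mu a)) mV.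
have [i4 e4] := Rintegral_sum (index_enum 'I_n) mV i3.
transitivity (- \sum_a \int[lam]_(z in (V : set T)) (G mu a z * partial a phi z)).
  rewrite -sumrN; apply: eq_bigr => a _.
  by have [_ ->] := (w a).2 _ tphi; rewrite opprK.
rewrite -e4 -(change_of_variables_int md i4).2.
have tq := push_test md' tphi.
have [_ [K [cK KU K0]]] := test_partial mu tq.
transitivity (- \int[lam]_y partial mu (push U psi phi) y); last by rewrite (integral_partial _ (test_sub (@subsetT _ U) tq)) oppr0.
congr (- _); rewrite [RHS](@supp_integral _ _ setT U) ?setTI//; last by move=> y _ nU; apply: K0 => /KU.
apply: Rintegral_ext => y Uy; rewrite (partial_push md _ tq Uy) mulr_suml.
apply: eq_bigr => a _; rewrite mulrAC piola_psi//; congr (_ * _).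
apply: (@partial_ext _ _ V _ _ a (md_oV md)); last exact: md_psi md _ Uy.
by move=> z Vz; rewrite /push !asboolT ?(md_kapK md)//; exact: md_kap md _ Vz.
Qed.

(** The chain rule by duality: the integral against [phi] on [U] is transported to [V], where the
    weak derivatives of [f] are tested against [G mu a * push phi]. Derivatives that fall on [G]
    drop out by the Piola identity. *)
Lemma weak_pullback (f : X -> R) (h : 'I_n -> X -> R) mu : Defs.locally_integrable V f ->
  (forall a, weak_partial V a f (h a)) ->
  weak_partial U mu (f \o psi) (fun y => \sum_a jacmx psi y mu a * h a (psi y)).
Proof.
move=> lf w.
have oU := md_oU md; have oV := md_oV md.
have mV : measurable (V : set T) by exact: measurable_open oV.
have mU : measurable (U : set T) by exact: measurable_open oU.
split.
  apply: (@measurable_sum _ _ _ _ _ _ (fun a (y : T) => jacmx psi y mu a * h a (psi y))) => a.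
  apply: measurable_funM; last exact: (measurable_fun_psi md (w a).1).
  exact: (measurable_continuous oU (Ck_on_continuous (jacmx_smooth md mu a 0))).
move=> phi tphi; pose q := psh phi; have tq : test_function V q := push_test md tphi.
have tG a : test_function V (fun z => G mu a z * q z) := test_mul oV tq (piola_smooth mu a).
have i1 a : lam.-integrable (V : set T) (EFin \o (fun z => h a z * (G mu a z * q z))).
  by case: ((w a).2 _ (tG a)).
have [i2 e2] := Rintegral_sum (index_enum 'I_n) mV i1.
have [i3 e3] := change_of_variables_int md i2.
have E1 y : U y -> (\sum_a h a (psi y) * (G mu a (psi y) * q (psi y))) * `|\det (jacmx psi y)| =
    (\sum_a jacmx psi y mu a * h a (psi y)) * phi y.
  move=> Uy; rewrite !mulr_suml; apply: eq_bigr => a _.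
  by rewrite -(piola_psi mu a Uy) /q (push_psi md)//; ring.
split; first by apply: eq_integrable i3 => // y; rewrite inE => Uy /=; rewrite -E1.
rewrite -(Rintegral_ext E1) e3 e2.
have j1 a : lam.-integrable (V : set T) (EFin \o (fun z => f z * partial a (fun z => G mu a z * q z) z)).
  exact: (loc_test_integrable oV lf (test_partial a (tG a))).
have [j2 k2] := Rintegral_sum (index_enum 'I_n) mV j1.
transitivity (\sum_a \int[lam]_(z in (V : set T)) (f z * partial a (fun z => G mu a z * q z) z)); last first.
  by rewrite -sumrN; apply: eq_bigr => a _; case: ((w a).2 _ (tG a)).
rewrite -k2.
have l1 a : lam.-integrable (V : set T) (EFin \o (fun z => f z * (G mu a z * partial a q z))).
  exact: (loc_test_integrable oV lf (test_mul oV (test_partial a tq) (piola_smooth mu a))).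
have [l2 _] := Rintegral_sum (index_enum 'I_n) mV l1.
transitivity (\int[lam]_(z in (V : set T)) (\sum_a f z * (G mu a z * partial a q z))); last first.
  have /integrableP[ml2 _] := l2; have /integrableP[mj2 _] := j2.
  rewrite /Rintegral; congr (fine _); apply: (ae_eq_integral _ _ mV ml2 mj2).
  have [N [mN N0 NE]] := ae_in_ae (piola_identity mu).
  exists N; split => // z nz; apply: NE => /= Hz; apply: nz => /= Vz; have {}Hz := Hz Vz.
  congr (_%:E); rewrite -!mulr_sumr; congr (_ * _).
  transitivity (\sum_a (partial a (G mu a) z * q z + G mu a z * partial a q z)).
    by rewrite big_split /= -mulr_suml Hz mul0r add0r.
  apply: eq_bigr => a _; rewrite /partial [RHS]deriveM.
  - by rewrite /GRing.scale /= addrC [q z * _]mulrC.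
  - by have [_ /(_ a)[d _]] := piola_smooth mu a 1; apply: d; rewrite inE.
  - by have [/(_ 1%N)[_ /(_ a)[d _]] _] := tq; apply: d; rewrite inE.
rewrite -(change_of_variables_int md l2).2; apply: Rintegral_ext => y Uy.
rewrite (partial_push md mu tphi Uy) -mulr_sumr /= -mulrA; congr (_ * _).
rewrite mulr_suml; apply: eq_bigr => a _; by rewrite mulrAC piola_psi.
Qed.

End weak_pullback.
End piola.
(** * Rotations and the spin group *)

Section spin_algebra.
Variables (C : numFieldType) (cj : {rmorphism C -> C}) (cjK : involutive cj).
Variables (R : realFieldType) (rc : {rmorphism R -> C}) (cj_rc : forall x, cj (rc x) = rc x).
Hypothesis cj_gt0 : forall x, x != 0 -> 0 < cj x * x.
Variables (n N : nat).
Implicit Types (g : 'I_n -> 'M[C]_N) (A : 'M[R]_n).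
Local Notation adj := (adjmx cj).

Definition clifford g := (forall i, adj (g i) = g i) /\
  forall i j, g i *m g j + g j *m g i = ((i == j)%:R *+ 2)%:M.

Definition cl g (v : 'rV[R]_n) : 'M[C]_N := \sum_i rc (v ord0 i) *: g i.

Definition rot g A (k : 'I_n) : 'M[C]_N := \sum_j rc (A j k) *: g j.

Lemma sum_sqr_scale g (u v : 'I_n -> R) : clifford g ->
  (\sum_i rc (u i) *: g i) *m (\sum_j rc (v j) *: g j) +
  (\sum_j rc (v j) *: g j) *m (\sum_i rc (u i) *: g i) = (rc (\sum_i u i * v i) *+ 2)%:M.
Proof.
move=> [_ acg]; rewrite !mulmx_suml.
under eq_bigr do rewrite mulmx_sumr.
under [X in _ + X]eq_bigr do rewrite mulmx_sumr.
rewrite [X in _ + X]exchange_big -big_split /=.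
transitivity (\sum_i \sum_j (rc (u i * v j) * ((i == j)%:R *+ 2))%:M : 'M[C]_N).
  apply: eq_bigr => i _; rewrite -big_split /=; apply: eq_bigr => j _.
  rewrite -!scalemxAl -!scalemxAr !scalerA -!rmorphM /= [v j * _]mulrC -scalerDr acg.
  by rewrite scale_scalar_mx.
rewrite rmorph_sum -sumrMnl raddf_sum /=; apply: eq_bigr => i _.
rewrite (bigD1 i)//= eqxx big1 ?addr0 => [|j ji]; last by rewrite eq_sym (negbTE ji) mul0rn mulr0 raddf0.
by rewrite mulr_natr.
Qed.

Lemma sum_orth A k l : A^T *m A = 1%:M -> \sum_j A j k * A j l = (k == l)%:R.
Proof.
by move=> /matrixP/(_ k l); rewrite !mxE => <-; apply: eq_bigr => j _; rewrite !mxE.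
Qed.

Lemma rot_clifford g A : clifford g -> A^T *m A = 1%:M -> clifford (rot g A).
Proof.
move=> cg AA; split.
  move=> k; rewrite /rot adjmx_sum; apply: eq_bigr => j _.
  by rewrite adjmxZ cj_rc (cg.1 j).
by move=> k l; rewrite (sum_sqr_scale _ _ cg) (sum_orth _ _ AA); case: eqP => _; rewrite ?rmorph1 ?rmorph0.
Qed.

(** The integrand as a function of the covariant derivatives [p a], [q a] in frame directions. The
    factor of modulus 1 in the Dirac operator is gone; see [integrandE]. *)
Definition quad g (p q : 'I_n -> 'cV[C]_N) : 'M[C]_1 :=
  adj (\sum_a g a *m p a) *m (\sum_a g a *m q a) - \sum_a adj (p a) *m q a.

(** A rotation of the frame together with a unitary intertwiner of the gammas multiplies the Dirac
    term by [U], and preserves both inner products. *)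
Lemma quad_change g g' (U : 'M[C]_N) A p q : adj U *m U = 1%:M -> A^T *m A = 1%:M ->
  (forall k, rot g A k *m U = U *m g' k) ->
  quad g (fun j => \sum_k rc (A j k) *: (U *m p k)) (fun j => \sum_k rc (A j k) *: (U *m q k)) =
  quad g' p q.
Proof.
move=> UU AA H; have E (r : 'I_n -> 'cV[C]_N) : \sum_j g j *m (\sum_k rc (A j k) *: (U *m r k)) =
    U *m \sum_k g' k *m r k.
  under eq_bigr do rewrite mulmx_sumr.
  rewrite exchange_big mulmx_sumr; apply: eq_bigr => k _ /=.
  rewrite [in RHS]mulmxA -H -mulmxA mulmx_suml; apply: eq_bigr => j _.
  by rewrite -scalemxAl -scalemxAr.
rewrite /quad !E adjmxM mulmxA -[adj _ *m adj U *m U]mulmxA UU mulmx1; congr (_ - _).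
under eq_bigr => j _.
  rewrite adjmx_sum mulmx_suml.
  under eq_bigr do rewrite mulmx_sumr.
  over.
rewrite exchange_big /=; apply: eq_bigr => k _; rewrite exchange_big /=.
rewrite (bigD1 k)//= [X in _ + X]big1 ?addr0 => [|l lk].
  under eq_bigr do rewrite adjmxZ cj_rc -scalemxAl -scalemxAr scalerA -rmorphM.
  rewrite -scaler_suml -rmorph_sum /= (sum_orth _ _ AA) eqxx rmorph1 scale1r.
  by rewrite adjmxM mulmxA -[adj _ *m adj U *m U]mulmxA UU mulmx1.
under eq_bigr do rewrite adjmxZ cj_rc -scalemxAl -scalemxAr scalerA -rmorphM.
by rewrite -scaler_suml -rmorph_sum /= (sum_orth _ _ AA) eq_sym (negbTE lk) rmorph0 scale0r.
Qed.

(** The squares of the gammas are 1, so the diagonal terms cancel the second sum. *)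
Lemma quadE g p q : clifford g -> quad g p q = \sum_a \sum_b adj (p a) *m G2 g a b *m q b.
Proof.
move=> [adg acg]; rewrite /quad adjmx_sum mulmx_suml -sumrB; apply: eq_bigr => a _.
rewrite mulmx_sumr adjmxM adg.
transitivity (\sum_b (adj (p a) *m G2 g a b *m q b + (a == b)%:R *: (adj (p a) *m q b)) - adj (p a) *m q a).
  congr (_ - _); apply: eq_bigr => b _.
  rewrite mulmxA -[adj _ *m g a *m g b]mulmxA (G2E acg) mulmxDr mulmxDl addrC; congr (_ + _).
  by rewrite mul_mx_scalar -scalemxAl.
by rewrite big_split /= sum_deltar addrK.
Qed.

(* [gprod s] is a scalar or anticommutes with some generator. *)
Lemma gprod_even_counts g s : clifford g -> (forall i, ~~ odd (count_mem i s)) ->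
  exists k, gprod g s = ((-1) ^+ k)%:M.
Proof.
move=> [_ acg]; have [m] := ubnP (size s); elim: m s => // m IH [|i s] sm H.
  by exists 0%N; rewrite expr0.
have is' : i \in s.
  by rewrite -has_pred1 has_count; have := H i; rewrite /= eqxx; case: (count _ _).
case/splitPr: is' sm H => p q sm H.
have /IH[] : (size (p ++ q) < m)%N by move: sm; rewrite /= !size_cat /= addnS !ltnS => /ltnW.
  move=> j; have := H j; rewrite /= !count_cat /=; case: (i == j) => //=.
  by rewrite !oddD /=; case: (odd _) => //=; case: (odd _).
move=> k E; exists (size p + count_mem i p + k)%N.
rewrite -[_ :: _]/([:: i] ++ p ++ [:: i] ++ q) !gprod_cat gprod1 !mulmxA (gprod_comm acg).
rewrite -!scalemxAl -[_ *m g i *m g i]mulmxA (gg acg) mulmx1 -gprod_cat E.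
by rewrite scale_scalar_mx -exprD.
Qed.

Lemma gprod_dichotomy g s : clifford g -> ~~ odd (size s) ->
  (exists a, g a *m gprod g s = - (gprod g s *m g a)) \/ exists k, gprod g s = ((-1) ^+ k)%:M.
Proof.
move=> cg es; have [/existsP[a oa]|/existsPn H] := boolP [exists a, odd (count_mem a s)].
  left; exists a; rewrite (gprod_comm cg.2) -signr_odd oddD (negbTE es) oa /=.
  by rewrite expr1 scaleN1r.
by right; apply: gprod_even_counts => // i; exact: H.
Qed.

(** Conjugation by [g a] fixes [Y] and negates [m]. *)
Lemma tr_anticomm g (Y m : 'M[C]_N) a : clifford g -> Y *m g a = g a *m Y ->
  g a *m m = - (m *m g a) -> \tr (Y *m m) = 0.
Proof.
move=> [_ acg] Yg gm; apply/eqP; rewrite -eqNr; apply/eqP.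
rewrite -{2}[m]mulmx1 -(gg acg a) (mulmxA m) (mulmxA Y) -[m *m g a]opprK -gm.
rewrite mulmxN mulNmx linearN /=; congr (- _).
by rewrite [RHS]mxtrace_mulC !mulmxA -Yg -(mulmxA Y) (gg acg) mulmx1.
Qed.

Lemma tr_gprod_comm g Y s : clifford g -> (forall a, Y *m g a = g a *m Y) -> \tr Y = 0 ->
  ~~ odd (size s) -> \tr (Y *m gprod g s) = 0.
Proof.
move=> cg Yg Y0 /(gprod_dichotomy cg)[[a gs]|[k ->]]; first exact: tr_anticomm cg (Yg a) gs.
by rewrite mul_mx_scalar mxtraceZ Y0 mulr0.
Qed.

Lemma tr_gprod_real g s : clifford g -> ~~ odd (size s) -> cj (\tr (gprod g s)) = \tr (gprod g s).
Proof.
move=> cg /(gprod_dichotomy cg)[[a gs]|[k ->]].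
  by rewrite -[gprod g s]mul1mx (tr_anticomm cg _ gs) ?rmorph0// mul1mx mulmx1.
by rewrite mxtrace_scalar rmorphMn rmorphXn rmorphN1.
Qed.

(** Even products of vectors lie in the real span of even products of generators. The induction
    carries a prefix [s] of factors already expanded. *)
Lemma even_cl_ind g (P : 'M[C]_N -> Prop) : P 0 ->
  (forall m p, P m -> P p -> P (m + p)) -> (forall x m, P m -> P (rc x *: m)) ->
  (forall s, ~~ odd (size s) -> P (gprod g s)) ->
  forall vs : seq 'rV[R]_n, ~~ odd (size vs) -> P (\prod_(v <- vs) cl g v).
Proof.
move=> P0 PD PZ Ps vs evs.
suff H s : ~~ odd (size s + size vs) -> P (gprod g s *m \prod_(v <- vs) cl g v).
  by have := H [::] evs; rewrite /= mul1mx.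
elim: vs s {evs} => [|v vs IH] s /=; first by rewrite addn0 big_nil => /Ps; rewrite -[1]/(1%:M) mulmx1.
rewrite addnS => es; rewrite big_cons -mulmxE mulmxA /cl mulmx_sumr mulmx_suml.
have PS (I : Type) (r : seq I) F : (forall i, P (F i)) -> P (\sum_(i <- r) F i).
  by move=> PF; elim/big_ind : _.
apply: (PS) => i; rewrite -scalemxAr -scalemxAl; apply: PZ.
by rewrite -(gprod1 g) -gprod_cat; apply: IH; rewrite size_cat addn1 addSn.
Qed.

(* The derivative of a curve in Spin(n) is determined by the derivative of the *)
(* curve in SO(n) it covers; [T] is [s^-1 ds] and [B] is [A^-1 dA].            *)
Lemma spin_rigidity g (T : 'M[C]_N) (B : 'I_n -> 'I_n -> R) : clifford g ->
  (forall a b, B a b = - B b a) -> adj T = - T ->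
  (forall j, T *m g j - g j *m T = \sum_k rc (B k j) *: g k) ->
  cj (\tr T) = \tr T ->
  (forall Y, (forall j, Y *m g j = g j *m Y) -> \tr Y = 0 -> \tr (Y *m T) = 0) ->
  T = 4^-1 *: \sum_a \sum_b rc (B a b) *: (g a *m g b).
Proof.
move=> cg BN Tskew Tg Treal TY; have [adg acg] := cg.
pose om a b (c : 'I_n) := rc (B a b).
have omN a b c : om a b c = - om b a c by rewrite /om BN rmorphN.
set W := 4^-1 *: _; have WE c : Om g om c = W by [].
(* [X] commutes with all generators and has trace 0. In place of Schur's lemma: [TY] and the same
   property of [W], with [Y = X], give trace 0 for [X *m X]; as [X] is skew-adjoint, its
   Hilbert-Schmidt norm vanishes. *)
pose X := T - W.
have gj j : W *m g j - g j *m W = \sum_k rc (B k j) *: g k.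
  by rewrite -(WE j) (Om_g acg).
have XE j : X *m g j = g j *m X.
  have E : X *m g j - g j *m X = (T *m g j - g j *m T) - (W *m g j - g j *m W).
    by rewrite /X mulmxBl mulmxBr !opprB addrACA [X in _ + X]addrC addrACA.
  by apply/eqP; rewrite -subr_eq0 E Tg gj subrr.
have trT : \tr T = 0.
  by have := Treal; rewrite -tr_adjmx Tskew linearN /= => /eqP; rewrite eqNr => /eqP.
have trW Y : (forall j, Y *m g j = g j *m Y) -> (Y = 1%:M \/ \tr Y = 0) -> \tr (Y *m W) = 0.
  move=> Yg HY; rewrite /W -scalemxAr mxtraceZ mulmx_sumr raddf_sum /= big1 ?mulr0// => a _.
  rewrite mulmx_sumr raddf_sum /= big1// => b _; rewrite -scalemxAr mxtraceZ.
  have [<-|ab] := eqVneq a b.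
    suff -> : B a a = 0 by rewrite rmorph0 mul0r.
    by apply/eqP; rewrite -eqNr -BN.
  rewrite (_ : g a *m g b = G2 g a b); last by rewrite (G2E acg) (negbTE ab) raddf0 add0r.
  case: HY => [->|Y0]; first by rewrite mul1mx (tr_G2 acg) mulr0.
  by rewrite /G2 (negbTE ab) (tr_gprod_comm cg)// mulr0.
have trX : \tr X = 0.
  rewrite /X linearB /= trT sub0r -[W]mul1mx trW ?oppr0//; last by left.
  by move=> j; rewrite mul1mx mulmx1.
have XX : \tr (adj X *m X) = 0.
  have -> : adj X = - X.
    rewrite /X adjmxD adjmxN Tskew opprB addrC; congr (_ - _).
    rewrite /W adjmxZ fmorphV rmorph_nat -scalerN; congr (_ *: _).
    rewrite adjmx_sum -sumrN exchange_big /=; apply: eq_bigr => a _.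
    rewrite adjmx_sum -sumrN; apply: eq_bigr => b _.
    by rewrite adjmxZ cj_rc adjmxM !adg BN rmorphN scaleNr opprK.
  rewrite mulNmx linearN /= {2}/X mulmxBr linearB /= TY// trW ?subrr ?oppr0//; by right.
apply/eqP; rewrite -subr_eq0; apply/eqP/matrixP => i j; rewrite [RHS]mxE.
have [//|Xij] := eqVneq (X i j) 0.
suff : 0 < \tr (adj X *m X) by rewrite XX ltxx.
have P k l : 0 <= adj X k l * X l k.
  have -> : adj X k l = cj (X l k) by rewrite [LHS]mxE [X^T _ _]mxE.
  by have [->|/cj_gt0/ltW//] := eqVneq (X l k) 0; rewrite mulr0.
rewrite /mxtrace (bigD1 j)//= ltr_pwDl//; last by apply: sumr_ge0 => k _; rewrite mxE sumr_ge0.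
rewrite mxE (bigD1 i)//= ltr_pwDl//; last by apply: sumr_ge0 => k _.
have -> : adj X j i = cj (X i j) by rewrite [LHS]mxE [X^T _ _]mxE.
exact: cj_gt0.
Qed.

Lemma cl_sqr g (v : 'rV[R]_n) : clifford g -> v *m v^T = 1%:M -> cl g v *m cl g v = 1%:M.
Proof.
move=> cg vv; have := sum_sqr_scale (v ord0) (v ord0) cg.
have -> : \sum_i v ord0 i * v ord0 i = 1.
  have := vv => /matrixP/(_ ord0 ord0); rewrite !mxE eqxx => H.
  by apply: etrans H; apply: eq_bigr => i _; rewrite mxE.
rewrite -/(cl g v) rmorph1 => E.
apply: (@scalerI _ _ 2); first by rewrite pnatr_eq0.
by rewrite scale_scalar_mx mulr1 scaler_nat mulr2n; exact: E.
Qed.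

Lemma adj_cl g v : clifford g -> adj (cl g v) = cl g v.
Proof.
move=> [adg _]; rewrite /cl adjmx_sum; apply: eq_bigr => i _.
by rewrite adjmxZ cj_rc adg.
Qed.

Lemma adj_cl_prod g vs : clifford g -> adj (\prod_(v <- vs) cl g v) = \prod_(v <- rev vs) cl g v.
Proof.
move=> cg; elim: vs => [|v vs IH]; first by rewrite !big_nil -[1]/(1%:M) adjmx1.
rewrite big_cons rev_cons -cats1 big_cat big_seq1 -!mulmxE adjmxM IH.
by rewrite adj_cl.
Qed.

Lemma cl_prod_unitary g vs : clifford g -> (forall v, v \in vs -> v *m v^T = 1%:M) ->
  adj (\prod_(v <- vs) cl g v) *m \prod_(v <- vs) cl g v = 1%:M.
Proof.
move=> cg; elim: vs => [|v vs IH] H; first by rewrite !big_nil -[1]/(1%:M) adjmx1 mulmx1.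
rewrite big_cons -!mulmxE adjmxM adj_cl// mulmxA -[_ *m cl g v *m cl g v]mulmxA.
rewrite cl_sqr// ?mulmx1 ?IH// => [u uv|]; first by apply: H; rewrite in_cons uv orbT.
by apply: H; rewrite mem_head.
Qed.

(** Conjugation by the unit vector [v] in the Clifford algebra: the negative of the reflection in
    the hyperplane orthogonal to [v]. *)
Definition refl (v : 'rV[R]_n) : 'M[R]_n := 2 *: (v^T *m v) - 1%:M.

Lemma refl_sqr v : v *m v^T = 1%:M -> refl v *m (refl v)^T = 1%:M.
Proof.
move=> vv; have -> : (refl v)^T = refl v.
  by rewrite /refl linearB /= linearZ /= trmx_mul trmxK trmx1.
rewrite /refl mulmxBl !mulmxBr -scalemxAl -scalemxAr mulmxA -[v^T *m v *m v^T]mulmxA vv !mulmx1 mul1mx.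
by rewrite scalerA; apply/matrixP => i j; rewrite !mxE; ring.
Qed.

(** Sylvester's identity det (1 - a b) = det (1 - b a), from two triangular factorizations of one
    block matrix. The smaller determinant is 1 - 2 = -1, and the overall sign of [refl] contributes
    [(-1) ^+ n]. *)
Lemma det_refl v : v *m v^T = 1%:M -> \det (refl v) = (-1) ^+ n.+1.
Proof.
move=> vv; have -> : refl v = - (1%:M - (2 *: v^T) *m v) by rewrite /refl opprB scalemxAl.
rewrite -scaleN1r detZ exprSr; congr (_ * _).
have E1 : block_mx 1%:M (2 *: v^T) v 1%:M =
    block_mx (1%:M - (2 *: v^T) *m v) (2 *: v^T) 0 1%:M *m block_mx 1%:M 0 v 1%:M.
  by rewrite mulmx_block !mulmx1 !mul0mx !mulmx0 !add0r addrNK// mul1mx.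
have E2 : block_mx 1%:M (2 *: v^T) v 1%:M =
    block_mx 1%:M 0 v 1%:M *m block_mx 1%:M (2 *: v^T) 0 (1%:M - v *m (2 *: v^T)).
  by rewrite mulmx_block !mulmx1 !mul1mx !mul0mx ?mulmx0 !addr0 addrC subrK.
have := congr1 determinant E1; rewrite E2 !det_mulmx !det_ublock !det_lblock !det1 !mulr1 !mul1r => <-.
rewrite -scalemxAr vv (_ : 1%:M - _ = (-1)%:M); first by rewrite det_scalar1.
by apply/matrixP => i j; rewrite !mxE !ord1 eqxx; ring.
Qed.

(** One factor [refl v] for each vector; for an even number of vectors the determinant is 1. *)
Lemma cl_prod_rot g vs : clifford g -> (forall v, v \in vs -> v *m v^T = 1%:M) ->
  exists A, [/\ A *m A^T = 1%:M, \det A = (-1) ^+ (n.+1 * size vs) &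
    forall j, \prod_(v <- vs) cl g v *m g j = rot g A j *m \prod_(v <- vs) cl g v].
Proof.
move=> cg; elim: vs => [|v vs IH] H.
  exists 1%:M; split; rewrite ?trmx1 ?mulmx1 ?det1 ?muln0//.
  move=> j; rewrite big_nil -[1]/(1%:M) mul1mx mulmx1 /rot (bigD1 j)//= mxE eqxx rmorph1 scale1r.
  by rewrite big1 ?addr0// => i ij; rewrite mxE (negbTE ij) rmorph0 scale0r.
have vv : v *m v^T = 1%:M by apply: H; rewrite mem_head.
have [|A [AA dA HA]] := IH; first by move=> u uv; apply: H; rewrite in_cons uv orbT.
have Hv j : cl g v *m g j = rot g (refl v) j *m cl g v.
  have := sum_sqr_scale (v ord0) (fun k => (k == j)%:R) cg.
  have -> : \sum_j0 rc (j0 == j)%:R *: g j0 = g j.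
    rewrite (bigD1 j)//= eqxx rmorph1 scale1r big1 ?addr0// => i ij.
    by rewrite (negbTE ij) rmorph0 scale0r.
  have -> : \sum_i v ord0 i * (i == j)%:R = v ord0 j.
    rewrite (bigD1 j)//= eqxx mulr1 big1 ?addr0// => i ij.
    by rewrite (negbTE ij) mulr0.
  rewrite -/(cl g v) => /eqP; rewrite -subr_eq0 -addrA addr_eq0 => /eqP ->.
  have -> : rot g (refl v) j = (rc (v ord0 j) *+ 2) *: cl g v - g j.
    rewrite /rot /cl scaler_sumr.
    under eq_bigr do rewrite !mxE big_ord1 !mxE rmorphB scalerBl.
    rewrite sumrB; congr (_ - _); last first.
      rewrite (bigD1 j)//= eqxx rmorph1 scale1r big1 ?addr0// => i ij.
      by rewrite (negbTE ij) rmorph0 scale0r.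
    apply: eq_bigr => i _; rewrite scalerA -rmorphMn -rmorphM; congr (rc _ *: _); ring.
  by rewrite mulmxBl -scalemxAl cl_sqr// opprB scalemx1.
exists (refl v *m A); split.
- by rewrite trmx_mul mulmxA -[_ *m A *m A^T]mulmxA AA mulmx1 refl_sqr.
- by rewrite det_mulmx dA det_refl// -exprD mulnS.
move=> j; rewrite big_cons -mulmxE -mulmxA HA mulmxA /rot mulmx_sumr !mulmxA; congr (_ *m _).
transitivity (\sum_i rc (A i j) *: (rot g (refl v) i *m cl g v)).
  by apply: eq_bigr => i _; rewrite -scalemxAr Hv.
under eq_bigr do rewrite scalemxAl; rewrite -mulmx_suml; congr (_ *m _).
rewrite /rot; under eq_bigr do rewrite scaler_sumr.
rewrite exchange_big /=; apply: eq_bigr => k _.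
rewrite mxE rmorph_sum scaler_suml; apply: eq_bigr => i _.
by rewrite scalerA -rmorphM mulrC.
Qed.

End spin_algebra.
(** * Manifolds and principal bundles *)

(* vector.v hides [coord]. *)
Import Defs.

Section charts.
Variables (R : realType) (n : nat) (M : manifold R n).
Implicit Types (c d : chart R n M) (V W : set M) (x : M).
Local Notation X := 'rV[R]_n.

Lemma dom_open c : open (dom c). Proof. by case: c. Qed.
Lemma coord_dom_open c : open (coord c @` dom c). Proof. by case: c. Qed.
Lemma coordK c : {in dom c, cancel (coord c) (icoord c)}. Proof. by case: c. Qed.
Lemma coord_cont c : {in dom c, continuous (coord c)}. Proof. by case: c. Qed.
Lemma icoord_cont c : {in coord c @` dom c, continuous (icoord c)}. Proof. by case: c. Qed.

Lemma icoordK c x : dom c x -> icoord c (coord c x) = x.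
Proof. by move=> dx; apply: coordK; rewrite inE. Qed.

Lemma manifold_hausdorff : hausdorff_space M. Proof. by case: M. Qed.
Lemma atlas_cover x : exists2 c, atlas c & dom c x. Proof. by case: M x. Qed.
Lemma atlas_compatible c d : atlas c -> atlas d -> compatible c d. Proof. by case: M c d. Qed.

Lemma coord_image c V y : V `<=` dom c -> (coord c @` V) y -> V (icoord c y) /\ coord c (icoord c y) = y.
Proof. by move=> Vc [x Vx <-]; rewrite icoordK//; exact: Vc. Qed.

Lemma icoord_preimage c V : V `<=` dom c -> coord c @` V = coord c @` dom c `&` icoord c @^-1` V.
Proof.
move=> Vc; apply/seteqP; split => y.
  by move=> [x Vx <-]; split; [exists x => //; exact: Vc|rewrite /= icoordK//; exact: Vc].
by move=> [[x dx <-] /=]; rewrite icoordK// => Vx; exists x.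
Qed.

Lemma coord_open c V : open V -> V `<=` dom c -> open (coord c @` V).
Proof.
move=> oV Vc; rewrite (icoord_preimage Vc) openE => y [dy Vy]; rewrite /interior.
apply: filterI; first by apply: open_nbhs_nbhs; split => //; exact: coord_dom_open.
have ciy : {for y, continuous (icoord c)} by apply: icoord_cont; rewrite inE.
by apply: ciy; exact: open_nbhs_nbhs.
Qed.

Lemma coord_compact c K : compact K -> K `<=` dom c -> compact (coord c @` K).
Proof.
move=> cK Kc; apply: continuous_compact => //; apply: continuous_in_subspaceT => x.
by rewrite inE => /Kc dx; apply: coord_cont; rewrite inE.
Qed.

Lemma compact_icoord c K : compact K -> K `<=` coord c @` dom c -> compact (icoord c @` K).
Proof.
move=> cK Kc; apply: continuous_compact => //; apply: continuous_in_subspaceT => x.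
by rewrite inE => /Kc dx; apply: icoord_cont; rewrite inE.
Qed.

Lemma open_icoord c (U : set X) : open U -> U `<=` coord c @` dom c ->
  open (icoord c @` U) /\ icoord c @` U `<=` dom c.
Proof.
move=> oU Uc; have sub : icoord c @` U `<=` dom c.
  by move=> _ [y /Uc[x dx <-] <-]; rewrite icoordK.
split => //; rewrite openE => _ [y Uy <-]; rewrite /interior.
have [x dx E] := Uc _ Uy; rewrite -E icoordK//.
have : nbhs x (dom c `&` coord c @^-1` U).
  apply: filterI; first by apply: open_nbhs_nbhs; split => //; exact: dom_open.
  have cx : {for x, continuous (coord c)} by apply: coord_cont; rewrite inE.
  by apply: cx; apply: open_nbhs_nbhs; split => //; rewrite E.
by apply: filterS => z [dz Uz]; exists (coord c z) => //; rewrite icoordK.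
Qed.

Definition trans c d : X -> X := coord d \o icoord c.

Lemma trans_smooth c d V a : atlas c -> atlas d -> V `<=` dom c `&` dom d ->
  smooth_on (coord c @` V) (fun y => trans c d y ord0 a).
Proof.
move=> ac ad Vcd k; have [H _] := atlas_compatible ac ad.
by apply: Ck_on_sub (H a k); exact: image_subset.
Qed.

Lemma trans_image c d V y : V `<=` dom c `&` dom d -> (coord c @` V) y -> (coord d @` V) (trans c d y).
Proof.
by move=> Vcd [x Vx <-]; exists x => //; rewrite /trans /= icoordK//; have [] := Vcd _ Vx.
Qed.

Lemma transK c d V y : V `<=` dom c `&` dom d -> (coord c @` V) y -> trans d c (trans c d y) = y.
Proof. by move=> Vcd [x Vx <-]; have [cx dx] := Vcd _ Vx; rewrite /trans /= !icoordK. Qed.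

Lemma jacE c d x : atlas c -> atlas d -> dom c x -> dom d x ->
  jac c d x = jacmx (trans c d) (coord c x).
Proof.
move=> ac ad cx dx; pose V := dom c `&` dom d.
have oV : open V by apply: openI; exact: dom_open.
have oU : open (coord c @` V) by apply: coord_open => // y [].
have Uy : (coord c @` V) (coord c x) by exists x.
have sp a : smooth_on (coord c @` V) (fun y => trans c d y ord0 a) by exact: trans_smooth.
have dpsi_a a : differentiable (fun z => trans c d z ord0 a) (coord c x) :=
  Ck_on_differentiable oU (sp a 1%N) Uy.
have psiE : trans c d = fun z => \sum_a trans c d z ord0 a *: (delta_mx ord0 a : X).
  by apply/funext => z; rewrite {1}[trans c d z]row_sum_delta.
have dpsi : differentiable (trans c d) (coord c x).
  by rewrite psiE -fct_sumE; apply: differentiable_sum => a; exact: differentiableZl.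
apply/matrixP => m a; rewrite [RHS]mxE.
have -> : jac c d x m a = ((delta_mx ord0 m : X) *m jac c d x) ord0 a.
  by rewrite -rowE [RHS]mxE.
rewrite /jac -deriveEjacobian// /partial.
have dy : derivable (trans c d) (coord c x) (delta_mx ord0 m) by exact: diff_derivable.
by rewrite (derive_mx dy) mxE.
Qed.

Lemma smooth_fun_sub V W (f : M -> R) : W `<=` V -> smooth_fun V f -> smooth_fun W f.
Proof.
move=> WV sf c ac k; apply: Ck_on_sub (sf c ac k); apply: image_subset.
exact: setSI.
Qed.

Lemma coordI_open c V : open V -> open (coord c @` (V `&` dom c)).
Proof. by move=> oV; apply: coord_open => [|x []//]; apply: openI => //; exact: dom_open. Qed.

Lemma smooth_fun_local V (f : M -> R) :
  (forall x, V x -> exists W, [/\ open W, W x & smooth_fun (V `&` W) f]) -> smooth_fun V f.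
Proof.
move=> loc c ac k; apply: Ck_on_local => _ [x [Vx cx] <-].
have [W [oW Wx sf]] := loc _ Vx.
exists (coord c @` (V `&` W `&` dom c)); first by exists x.
exact: sf.
Qed.

Lemma smooth_fun_ext V (f h : M -> R) : open V -> (forall x, V x -> f x = h x) ->
  smooth_fun V f -> smooth_fun V h.
Proof.
move=> oV fh sf c ac k.
have E y : (coord c @` (V `&` dom c)) y -> (f \o icoord c) y = (h \o icoord c) y.
  by move=> [x [Vx cx] <-] /=; rewrite icoordK// fh.
exact: (Ck_on_ext (coordI_open oV) E (sf c ac k)).
Qed.

Lemma smooth_fun_cst V (a : R) : smooth_fun V (cst a).
Proof. by move=> c ac k; exact: Ck_on_cst. Qed.

Lemma smooth_funD V f h : open V -> smooth_fun V f -> smooth_fun V h ->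
  smooth_fun V (fun x => f x + h x : R).
Proof. by move=> oV sf sh c ac k; exact: (Ck_onD (coordI_open oV) (sf c ac k) (sh c ac k)). Qed.

Lemma smooth_funM V f h : open V -> smooth_fun V f -> smooth_fun V h ->
  smooth_fun V (fun x => f x * h x : R).
Proof. by move=> oV sf sh c ac k; exact: (Ck_onM (coordI_open oV) (sf c ac k) (sh c ac k)). Qed.

Lemma smooth_funN V f : open V -> smooth_fun V f -> smooth_fun V (fun x => - f x : R).
Proof. by move=> oV sf c ac k; exact: (Ck_onN (coordI_open oV) (sf c ac k)). Qed.

Lemma smooth_fun_sum V (I : Type) (r : seq I) (F : I -> M -> R) : open V ->
  (forall i, smooth_fun V (F i)) -> smooth_fun V (fun x => \sum_(i <- r) F i x).
Proof. by move=> oV sF c ac k; exact: (Ck_on_sum r (coordI_open oV) (fun i => sF i c ac k)). Qed.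

(** Transition maps are smooth, so it suffices to check a single chart. *)
Lemma smooth_fun_chart c V (f : M -> R) : atlas c -> open V -> V `<=` dom c ->
  smooth_on (coord c @` V) (f \o icoord c) -> smooth_fun V f.
Proof.
move=> ac oV Vc sf d ad k; pose W := V `&` dom d.
have oW : open W by apply: openI => //; exact: dom_open.
have Wcd : W `<=` dom d `&` dom c by move=> x [/Vc cx dx].
have oU : open (coord d @` W) by apply: coord_open => // x [].
have C : Ck_on k (coord d @` W) ((f \o icoord c) \o trans d c).
  apply: (Ck_on_comp oU (coord_open oV Vc)) (sf k) => [y Wy|a].
    by have [x [Vx _] E] := trans_image Wcd Wy; exists x.
  exact: trans_smooth.
apply: (Ck_on_ext oU _ C) => _ [x [Vx dx] <-] /=.
by rewrite /trans /= !icoordK//; exact: Vc.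
Qed.

Lemma smooth_fun_cont V (f : M -> R) : open V -> smooth_fun V f -> {in V, continuous f}.
Proof.
move=> oV sf x; rewrite inE => Vx; have [c ac cx] := atlas_cover x.
have [cf _] := sf c ac 0%N.
have cfx : {for coord c x, continuous (f \o icoord c)}.
  by apply: cf; rewrite inE; exists x.
have cc : {for x, continuous (coord c)} by apply: coord_cont; rewrite inE.
have : {for x, continuous ((f \o icoord c) \o coord c)} by exact: continuous_comp.
rewrite /prop_for /continuous_at /= icoordK//; apply: cvg_trans.
apply: near_eq_cvg; near=> y; rewrite /= icoordK//.
by near: y; apply: open_nbhs_nbhs; split => //; exact: dom_open.
Unshelve. all: by end_near. Qed.

Lemma null_set_sub V W : V `<=` W -> null_set W -> null_set V.
Proof.
by move=> VW W0 c ac; apply: null_subset (W0 c ac); apply: image_subset; exact: setSI.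
Qed.

Lemma null_set_union V W : null_set V -> null_set W -> null_set (V `|` W).
Proof.
move=> V0 W0 c ac; rewrite setIUl image_setU.
by have := null_setU (V0 c ac) (W0 c ac).
Qed.

Lemma ae_on_sub V W P : W `<=` V -> ae_on V P -> ae_on W P.
Proof. by move=> WV; apply: null_set_sub => x [/WV Vx nP]. Qed.

Lemma ae_on_impl V (P Q : M -> Prop) : (forall x, V x -> P x -> Q x) -> ae_on V P -> ae_on V Q.
Proof. by move=> PQ; apply: null_set_sub => x [Vx nQ]; split => // /(PQ _ Vx). Qed.

End charts.
Section bundles.
Variables (R : realType) (n : nat) (M : manifold R n).
Variables (K : pzRingType) (m : nat) (G : set 'M[K]_m) (sK : set M -> (M -> K) -> Prop).
Variable P : principal_bundle G sK.
Implicit Types (p q : P) (V W : set M) (s : M -> P) (Vs : set M * (M -> P)).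

Lemma act_proj p g : G g -> proj (act p g) = proj p. Proof. by case: P p => ? ? ? ? H ? ? ? ? ? ? p; exact: H. Qed.
Lemma actM p g h : G g -> G h -> act (act p g) h = act p (g *m h).
Proof. by case: P p => ? ? ? ? ? ? H ? ? ? ? p; exact: H. Qed.
Lemma act_unique p q : proj p = proj q -> exists! g, G g /\ q = act p g.
Proof. by case: P p q => ? ? ? ? ? ? ? H ? ? ? p q; exact: H. Qed.
Lemma triv_open Vs : triv Vs -> open Vs.1 /\ forall x, Vs.1 x -> proj (Vs.2 x) = x.
Proof. by case: P Vs => ? ? ? ? ? ? ? ? H ? ? Vs; exact: H. Qed.
Lemma triv_cover (x : M) : exists2 Vs : set M * (M -> P), triv Vs & Vs.1 x.
Proof. by case: P => ? ? ? ? ? ? ? ? ? H *; exact: H. Qed.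
Lemma triv_trans (Vs Ws : set M * (M -> P)) : triv Vs -> triv Ws ->
  exists g : M -> 'M[K]_m,
    (forall x, Vs.1 x -> Ws.1 x -> G (g x) /\ Ws.2 x = act (Vs.2 x) (g x)) /\
    forall i j, sK (Vs.1 `&` Ws.1) (fun x => g x i j).
Proof. by case: P Vs Ws => ? ? ? ? ? ? ? ? ? ? H Vs Ws; exact: H. Qed.

Hypothesis sK_sub : forall V W f, W `<=` V -> sK V f -> sK W f.

Lemma section_sub V W s : open W -> W `<=` V -> smooth_section V s -> smooth_section W s.
Proof.
move=> oW WV [oV pV H]; split => // [x /WV|Ws tW]; first exact: pV.
have [g [Hg sg]] := H _ tW; exists g; split => [x /WV|i j]; first exact: Hg.
by apply: sK_sub (sg i j); exact: setSI.
Qed.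

Lemma triv_section Vs : triv Vs -> smooth_section Vs.1 Vs.2.
Proof.
move=> tV; have [oV pV] := triv_open tV; split => // Ws tW.
have [g [Hg sg]] := triv_trans tW tV; exists g; split => [x Vx Wx|i j]; first exact: Hg.
by apply: sK_sub (sg i j); rewrite setIC.
Qed.

Lemma local_section (U : set M) (x : M) : open U -> U x ->
  exists W (s : M -> P), [/\ open W, W x, W `<=` U & smooth_section W s].
Proof.
move=> oU Ux; have [Vs tV Vx] := triv_cover x; have [oV _] := triv_open tV.
have oW : open (U `&` Vs.1) by exact: openI.
exists (U `&` Vs.1), Vs.2; split => //; apply: (section_sub oW _ (triv_section tV)).
exact: subIsetr.
Qed.

Variable inv : 'M[K]_m -> 'M[K]_m.
Hypothesis invG : forall g, G g -> inv g *m g = 1%:M.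
Hypothesis GM : forall g h, G g -> G h -> G (g *m h).
Hypothesis sK_local : forall V f,
  (forall x, V x -> exists W, [/\ open W, W x & sK (V `&` W) f]) -> sK V f.
Hypothesis sK_ext : forall V f h, open V -> (forall x, V x -> f x = h x) -> sK V f -> sK V h.
Hypothesis sK_div : forall V (g h : M -> 'M[K]_m), open V ->
  (forall i j, sK V (fun x => g x i j)) -> (forall i j, sK V (fun x => h x i j)) ->
  forall i j, sK V (fun x => (inv (g x) *m h x) i j).

(** Against a common local trivialization the sections are given by smooth [g] and [g'], and
    freeness of the action forces their quotient to be the comparison map. Used for SO(n) and
    Spin(n), with transpose and adjoint as inverse. *)
Lemma compare_sections V V' s s' : smooth_section V s -> smooth_section V' s' ->
  exists A : M -> 'M[K]_m,
    (forall x, V x -> V' x -> G (A x) /\ s' x = act (s x) (A x)) /\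
    forall i j, sK (V `&` V') (fun x => A x i j).
Proof.
move=> [oV pV Hs] [oV' pV' Hs'].
have /choice[A HA] : forall x, exists A, V x -> V' x -> G A /\ s' x = act (s x) A.
  move=> x; have [Vx|nV] := pselect (V x); last by exists 0.
  have [V'x|nV'] := pselect (V' x); last by exists 0.
  have [|A [HA _]] := @act_unique (s x) (s' x); first by rewrite pV// pV'.
  by exists A.
exists A; split => // i j; apply: sK_local => x [Vx V'x].
have [Ws tW Wx] := triv_cover x; have [oW pW] := triv_open tW.
exists Ws.1; split => //; set U := V `&` V' `&` Ws.1.
have oU : open U by apply: openI => //; exact: openI.
have [g [Hg sg]] := Hs _ tW; have [g' [Hg' sg']] := Hs' _ tW.
have s1 k l : sK U (fun x => g x k l) by apply: sK_sub (sg k l) => y [[]].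
have s2 k l : sK U (fun x => g' x k l) by apply: sK_sub (sg' k l) => y [[]].
apply: (sK_ext oU _ (sK_div oU s1 s2 i j)) => y [[Vy V'y] Wy].
have [Gg E] := Hg _ Vy Wy; have [Gg' E'] := Hg' _ V'y Wy; have [GA EA] := HA _ Vy V'y.
have [|h [_ hU]] := @act_unique (Ws.2 y) (s' y); first by rewrite pW// pV'.
have h1 : h = g' y by apply: hU.
have h2 : h = g y *m A y by apply: hU; split; [exact: GM|rewrite EA E actM].
by rewrite -h1 h2 mulmxA invG// mul1mx.
Qed.

End bundles.

Section smooth_complex.
Variables (R : realType) (n : nat) (M : manifold R n).
Implicit Types (V W : set M) (f h : M -> R[i]).

Lemma smooth_cfun_sub V W f : W `<=` V -> smooth_cfun V f -> smooth_cfun W f.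
Proof. by move=> WV [s1 s2]; split; apply: smooth_fun_sub WV _. Qed.

Lemma smooth_cfun_local V f :
  (forall x, V x -> exists W, [/\ open W, W x & smooth_cfun (V `&` W) f]) -> smooth_cfun V f.
Proof.
by move=> H; split; apply: smooth_fun_local => x /H[W [oW Wx []]]; exists W.
Qed.

Lemma smooth_cfun_ext V f h : open V -> (forall x, V x -> f x = h x) ->
  smooth_cfun V f -> smooth_cfun V h.
Proof.
by move=> oV fh [s1 s2]; split; [apply: smooth_fun_ext s1|apply: smooth_fun_ext s2] => // x Vx /=; rewrite fh.
Qed.

Lemma smooth_cfun_cst V (a : R[i]) : smooth_cfun V (cst a).
Proof. by split; exact: smooth_fun_cst. Qed.

Lemma smooth_cfun_real V (f : M -> R) : smooth_fun V f -> smooth_cfun V (fun x => real_complex R (f x)).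
Proof. by move=> sf; split => //; exact: smooth_fun_cst. Qed.

Lemma smooth_cfun_conj V f : open V -> smooth_cfun V f -> smooth_cfun V (fun x => conjc (f x)).
Proof.
move=> oV [s1 s2]; split; first by apply: (smooth_fun_ext oV _ s1) => x _ /=; case: (f x).
by apply: (smooth_fun_ext oV _ (smooth_funN oV s2)) => x _ /=; case: (f x).
Qed.

Lemma smooth_cfunD V f h : open V -> smooth_cfun V f -> smooth_cfun V h ->
  smooth_cfun V (fun x => f x + h x).
Proof.
move=> oV [f1 f2] [h1 h2]; split.
  by apply: (smooth_fun_ext oV _ (smooth_funD oV f1 h1)) => x _ /=; case: (f x) (h x) => ? ? [].
by apply: (smooth_fun_ext oV _ (smooth_funD oV f2 h2)) => x _ /=; case: (f x) (h x) => ? ? [].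
Qed.

Lemma smooth_cfunM V f h : open V -> smooth_cfun V f -> smooth_cfun V h ->
  smooth_cfun V (fun x => f x * h x).
Proof.
move=> oV [f1 f2] [h1 h2]; split.
  apply: (smooth_fun_ext oV _ (smooth_funD oV (smooth_funM oV f1 h1) (smooth_funN oV (smooth_funM oV f2 h2)))).
  by move=> x _ /=; case: (f x) (h x) => ? ? [].
apply: (smooth_fun_ext oV _ (smooth_funD oV (smooth_funM oV f1 h2) (smooth_funM oV f2 h1))).
by move=> x _ /=; case: (f x) (h x) => ? ? [].
Qed.

Lemma smooth_cfun_sum V (I : Type) (r : seq I) (F : I -> M -> R[i]) : open V ->
  (forall i, smooth_cfun V (F i)) -> smooth_cfun V (fun x => \sum_(i <- r) F i x).
Proof.
move=> oV sF; elim: r => [|i r IH].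
  by apply: (smooth_cfun_ext oV _ (smooth_cfun_cst V 0)) => x _; rewrite big_nil.
by apply: (smooth_cfun_ext oV _ (smooth_cfunD oV (sF i) IH)) => x _; rewrite big_cons.
Qed.

Lemma smooth_cfun_mulmx V m p q (A : M -> 'M[R[i]]_(m, p)) (B : M -> 'M[R[i]]_(p, q)) : open V ->
  (forall i j, smooth_cfun V (fun x => A x i j)) -> (forall i j, smooth_cfun V (fun x => B x i j)) ->
  forall i j, smooth_cfun V (fun x => (A x *m B x) i j).
Proof.
move=> oV sA sB i j.
apply: (@smooth_cfun_ext V (fun x => \sum_k A x i k * B x k j) _ oV) => [x _|].
  by rewrite mxE.
by apply: smooth_cfun_sum => // k; exact: smooth_cfunM.
Qed.

Lemma smooth_fun_mulmx V m p q (A : M -> 'M[R]_(m, p)) (B : M -> 'M[R]_(p, q)) : open V ->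
  (forall i j, smooth_fun V (fun x => A x i j)) -> (forall i j, smooth_fun V (fun x => B x i j)) ->
  forall i j, smooth_fun V (fun x => (A x *m B x) i j).
Proof.
move=> oV sA sB i j.
apply: (@smooth_fun_ext _ _ _ V (fun x => \sum_k A x i k * B x k j) _ oV) => [x _|].
  by rewrite mxE.
by apply: smooth_fun_sum => // k; exact: smooth_funM.
Qed.

End smooth_complex.

Section groups.
Variables (R : realType) (n : nat) (gamma : 'I_n -> 'M[R[i]]_(spinor_dim n)).
Hypothesis hgamma : is_clifford gamma.

Lemma conjcK : involutive (@conjc R).
Proof. by case=> a b /=; rewrite opprK. Qed.

Lemma conjc_rc (x : R) : conjc (real_complex R x) = real_complex R x.
Proof. by rewrite /= oppr0. Qed.

Lemma conjc_gt0 (x : R[i]) : x != 0 -> 0 < conjc x * x.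
Proof.
case: x => a b; rewrite eq_complex /= => ab.
have -> : conjc (Complex a b) * Complex a b = real_complex R (a * a + b * b).
  by apply/eqP; rewrite eq_complex /=; apply/andP; split; apply/eqP; ring.
rewrite ltcR.
have : a != 0 \/ b != 0 by move: ab; rewrite negb_and => /orP.
case=> ?; first by rewrite ltr_pwDl// -?expr2 ?sqr_ge0// lt_def sqr_ge0 sqrf_eq0 andbT.
by rewrite ltr_pwDr// -?expr2 ?sqr_ge0// lt_def sqr_ge0 sqrf_eq0 andbT.
Qed.

Definition cj : {rmorphism R[i] -> R[i]} := @conjc R.
Definition rc : {rmorphism R -> R[i]} := real_complex R.
Local Notation adj := (adjmx (@conjc R)).

Lemma cliffordE : clifford cj gamma.
Proof. exact: hgamma. Qed.

Lemma SO_inv (A : 'M[R]_n) : SO A -> A^T *m A = 1%:M.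
Proof. by move=> [/mulmx1C]. Qed.

Lemma SO_mul (A B : 'M[R]_n) : SO A -> SO B -> SO (A *m B).
Proof.
move=> [AA dA] [BB dB]; split; last by rewrite det_mulmx dA dB mulr1.
by rewrite trmx_mul mulmxA -[A *m B *m B^T]mulmxA BB mulmx1 AA.
Qed.

Lemma SO_trmx (A : 'M[R]_n) : SO A -> SO A^T.
Proof. by move=> [AA dA]; split; rewrite ?det_tr// trmxK mulmx1C. Qed.

Lemma Spin_inv s : Spin gamma s -> adj s *m s = 1%:M.
Proof. by move=> [vs [_ H ->]]; exact: (cl_prod_unitary conjc_rc cliffordE H). Qed.

Lemma Spin_mul s t : Spin gamma s -> Spin gamma t -> Spin gamma (s *m t).
Proof.
move=> [vs [ov Hv ->]] [us [ou Hu ->]]; exists (vs ++ us); split.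
- by rewrite size_cat oddD (negbTE ov).
- by move=> v; rewrite mem_cat => /orP[/Hv|/Hu].
- by rewrite big_cat.
Qed.

Lemma Spin_adj s : Spin gamma s -> Spin gamma (adj s).
Proof.
move=> [vs [ov Hv ->]]; exists (rev vs); split; first by rewrite size_rev.
  by move=> v; rewrite mem_rev => /Hv.
exact: (adj_cl_prod conjc_rc vs cliffordE).
Qed.

Lemma Spin_covers s : Spin gamma s -> exists2 A, SO A & spin_covers gamma s A.
Proof.
move=> [vs [ov Hv ->]].
have [A [AA dA HA]] := cl_prod_rot rc cliffordE Hv.
exists A => //; split => //.
by rewrite dA -signr_odd oddM (negbTE ov) andbF.
Qed.

Lemma Spin_ind (Q : 'M[R[i]]_(spinor_dim n) -> Prop) : Q 0 ->
  (forall m p, Q m -> Q p -> Q (m + p)) -> (forall x m, Q m -> Q (real_complex R x *: m)) ->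
  (forall s, ~~ odd (size s) -> Q (gprod gamma s)) -> forall s, Spin gamma s -> Q s.
Proof.
move=> Q0 QD QZ Qg s [vs [ov _ ->]].
exact: (even_cl_ind Q0 QD QZ Qg).
Qed.

End groups.
Lemma measurable_det d (T : measurableType d) (R : realType) (D : set T) m (F : T -> 'M[R]_m) :
  (forall i j, measurable_fun D (fun x => F x i j)) -> measurable_fun D (fun x => \det (F x)).
Proof.
move=> mF; rewrite /determinant.
apply: (@measurable_sum _ _ _ _ _ _ (fun (s : 'S_m) x => (-1) ^+ s * \prod_i F x i (s i))) => s.
apply: measurable_funM; first exact: measurable_cst.
by apply: (@measurable_prod _ _ _ _ _ _ (fun i x => F x i (s i))) => i _; exact: mF.
Qed.

(** * Singular metrics in charts *)

Section so_bundles.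
Variables (R : realType) (n : nat) (M : manifold R n).

Lemma so_compare (P : principal_bundle (@SO R n) (@smooth_fun R n M)) V V' (s s' : M -> P) :
  smooth_section V s -> smooth_section V' s' ->
  exists A : M -> 'M[R]_n,
    (forall x, V x -> V' x -> SO (A x) /\ s' x = act (s x) (A x)) /\
    forall i j, smooth_fun (V `&` V') (fun x => A x i j).
Proof.
apply: (compare_sections (@smooth_fun_sub _ _ _) (inv := trmx)).
- exact: SO_inv.
- exact: SO_mul.
- exact: smooth_fun_local.
- exact: smooth_fun_ext.
- move=> W g h oW sg sh; apply: smooth_fun_mulmx => // i j.
  by apply: (smooth_fun_ext oW _ (sg j i)) => x _; rewrite mxE.
Qed.

Variables (P : SO_reduction M) (g : singular_metric P).
Implicit Types (V W : set M) (s : M -> P) (c d : chart R n M).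

Lemma tau_trans (f : P) c d : atlas c -> atlas d -> dom c (proj f) -> dom d (proj f) ->
  tau g f c = jac c d (proj f) *m tau g f d.
Proof. by case: g f c d => ? ? H ? ? ? ? ? f c d; exact: H. Qed.

Lemma tau_act (f : P) A c : SO A -> atlas c -> dom c (proj f) -> tau g (act f A) c = tau g f c *m A.
Proof.
move=> SA ac cf; apply: trmx_inj; rewrite trmx_mul.
have -> : A^T = invmx A.
  have [AA _] := SA; have uA : A \in unitmx by have [] := mulmx1_unit AA.
  by rewrite -[LHS](mulKmx uA) AA mulmx1.
by case: g f A c SA ac cf => ? ? ? H ? ? ? ? f A c; exact: H.
Qed.

Lemma tau_unit (f : P) c : atlas c -> dom c (proj f) -> tau g f c \in unitmx.
Proof. by case: g f c => ? ? ? ? H ? ? ? f c; exact: H. Qed.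

Lemma sing_closed : closed (sing g). Proof. by case: g. Qed.
Lemma sing_null : null_set (sing g). Proof. by case: g. Qed.

Lemma coframe_regular c V s mu i : atlas c -> smooth_section V s -> V `<=` dom c ->
  locally_integrable (coord c @` (V `\` sing g)) (fun y => coframe g c s (icoord c y) mu i) /\
  forall nu, exists h, weak_partial (coord c @` (V `\` sing g)) nu
    (fun y => coframe g c s (icoord c y) mu i) h.
Proof. by case: g c V s mu i => ? ? ? ? ? ? ? H c V s mu i ac ss Vc; exact: H. Qed.

Lemma section_open V s : smooth_section V s -> open V. Proof. by case. Qed.
Lemma section_proj V s x : smooth_section V s -> V x -> proj (s x) = x.
Proof. by case=> _ H _; exact: H. Qed.

Lemma setD_sing_open V : open V -> open (V `\` sing g).
Proof. by move=> oV; rewrite setDE; apply: openI => //; exact: closed_openC sing_closed. Qed.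

Lemma coordD_open c V s : smooth_section V s -> V `<=` dom c -> open (coord c @` (V `\` sing g)).
Proof.
move=> ss Vc; apply: coord_open; first exact: setD_sing_open (section_open ss).
by move=> x [/Vc].
Qed.

Definition rho c s (y : 'rV[R]_n) : R := Num.sqrt (\det (metric_mx g c s (icoord c y))).

Lemma rhoE c s y : rho c s y = `|\det (tau g (s (icoord c y)) c)|.
Proof.
rewrite /rho; have -> : metric_mx g c s (icoord c y) =
    tau g (s (icoord c y)) c *m (tau g (s (icoord c y)) c)^T.
  by apply/matrixP => i j; rewrite !mxE; apply: eq_bigr => k _; rewrite /coframe mxE.
by rewrite det_mulmx det_tr -expr2 sqrtr_sqr.
Qed.

Lemma rho_measurable c V s : atlas c -> smooth_section V s -> V `<=` dom c ->
  measurable_fun (coord c @` (V `\` sing g) : set (Rn_leb R n)) (rho c s : Rn_leb R n -> R).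
Proof.
move=> ac ss Vc.
have oU := coordD_open ss Vc.
apply: (@eq_measurable_fun _ _ _ _ _ (fun y : Rn_leb R n => `|\det (tau g (s (icoord c y)) c)|)).
  by move=> y _; rewrite rhoE.
apply: measurableT_comp; first exact: normr_measurable.
apply: measurable_det => mu i; apply: (loc_int_measurable oU).
by have [] := coframe_regular mu i ac ss Vc.
Qed.

(** Transforming [tau] from [c] to [d] and back must return it, and [tau] is invertible. *)
Lemma jac_unit (f : P) c d : atlas c -> atlas d -> dom c (proj f) -> dom d (proj f) ->
  jac c d (proj f) *m jac d c (proj f) = 1%:M.
Proof.
move=> ac ad cf df; have u := tau_unit ac cf.
have := tau_trans ac ad cf df; rewrite (tau_trans ad ac df cf) mulmxA => H.
by rewrite -[LHS]mulmx1 -(mulmxV u) mulmxA -H.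
Qed.

Variables (dvol : {measure set (mleb M) -> \bar R}) (hdvol : is_dvol g dvol).

(** The densities [rho] are sqrt |g| in the two charts. Their integrals over corresponding sets
    agree because both are [dvol] of the same subset of M, and [tau_trans] relates them by the
    Jacobian determinant. *)
Lemma chart_meas_diffeo c d V s : atlas c -> atlas d -> smooth_section V s ->
  V `<=` dom c `&` dom d ->
  meas_diffeo (coord c @` (V `\` sing g)) (coord d @` (V `\` sing g))
    (trans c d) (trans d c) (rho c s) (rho d s).
Proof.
move=> ac ad ss Vcd.
have Vc : V `<=` dom c by move=> x /Vcd[].
have Vd : V `<=` dom d by move=> x /Vcd[].
have Ucd : V `\` sing g `<=` dom c `&` dom d by move=> x [/Vcd].
have Udc : V `\` sing g `<=` dom d `&` dom c by move=> x [/Vcd[]].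
have rho0 e y : atlas e -> V `<=` dom e -> (coord e @` (V `\` sing g)) y -> 0 < rho e s y.
  move=> ae Ve [x [Vx _] <-]; rewrite rhoE normr_gt0 icoordK; last exact: Ve.
  by rewrite -unitfE -unitmxE tau_unit// (section_proj ss Vx); exact: Ve.
split.
- exact: coordD_open ss Vc.
- exact: coordD_open ss Vd.
- by move=> y; exact: trans_image.
- by move=> y; exact: trans_image.
- by move=> y; exact: transK.
- by move=> y; exact: transK.
- by move=> a; exact: trans_smooth.
- by move=> a; exact: trans_smooth.
- exact: rho_measurable.
- exact: rho_measurable.
- by move=> y; exact: rho0.
- by move=> y; exact: rho0.
- move=> E EU mE mpE; pose A := [set x | V x /\ E (coord c x)].
  have cA : coord c @` A = E.
    apply/seteqP; split => [_ [x [_ Ex] <-]//|y Ey].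
    by have [x [Vx _] xy] := EU _ Ey; exists x => //; split => //; rewrite xy.
  have dA : coord d @` A = trans c d @` E.
    apply/seteqP; split => z.
      by move=> [x [Vx Ex] <-]; exists (coord c x) => //; rewrite /trans /= icoordK//; exact: Vc.
    move=> [y Ey <-]; have [x [Vx _] xy] := EU _ Ey.
    by exists x; [split => //; rewrite xy|rewrite /trans /= -xy icoordK//; exact: Vc].
  have AV : A `<=` V by move=> x [].
  have := hdvol ac ss Vc AV; rewrite cA => <- //.
  by have := hdvol ad ss Vd AV; rewrite dA => <-.
- move=> _ [x [Vx _] <-]; have cx := Vc _ Vx; have dx := Vd _ Vx.
  rewrite !rhoE /trans /= !icoordK// -jacE//.
  by have := @tau_trans (s x) c d; rewrite (section_proj ss Vx) => -> //; rewrite det_mulmx normrM.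
Qed.

(** Being null is local; near a point where two charts and a section of PSO(M) are defined,
    [null_image] transports it, away from the singular set, which is null by assumption. *)
Lemma null_set_chart c N : atlas c -> N `<=` dom c -> lebesgue_outer (coord c @` N) = 0%E ->
  null_set N.
Proof.
move=> ac Nc N0 d ad; apply: null_local => _ [x [Nx dx] <-].
have cx := Nc _ Nx.
have oU : open (dom c `&` dom d) by apply: openI; exact: dom_open.
have [W [s [oW Wx Wcd ss]]] := local_section P (@smooth_fun_sub _ _ _) oU (conj cx dx).
have Wd : W `<=` dom d by move=> y /Wcd[].
exists (coord d @` W); split; [exact: coord_open|by exists x|].
have md := chart_meas_diffeo ac ad ss Wcd.
apply: (@null_subset _ _ _ (trans c d @` (coord c @` (N `&` (W `\` sing g))) `|`
    coord d @` (sing g `&` dom d))).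
  move=> _ [[y [Ny dy] <-] [z Wz zy]].
  have {zy} zy : z = y by rewrite -(icoordK (Wd _ Wz)) zy icoordK.
  rewrite zy in Wz; have [sy|nsy] := pselect (sing g y); [by right; exists y|left].
  exists (coord c y); first by exists y.
  by rewrite /trans /= icoordK//; exact: Nc.
apply: null_setU; last exact: sing_null ad.
apply: (null_image md).
  by apply: image_subset => y [].
by apply: null_subset N0; apply: image_subset => y [].
Qed.

Lemma ae_on_chart c V (Q : M -> Prop) : atlas c -> V `<=` dom c ->
  ae_in (coord c @` V) (Q \o icoord c) -> ae_on V Q.
Proof.
move=> ac Vc H; apply: (null_set_chart ac); first by move=> x [/Vc].
apply: null_subset H => _ [x [Vx nQ] <-]; split; first by exists x.
by rewrite /= icoordK//; exact: Vc.
Qed.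

Lemma ae_on_setD V Q : ae_on (V `\` sing g) Q -> ae_on V Q.
Proof.
move=> H; apply: null_set_sub (null_set_union H sing_null) => x [Vx nQ].
by have [sx|nsx] := pselect (sing g x); [right|left].
Qed.

Lemma ae_onI V (Q Q' : M -> Prop) : ae_on V Q -> ae_on V Q' -> ae_on V (fun x => Q x /\ Q' x).
Proof.
move=> H H'; apply: null_set_sub (null_set_union H H') => x [Vx /not_andP[?|?]]; by [left|right].
Qed.

Lemma ae_on_forall (I : finType) V (Q : I -> M -> Prop) :
  (forall i, ae_on V (Q i)) -> ae_on V (fun x => forall i, Q i x).
Proof.
move=> H c ac; apply: (@null_subset _ _ _ (\bigcup_(i in [set: I]) (coord c @` ([set x | V x /\ ~ Q i x] `&` dom c)))).
  by move=> _ [x [[Vx /existsNP[i nQ]] cx] <-]; exists i => //; exists x.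
by apply: null_bigcup => [|i _]; [exact: countableP|exact: H].
Qed.

Lemma measurable_chart c (A : set M) : atlas c -> A `<=` dom c ->
  measurable (coord c @` A : set (Rn_leb R n)) -> measurable (A : set (mleb M)).
Proof. by move=> ac Ac mA; apply: sub_sigma_algebra; exists c. Qed.

Lemma measurable_compact_chart c (K : set M) : atlas c -> K `<=` dom c -> compact K ->
  measurable (K : set (mleb M)).
Proof.
move=> ac Kc cK; apply: (measurable_chart ac Kc); apply: measurable_compact.
exact: coord_compact.
Qed.

Lemma measurable_open_chart c (V : set M) : atlas c -> V `<=` dom c -> open V ->
  measurable (V : set (mleb M)).
Proof.
move=> ac Vc oV; apply: (measurable_chart ac Vc); apply: measurable_open.
exact: coord_open.
Qed.

Lemma null_set_chart_measurable c (N : set M) : atlas c -> N `<=` dom c -> null_set N ->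
  measurable (N : set (mleb M)).
Proof.
move=> ac Nc N0; apply: (measurable_chart ac Nc); apply: null_measurable.
by have := N0 _ ac; rewrite setIidl.
Qed.

Lemma dvol_null c V s (N : set M) : atlas c -> smooth_section V s -> V `<=` dom c -> N `<=` V ->
  null_set N -> measurable (N : set (mleb M)) /\ dvol N = 0%E.
Proof.
move=> ac ss Vc NV N0; have Nc : N `<=` dom c by exact: subset_trans NV Vc.
have cN0 : lebesgue_outer (coord c @` N) = 0%E by have := N0 _ ac; rewrite setIidl.
have mN : measurable (coord c @` N : set (Rn_leb R n)) by exact: null_measurable.
split; first exact: (null_set_chart_measurable ac Nc N0).
rewrite (hdvol ac ss Vc NV)//; apply: null_set_integral => //.
move=> _ B mB; apply: null_measurable; apply: null_subset cN0; exact: subIsetl.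
Qed.

Lemma measurable_continuous_chart c V (D : set M) (f : M -> R) : atlas c -> V `<=` dom c ->
  open V -> {in V, continuous f} -> D `<=` V -> measurable (coord c @` D : set (Rn_leb R n)) ->
  measurable_fun (D : set (mleb M)) (f : mleb M -> R).
Proof.
move=> ac Vc oV cf DV mD _ B mB.
have Dc : D `<=` dom c by exact: subset_trans DV Vc.
have cfc : {in coord c @` V, continuous (f \o icoord c)}.
  move=> y; rewrite inE => -[x Vx <-].
  apply: continuous_comp; first by apply: icoord_cont; rewrite inE; exists x => //; exact: Vc.
  by rewrite icoordK; [apply: cf; rewrite inE|exact: Vc].
have DcV : coord c @` D `<=` coord c @` V by exact: image_subset.
have := measurable_continuous (coord_open oV Vc) cfc DcV mD mB.
set E := _ `&` _ => mE; apply: (measurable_chart ac); first by move=> x [/Dc].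
rewrite (_ : _ @` _ = E)//; apply/seteqP; split => y.
  by move=> [x [Dx Bx] <-]; split; [exists x|rewrite /= icoordK//; exact: Dc].
by move=> [[x Dx <-] /=]; rewrite icoordK => [Bx|]; [exists x|exact: Dc].
Qed.

(* [mleb M] is not complete by definition, but it contains the null sets that   *)
(* lie in one chart.                                                           *)
Lemma integrable_ae_eq c V s (D : set M) (f h : M -> R) : atlas c -> smooth_section V s ->
  V `<=` dom c -> D `<=` V -> measurable (D : set (mleb M)) ->
  ae_on D (fun x => f x = h x) -> dvol.-integrable (D : set (mleb M)) (EFin \o f) ->
  dvol.-integrable (D : set (mleb M)) (EFin \o h).
Proof.
move=> ac ss Vc DV mD fh fi; set N := [set x | D x /\ ~ f x = h x] in fh.
have ND : N `<=` D by move=> x [].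
have NV : N `<=` V by exact: subset_trans ND DV.
have [mN N0] := dvol_null ac ss Vc NV fh.
have mfD : measurable_fun (D : set (mleb M)) f by have /integrableP[/measurable_EFinP] := fi.
have mh : measurable_fun (D : set (mleb M)) h.
  move=> _ B mB; rewrite (_ : _ `&` _ = ((D `\` N) `&` (D `&` f @^-1` B)) `|` (N `&` h @^-1` B)).
    apply: measurableU; first by apply: measurableI; [exact: measurableD|exact: mfD].
    have sub : N `&` h @^-1` B `<=` V by move=> x [/NV].
    apply: (dvol_null ac ss Vc sub _).1.
    by apply: null_set_sub fh => x [Nx _]; exact: Nx.
  apply/seteqP; split => x /=.
    move=> [Dx Bx]; have [Nx|nNx] := pselect (N x); [by right|left].
    have fx : f x = h x by apply: contrapT => nfx; apply: nNx.
    by rewrite /preimage/= fx; split.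
  move=> [[[Dx nN] [_ Bx]]|[[Dx _] Bx]]; last by [].
  have fx : f x = h x by apply: contrapT => nfx; apply: nN.
  by rewrite -fx.
have mDN : measurable (D `\` N : set (mleb M)) by exact: measurableD.
apply/(negligible_integrable mN mD) => //; first exact/measurable_EFinP.
have i1 : dvol.-integrable (D `\` N : set (mleb M)) (EFin \o f).
  by apply: integrableS fi => // x [].
apply: eq_integrable i1 => // x; rewrite inE => -[Dx nN] /=; congr (_%:E).
by apply: contrapT => nfx; apply: nN.
Qed.

End so_bundles.
(** * Connection forms *)

Section partial_rules.
Variables (R : realType) (n : nat).
Implicit Types (U : set 'rV[R]_n) (f h : 'rV[R]_n -> R).

Lemma partialM U f h i y : Ck_on 1 U f -> Ck_on 1 U h -> U y ->
  partial i (fun z => f z * h z) y = partial i f y * h y + f y * partial i h y.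
Proof.
move=> [_ /(_ i)[df _]] [_ /(_ i)[dh _]] Uy; rewrite /partial deriveM.
- by rewrite /GRing.scale /= addrC [h y * _]mulrC.
- by apply: df; rewrite inE.
- by apply: dh; rewrite inE.
Qed.

Lemma partial_sum U (I : finType) (F : I -> 'rV[R]_n -> R) i y :
  (forall k, Ck_on 1 U (F k)) -> U y ->
  partial i (fun z => \sum_k F k z) y = \sum_k partial i (F k) y.
Proof.
move=> CF Uy; have dF k : derivable (F k) y (delta_mx ord0 i).
  by have [_ /(_ i)[d _]] := CF k; apply: d; rewrite inE.
suff [] : derivable (fun z => \sum_(k <- index_enum I) F k z) y (delta_mx ord0 i) /\
  partial i (fun z => \sum_(k <- index_enum I) F k z) y = \sum_(k <- index_enum I) partial i (F k) y by [].
elim: (index_enum I) => [|k r [IH1 IH2]].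
  have -> : (fun z => \sum_(k <- [::]) F k z) = cst 0 by apply/funext => z; rewrite big_nil.
  by split; [exact: derivable_cst|rewrite big_nil /partial derive_cst].
have -> : (fun z => \sum_(j <- k :: r) F j z) = F k \+ (fun z => \sum_(j <- r) F j z).
  by apply/funext => z; rewrite big_cons.
split; first exact: derivableD.
by rewrite big_cons -IH2 /partial deriveD.
Qed.

End partial_rules.

Lemma mulmx3E (R : pzRingType) m p q t (X : 'M[R]_(m, p)) (Y : 'M[R]_(p, q)) (Z : 'M[R]_(q, t)) i j :
  (X *m Y *m Z) i j = \sum_a \sum_b X i a * Y a b * Z b j.
Proof.
rewrite mxE exchange_big /=; apply: eq_bigr => b _.
by rewrite mxE mulr_suml.
Qed.

(** * The structure equation at a point *)

Section structure_equation.
Variables (R : realType) (n : nat).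
Implicit Types (E A J : 'M[R]_n) (D w P : 'I_n -> 'M[R]_n).

(* [D mu] and [w mu] are the matrices of de_(nu i) and omega_(i j) in the       *)
(* direction mu. For antisymmetric w, the structure equation says that         *)
(* (D mu - E w mu)_(nu i) is symmetric in mu and nu.                           *)
Lemma structure_sym E D w : (forall mu, (w mu)^T = - w mu) ->
  (forall i mu nu, D mu nu i - D nu mu i +
     \sum_j (w mu i j * E nu j - w nu i j * E mu j) = 0) <->
  (forall i mu nu, (D mu - E *m w mu) nu i = (D nu - E *m w nu) mu i).
Proof.
move=> wN; have H i mu nu : D mu nu i - D nu mu i + \sum_j (w mu i j * E nu j - w nu i j * E mu j) =
    (D mu - E *m w mu) nu i - (D nu - E *m w nu) mu i.
  have K mu' nu' : \sum_j w mu' i j * E nu' j = - (E *m w mu') nu' i.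
    rewrite mxE -sumrN; apply: eq_bigr => j _.
    have -> : w mu' i j = - w mu' j i by have /matrixP/(_ j i) := wN mu'; rewrite !mxE.
    by rewrite mulrC mulrN.
  rewrite sumrB !K !mxE; ring.
split=> S i mu nu; first by apply/eqP; rewrite -subr_eq0 -H S.
by rewrite H S subrr.
Qed.

(** [D'] is the Leibniz rule for [J E A], with [P] the derivative of [J]. The terms with [dA] cancel
    against the inhomogeneous part of [w'], and the term with [P] is symmetric because second
    derivatives of coordinate changes are. *)
Lemma structure_change E D w A J P dA : (forall mu, (w mu)^T = - w mu) -> A *m A^T = 1%:M ->
  (forall mu, (A^T *m dA mu)^T = - (A^T *m dA mu)) ->
  (forall mu nu al, P mu nu al = P nu mu al) ->
  (forall i mu nu, (D mu - E *m w mu) nu i = (D nu - E *m w nu) mu i) ->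
  let w' mu := A^T *m (\sum_b J mu b *: w b) *m A + A^T *m dA mu in
  let D' mu := J *m (\sum_b J mu b *: D b) *m A + P mu *m E *m A + J *m E *m dA mu in
  (forall mu, (w' mu)^T = - w' mu) /\
  (forall i mu nu, (D' mu - (J *m E *m A) *m w' mu) nu i = (D' nu - (J *m E *m A) *m w' nu) mu i).
Proof.
move=> wN AA dAN Psym S w' D'; split.
  move=> mu; rewrite /w' linearD /= dAN opprD; congr (_ + _).
  rewrite !trmx_mul trmxK mulmxA -mulNmx -mulmxN; congr (_ *m _ *m _).
  by rewrite linear_sum /= -sumrN; apply: eq_bigr => b _; rewrite linearZ /= wN scalerN.
have E1 mu : D' mu - (J *m E *m A) *m w' mu =
    J *m (\sum_b J mu b *: (D b - E *m w b)) *m A + P mu *m E *m A.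
  have -> : (J *m E *m A) *m w' mu = J *m (E *m \sum_b J mu b *: w b) *m A + J *m E *m dA mu.
    by rewrite /w' mulmxDr !mulmxA -[J *m E *m A *m A^T]mulmxA AA mulmx1.
  have -> : \sum_b J mu b *: (D b - E *m w b) = (\sum_b J mu b *: D b) - E *m \sum_b J mu b *: w b.
    by rewrite mulmx_sumr -sumrB; apply: eq_bigr => b _; rewrite scalerBr scalemxAr.
  by rewrite /D' mulmxBr mulmxBl opprD addrACA subrr addr0 addrAC.
move=> i mu nu; rewrite !E1 [LHS]mxE [RHS]mxE; congr (_ + _); last first.
  rewrite -!mulmxA [LHS]mxE [RHS]mxE; apply: eq_bigr => al _; by rewrite Psym.
rewrite !mulmx3E.
have X m p : \sum_a \sum_b J p a * (\sum_c J m c *: (D c - E *m w c)) a b * A b i =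
    \sum_a \sum_c \sum_b J p a * J m c * (D c - E *m w c) a b * A b i.
  apply: eq_bigr => a _; rewrite [RHS]exchange_big /=; apply: eq_bigr => b _.
  rewrite summxE mulr_sumr mulr_suml; apply: eq_bigr => c _.
  by rewrite [X in _ * X * _]mxE mulrA.
rewrite !X exchange_big /=; apply: eq_bigr => a _; apply: eq_bigr => c _; apply: eq_bigr => b _.
by rewrite S [J nu _ * _]mulrC.
Qed.

End structure_equation.

Section connection_unique.
Variables (R : realType) (n : nat).

Lemma structure_unique (E : 'M[R]_n) (D w w' : 'I_n -> 'M[R]_n) : E \in unitmx ->
  (forall mu, (w mu)^T = - w mu) -> (forall mu, (w' mu)^T = - w' mu) ->
  (forall i mu nu, (D mu - E *m w mu) nu i = (D nu - E *m w nu) mu i) ->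
  (forall i mu nu, (D mu - E *m w' mu) nu i = (D nu - E *m w' nu) mu i) ->
  forall mu, w mu = w' mu.
Proof.
move=> uE wN w'N S S'; pose v mu := w mu - w' mu.
have vN mu i j : v mu i j = - v mu j i.
  by have /matrixP/(_ j i) := wN mu; have /matrixP/(_ j i) := w'N mu; rewrite !mxE => -> ->; rewrite opprB opprK addrC.
have Sv i mu nu : (E *m v mu) nu i = (E *m v nu) mu i.
  rewrite /v !mulmxBr !mxE.
  have := S i mu nu; have := S' i mu nu; rewrite !mxE => H1 H2.
  by move: H1 H2; lra.
(* In frame components the difference of two solutions is antisymmetric in the first two indices and
   symmetric in the first and third; such a tensor is 0. *)
pose u b i c := \sum_mu invmx E c mu * v mu b i.
have uN b i c : u b i c = - u i b c.
  by rewrite /u -sumrN; apply: eq_bigr => mu _; rewrite vN mulrN.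
have uS b i c : u b i c = u c i b.
  have K p q : u p i q = \sum_mu \sum_nu invmx E q mu * invmx E p nu * (E *m v mu) nu i.
    apply: eq_bigr => mu _; transitivity (invmx E q mu * (invmx E *m (E *m v mu)) p i).
      by rewrite mulKmx.
    by rewrite mxE mulr_sumr; apply: eq_bigr => nu _; rewrite mulrA.
  rewrite !K exchange_big /=; apply: eq_bigr => mu _; apply: eq_bigr => nu _.
  by rewrite Sv [invmx E c _ * _]mulrC.
have u0 b i c : u b i c = 0.
  have : u b i c = - u b i c by rewrite {1}uS uN uS uN opprK uS uN uS.
  by move=> /eqP; rewrite -addr_eq0 -mulr2n mulrn_eq0 => /eqP.
move=> mu; apply/eqP; rewrite -subr_eq0; apply/eqP/matrixP => b i; rewrite [RHS]mxE.
have -> : (w mu - w' mu) b i = \sum_nu (E *m invmx E) mu nu * v nu b i.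
  rewrite mulmxV// (bigD1 mu)//= [1%:M _ _]mxE eqxx mul1r big1 ?addr0// => nu nm.
  by rewrite mxE eq_sym (negbTE nm) mul0r.
transitivity (\sum_c E mu c * u b i c); last by rewrite big1// => c _; rewrite u0 mulr0.
under eq_bigr do rewrite mxE mulr_suml.
rewrite exchange_big /=; apply: eq_bigr => c _; rewrite mulr_sumr.
by apply: eq_bigr => nu _; rewrite mulrA.
Qed.

(* Koszul's formula. *)
Lemma structure_exists (E : 'M[R]_n) (D : 'I_n -> 'M[R]_n) : E \in unitmx ->
  exists w : 'I_n -> 'M[R]_n, (forall mu, (w mu)^T = - w mu) /\
  forall i mu nu, D mu nu i - D nu mu i + \sum_j (w mu i j * E nu j - w nu i j * E mu j) = 0.
Proof.
move=> uE.
pose c i a b := \sum_mu \sum_nu invmx E a mu * invmx E b nu * (D mu nu i - D nu mu i).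
have cN i a b : c i a b = - c i b a.
  rewrite /c exchange_big -sumrN /=; apply: eq_bigr => mu _; rewrite -sumrN.
  by apply: eq_bigr => nu _; rewrite -mulrN opprB [invmx E a _ * _]mulrC.
have cE i mu nu : \sum_j \sum_k E mu k * E nu j * c i k j = D mu nu i - D nu mu i.
  transitivity (\sum_p \sum_q (E *m invmx E) mu p * (E *m invmx E) nu q * (D p q i - D q p i)).
    under [RHS]eq_bigr do under eq_bigr do rewrite !mxE big_distrlr mulr_suml /=.
    under [RHS]eq_bigr do under eq_bigr do under eq_bigr do rewrite mulr_suml.
    transitivity (\sum_j \sum_k \sum_p \sum_q E mu k * invmx E k p * (E nu j * invmx E j q) * (D p q i - D q p i)).
      apply: eq_bigr => j _; apply: eq_bigr => k _; rewrite mulr_sumr; apply: eq_bigr => p _.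
      by rewrite mulr_sumr; apply: eq_bigr => q _; ring.
    rewrite exchange_big /=; under eq_bigr do rewrite exchange_big /=.
    under eq_bigr do under eq_bigr do rewrite exchange_big /=.
    rewrite exchange_big /=; apply: eq_bigr => p _; rewrite exchange_big /=.
    by under eq_bigr do rewrite exchange_big /=; rewrite exchange_big /=; apply: eq_bigr => q _; rewrite exchange_big.
  rewrite mulmxV// (bigD1 mu)//= [X in _ + X]big1 ?addr0 => [|p pm]; last first.
    by rewrite big1// => q _; rewrite mxE eq_sym (negbTE pm) !mul0r.
  rewrite (bigD1 nu)//= big1 ?addr0 => [|q qn]; last by rewrite !mxE eqxx eq_sym (negbTE qn) mulr0 mul0r.
  by rewrite !mxE !eqxx !mul1r.
pose K i j k := 2^-1 * (c i j k - c j i k - c k i j).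
exists (fun mu => \matrix_(i, j) \sum_k E mu k * K i j k); split.
  move=> mu; apply/matrixP => i j; rewrite !mxE -sumrN; apply: eq_bigr => k _.
  by rewrite -mulrN /K [c k j i]cN; congr (_ * _); ring.
move=> i mu nu; rewrite -cE sumrB.
have -> : \sum_j (\matrix_(i, j) \sum_k E nu k * K i j k) i j * E mu j =
    \sum_j \sum_k E nu j * K i k j * E mu k.
  by rewrite exchange_big /=; apply: eq_bigr => j _; rewrite mxE mulr_suml.
rewrite -sumrB -big_split /= big1// => j _; rewrite mxE mulr_suml -sumrB -big_split /= big1// => k _.
have H : 2 * K i j k = c i j k - c j i k - c k i j by rewrite /K mulrA mulfV ?mul1r// pnatr_eq0.
have H' : 2 * K i k j = c i k j - c k i j - c j i k by rewrite /K mulrA mulfV ?mul1r// pnatr_eq0.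
apply: (@mulfI _ 2); first by rewrite pnatr_eq0.
rewrite mulr0.
transitivity (E mu k * E nu j * (2 * c i k j + 2 * K i j k - 2 * K i k j)); first by ring.
by rewrite H H' [c i j k]cN; ring.
Qed.

End connection_unique.
Section connections.
Variables (R : realType) (n : nat) (M : manifold R n) (P : SO_reduction M) (g : singular_metric P).
Variables (dvol : {measure set (mleb M) -> \bar R}) (hdvol : is_dvol g dvol).
Implicit Types (V W : set M) (s : M -> P) (c d : chart R n M).
Implicit Types w : M -> 'I_n -> 'I_n -> 'I_n -> R.

Definition wmx w x mu : 'M[R]_n := \matrix_(i, j) w x i j mu.

Lemma structure_eqP c s w (de : 'I_n -> 'I_n -> 'I_n -> M -> R) x :
  ((forall i j mu, w x i j mu + w x j i mu = 0) /\
   forall i mu nu, de mu nu i x - de nu mu i x +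
     \sum_j (w x i j mu * coframe g c s x nu j - w x i j nu * coframe g c s x mu j) = 0) <->
  (forall mu, (wmx w x mu)^T = - wmx w x mu) /\
  (forall i mu nu, ((\matrix_(a, b) de mu a b x) - tau g (s x) c *m wmx w x mu) nu i =
     ((\matrix_(a, b) de nu a b x) - tau g (s x) c *m wmx w x nu) mu i).
Proof.
have H1 : (forall i j mu, w x i j mu + w x j i mu = 0) <-> (forall mu, (wmx w x mu)^T = - wmx w x mu).
  split=> [H mu|H i j mu].
    by apply/matrixP => i j; rewrite !mxE; apply/eqP; rewrite -addr_eq0 H.
  by have /matrixP/(_ j i) := H mu; rewrite !mxE => ->; rewrite addNr.
split=> [[/H1 wN S]|[wN S]].
  split => //; apply/(structure_sym _ _ wN) => i mu nu; rewrite !mxE -[RHS](S i mu nu); congr (_ + _).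
  by apply: eq_bigr => j _; rewrite !mxE.
split; first exact/H1.
move=> i mu nu; rewrite -[RHS]((structure_sym _ _ wN).2 S i mu nu) !mxE; congr (_ + _).
by apply: eq_bigr => j _; rewrite !mxE.
Qed.

(** Weak derivatives of the coframe are fixed once, and the structure equation is then solved point
    by point in V. *)
Lemma connection_exists c V s : atlas c -> smooth_section V s -> V `<=` dom c ->
  exists w, connection_forms g c V s w.
Proof.
move=> ac ss Vc.
have /choice[h Hh] : forall p : 'I_n * 'I_n * 'I_n, exists h,
    weak_partial (coord c @` (V `\` sing g)) p.1.1 (fun y => coframe g c s (icoord c y) p.1.2 p.2) h.
  by move=> p; have [_] := coframe_regular g p.1.2 p.2 ac ss Vc; exact.
pose de nu mu i x := h (nu, mu, i) (coord c x).
have /choice[w Hw] : forall x, exists w : 'I_n -> 'I_n -> 'I_n -> R, V x ->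
    (forall mu, (\matrix_(i, j) w i j mu : 'M[R]_n)^T = - \matrix_(i, j) w i j mu) /\
    forall i mu nu, de mu nu i x - de nu mu i x +
     \sum_j (w i j mu * coframe g c s x nu j - w i j nu * coframe g c s x mu j) = 0.
  move=> x; have [Vx|nV] := pselect (V x); last by exists (fun _ _ _ => 0).
  have u : tau g (s x) c \in unitmx by apply: tau_unit => //; rewrite (section_proj ss Vx); exact: Vc.
  have [w [wN S]] := structure_exists (fun mu => \matrix_(a, b) de mu a b x) u.
  exists (fun i j mu => w mu i j) => _.
  have E mu : \matrix_(i, j) w mu i j = w mu by apply/matrixP => i j; rewrite mxE.
  split => [mu|i mu nu]; first by rewrite !E.
  by rewrite -[RHS](S i mu nu) !mxE.
exists w, de; split.
  move=> nu mu i; apply: (weak_partial_ext _ _ _ (Hh (nu, mu, i))) => //.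
    exact: coordD_open ss Vc.
  by move=> _ [x [Vx _] <-]; rewrite /de /= icoordK//; exact: Vc.
rewrite /ae_on (_ : [set x | _] = set0).
  by move=> e ae; rewrite set0I image_set0 lebesgue_outer0.
apply/seteqP; split => // x [Vx]; apply; have [wN S] := Hw _ Vx; split => // i j mu.
by have /matrixP/(_ j i) := wN mu; rewrite !mxE => ->; rewrite addNr.
Qed.

Lemma connection_sub c V W s w : atlas c -> smooth_section V s -> V `<=` dom c -> open W -> W `<=` V ->
  connection_forms g c V s w -> connection_forms g c W s w.
Proof.
move=> ac ss Vc oW WV [de [Hde Hw]]; exists de; split; last exact: ae_on_sub Hw.
have sW := section_sub (@smooth_fun_sub _ _ _) oW WV ss.
have Wc : W `<=` dom c by exact: subset_trans WV Vc.
move=> nu mu i; apply: (weak_partial_sub _ _ _ (Hde nu mu i)).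
- exact: coordD_open ss Vc.
- exact: coordD_open sW Wc.
- by apply: image_subset; exact: setSD.
Qed.

(** Weak derivatives agree a.e. by the fundamental lemma, and where they do, [structure_unique]
    applies. *)
Lemma connection_unique c V s w w' : atlas c -> smooth_section V s -> V `<=` dom c ->
  connection_forms g c V s w -> connection_forms g c V s w' ->
  ae_on V (fun x => forall i j mu, w x i j mu = w' x i j mu).
Proof.
move=> ac ss Vc [de [Hde Hw]] [de' [Hde' Hw']].
have oU := coordD_open (g := g) ss Vc.
have Vc' : V `\` sing g `<=` dom c by move=> x [/Vc].
have E : ae_on V (fun x => forall p : 'I_n * 'I_n * 'I_n, de p.1.1 p.1.2 p.2 x = de' p.1.1 p.1.2 p.2 x).
  apply: (@ae_on_setD _ _ _ _ g); apply: ae_on_forall => p.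
  exact: (ae_on_chart hdvol ac Vc' (weak_partial_unique oU (Hde p.1.1 p.1.2 p.2) (Hde' p.1.1 p.1.2 p.2))).
apply: ae_on_impl (ae_onI E (ae_onI Hw Hw')) => x Vx [Ex [/structure_eqP[wN S] /structure_eqP[w'N S']]] i j mu.
have u : tau g (s x) c \in unitmx by apply: tau_unit => //; rewrite (section_proj ss Vx); exact: Vc.
have DE mu' : \matrix_(a, b) de' mu' a b x = \matrix_(a, b) de mu' a b x.
  by apply/matrixP => a b; rewrite !mxE (Ex (mu', a, b)).
have {}S' i' mu' nu' : ((\matrix_(a, b) de mu' a b x) - tau g (s x) c *m wmx w' x mu') nu' i' =
     ((\matrix_(a, b) de nu' a b x) - tau g (s x) c *m wmx w' x nu') mu' i'.
  by rewrite -!DE.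
have /matrixP/(_ i j) := structure_unique u wN w'N S S' mu.
by rewrite !mxE.
Qed.

Definition dpart c (mu : 'I_n) (f : M -> R) (x : M) : R := partial mu (f \o icoord c) (coord c x).

(** The gauge transformation A^-1 w A + A^-1 dA, combined with the change of the form index by the
    Jacobian. *)
Definition wchange c d (A : M -> 'M[R]_n) w x i j mu : R :=
  ((A x)^T *m (\sum_al jac d c x mu al *: wmx w x al) *m A x +
   (A x)^T *m \matrix_(k, l) dpart d mu (fun z => A z k l) x) i j.

Lemma dpart_smooth c W f : atlas c -> open W -> W `<=` dom c -> smooth_fun W f ->
  forall k, Ck_on k (coord c @` W) (f \o icoord c).
Proof.
by move=> ac oW Wc sf k; have := sf c ac k; rewrite setIidl.
Qed.

(** Differentiate [A^T *m A = 1]. *)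
Lemma dpart_orth c W (A : M -> 'M[R]_n) mu x : atlas c -> open W -> W `<=` dom c -> W x ->
  (forall z, W z -> SO (A z)) -> (forall i j, smooth_fun W (fun z => A z i j)) ->
  let dA := \matrix_(k, l) dpart c mu (fun z => A z k l) x in
  ((A x)^T *m dA)^T = - ((A x)^T *m dA).
Proof.
move=> ac oW Wc Wx SA sA dA; have oU : open (coord c @` W) by exact: coord_open.
have Ux : (coord c @` W) (coord c x) by exists x.
have C k l : Ck_on 1 (coord c @` W) (fun y => A (icoord c y) k l) := dpart_smooth ac oW Wc (sA k l) 1.
apply/matrixP => i j; rewrite !mxE; apply/eqP; rewrite -addr_eq0 -big_split /=; apply/eqP.
transitivity (partial mu (fun y => \sum_k A (icoord c y) k i * A (icoord c y) k j) (coord c x)).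
  rewrite (@partial_sum _ _ (coord c @` W) _ (fun k y => A (icoord c y) k i * A (icoord c y) k j))//.
    apply: eq_bigr => k _; rewrite (partialM mu (C k i) (C k j) Ux) !mxE /dpart icoordK; last exact: Wc.
    by rewrite /comp; ring.
  by move=> k; apply: (Ck_onM oU).
rewrite (@partial_ext _ _ (coord c @` W) _ (cst (i == j)%:R) mu oU)//; first by rewrite /partial derive_cst.
move=> y Wy; have [Wiy _] := coord_image Wc Wy.
have /matrixP/(_ i j) := SO_inv (SA _ Wiy); rewrite !mxE => <-.
by apply: eq_bigr => k _; rewrite mxE.
Qed.

(** The new coframe is a sum of smooth coefficients times the old coframe composed with the
    transition map, so [weak_pullback] and [weak_partialM] give its weak derivatives; the rest is
    [structure_change] at each point. *)
Lemma connection_change c d V W s s' (A : M -> 'M[R]_n) w : atlas c -> atlas d ->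
  smooth_section V s -> V `<=` dom c -> smooth_section W s' -> W `<=` V -> W `<=` dom d ->
  (forall x, W x -> SO (A x) /\ s' x = act (s x) (A x)) ->
  (forall i j, smooth_fun W (fun x => A x i j)) ->
  connection_forms g c V s w -> connection_forms g d W s' (wchange c d A w).
Proof.
move=> ac ad ss Vc ss' WV Wd HA sA [de [Hde Hw]].
have oW := section_open ss'.
have Wc : W `<=` dom c by exact: subset_trans WV Vc.
have sW := section_sub (@smooth_fun_sub _ _ _) oW WV ss.
have Wcd : W `<=` dom c `&` dom d by move=> x Wx; split; [exact: Wc|exact: Wd].
have Wdc : W `<=` dom d `&` dom c by move=> x /Wcd[].
have md := chart_meas_diffeo hdvol ad ac sW Wdc.
set U := coord d @` (W `\` sing g) in md; set U' := coord c @` (W `\` sing g) in md.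
have oU := md_oU md; have oU' := md_oV md.
have oUW : open (coord d @` W) by exact: coord_open.
have UUW : U `<=` coord d @` W by apply: image_subset => x [].
pose psi := trans d c.
pose a mu i (p : 'I_n * 'I_n) y := jacmx psi y mu p.1 * A (icoord d y) p.2 i.
pose e (p : 'I_n * 'I_n) y := coframe g c s (icoord c y) p.1 p.2.
have spsi al k : Ck_on k (coord d @` W) (fun y => psi y ord0 al) by exact: trans_smooth.
have sJ mu al k : Ck_on k (coord d @` W) (fun y => jacmx psi y mu al).
  have [_ /(_ mu)[_ C]] := spsi al k.+1.
  by apply: (Ck_on_ext oUW _ C) => y _; rewrite mxE.
have sAd k l m : Ck_on m (coord d @` W) (fun y => A (icoord d y) k l) := dpart_smooth ad oW Wd (sA k l) m.
have sa mu i p k : Ck_on k (coord d @` W) (a mu i p) by apply: (Ck_onM oUW).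
have le p : locally_integrable U' (e p).
  by have [] := coframe_regular g p.1 p.2 ac sW Wc.
have we p nu : weak_partial U nu (e p \o psi)
    (fun y => \sum_be jacmx psi y nu be * de be p.1 p.2 (icoord c (psi y))).
  apply: (weak_pullback md (h := fun be => de be p.1 p.2 \o icoord c)) => [|be]; first exact: le.
  apply: (weak_partial_sub (coordD_open ss Vc) oU' _ (Hde be p.1 p.2)).
  by apply: image_subset; exact: setSD.
have lep p : locally_integrable U (e p \o psi) := loc_int_psi md (le p).
have saU mu i p : smooth_on U (a mu i p) by move=> k; exact: Ck_on_sub (sa mu i p k).
(* The Leibniz rule for Jacobian times coframe times rotation; [p] runs over the two summation
   indices. *)
pose de'y nu mu i y := \sum_p (a mu i p y * (\sum_be jacmx psi y nu be * de be p.1 p.2 (icoord c (psi y)))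
   + partial nu (a mu i p) y * (e p \o psi) y).
have psix x : W x -> psi (coord d x) = coord c x.
  by move=> Wx; rewrite /psi /trans /= icoordK//; exact: Wd.
have e'E x mu i : W x -> tau g (s' x) d mu i = \sum_p a mu i p (coord d x) * e p (psi (coord d x)).
  move=> Wx; have [SAx ->] := HA _ Wx; have px := section_proj sW Wx.
  rewrite tau_act//; last by rewrite px; exact: Wd.
  rewrite (@tau_trans _ _ _ _ g (s x) d c)// ?px; [|exact: Wd|exact: Wc].
  rewrite mulmx3E pair_bigA /=; apply: eq_bigr => p _.
  have dx := Wd _ Wx; have cx := Wc _ Wx.
  by rewrite /a /e /coframe psix// !icoordK// jacE// mulrAC.
exists (fun nu mu i x => de'y nu mu i (coord d x)); split.
  move=> nu mu i.
  apply: (@weak_partial_ext _ _ U nu (fun y => \sum_p a mu i p y * (e p \o psi) y) _ (de'y nu mu i)) => //.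
  - move=> _ [x [Wx _] <-]; rewrite icoordK; last exact: Wd.
    by rewrite /coframe e'E.
  - by move=> _ [x [Wx _] <-]; rewrite /= icoordK//; exact: Wd.
  apply: (weak_partial_sum oU) => p.
    by apply: (loc_intM oU (lep p)); exact: Ck_on_continuous (saU mu i p 0%N).
  exact: weak_partialM.
apply: ae_on_impl (ae_on_sub WV Hw) => x Wx /structure_eqP[wN S].
apply/(structure_eqP d s' (wchange c d A w) (fun nu mu i x => de'y nu mu i (coord d x)) x).
have [SAx _] := HA _ Wx; have [AA _] := SAx.
have cx := Wc _ Wx; have dx := Wd _ Wx.
have Ux : (coord d @` W) (coord d x) by exists x.
pose J := jac d c x; pose y := coord d x.
pose Pm mu : 'M[R]_n := \matrix_(nu, al) partial mu (fun z => jacmx psi z nu al) y.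
pose dA mu : 'M[R]_n := \matrix_(k, l) dpart d mu (fun z => A z k l) x.
pose D mu : 'M[R]_n := \matrix_(a, b) de mu a b x.
have Psym mu nu al : Pm mu nu al = Pm nu mu al.
  have E mu' nu' : partial mu' (fun z => jacmx psi z nu' al) y =
      partial mu' (partial nu' (fun z => psi z ord0 al)) y.
    by apply: (@partial_ext _ _ (coord d @` W)) => // z _; rewrite mxE.
  rewrite [LHS]mxE [RHS]mxE E E.
  exact: (@schwarz _ _ (coord d @` W) (fun z => psi z ord0 al) nu mu y oUW Ux (spsi al 2%N)).
have dAN mu : ((A x)^T *m dA mu)^T = - ((A x)^T *m dA mu).
  by apply: (@dpart_orth d W) => // z /HA[].
have [w'N S'] := @structure_change _ _ (tau g (s x) c) D (wmx w x) (A x) J Pm dA wN AA dAN Psym S.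
have E' : tau g (s' x) d = J *m tau g (s x) c *m A x.
  have [_ ->] := HA _ Wx; have px := section_proj sW Wx.
  by rewrite tau_act ?px// (@tau_trans _ _ _ _ g (s x) d c) ?px.
have W' mu : wmx (wchange c d A w) x mu =
    (A x)^T *m (\sum_b J mu b *: wmx w x b) *m A x + (A x)^T *m dA mu.
  by apply/matrixP => i j; rewrite mxE.
have D' mu : \matrix_(a, b) de'y mu a b (coord d x) =
    J *m (\sum_b J mu b *: D b) *m A x + Pm mu *m tau g (s x) c *m A x + J *m tau g (s x) c *m dA mu.
  apply/matrixP => nu i; rewrite [LHS]mxE [RHS]mxE [X in _ = X + _]mxE !mulmx3E !pair_bigA /= -!big_split /=.
  rewrite /de'y; apply: eq_bigr => p _.
  have JE al be : jacmx psi (coord d x) al be = J al be by rewrite /J jacE.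
  rewrite (partialM mu (sJ nu p.1 1%N) (sAd p.2 i 1%N) Ux) /a /e /coframe /= psix// !icoordK//.
  rewrite !JE; have -> : \sum_be jacmx psi (coord d x) mu be * de be p.1 p.2 x = (\sum_b J mu b *: D b) p.1 p.2.
    by rewrite summxE; apply: eq_bigr => b _; rewrite JE [RHS]mxE [D b _ _]mxE.
  rewrite [Pm mu _ _]mxE [dA mu _ _]mxE /dpart -/y.
  by rewrite -/psi /comp; ring.
split=> [mu|i mu nu]; first by rewrite W'.
by rewrite E' !W' !D'; exact: S'.
Qed.

End connections.
(** * Spinors under changes of chart and frame *)

Section complex_partials.
Variables (R : realType) (n : nat) (M : manifold R n).
Implicit Types (V W : set M) (c d : chart R n M) (u v : M -> R[i]).

Lemma cpartial_ext c W u v mu x : open W -> W `<=` dom c -> W x -> (forall z, W z -> u z = v z) ->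
  cpartial c mu u x = cpartial c mu v x.
Proof.
move=> oW Wc Wx uv; have oU : open (coord c @` W) by exact: coord_open.
have Ux : (coord c @` W) (coord c x) by exists x.
by congr Complex; apply: (@partial_ext _ _ (coord c @` W)) => // y /(coord_image Wc)[Wy _]; rewrite uv.
Qed.

Section rules.
Variables (c : chart R n M) (W : set M) (x : M) (mu : 'I_n).
Hypotheses (ac : atlas c) (oW : open W) (Wc : W `<=` dom c) (Wx : W x).
Let oU : open (coord c @` W). Proof. exact: coord_open. Qed.
Let Ux : (coord c @` W) (coord c x). Proof. by exists x. Qed.
Let C1 (f : M -> R) : smooth_fun W f -> Ck_on 1 (coord c @` W) (f \o icoord c).
Proof. by move=> sf; exact: dpart_smooth. Qed.

Lemma dpartM f h : smooth_fun W f -> smooth_fun W h ->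
  dpart c mu (fun z => f z * h z) x = dpart c mu f x * h x + f x * dpart c mu h x.
Proof.
move=> sf sh; have := partialM mu (C1 sf) (C1 sh) Ux.
by rewrite /dpart /= icoordK//; exact: Wc.
Qed.

Lemma dpartD f h : smooth_fun W f -> smooth_fun W h ->
  dpart c mu (fun z => f z + h z) x = dpart c mu f x + dpart c mu h x.
Proof.
move=> sf sh; rewrite /dpart /partial.
have [_ /(_ mu)[df _]] := C1 sf; have [_ /(_ mu)[dh _]] := C1 sh.
by apply: deriveD; [apply: df|apply: dh]; rewrite inE.
Qed.

Lemma cpartialE u : cpartial c mu u x =
  Complex (dpart c mu (fun z => complex.Re (u z)) x) (dpart c mu (fun z => complex.Im (u z)) x).
Proof. by []. Qed.

Lemma dpart_ext f h : (forall z, f z = h z) -> dpart c mu f x = dpart c mu h x.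
Proof. by move=> fh; congr (dpart c mu _ x); apply/funext. Qed.

Lemma dpartN f : smooth_fun W f -> dpart c mu (fun z => - f z) x = - dpart c mu f x.
Proof.
move=> sf; rewrite /dpart /partial; have [_ /(_ mu)[df _]] := C1 sf.
by apply: deriveN; apply: df; rewrite inE.
Qed.

Lemma cpartialM u v : smooth_cfun W u -> smooth_cfun W v ->
  cpartial c mu (fun z => u z * v z) x = cpartial c mu u x * v x + u x * cpartial c mu v x.
Proof.
move=> [u1 u2] [v1 v2]; rewrite !cpartialE.
rewrite (@dpart_ext _ (fun z => complex.Re (u z) * complex.Re (v z) + (-1) * (complex.Im (u z) * complex.Im (v z)))); last first.
  by move=> z; case: (u z) (v z) => ? ? [? ?] /=; rewrite mulN1r.
rewrite (@dpart_ext (fun z => complex.Im (u z * v z)) (fun z => complex.Re (u z) * complex.Im (v z) + complex.Im (u z) * complex.Re (v z))); last first.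
  by move=> z; case: (u z) (v z) => ? ? [? ?].
have c1 : smooth_fun W (cst (-1) : M -> R) by exact: smooth_fun_cst.
have d0 : dpart c mu (cst (-1) : M -> R) x = 0 by rewrite /dpart /partial derive_cst.
rewrite !dpartD; try by [|do ?[apply: smooth_funM => //]].
rewrite (dpartM c1); last exact: smooth_funM.
rewrite !dpartM// d0.
case: (u x) (v x) => u1x u2x [v1x v2x] /=.
by apply/eqP; rewrite eq_complex /=; apply/andP; split; apply/eqP; ring.
Qed.

Lemma cpartialD u v : smooth_cfun W u -> smooth_cfun W v ->
  cpartial c mu (fun z => u z + v z) x = cpartial c mu u x + cpartial c mu v x.
Proof.
move=> [u1 u2] [v1 v2]; rewrite !cpartialE.
rewrite (@dpart_ext _ (fun z => complex.Re (u z) + complex.Re (v z))); last first.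
  by move=> z; case: (u z) (v z) => ? ? [? ?].
rewrite (@dpart_ext (fun z => complex.Im (u z + v z)) (fun z => complex.Im (u z) + complex.Im (v z))); last first.
  by move=> z; case: (u z) (v z) => ? ? [? ?].
by rewrite !dpartD.
Qed.

Lemma cpartial_cst (a : R[i]) : cpartial c mu (cst a) x = 0.
Proof. by rewrite /cpartial /partial !derive_cst. Qed.

Lemma cpartial_conj u : smooth_cfun W u -> cpartial c mu (fun z => conjc (u z)) x = conjc (cpartial c mu u x).
Proof.
move=> [_ su]; rewrite !cpartialE /= (@dpart_ext (fun z => complex.Im (conjc (u z))) (fun z => - complex.Im (u z))).
  by rewrite dpartN//; congr Complex; apply: dpart_ext => z; case: (u z).
by move=> z; case: (u z).
Qed.

Lemma cpartial_real f : cpartial c mu (fun z => real_complex R (f z)) x = real_complex R (dpart c mu f x).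
Proof. by rewrite /cpartial /=; congr Complex; rewrite /partial derive_cst. Qed.

Lemma cpartial_sum (I : finType) (F : I -> M -> R[i]) : (forall i, smooth_cfun W (F i)) ->
  cpartial c mu (fun z => \sum_i F i z) x = \sum_i cpartial c mu (F i) x.
Proof.
move=> sF; elim: (index_enum I) => [|i r IH].
  rewrite big_nil -[RHS](cpartial_cst 0); congr (cpartial c mu _ x).
  by apply/funext => z; rewrite big_nil.
rewrite big_cons -IH -cpartialD//; last exact: smooth_cfun_sum.
by congr (cpartial c mu _ x); apply/funext => z; rewrite big_cons.
Qed.

Definition dmx m p (F : M -> 'M[R[i]]_(m, p)) : 'M[R[i]]_(m, p) :=
  \matrix_(i, j) cpartial c mu (fun z => F z i j) x.

Definition smooth_mx m p (F : M -> 'M[R[i]]_(m, p)) := forall i j, smooth_cfun W (fun z => F z i j).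

Lemma dmxM m p q (F : M -> 'M[R[i]]_(m, p)) (H : M -> 'M[R[i]]_(p, q)) :
  smooth_mx F -> smooth_mx H -> dmx (fun z => F z *m H z) = dmx F *m H x + F x *m dmx H.
Proof.
move=> sF sH; apply/matrixP => i j; rewrite !mxE -big_split /=.
rewrite (_ : (fun z => (F z *m H z) i j) = fun z => \sum_k F z i k * H z k j).
  rewrite cpartial_sum; last by move=> k; exact: smooth_cfunM.
  by apply: eq_bigr => k _; rewrite cpartialM// !mxE.
by apply/funext => z; rewrite mxE.
Qed.

Lemma dmx_cst m p (A : 'M[R[i]]_(m, p)) : dmx (fun=> A) = 0.
Proof. by apply/matrixP => i j; rewrite !mxE cpartial_cst. Qed.

Lemma smooth_mx_cst m p (A : 'M[R[i]]_(m, p)) : smooth_mx (fun=> A).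
Proof. by move=> i j; exact: smooth_cfun_cst. Qed.

Lemma smooth_mxM m p q (F : M -> 'M[R[i]]_(m, p)) (H : M -> 'M[R[i]]_(p, q)) :
  smooth_mx F -> smooth_mx H -> smooth_mx (fun z => F z *m H z).
Proof. by move=> sF sH; exact: smooth_cfun_mulmx. Qed.

Lemma smooth_mx_adj m p (F : M -> 'M[R[i]]_(m, p)) : smooth_mx F -> smooth_mx (fun z => adjmx (@conjc R) (F z)).
Proof.
move=> sF i j; apply: (smooth_cfun_ext oW _ (smooth_cfun_conj oW (sF j i))) => z _.
by rewrite !mxE.
Qed.

Lemma dmx_adj m p (F : M -> 'M[R[i]]_(m, p)) : smooth_mx F -> dmx (fun z => adjmx (@conjc R) (F z)) = adjmx (@conjc R) (dmx F).
Proof.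
move=> sF; apply/matrixP => i j; transitivity (conjc (cpartial c mu (fun z => F z j i) x)).
  rewrite mxE -(cpartial_conj (sF j i)); congr (cpartial c mu _ x).
  by apply/funext => z; rewrite !mxE.
by rewrite !mxE.
Qed.

Lemma dmx_ext m p (F H : M -> 'M[R[i]]_(m, p)) : (forall z, W z -> F z = H z) -> dmx F = dmx H.
Proof.
by move=> FH; apply/matrixP => i j; rewrite !mxE; apply: (cpartial_ext _ oW) => // z /FH ->.
Qed.

Lemma dmx_tr m (F : M -> 'M[R[i]]_m) : smooth_mx F ->
  \tr (dmx F) = cpartial c mu (fun z => \tr (F z)) x.
Proof.
move=> sF; rewrite /mxtrace cpartial_sum//.
by apply: eq_bigr => i _; rewrite mxE.
Qed.

End rules.

Lemma cpartial_change c d W u mu x : atlas c -> atlas d -> open W -> W `<=` dom c `&` dom d -> W x ->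
  smooth_cfun W u ->
  cpartial d mu u x = \sum_al real_complex R (jac d c x mu al) * cpartial c al u x.
Proof.
move=> ac ad oW Wcd Wx [s1 s2].
have Wc : W `<=` dom c by move=> z /Wcd[].
have Wd : W `<=` dom d by move=> z /Wcd[].
have cx := Wc _ Wx; have dx := Wd _ Wx.
have E f : smooth_fun W f -> dpart d mu f x = \sum_al jac d c x mu al * dpart c al f x.
  move=> sf; have Wdc : W `<=` dom d `&` dom c by move=> z /Wcd[].
  have oU : open (coord d @` W) by exact: coord_open.
  have oU' : open (coord c @` W) by exact: coord_open.
  have Ux : (coord d @` W) (coord d x) by exists x.
  have Ux' : (coord c @` W) (trans d c (coord d x)) by exact: trans_image Ux.
  have [_ H] := partial_comp mu oU oU' (fun a => trans_smooth a ad ac Wdc 1) (dpart_smooth ac oW Wc sf 1) Ux Ux'.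
  have Efc y : (coord d @` W) y -> (f \o icoord d) y = ((f \o icoord c) \o trans d c) y.
    by move=> Uy; have [Wy _] := coord_image Wd Uy; rewrite /trans /= icoordK//; exact: Wc.
  have := partial_ext mu oU Efc Ux; rewrite /dpart => ->; rewrite H.
  apply: eq_bigr => al _; rewrite jacE// mxE; congr (_ * _).
  by rewrite /trans /= icoordK.
rewrite !cpartialE !E//; apply/eqP; rewrite eq_complex !raddf_sum /=.
by apply/andP; split; apply/eqP; apply: eq_bigr => al _ /=; rewrite mul0r ?subr0 ?addr0.
Qed.

End complex_partials.

Section spin_sections.
Variables (R : realType) (n : nat) (gamma : 'I_n -> 'M[R[i]]_(spinor_dim n)).
Hypothesis hgamma : is_clifford gamma.
Variables (M : manifold R n) (P : SO_reduction M) (S : spin_structure gamma P).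
Implicit Types (V W : set M) (s : M -> S) (c d : chart R n M).
Local Notation adj := (adjmx (@conjc R)).
Local Notation rC := (real_complex R).

Lemma bundle_open V s : smooth_section V s -> open V. Proof. by case. Qed.
Lemma bundle_proj V s x : smooth_section V s -> V x -> proj (s x) = x.
Proof. by case=> _ H _; exact: H. Qed.

Lemma spin_compare V V' (s s' : M -> S) : smooth_section V s -> smooth_section V' s' ->
  exists A : M -> 'M[R[i]]_(spinor_dim n),
    (forall x, V x -> V' x -> Spin gamma (A x) /\ s' x = act (s x) (A x)) /\
    forall i j, smooth_cfun (V `&` V') (fun x => A x i j).
Proof.
apply: (compare_sections (@smooth_cfun_sub _ _ _) (inv := fun m => adj m)).
- exact: Spin_inv.
- exact: Spin_mul.
- exact: smooth_cfun_local.
- exact: smooth_cfun_ext.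
- move=> W g h oW sg sh; apply: smooth_cfun_mulmx => // i j.
  by apply: (smooth_cfun_ext oW _ (smooth_cfun_conj oW (sg j i))) => x _; rewrite !mxE.
Qed.

Lemma proj_cov (p : S) : proj (cov p) = proj p. Proof. by case: S p => ? ? H ? ? p; exact: H. Qed.
Lemma cov_act (p : S) t A : Spin gamma t -> SO A -> spin_covers gamma t A -> cov (act p t) = act (cov p) A.
Proof. by case: S p t A => ? ? ? H ? p t A; exact: H. Qed.
Lemma cov_section V s : smooth_section V s -> smooth_section V (@cov _ _ _ _ _ S \o s).
Proof. by case: S V s => ? ? ? ? H V s; exact: H. Qed.

(** The rotation covered by [t x] also relates the projected sections, so it is [A x] by freeness.
    This makes the covered rotation depend smoothly on [x]. *)
Lemma spin_compare_cov V V' (s s' : M -> S) : smooth_section V s -> smooth_section V' s' ->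
  exists t A, [/\ forall x, V x -> V' x ->
      [/\ Spin gamma (t x), s' x = act (s x) (t x), SO (A x), spin_covers gamma (t x) (A x) &
          cov (s' x) = act (cov (s x)) (A x)],
    forall i j, smooth_cfun (V `&` V') (fun x => t x i j) &
    forall i j, smooth_fun (V `&` V') (fun x => A x i j)].
Proof.
move=> ss ss'; have [t [Ht st]] := spin_compare ss ss'.
have [A [HA sA]] := so_compare (cov_section ss) (cov_section ss').
exists t, A; split => // x Vx V'x; have [Stx E] := Ht _ Vx V'x; have [SAx EA] := HA _ Vx V'x.
split => //; have [A' SA' cA'] := Spin_covers hgamma Stx.
have E' : cov (s' x) = act (cov (s x)) A' by rewrite E (cov_act _ Stx SA' cA').
have [|B [_ HB]] := @act_unique _ _ _ _ _ _ _ P (cov (s x)) (cov (s' x)).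
  by rewrite !proj_cov (bundle_proj ss Vx) (bundle_proj ss' V'x).
have BA' : B = A' by apply: HB.
have BA : B = A x by apply: HB.
by rewrite -BA BA'.
Qed.

Lemma covers_adj t A k : Spin gamma t -> SO A -> spin_covers gamma t A ->
  adj t *m gamma k *m t = rot (rc R) gamma A^T k.
Proof.
move=> St SA cv; have tt := Spin_inv hgamma St; have [AA _] := SA.
have E : gamma k = \sum_j rC (A k j) *: rot (rc R) gamma A j.
  rewrite /rot; under eq_bigr do rewrite scaler_sumr.
  rewrite exchange_big /= (bigD1 k)//= [X in _ + X]big1 ?addr0 => [|i ik].
    under eq_bigr do rewrite scalerA -rmorphM.
    rewrite -scaler_suml -rmorph_sum.
    have /matrixP/(_ k k) := AA; rewrite !mxE eqxx => H.
    have -> : \sum_j A k j * A k j = 1 by apply: etrans H; apply: eq_bigr => j _; rewrite mxE.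
    by rewrite rmorph1 scale1r.
  under eq_bigr do rewrite scalerA -rmorphM.
  rewrite -scaler_suml -rmorph_sum.
  have /matrixP/(_ k i) := AA; rewrite !mxE eq_sym (negbTE ik) => H.
  have -> : \sum_j A k j * A i j = 0 by apply: etrans H; apply: eq_bigr => j _; rewrite mxE.
  by rewrite rmorph0 scale0r.
rewrite {1}E mulmx_sumr mulmx_suml; apply: eq_bigr => j _; rewrite mxE.
rewrite -scalemxAr -scalemxAl; congr (_ *: _).
by rewrite -mulmxA /rot -cv mulmxA tt mul1mx.
Qed.

(** The logarithmic derivative of a lift of [A] to Spin(n) is the image of [A^-1 dA] under the spin
    representation. The hypotheses of [spin_rigidity] are obtained by differentiating identities:
    unitarity, the covering relation, and the trace properties of Spin(n). *)
Lemma spin_derivative d W (t : M -> 'M[R[i]]_(spinor_dim n)) (A : M -> 'M[R]_n) mu x :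
  atlas d -> open W -> W `<=` dom d -> W x ->
  (forall z, W z -> [/\ Spin gamma (t z), SO (A z) & spin_covers gamma (t z) (A z)]) ->
  smooth_mx W t -> (forall i j, smooth_fun W (fun z => A z i j)) ->
  let B := (A x)^T *m \matrix_(k, l) dpart d mu (fun z => A z k l) x in
  adj (t x) *m dmx d x mu t = 4^-1 *: \sum_a \sum_b rC (B a b) *: (gamma a *m gamma b).
Proof.
move=> ad oW Wd Wx H st sA B.
have [Stx SAx cvx] := H _ Wx; have tt := Spin_inv hgamma Stx.
pose dA : 'M[R]_n := \matrix_(k, l) dpart d mu (fun z => A z k l) x.
have BN : B^T = - B by apply: (dpart_orth mu ad oW Wd Wx) => // z /H[].
have cT := @smooth_mx_cst _ _ M W.
apply: (spin_rigidity (rc := rc R) (cj := cj R) (@conjc_rc R) (@conjc_gt0 R) (cliffordE hgamma)).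
- by move=> a b; have /matrixP/(_ b a) := BN; rewrite !mxE.
- have : dmx d x mu (fun z => adj (t z) *m t z) = 0.
    rewrite (dmx_ext mu oW Wd Wx (H := fun=> 1%:M)) ?dmx_cst// => z Wz.
    by have [Stz _ _] := H _ Wz; exact: (Spin_inv hgamma Stz).
  rewrite (dmxM mu ad oW Wd Wx)//; last exact: smooth_mx_adj.
  rewrite (dmx_adj mu ad oW Wd Wx st) => /eqP; rewrite addrC addr_eq0 => /eqP E.
  by rewrite adjmxM (adjmxK (@conjcK R)) E opprK.
- move=> j.
  have : dmx d x mu (fun z => t z *m gamma j) = dmx d x mu (fun z => rot (rc R) gamma (A z) j *m t z).
    by apply: (dmx_ext mu oW Wd Wx) => z Wz; have [_ _ ->] := H _ Wz.
  have srot : smooth_mx W (fun z => rot (rc R) gamma (A z) j).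
    move=> k l; apply: (@smooth_cfun_ext _ _ _ W (fun z => \sum_i rC (A z i j) * gamma i k l)) => // [z _|].
      by rewrite summxE; apply: eq_bigr => i _; rewrite [RHS]mxE.
    apply: smooth_cfun_sum => // i; apply: smooth_cfunM => //; last exact: smooth_cfun_cst.
    exact: smooth_cfun_real.
  rewrite (dmxM mu ad oW Wd Wx st (cT _ _ _)).
  rewrite dmx_cst mulmx0 addr0 (dmxM mu ad oW Wd Wx)//.
  have -> : dmx d x mu (fun z => rot (rc R) gamma (A z) j) = rot (rc R) gamma dA j.
    apply/matrixP => k l; rewrite mxE summxE.
    rewrite (_ : (fun z => _) = (fun z => \sum_i rC (A z i j) * gamma i k l)); last first.
      by apply/funext => z; rewrite summxE; apply: eq_bigr => i _; rewrite mxE.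
    rewrite (cpartial_sum mu ad oW Wd Wx); last first.
      move=> i; apply: smooth_cfunM => //; last exact: smooth_cfun_cst.
      exact: smooth_cfun_real.
    apply: eq_bigr => i _; rewrite (cpartialM mu ad oW Wd Wx); [|exact: smooth_cfun_real|exact: smooth_cfun_cst].
    by rewrite cpartial_cst mulr0 addr0 cpartial_real [RHS]mxE /dA mxE.
  move=> E.
  have adjcv : gamma j *m adj (t x) = adj (t x) *m rot (rc R) gamma (A x) j.
    have cv : t x *m gamma j = rot (rc R) gamma (A x) j *m t x := cvx j.
    have hg : adj (gamma j) = gamma j := hgamma.1 j.
    have hr : adj (rot (rc R) gamma (A x) j) = rot (rc R) gamma (A x) j.
      by have [+ _] := rot_clifford (@conjc_rc R) (cliffordE hgamma) (SO_inv SAx); exact.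
    by have := congr1 (fun m => adj m) cv; rewrite /= !adjmxM hg hr.
  rewrite -mulmxA E mulmxDr !mulmxA -adjcv addrK.
  rewrite /rot mulmx_sumr mulmx_suml.
  under eq_bigr => i _.
    rewrite -scalemxAr -scalemxAl (covers_adj i Stx SAx cvx) /rot scaler_sumr.
    over.
  rewrite exchange_big /=; apply: eq_bigr => k _.
  rewrite mxE rmorph_sum scaler_suml; apply: eq_bigr => i _.
  by rewrite scalerA -rmorphM mulrC /dA !mxE.
(* With the first factor frozen at [x], the product stays in Spin(n) for all [z], where traces are
   real; so is the derivative of the trace. *)
- have sT : smooth_mx W (fun z => adj (t x) *m t z) by apply: smooth_mxM => //; apply: cT.
  have E : adj (t x) *m dmx d x mu t = dmx d x mu (fun z => adj (t x) *m t z).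
    by rewrite (dmxM mu ad oW Wd Wx (cT _ _ _) st) dmx_cst mul0mx add0r.
  have sTr : smooth_cfun W (fun z => \tr (adj (t x) *m t z)).
    by apply: smooth_cfun_sum => // i; exact: sT.
  rewrite E (dmx_tr mu ad oW Wd Wx sT) -[LHS](cpartial_conj mu ad oW Wd Wx sTr).
  apply: (cpartial_ext mu oW) => // z Wz; have [Stz _ _] := H _ Wz.
  have := Spin_mul (Spin_adj hgamma Stx) Stz.
  apply: (@Spin_ind _ _ _ (fun m => conjc (\tr m) = \tr m)).
  + by rewrite mxtrace0 conjc0.
  + by move=> m p Em Ep; rewrite !mxtraceD rmorphD /= Em Ep.
  + by move=> a m Em; rewrite !mxtraceZ (rmorphM (cj R)) -[X in _ * X = _]/(conjc _) Em [X in X * _]conjc_rc.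
  + by move=> q eq; exact: (tr_gprod_real (cj := cj R) (cliffordE hgamma) eq).
- move=> Y Yg Y0.
  have sT : smooth_mx W (fun z => Y *m adj (t x) *m t z) by apply: smooth_mxM => //; apply: cT.
  have E : Y *m (adj (t x) *m dmx d x mu t) = dmx d x mu (fun z => Y *m adj (t x) *m t z).
    by rewrite (dmxM mu ad oW Wd Wx (cT _ _ _) st) dmx_cst mul0mx add0r mulmxA.
  rewrite E (dmx_tr mu ad oW Wd Wx sT) -[RHS](cpartial_cst d x mu 0).
  apply: (cpartial_ext mu oW) => // z Wz; have [Stz _ _] := H _ Wz.
  rewrite /cst -mulmxA; have := Spin_mul (Spin_adj hgamma Stx) Stz.
  apply: (@Spin_ind _ _ _ (fun m => \tr (Y *m m) = 0)).
  + by rewrite mulmx0 mxtrace0.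
  + by move=> m p Em Ep; rewrite mulmxDr mxtraceD Em Ep addr0.
  + by move=> a m Em; rewrite -scalemxAr mxtraceZ Em mulr0.
  + by move=> q eq; exact: (tr_gprod_comm (cj := cj R) (cliffordE hgamma) Yg Y0 eq).
Qed.

End spin_sections.

(** * The spin representation of so(n) and the quadratic form in coordinates *)

Section quadratic_gamma.
Variables (C : numFieldType) (R : realFieldType) (rc : {rmorphism R -> C}) (n N : nat).
Implicit Types (g : 'I_n -> 'M[C]_N) (A X Y : 'M[R]_n).

(** On antisymmetric [X], the spin representation of so(n). *)
Definition gg2 g X : 'M[C]_N := 4^-1 *: \sum_a \sum_b rc (X a b) *: (g a *m g b).

Lemma gg2D g X Y : gg2 g (X + Y) = gg2 g X + gg2 g Y.
Proof.
rewrite /gg2 -scalerDr -big_split /=; congr (_ *: _); apply: eq_bigr => a _.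
by rewrite -big_split /=; apply: eq_bigr => b _; rewrite mxE rmorphD scalerDl.
Qed.

Lemma gg2_sum g (I : finType) (k : I -> R) (X : I -> 'M[R]_n) :
  gg2 g (\sum_i k i *: X i) = \sum_i rc (k i) *: gg2 g (X i).
Proof.
rewrite /gg2; under [RHS]eq_bigr do rewrite scalerA mulrC -scalerA.
rewrite -scaler_sumr; congr (_ *: _).
under [RHS]eq_bigr do rewrite scaler_sumr.
rewrite [RHS]exchange_big /=; apply: eq_bigr => a _.
under [RHS]eq_bigr do rewrite scaler_sumr.
rewrite [RHS]exchange_big /=; apply: eq_bigr => b _.
rewrite summxE rmorph_sum scaler_suml; apply: eq_bigr => i _.
by rewrite mxE rmorphM scalerA.
Qed.

Lemma gg2_rot g A X : 4^-1 *: \sum_a \sum_b rc (X a b) *: (rot rc g A a *m rot rc g A b) =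
  gg2 g (A *m X *m A^T).
Proof.
rewrite /gg2; congr (_ *: _).
transitivity (\sum_a \sum_b \sum_j \sum_k rc (A j a * X a b * A^T b k) *: (g j *m g k)).
  apply: eq_bigr => a _; apply: eq_bigr => b _; rewrite /rot mulmx_suml scaler_sumr.
  apply: eq_bigr => j _; rewrite mulmx_sumr scaler_sumr; apply: eq_bigr => k _.
  by rewrite -scalemxAl -scalemxAr !scalerA -!rmorphM mxE; congr (rc _ *: _); ring.
under eq_bigr do rewrite exchange_big /=.
rewrite exchange_big /=; apply: eq_bigr => j _.
under eq_bigr do rewrite exchange_big /=.
rewrite exchange_big /=; apply: eq_bigr => k _.
rewrite mulmx3E rmorph_sum scaler_suml; apply: eq_bigr => a _.
by rewrite rmorph_sum scaler_suml.
Qed.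

Lemma gg2_conj g A X (U V : 'M[C]_N) : U *m V = 1%:M -> (forall k, V *m g k *m U = rot rc g A k) ->
  V *m gg2 g X *m U = gg2 g (A *m X *m A^T).
Proof.
move=> UV H; rewrite -gg2_rot /gg2 -scalemxAr -scalemxAl; congr (_ *: _).
rewrite mulmx_sumr mulmx_suml; apply: eq_bigr => a _.
rewrite mulmx_sumr mulmx_suml; apply: eq_bigr => b _.
rewrite -scalemxAr -scalemxAl -!H; congr (_ *: _).
by rewrite !mulmxA -[V *m g a *m U *m V]mulmxA UV mulmx1.
Qed.

Lemma gg2_frame g A X Y : gg2 g (A *m X *m A^T + Y) = gg2 (rot rc g A) X + gg2 g Y.
Proof. by rewrite gg2D -gg2_rot. Qed.

(** [I] and [I'] are dual frames, [J] the Jacobian, [B] the rotation: covectors that transform by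
    [J] have frame components that transform by [B]. *)
Lemma frame_transfer (U : 'M[C]_N) (J I' I B : 'M[R]_n) (v v' : 'I_n -> 'cV[C]_N) a :
  (forall mu, v' mu = U *m \sum_al rc (J mu al) *: v al) -> I' *m J = B *m I ->
  \sum_mu rc (I' a mu) *: v' mu = \sum_k rc (B a k) *: (U *m \sum_al rc (I k al) *: v al).
Proof.
move=> Hv HI; under eq_bigr do rewrite Hv mulmx_sumr scaler_sumr.
rewrite exchange_big /=.
transitivity (\sum_al rc ((I' *m J) a al) *: (U *m v al)).
  apply: eq_bigr => al _; rewrite mxE rmorph_sum scaler_suml; apply: eq_bigr => mu _.
  by rewrite -scalemxAr scalerA -rmorphM.
rewrite HI; under [RHS]eq_bigr do rewrite mulmx_sumr scaler_sumr.
rewrite [RHS]exchange_big /=; apply: eq_bigr => al _.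
rewrite mxE rmorph_sum scaler_suml; apply: eq_bigr => k _.
by rewrite -scalemxAr scalerA -rmorphM.
Qed.

Variables (cj : {rmorphism C -> C}) (cj_rc : forall x, cj (rc x) = rc x).
Local Notation adj := (adjmx cj).

Lemma quad_ext g (p p' q q' : 'I_n -> 'cV[C]_N) : (forall a, p a = p' a) -> (forall a, q a = q' a) ->
  quad cj g p q = quad cj g p' q'.
Proof. by move=> /funext -> /funext ->. Qed.

Lemma quad_frame g (I : 'M[R]_n) (v u : 'I_n -> 'cV[C]_N) : clifford cj g ->
  quad cj g (fun a => \sum_mu rc (I a mu) *: v mu) (fun a => \sum_mu rc (I a mu) *: u mu) =
  \sum_mu \sum_nu adj (v mu) *m (\sum_a \sum_b rc (I a mu * I b nu) *: G2 g a b) *m u nu.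
Proof.
move=> cg; rewrite (quadE _ _ cg).
transitivity (\sum_a \sum_b \sum_mu \sum_nu rc (I a mu * I b nu) *:
   (adj (v mu) *m G2 g a b *m u nu)).
  apply: eq_bigr => a _; apply: eq_bigr => b _.
  rewrite adjmx_sum !mulmx_suml; apply: eq_bigr => mu _.
  rewrite mulmx_sumr; apply: eq_bigr => nu _.
  by rewrite adjmxZ cj_rc -!scalemxAl -scalemxAr scalerA rmorphM.
under eq_bigr do rewrite exchange_big /=.
rewrite exchange_big /=; apply: eq_bigr => mu _.
under eq_bigr do rewrite exchange_big /=.
rewrite exchange_big /=; apply: eq_bigr => nu _.
rewrite mulmx_sumr mulmx_suml; apply: eq_bigr => a _.
rewrite mulmx_sumr mulmx_suml; apply: eq_bigr => b _.
by rewrite -scalemxAr -scalemxAl.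
Qed.

End quadratic_gamma.

Lemma invmx_change (F : fieldType) n (E E' J J' A : 'M[F]_n) : E' = J *m E *m A -> E \in unitmx ->
  J *m J' = 1%:M -> A^T *m A = 1%:M -> invmx E' *m J = A^T *m invmx E.
Proof.
move=> E'E uE JJ AA.
have I1 : (A^T *m invmx E *m J') *m E' = 1%:M.
  rewrite E'E !mulmxA -[_ *m J' *m J]mulmxA (mulmx1C JJ) mulmx1.
  by rewrite -[_ *m invmx E *m E]mulmxA mulVmx// mulmx1.
have u' : E' \in unitmx by have [] := mulmx1_unit I1.
have -> : invmx E' = A^T *m invmx E *m J' by rewrite -[LHS]mul1mx -I1 mulmxK.
by rewrite -[LHS]mulmxA (mulmx1C JJ) mulmx1.
Qed.

Lemma invmx_mul_unit (F : fieldType) n (E A : 'M[F]_n) : E \in unitmx -> A \in unitmx ->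
  invmx E = A *m invmx (E *m A).
Proof. move=> uE uA; have uEA : E *m A \in unitmx by rewrite unitmx_mul uE.
by rewrite -[LHS]mulmx1 -(mulmxV uEA) -mulmxA mulKmx. Qed.

Section dirac_change.
Variables (R : realType) (n : nat) (gamma : 'I_n -> 'M[R[i]]_(spinor_dim n)).
Hypothesis hgamma : is_clifford gamma.
Variables (M : manifold R n) (P : SO_reduction M) (S : spin_structure gamma P).
Variable g : singular_metric P.
Implicit Types (V W : set M) (s : M -> S) (c d : chart R n M).
Implicit Types (w : M -> 'I_n -> 'I_n -> 'I_n -> R) (x : M).
Local Notation adj := (adjmx (@conjc R)).
Local Notation rC := (real_complex R).
Local Notation gg2 := (gg2 (rc R)).
Local Notation rot := (rot (rc R)).

Definition wanti w x := forall mu, (wmx w x mu)^T = - wmx w x mu.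

(** Antisymmetry of [w] turns 1/8 of the commutators into 1/4 of the products. *)
Lemma nabla_coordE c s w psi mu x : wanti w x ->
  nabla_coord c s w psi mu x =
  dmx c x mu (fun z => psi (s z)) + gg2 gamma (wmx w x mu) *m psi (s x).
Proof.
move=> wN; rewrite /nabla_coord; congr (_ + _).
  by apply/matrixP => i j; rewrite [j]ord1 !mxE.
rewrite /gg2 -scalemxAl mulmx_suml.
have E2 : 8%:R^-1 = 4^-1 * 2^-1 :> R[i] by rewrite -invfM -natrM.
rewrite E2 -scalerA; congr (_ *: _).
transitivity (2^-1 *: (2 *: \sum_j \sum_k rC (w x j k mu) *: (gamma j *m gamma k *m psi (s x)))); last first.
  rewrite scalerA mulVf ?pnatr_eq0// scale1r; apply: eq_bigr => a _; rewrite mulmx_suml.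
  by apply: eq_bigr => b _; rewrite mxE scalemxAl.
congr (_ *: _); rewrite scaler_nat mulr2n [X in _ = _ + X]exchange_big -big_split /=.
apply: eq_bigr => j _; rewrite -big_split /=; apply: eq_bigr => k _.
have -> : w x k j mu = - w x j k mu by have /matrixP/(_ j k) := wN mu; rewrite !mxE.
by rewrite mulmxBl scalerBr rmorphN scaleNr.
Qed.

Lemma compact_spinor_smooth psi V s : compact_spinor psi -> smooth_section V s ->
  smooth_mx V (fun z => psi (s z)).
Proof. by move=> [_ H _] ss i j; rewrite ord1; exact: H. Qed.

Lemma spinor_act psi (p : S) t : compact_spinor psi -> Spin gamma t -> psi (act p t) = adj t *m psi p.
Proof.
move=> [H _ _] St; rewrite -(H p t St) mulmxA.
by rewrite (Spin_inv hgamma St) mul1mx.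
Qed.

Definition spin_change W s s' (t : M -> 'M[R[i]]_(spinor_dim n)) (A : M -> 'M[R]_n) :=
  [/\ forall z, W z -> [/\ Spin gamma (t z), s' z = act (s z) (t z), SO (A z) &
      spin_covers gamma (t z) (A z)],
    smooth_mx W t & forall i j, smooth_fun W (fun z => A z i j)].

Lemma dmx_change c d W m p (F : M -> 'M[R[i]]_(m, p)) mu x : atlas c -> atlas d -> open W ->
  W `<=` dom c `&` dom d -> W x -> smooth_mx W F ->
  dmx d x mu F = \sum_al rC (jac d c x mu al) *: dmx c x al F.
Proof.
move=> ac ad oW Wcd Wx sF; apply/matrixP => i j; rewrite summxE mxE.
rewrite (cpartial_change mu ac ad oW Wcd Wx (sF i j)).
by apply: eq_bigr => al _; rewrite !mxE.
Qed.

(** Covariance: the derivative of [adj t] applied to the spinor is cancelled by the inhomogeneous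
    term of [w'], which [spin_derivative] identifies as [adj t *m dt]. *)
Lemma nabla_coord_change c d W s s' t A w w' psi mu x : atlas c -> atlas d ->
  W `<=` dom c `&` dom d -> W x -> smooth_section W s -> spin_change W s s' t A ->
  compact_spinor psi -> wanti w x -> wanti w' x ->
  (forall mu, wmx w' x mu = (A x)^T *m (\sum_al jac d c x mu al *: wmx w x al) *m A x +
     (A x)^T *m \matrix_(k, l) dpart d mu (fun z => A z k l) x) ->
  nabla_coord d s' w' psi mu x =
  adj (t x) *m \sum_al rC (jac d c x mu al) *: nabla_coord c s w psi al x.
Proof.
move=> ac ad Wcd Wx ss [H st sA] cpsi wN w'N w'E.
have oW := bundle_open ss; have Wd : W `<=` dom d by move=> z /Wcd[].
have [Stx s'x SAx cvx] := H _ Wx; have tt := Spin_inv hgamma Stx.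
have sf := compact_spinor_smooth cpsi ss.
have E0 z : W z -> psi (s' z) = adj (t z) *m psi (s z).
  by move=> Wz; have [Stz -> _ _] := H _ Wz; exact: spinor_act.
rewrite nabla_coordE// (dmx_ext mu oW Wd Wx E0) E0//.
rewrite (dmxM mu ad oW Wd Wx (smooth_mx_adj oW st) sf) (dmx_adj mu ad oW Wd Wx st).
have D : adj (dmx d x mu t) = - (adj (t x) *m dmx d x mu t *m adj (t x)).
  have : dmx d x mu (fun z => adj (t z) *m t z) = 0.
    rewrite (dmx_ext mu oW Wd Wx (H := fun=> 1%:M)) ?dmx_cst// => z Wz.
    by have [Stz _ _ _] := H _ Wz; exact: (Spin_inv hgamma Stz).
  rewrite (dmxM mu ad oW Wd Wx (smooth_mx_adj oW st) st) (dmx_adj mu ad oW Wd Wx st).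
  move=> /eqP; rewrite addr_eq0 => /eqP E.
  by rewrite -mulNmx -E -mulmxA (mulmx1C tt) mulmx1.
have Om : gg2 gamma (wmx w' x mu) = adj (t x) *m (\sum_al rC (jac d c x mu al) *: gg2 gamma (wmx w x al)) *m t x
    + adj (t x) *m dmx d x mu t.
  have Hc z : W z -> [/\ Spin gamma (t z), SO (A z) & spin_covers gamma (t z) (A z)].
    by move=> /H[].
  rewrite w'E gg2D; congr (_ + _); last by rewrite (spin_derivative hgamma mu ad oW Wd Wx Hc st sA).
  rewrite -(gg2_sum (rc R)) (gg2_conj (rc := rc R) (A := (A x)^T) _ (mulmx1C tt)) ?trmxK// => k.
  exact: covers_adj.
rewrite Om D mulmxDl mulNmx.
have -> : adj (t x) *m dmx d x mu t *m (adj (t x) *m psi (s x)) =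
    adj (t x) *m dmx d x mu t *m adj (t x) *m psi (s x) by rewrite !mulmxA.
rewrite [_ + adj (t x) *m dmx d x mu (fun z => psi (s z))]addrC addrACA addNr addr0.
rewrite !mulmxA -[_ *m t x *m adj (t x)]mulmxA (mulmx1C tt) mulmx1 -mulmxA -mulmxDr; congr (_ *m _).
rewrite (dmx_change mu ac ad oW Wcd Wx sf) mulmx_suml -big_split /=; apply: eq_bigr => al _.
by rewrite nabla_coordE// scalerDr scalemxAl.
Qed.

Lemma integrandE c s w eta psi x :
  integrand g c s w eta psi x =
  quad (cj R) gamma (fun a => nabla g c s w eta a x) (fun a => nabla g c s w psi a x) ord0 ord0.
Proof.
have hE (u v : 'cV[R[i]]_(spinor_dim n)) : herm u v = (adj u *m v) ord0 ord0.
  by rewrite /herm mxE; apply: eq_bigr => k _; rewrite !mxE.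
rewrite /integrand /quad [RHS]mxE; congr (_ + _).
  rewrite hE /dirac adjmxZ -scalemxAl -scalemxAr scalerA.
  have -> : GRing.RMorphism.sort (cj R) (- Complex 0 1) * - Complex 0 1 = 1.
    by apply/eqP; rewrite eq_complex /=; apply/andP; split; apply/eqP; ring.
  by rewrite scale1r.
rewrite [RHS]mxE summxE; congr (- _); apply: eq_bigr => a _.
by rewrite hE.
Qed.

(** The frame derivatives rotate by [A] and are multiplied by a unitary matrix that intertwines the
    gammas, so [quad_change] applies. *)
Lemma integrand_change c d W s s' t A w w' eta psi x : atlas c -> atlas d ->
  W `<=` dom c `&` dom d -> W x -> smooth_section W s -> spin_change W s s' t A ->
  compact_spinor eta -> compact_spinor psi -> wanti w x -> wanti w' x ->
  (forall mu, wmx w' x mu = (A x)^T *m (\sum_al jac d c x mu al *: wmx w x al) *m A x +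
     (A x)^T *m \matrix_(k, l) dpart d mu (fun z => A z k l) x) ->
  integrand g d s' w' eta psi x = integrand g c s w eta psi x.
Proof.
move=> ac ad Wcd Wx ss sc ceta cpsi wN w'N w'E.
have [H st sA] := sc; have [Stx s'x SAx cvx] := H _ Wx; have tt := Spin_inv hgamma Stx.
have [cx dx] := Wcd _ Wx.
have px : proj (cov (s x)) = x by rewrite proj_cov (bundle_proj ss).
have nE psi0 a : compact_spinor psi0 -> nabla g d s' w' psi0 a x =
    \sum_k rC ((A x)^T a k) *: (adj (t x) *m nabla g c s w psi0 k x).
  move=> c0; rewrite /nabla.
  have E : tau g (cov (s' x)) d = jac d c x *m tau g (cov (s x)) c *m A x.
    rewrite s'x (cov_act _ Stx SAx cvx) tau_act ?px//.
    by rewrite (@tau_trans _ _ _ _ g (cov (s x)) d c) ?px.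
  have uc : tau g (cov (s x)) c \in unitmx by apply: tau_unit; rewrite ?px.
  have JJ : jac d c x *m jac c d x = 1%:M.
    by have := @jac_unit _ _ _ _ g (cov (s x)) d c; rewrite px; apply.
  have inv : invmx (tau g (cov (s' x)) d) *m jac d c x = (A x)^T *m invmx (tau g (cov (s x)) c).
    exact: invmx_change E uc JJ (SO_inv SAx).
  have Hv mu := nabla_coord_change mu ac ad Wcd Wx ss sc c0 wN w'N w'E.
  exact: (@frame_transfer _ _ (rc R) _ _ (adj (t x)) (jac d c x) _ _ _
    (fun al => nabla_coord c s w psi0 al x) (fun mu => nabla_coord d s' w' psi0 mu x) a Hv inv).
have e1 := quad_ext (cj R) gamma (fun a => nE eta a ceta) (fun a => nE psi a cpsi).
have UU : adjmx (cj R) (adj (t x)) *m adj (t x) = 1%:M by rewrite (adjmxK (@conjcK R)) (mulmx1C tt).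
have AA : ((A x)^T)^T *m (A x)^T = 1%:M by rewrite trmxK; have [] := SAx.
have rE k : rot gamma (A x)^T k *m adj (t x) = adj (t x) *m gamma k.
  by rewrite -(covers_adj hgamma k Stx SAx cvx) -mulmxA (mulmx1C tt) mulmx1.
have e2 := quad_change (@conjc_rc R) (fun k => nabla g c s w eta k x)
  (fun k => nabla g c s w psi k x) UU AA rE.
apply: etrans (integrandE _ _ _ _ _ _) (etrans _ (esym (integrandE _ _ _ _ _ _))).
exact: (congr1 (fun m : 'M[R[i]]_1 => m ord0 ord0) (etrans e1 e2)).
Qed.

Definition Qmx (g' : 'I_n -> 'M[R[i]]_(spinor_dim n)) (e : 'I_n -> 'I_n -> R) mu nu :=
  \sum_a \sum_b rC (e a mu * e b nu) *: G2 g' a b.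

(** [sP] is an arbitrary frame and [s] a spin section whose projection it rotates by [A]. The
    integrand computed with [s] is expressed by the dual frame and connection of [sP], at the price
    of rotated gammas [g'] and a smooth correction of the connection. *)
Lemma integrand_frame c W (sP : M -> P) s A w w1 eta psi x : atlas c -> W `<=` dom c -> W x ->
  smooth_section W s -> SO (A x) -> sP x = act (cov (s x)) (A x) -> wanti w x -> wanti w1 x ->
  (forall mu, wmx w1 x mu = A x *m wmx w x mu *m (A x)^T +
    A x *m (\matrix_(k, l) dpart c mu (fun z => A z k l) x)^T) ->
  let g' := rot gamma (A x) in
  let nc psi mu := dmx c x mu (fun z => psi (s z)) +
    (gg2 g' (wmx w x mu) + gg2 gamma (A x *m (\matrix_(k, l) dpart c mu (fun z => A z k l) x)^T))
      *m psi (s x) in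
  integrand g c s w1 eta psi x =
  (\sum_mu \sum_nu adj (nc eta mu) *m Qmx g' (dual_frame g c sP x) mu nu *m nc psi nu) ord0 ord0.
Proof.
move=> ac Wc Wx ss SAx sPx wN w1N w1E g' nc.
have cx := Wc _ Wx; have px : proj (cov (s x)) = x by rewrite proj_cov (bundle_proj ss).
have ncE psi0 mu : nabla_coord c s w1 psi0 mu x = nc psi0 mu.
  by rewrite (nabla_coordE c s psi0 mu w1N) w1E gg2_frame.
have cg' : clifford (cj R) g' := rot_clifford (@conjc_rc R) (cliffordE hgamma) (SO_inv SAx).
pose p psi0 k := \sum_mu rC (dual_frame g c sP x k mu) *: nc psi0 mu.
have nE psi0 j : nabla g c s w1 psi0 j x = \sum_k rC (A x j k) *: (1%:M *m p psi0 k).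
  have uA : A x \in unitmx by have [AA _] := SAx; have [] := mulmx1_unit AA.
  have uc : tau g (cov (s x)) c \in unitmx by apply: tau_unit; rewrite ?px.
  have H : invmx (tau g (cov (s x)) c) *m 1%:M = A x *m invmx (tau g (sP x) c).
    by rewrite mulmx1 sPx tau_act ?px// -invmx_mul_unit.
  have X := @frame_transfer _ _ (rc R) _ _ 1%:M 1%:M _ _ _ (nc psi0) (fun mu => nabla_coord c s w1 psi0 mu x) j _ H.
  apply: X => mu; rewrite ncE mul1mx.
  rewrite (bigD1 mu)//= mxE eqxx rmorph1 scale1r big1 ?addr0// => al am.
  by rewrite mxE eq_sym (negbTE am) rmorph0 scale0r.
rewrite integrandE.
rewrite (quad_ext _ _ (nE eta) (nE psi)).
rewrite (@quad_change _ (cj R) _ (rc R) (@conjc_rc R) _ _ gamma g' 1%:M (A x)).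
- by rewrite (quad_frame (@conjc_rc R) (invmx (tau g (sP x) c)) _ _ cg').
- by rewrite adjmx1 mulmx1.
- exact: SO_inv.
- by move=> k; rewrite mulmx1 mul1mx.
Qed.

End dirac_change.

(** * Local integrability *)

Section compact_induction.
Variable (X : ptopologicalType).

(** A property stable under unions and valid near every point of [K] holds on some neighbourhood of
    [K]. *)
Lemma compact_union_ind (Q : set X -> Prop) (K : set X) : compact K -> Q set0 ->
  (forall U V, Q U -> Q V -> Q (U `|` V)) ->
  (forall x, K x -> exists W, [/\ open W, W x & Q W]) -> exists2 U, K `<=` U & Q U.
Proof.
move=> cK Q0 QU loc.
have [F FP] : {F : X -> set X & forall x, K x -> [/\ open (F x), F x x & Q (F x)]}.
  apply: (@choice _ _ (fun x W => K x -> [/\ open W, W x & Q W])) => x.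
  by have [/loc[W WP]|nK] := pselect (K x); [exists W|exists set0].
move: cK; rewrite compact_cover => /(_ X K F).
case=> [x /FP[]//|x Kx|D DK KD]; first by exists x => //; have [] := FP _ Kx.
move: KD; rewrite /cover bigcup_fset => KD; eexists; first exact: KD.
rewrite big_seq; apply: (big_ind Q) => // i Di.
by have [|_ _] := FP i; first exact/set_mem/DK.
Qed.

End compact_induction.

Section complex_integrable.
Variables (d : measure_display) (T : measurableType d) (R : realType).
Variables (mu : {measure set T -> \bar R}).

(** Prefixes [r], [c], [mc] stand for real, complex and matrix valued; [int] for integrable, [bd]
    for bounded and measurable, that is for the admissible multipliers. *)
Definition rint D (f : T -> R) := mu.-integrable D (EFin \o f).
Definition rbd (D : set T) (b : T -> R) :=
  measurable_fun D b /\ exists k, forall x, D x -> `|b x| <= k.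
Definition cint D (f : T -> R[i]) :=
  rint D (fun x => complex.Re (f x)) /\ rint D (fun x => complex.Im (f x)).
Definition cbd D (f : T -> R[i]) :=
  rbd D (fun x => complex.Re (f x)) /\ rbd D (fun x => complex.Im (f x)).
Definition mcint D m p (F : T -> 'M[R[i]]_(m, p)) := forall i j, cint D (fun x => F x i j).
Definition mcbd D m p (F : T -> 'M[R[i]]_(m, p)) := forall i j, cbd D (fun x => F x i j).

Section one_domain.
Variables (D : set T) (mD : measurable D).

Lemma rint_ext f h : (forall x, D x -> f x = h x) -> rint D f -> rint D h.
Proof. by move=> fh; apply: eq_integrable => // x; rewrite inE => /fh /= ->. Qed.

Lemma rint0 : rint D (fun=> 0).
Proof. exact: integrable0. Qed.

Lemma rintD f h : rint D f -> rint D h -> rint D (fun x => f x + h x).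
Proof. exact: integrableD. Qed.

Lemma rintM b f : rbd D b -> rint D f -> rint D (fun x => b x * f x).
Proof.
move=> [mb [k bk]] fi; apply: (integrableMr mD mb _ fi).
by exists k; split=> [|M kM x Dx]; [exact: num_real|exact: le_trans (bk _ Dx) (ltW kM)].
Qed.

Lemma rbd_cst a : rbd D (fun=> a).
Proof. by split; [exact: measurable_cst|exists `|a|]. Qed.

Lemma rintZ a f : rint D f -> rint D (fun x => a * f x).
Proof. exact/rintM/rbd_cst. Qed.

Lemma rintN f : rint D f -> rint D (fun x => - f x).
Proof. by move/(rintZ (-1)); apply: rint_ext => x _; rewrite mulN1r. Qed.

Lemma cint_ext f h : (forall x, D x -> f x = h x) -> cint D f -> cint D h.
Proof. by move=> fh [fr fi]; split; [apply: rint_ext fr|apply: rint_ext fi] => x /fh ->. Qed.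

Lemma cint0 : cint D (fun=> 0). Proof. by split; exact: rint0. Qed.

Lemma cintD f h : cint D f -> cint D h -> cint D (fun x => f x + h x).
Proof.
move=> [f1 f2] [h1 h2]; split.
  by apply: rint_ext (rintD f1 h1) => x _; rewrite raddfD.
by apply: rint_ext (rintD f2 h2) => x _; rewrite raddfD.
Qed.

Lemma cint_sum (I : finType) (P : pred I) (F : I -> T -> R[i]) :
  (forall i, P i -> cint D (F i)) -> cint D (fun x => \sum_(i | P i) F i x).
Proof.
move=> Fi; have H (r : seq I) : cint D (fun x => \sum_(i <- r | P i) F i x).
  elim: r => [|i r IH]; first by apply: cint_ext cint0 => x _; rewrite big_nil.
  case Pi: (P i); last by apply: cint_ext IH => x _; rewrite big_cons Pi.
  by apply: cint_ext (cintD (Fi _ Pi) IH) => x _; rewrite big_cons Pi.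
exact: H.
Qed.

Lemma cintM b f : cbd D b -> cint D f -> cint D (fun x => b x * f x).
Proof.
move=> [b1 b2] [f1 f2]; split.
  apply: rint_ext (rintD (rintM b1 f1) (rintN (rintM b2 f2))) => x _.
  by case: (b x) => u v; case: (f x).
apply: rint_ext (rintD (rintM b1 f2) (rintM b2 f1)) => x _.
by case: (b x) => u v; case: (f x) => u' v' /=; rewrite addrC.
Qed.

Lemma cbd_cst a : cbd D (fun=> a). Proof. by split; exact: rbd_cst. Qed.

Lemma cintZ a f : cint D f -> cint D (fun x => a * f x).
Proof. exact/cintM/cbd_cst. Qed.

Lemma cintN f : cint D f -> cint D (fun x => - f x).
Proof. by move/(cintZ (-1)); apply: cint_ext => x _; rewrite mulN1r. Qed.

Lemma cintB f h : cint D f -> cint D h -> cint D (fun x => f x - h x).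
Proof. by move=> fi /cintN; exact: cintD. Qed.

Lemma cint_conj f : cint D f -> cint D (fun x => conjc (f x)).
Proof.
move=> [f1 f2]; split; first by apply: rint_ext f1 => x _; case: (f x).
by apply: rint_ext (rintN f2) => x _; case: (f x).
Qed.

Lemma cint_real f : rint D f -> cint D (fun x => real_complex R (f x)).
Proof. by move=> fi; split=> //; exact: rint0. Qed.

Lemma cint_real_scale (k : R[i]) f : k != 0 -> cint D (fun x => real_complex R (f x) * k) -> rint D f.
Proof.
move=> k0 /(cintZ k^-1)[+ _]; apply: rint_ext => x _.
by rewrite mulrCA mulVf// mulr1.
Qed.

Lemma cbd_real f : rbd D f -> cbd D (fun x => real_complex R (f x)).
Proof. by move=> fi; split=> //; exact: rbd_cst. Qed.

Lemma mcint_ext m p (F H : T -> 'M[R[i]]_(m, p)) : (forall x, D x -> F x = H x) ->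
  mcint D F -> mcint D H.
Proof. by move=> FH Fi i j; apply: cint_ext (Fi i j) => x /FH ->. Qed.

Lemma mcintD m p (F H : T -> 'M[R[i]]_(m, p)) : mcint D F -> mcint D H ->
  mcint D (fun x => F x + H x).
Proof. by move=> Fi Hi i j; apply: cint_ext (cintD (Fi i j) (Hi i j)) => x _; rewrite mxE. Qed.

Lemma mcintN m p (F : T -> 'M[R[i]]_(m, p)) : mcint D F -> mcint D (fun x => - F x).
Proof. by move=> Fi i j; apply: cint_ext (cintN (Fi i j)) => x _; rewrite mxE. Qed.

Lemma mcintB m p (F H : T -> 'M[R[i]]_(m, p)) : mcint D F -> mcint D H ->
  mcint D (fun x => F x - H x).
Proof. by move=> Fi /mcintN; exact: mcintD. Qed.

Lemma mcint_sum m p (I : finType) (F : I -> T -> 'M[R[i]]_(m, p)) :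
  (forall i, mcint D (F i)) -> mcint D (fun x => \sum_i F i x).
Proof.
move=> Fi i j; apply: cint_ext (cint_sum (P := xpredT) (fun k _ => Fi k i j)) => x _.
by rewrite summxE.
Qed.

Lemma mcintMl m p q (B : T -> 'M[R[i]]_(m, p)) (F : T -> 'M[R[i]]_(p, q)) :
  mcbd D B -> mcint D F -> mcint D (fun x => B x *m F x).
Proof.
move=> Bb Fi i j.
apply: cint_ext (cint_sum (P := xpredT) (fun k _ => cintM (Bb i k) (Fi k j))) => x _.
by rewrite mxE.
Qed.

Lemma mcintMr m p q (B : T -> 'M[R[i]]_(p, q)) (F : T -> 'M[R[i]]_(m, p)) :
  mcbd D B -> mcint D F -> mcint D (fun x => F x *m B x).
Proof.
move=> Bb Fi i j.
apply: cint_ext (cint_sum (P := xpredT) (fun k _ => cintM (Bb k j) (Fi i k))) => x _.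
by rewrite mxE; apply: eq_bigr => k _; rewrite mulrC.
Qed.

Lemma mcint_scale m p (f : T -> R[i]) (B : T -> 'M[R[i]]_(m, p)) :
  cint D f -> mcbd D B -> mcint D (fun x => f x *: B x).
Proof. by move=> fi Bb i j; apply: cint_ext (cintM (Bb i j) fi) => x _; rewrite mxE mulrC. Qed.

Lemma mcint_adj m p (F : T -> 'M[R[i]]_(m, p)) : mcint D F -> mcint D (fun x => adjmx (@conjc R) (F x)).
Proof. by move=> Fi i j; apply: cint_ext (cint_conj (Fi j i)) => x _; rewrite !mxE. Qed.

Lemma cint_tr m (F : T -> 'M[R[i]]_m) : mcint D F -> cint D (fun x => \tr (F x)).
Proof. by move=> Fi; apply: cint_sum => k _; exact: Fi. Qed.

Lemma mcbd_cst m p (A : 'M[R[i]]_(m, p)) : mcbd D (fun=> A).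
Proof. by move=> i j; exact: cbd_cst. Qed.

Lemma rbdD b b' : rbd D b -> rbd D b' -> rbd D (fun x => b x + b' x).
Proof.
move=> [mb [k bk]] [mb' [k' bk']]; split; first exact: measurable_funD.
by exists (k + k') => x Dx; apply: le_trans (ler_normD _ _) _; apply: lerD; [exact: bk|exact: bk'].
Qed.

Lemma rbdM b b' : rbd D b -> rbd D b' -> rbd D (fun x => b x * b' x).
Proof.
move=> [mb [k bk]] [mb' [k' bk']]; split; first exact: measurable_funM.
by exists (k * k') => x Dx; rewrite normrM; apply: ler_pM => //; [exact: bk|exact: bk'].
Qed.

Lemma rbd_sum (I : finType) (F : I -> T -> R) :
  (forall i, rbd D (F i)) -> rbd D (fun x => \sum_i F i x).
Proof.
move=> Fi; have H (r : seq I) : rbd D (fun x => \sum_(i <- r) F i x).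
  elim: r => [|i r IH].
    by rewrite (_ : (fun x => _) = fun=> 0); [exact: rbd_cst|apply/funext => x; rewrite big_nil].
  rewrite (_ : (fun x => _) = fun x => F i x + \sum_(j <- r) F j x); first exact: rbdD.
  by apply/funext => x; rewrite big_cons.
exact: H.
Qed.

Lemma cbd_sum (I : finType) (F : I -> T -> R[i]) :
  (forall i, cbd D (F i)) -> cbd D (fun x => \sum_i F i x).
Proof.
move=> Fi; split.
  rewrite (_ : (fun x => _) = fun x => \sum_i complex.Re (F i x)); last first.
    by apply/funext => x; rewrite raddf_sum.
  by apply: rbd_sum => i; have [] := Fi i.
rewrite (_ : (fun x => _) = fun x => \sum_i complex.Im (F i x)); last first.
  by apply/funext => x; rewrite raddf_sum.
by apply: rbd_sum => i; have [] := Fi i.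
Qed.

Lemma cbd_realM b (a : R[i]) : rbd D b -> cbd D (fun x => real_complex R (b x) * a).
Proof.
case: a => a a' bb; split.
  rewrite (_ : (fun x => _) = fun x => b x * a); first exact/rbdM/rbd_cst.
  by apply/funext => x /=; rewrite mul0r subr0.
rewrite (_ : (fun x => _) = fun x => b x * a'); first exact/rbdM/rbd_cst.
by apply/funext => x /=; rewrite mul0r addr0.
Qed.

Lemma cbd_conj f : cbd D f -> cbd D (fun x => conjc (f x)).
Proof.
move=> [f1 f2]; split.
  by rewrite (_ : (fun x => _) = fun x => complex.Re (f x)) //; apply/funext => x; case: (f x).
rewrite (_ : (fun x => _) = fun x => -1 * complex.Im (f x)); first exact: rbdM (rbd_cst _) f2.
by apply/funext => x; case: (f x) => a b /=; rewrite mulN1r.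
Qed.

Lemma mcbd_adj m p (F : T -> 'M[R[i]]_(m, p)) : mcbd D F -> mcbd D (fun x => adjmx (@conjc R) (F x)).
Proof.
move=> Fb i j; rewrite (_ : (fun x => _) = fun x => conjc (F x j i)); first exact: cbd_conj.
by apply/funext => x; rewrite !mxE.
Qed.

Lemma mcbd_sum_real (I : finType) m p (b : I -> T -> R) (A : I -> 'M[R[i]]_(m, p)) :
  (forall k, rbd D (b k)) -> mcbd D (fun x => \sum_k real_complex R (b k x) *: A k).
Proof.
move=> bb i j; rewrite (_ : (fun x => _) = fun x => \sum_k real_complex R (b k x) * A k i j).
  by apply: cbd_sum => k; exact: cbd_realM.
by apply/funext => x; rewrite summxE; apply: eq_bigr => k _; rewrite mxE.
Qed.

End one_domain.

Lemma rint_sub D E f : measurable E -> measurable D -> D `<=` E -> rint E f -> rint D f.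
Proof. exact: integrableS. Qed.

Lemma rint_union D E f : measurable D -> measurable E -> rint D f -> rint E f -> rint (D `|` E) f.
Proof.
move=> mD mE fD fE; have mDE : measurable (E `\` D) by exact: measurableD.
have fE' : rint (E `\` D) f by apply: rint_sub fE => // x [].
move: fD fE'; rewrite /rint.
rewrite [X in X -> _]integrable_mkcond// => fD; rewrite [X in X -> _]integrable_mkcond// => fE'.
apply/(@integrable_mkcond _ _ _ mu (D `|` E)); first exact: measurableU.
apply: eq_integrable (integrableD measurableT fD fE') => // x _.
rewrite /patch in_setU in_setD.
case: (x \in D) => /=; first by rewrite andbF adde0.
by rewrite andbT add0e.
Qed.

Lemma cint_sub D E f : measurable E -> measurable D -> D `<=` E -> cint E f -> cint D f.
Proof. by move=> mE mD DE [f1 f2]; split; [apply: rint_sub f1|apply: rint_sub f2]. Qed.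

Lemma cint_glue D E f h : measurable D -> measurable E -> cint D f -> cint E h ->
  cint (D `|` E) (fun x => if pselect (D x) then f x else h x).
Proof.
move=> mD mE fD hE; have mDE : measurable (E `\` D) by exact: measurableD.
have -> : D `|` E = D `|` (E `\` D) by apply/seteqP; split => x [Dx|]; [left|have [|] := pselect (D x); [left|right]|left|case; right].
have [f1 f2] : cint D (fun x => if pselect (D x) then f x else h x).
  by apply: cint_ext fD => // x Dx; case: pselect.
have [h1 h2] : cint (E `\` D) (fun x => if pselect (D x) then f x else h x).
  by apply: (@cint_ext _ mDE h) => [x [_ nD]|]; [case: pselect|apply: cint_sub hE => // x []].
by split; exact: rint_union.
Qed.

End complex_integrable.

Section local_domains.
Variables (R : realType) (n : nat) (M : manifold R n).
Implicit Types (c : chart R n M) (V K D : set M).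

(** Nested boxes in coordinates: [W] is where the test spinors are exactly constant or linear, and
    smooth functions are bounded there because of the compact [K]. *)
Lemma local_box c V x : open V -> V `<=` dom c -> V x -> exists W K chi,
  [/\ open W /\ W x, W `<=` K /\ K `<=` V, compact K,
      test_function (coord c @` V) chi & forall z, W z -> chi (coord c z) = 1].
Proof.
move=> oV Vc Vx; have oU := coord_open oV Vc.
have [e e0 eU] := open_cbox oU (ex_intro2 _ _ x Vx erefl).
set y := coord c x in eU.
pose a := \row_i (y ord0 i - e / 2) : 'rV[R]_n; pose b := \row_i (y ord0 i + e / 2) : 'rV[R]_n.
have e2 : 0 < e / 2 by rewrite divr_gt0.
have abU : cbox (\row_i (a ord0 i - e / 2)) (\row_i (b ord0 i + e / 2)) `<=` coord c @` V.
  move=> z H; apply: eU => i; move: (H i); rewrite !mxE.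
  by rewrite -addrA -opprD -splitr -addrA -splitr.
have [tchi chi1] := test_plateau e2 abU.
have abV : cbox a b `<=` coord c @` V.
  move=> z H; apply: abU => i; move: (H i); rewrite !mxE => /andP[h1 h2].
  by apply/andP; split; lra.
have abc : cbox a b `<=` coord c @` dom c by move=> z /abV[t Vt <-]; exists t => //; exact: Vc.
have Bb : ball y (e / 2) `<=` cbox a b.
  move=> z /(ball_rV _ _ e2) H i; have := H i; rewrite !mxE ltr_distl => /andP[h1 h2].
  by apply/andP; split; lra.
have Bc : ball y (e / 2) `<=` coord c @` dom c by exact: subset_trans Bb abc.
have oB : open (ball y (e / 2)) by exact: ball_open.
have [oW Wc] := open_icoord oB Bc.
exists (icoord c @` ball y (e / 2)), (icoord c @` cbox a b), (cutoff a b (e / 2)^-1 1 1).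
split => //.
- by split=> //; exists y; [exact: ballxx|rewrite icoordK//; exact: Vc].
- split; first exact: image_subset.
  by move=> _ [z /abV[t Vt <-] <-]; rewrite icoordK//; exact: Vc.
- by apply: compact_icoord => //; exact: cbox_compact.
- move=> _ [z Bz <-]; apply: chi1; have [t ct tz] := Bc _ Bz.
  by rewrite -tz icoordK// tz; exact: Bb.
Qed.

Lemma rbd_continuous c V K D (f : M -> R) : atlas c -> open V -> V `<=` dom c ->
  compact K -> K `<=` V -> D `<=` K -> measurable (coord c @` D : set (Rn_leb R n)) ->
  {in V, continuous f} -> rbd (D : set (mleb M)) f.
Proof.
move=> ac oV Vc cK KV DK mD cf.
have DV : D `<=` V by exact: subset_trans DK KV.
split; first exact: (measurable_continuous_chart ac Vc oV cf DV mD).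
have cfc : {in coord c @` V, continuous (f \o icoord c)}.
  move=> y; rewrite inE => -[x Vx <-].
  apply: continuous_comp; first by apply: icoord_cont; rewrite inE; exists x => //; exact: Vc.
  by rewrite icoordK; [apply: cf; rewrite inE|exact: Vc].
have cKc : compact (coord c @` K) by apply: coord_compact => //; exact: subset_trans KV Vc.
have [k Hk] := continuous_bounded (coord_open oV Vc) cfc cKc (image_subset _ KV).
exists k => x Dx; have := Hk (coord c x); rewrite /= icoordK; last exact/Vc/DV.
by apply; exists x => //; exact: DK.
Qed.

Lemma dpart_continuous c V mu (f : M -> R) : atlas c -> open V -> V `<=` dom c ->
  smooth_fun V f -> {in V, continuous (dpart c mu f)}.
Proof.
move=> ac oV Vc sf x; rewrite inE => Vx.
have [_ H] : Ck_on 1 (coord c @` V) (f \o icoord c) by exact: dpart_smooth.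
have [_ [cf _]] := H mu.
apply: (@continuous_comp _ _ _ (coord c) (partial mu (f \o icoord c))).
  by apply: coord_cont; rewrite inE; exact: Vc.
by apply: cf; rewrite inE; exists x.
Qed.

End local_domains.

Section bounded_smooth.
Variables (R : realType) (n : nat) (M : manifold R n).
Variables (c : chart R n M) (V K D : set M).
Hypotheses (ac : atlas c) (oV : open V) (Vc : V `<=` dom c) (cK : compact K) (KV : K `<=` V)
  (DK : D `<=` K) (mD : measurable (coord c @` D : set (Rn_leb R n))).

Lemma rbd_smooth f : smooth_fun V f -> rbd (D : set (mleb M)) f.
Proof. by move=> sf; apply: (rbd_continuous ac oV Vc cK KV DK mD); exact: smooth_fun_cont. Qed.

Lemma cbd_smooth f : smooth_cfun V f -> cbd (D : set (mleb M)) f.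
Proof. by case=> sr si; split; exact: rbd_smooth. Qed.

Lemma rbd_dpart mu f : smooth_fun V f -> rbd (D : set (mleb M)) (dpart c mu f).
Proof. by move=> sf; apply: (rbd_continuous ac oV Vc cK KV DK mD); exact: dpart_continuous. Qed.

Lemma mcbd_smooth m p (F : M -> 'M[R[i]]_(m, p)) : smooth_mx V F -> mcbd (D : set (mleb M)) F.
Proof. by move=> sF i j; exact: cbd_smooth. Qed.

Lemma mcbd_dmx m p mu (F : M -> 'M[R[i]]_(m, p)) : smooth_mx V F ->
  mcbd (D : set (mleb M)) (fun x => dmx c x mu F).
Proof.
move=> sF i j.
rewrite (_ : (fun x => _) = fun x => cpartial c mu (fun z => F z i j) x); last first.
  by apply/funext => x; rewrite mxE.
by have [sr si] := sF i j; split; [exact: (rbd_dpart mu sr)|exact: (rbd_dpart mu si)].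
Qed.

Lemma rbd_coord al : rbd (D : set (mleb M)) (fun x => coord c x ord0 al).
Proof.
apply: (rbd_continuous ac oV Vc cK KV DK mD) => x xV.
apply: (@continuous_comp _ _ _ (coord c) (fun y : 'rV[R]_n => y ord0 al)).
  by apply: coord_cont; move: xV; rewrite !inE; exact: Vc.
exact: coord_continuous.
Qed.

End bounded_smooth.

Section connection_normalization.
Variables (R : realType) (n : nat) (M : manifold R n) (P : SO_reduction M) (g : singular_metric P).
Variables (dvol : {measure set (mleb M) -> \bar R}) (hdvol : is_dvol g dvol).

Lemma connection_wanti c V s w : connection_forms g c V s w -> ae_on V (wanti w).
Proof.
move=> [de [_ H]]; apply: ae_on_impl H => x _ [anti _] mu.
by apply/matrixP => i j; rewrite !mxE; apply/eqP; rewrite -addr_eq0 anti.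
Qed.

Lemma connection_ae c V s w w' : connection_forms g c V s w ->
  ae_on V (fun x => forall i j mu, w x i j mu = w' x i j mu) -> connection_forms g c V s w'.
Proof.
move=> [de [dP H]] ww'; exists de; split=> //.
apply: ae_on_impl (ae_onI H ww') => x _ [[anti str] e]; split => [i j mu|i mu nu].
  by rewrite -!e.
by rewrite -[RHS](str i mu nu); congr (_ + _); apply: eq_bigr => j _; rewrite !e.
Qed.

(** Connection forms are antisymmetric only a.e.; replacing them by 0 elsewhere makes the pointwise
    algebra available everywhere. *)
Lemma connection_anti c V s w : connection_forms g c V s w -> exists w',
  [/\ connection_forms g c V s w', forall x, wanti w' x &
      ae_on V (fun x => forall i j mu, w' x i j mu = w x i j mu)].
Proof.
move=> cw; pose w' x i j mu := if pselect (wanti w x) then w x i j mu else 0.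
have ww' : ae_on V (fun x => forall i j mu, w' x i j mu = w x i j mu).
  by apply: ae_on_impl (connection_wanti cw) => x _ wx i j mu; rewrite /w'; case: pselect.
exists w'; split=> // [|x mu].
  by apply: connection_ae cw _; apply: ae_on_impl ww' => x _ e i j mu; rewrite e.
apply/matrixP => i j; rewrite !mxE /w'; case: (pselect (wanti w x)) => /= [wx|_].
  by have /matrixP/(_ i j) := wx mu; rewrite !mxE.
by rewrite oppr0.
Qed.

Lemma cint_ae c V (s : M -> P) (D : set M) (f h : M -> R[i]) : atlas c -> smooth_section V s ->
  V `<=` dom c -> D `<=` V -> measurable (D : set (mleb M)) ->
  ae_on D (fun x => f x = h x) -> cint dvol (D : set (mleb M)) f -> cint dvol (D : set (mleb M)) h.
Proof.
move=> ac ss Vc DV mD fh [f1 f2].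
by split; [apply: (integrable_ae_eq hdvol ac ss Vc DV mD _ f1)|
  apply: (integrable_ae_eq hdvol ac ss Vc DV mD _ f2)];
  apply: ae_on_impl fh => x _ /= ->.
Qed.

End connection_normalization.

(** * The coefficients of the quadratic form *)

Section frame_contraction.
Variables (C : numFieldType) (cj : {rmorphism C -> C}) (cjK : involutive cj).
Variables (R : realType) (rc : {rmorphism R -> C}) (cj_rc : forall x, cj (rc x) = rc x).
Variables (n N : nat).
Variables (e : 'I_n -> 'I_n -> R) (w : 'I_n -> 'I_n -> 'I_n -> R).
Local Notation adj := (adjmx cj).

Definition frame_om a b d : R := \sum_mu w a b mu * e d mu.
Local Notation om := frame_om.
Local Notation rom := (fun a b d => rc (om a b d)).

Section gamma.
Variable (g : 'I_n -> 'M[C]_N).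
Hypothesis cg : clifford cj g.

Definition Om0 mu := gg2 rc g (\matrix_(i, j) w i j mu).
Definition Qm mu nu := \sum_a \sum_b rc (e a mu * e b nu) *: G2 g a b.

Lemma Om_contract a : \sum_mu rc (e a mu) *: Om0 mu = Om g rom a.
Proof.
rewrite /Om0 -gg2_sum /gg2 /Om; congr (_ *: _); apply: eq_bigr => c _; apply: eq_bigr => d _.
congr (rc _ *: _); rewrite summxE; apply: eq_bigr => mu _.
by rewrite !mxE mulrC.
Qed.

(** The coordinate index shared by [Qm] and [Om0] is absorbed into the frame components of the
    connection. *)
Lemma Clin_contract mu : \sum_nu Qm mu nu *m Om0 nu = Clin g rom (fun a => rc (e a mu)).
Proof.
rewrite /Clin; under eq_bigr => nu _.
  rewrite /Qm mulmx_suml; under eq_bigr do rewrite mulmx_suml.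
  over.
rewrite exchange_big; apply: eq_bigr => a _; rewrite exchange_big; apply: eq_bigr => b _.
rewrite -Om_contract mulmx_sumr scaler_sumr; apply: eq_bigr => nu _.
by rewrite -scalemxAl -(scalemxAr (rc (e b nu))) scalerA -rmorphM.

Qed.

Lemma Wquad_contract : \sum_mu \sum_nu Om0 mu *m Qm mu nu *m Om0 nu = Wquad g rom.
Proof.
transitivity (\sum_mu Om0 mu *m Clin g rom (fun a => rc (e a mu))).
  apply: eq_bigr => mu _; rewrite -Clin_contract mulmx_sumr; apply: eq_bigr => nu _.
  by rewrite mulmxA.
rewrite /Clin /Wquad; under eq_bigr => mu _.
  rewrite mulmx_sumr; under eq_bigr do rewrite mulmx_sumr.
  over.
rewrite exchange_big; apply: eq_bigr => a _; rewrite exchange_big; apply: eq_bigr => b _.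
rewrite -(Om_contract a) mulmx_suml mulmx_suml; apply: eq_bigr => mu _.
by rewrite -scalemxAr -!scalemxAl mulmxA.
Qed.

Lemma adj_Qm mu nu : adj (Qm mu nu) = Qm nu mu.
Proof.
case: cg => ag acg; rewrite /Qm adjmx_sum exchange_big; apply: eq_bigr => a _.
rewrite adjmx_sum; apply: eq_bigr => b _.
by rewrite adjmxZ cj_rc mulrC (adj_G2 ag acg) -(G2C acg).
Qed.

Hypothesis anti : forall a b mu, w a b mu = - w b a mu.

Lemma omN a b d : om a b d = - om b a d.
Proof. by rewrite -sumrN; apply: eq_bigr => mu _; rewrite anti mulNr. Qed.

Lemma romN a b d : rom a b d = - rom b a d.
Proof. by rewrite /= omN rmorphN. Qed.

Lemma Om0_alt mu : Om0 mu = Om g (fun a b d => rc (w a b mu)) mu.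
Proof.
by rewrite /Om0 /gg2 /Om; congr (_ *: _); apply: eq_bigr => c _; apply: eq_bigr => d _; rewrite mxE.
Qed.

Lemma adj_Om0 mu : adj (Om0 mu) = - Om0 mu.
Proof.
case: cg => ag acg; rewrite Om0_alt (adj_Om ag acg) => [//|a b _|a b _].
  by rewrite anti rmorphN.
exact: cj_rc.
Qed.

Lemma adj_Clin_contract nu :
  \sum_mu adj (Om0 mu) *m Qm mu nu = adj (Clin g rom (fun a => rc (e a nu))).
Proof.
rewrite -Clin_contract adjmx_sum; apply: eq_bigr => mu _.
by rewrite adjmxM adj_Qm.
Qed.

(* The quadratic form of the covariant derivatives [p mu + (Om0 mu + B mu) u], *)
(* sorted by the number of factors [Om0].                                      *)
Lemma quad_split m (p q : 'I_n -> 'M[C]_(N, m)) :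
  let Cl mu := Clin g rom (fun a => rc (e a mu)) in
  forall (u v : 'M[C]_(N, m)),
  \sum_mu \sum_nu adj (p mu + Om0 mu *m u) *m Qm mu nu *m (q nu + Om0 nu *m v) =
  \sum_mu \sum_nu adj (p mu) *m Qm mu nu *m q nu + \sum_mu adj (p mu) *m Cl mu *m v +
  \sum_nu adj u *m adj (Cl nu) *m q nu - adj u *m Wquad g rom *m v.
Proof.
move=> Cl u v.
have -> : \sum_mu adj (p mu) *m Cl mu *m v =
    \sum_mu \sum_nu adj (p mu) *m Qm mu nu *m (Om0 nu *m v).
  apply: eq_bigr => mu _; rewrite /Cl -Clin_contract mulmx_sumr mulmx_suml.
  by apply: eq_bigr => nu _; rewrite !mulmxA.
have -> : \sum_nu adj u *m adj (Cl nu) *m q nu =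
    \sum_mu \sum_nu adj (Om0 mu *m u) *m Qm mu nu *m q nu.
  rewrite exchange_big; apply: eq_bigr => nu _; rewrite /Cl -adj_Clin_contract mulmx_sumr mulmx_suml.
  by apply: eq_bigr => mu _; rewrite adjmxM !mulmxA.
have -> : adj u *m Wquad g rom *m v =
    - (\sum_mu \sum_nu adj (Om0 mu *m u) *m Qm mu nu *m (Om0 nu *m v)).
  rewrite -Wquad_contract mulmx_sumr mulmx_suml -sumrN; apply: eq_bigr => mu _.
  rewrite mulmx_sumr mulmx_suml -sumrN; apply: eq_bigr => nu _.
  by rewrite adjmxM adj_Om0 !mulmxN !mulNmx opprK !mulmxA.
rewrite opprK -!big_split; apply: eq_bigr => mu _; rewrite -!big_split; apply: eq_bigr => nu _ /=.
by rewrite adjmxD mulmxDr !mulmxDl addrACA !addrA.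
Qed.

(** The case of identity matrices in place of the spinors; it serves to subtract the smooth part of
    a connection in [mcint_Wquad_of]. *)
Lemma quad_split1 (p q : 'I_n -> 'M[C]_N) :
  let Cl mu := Clin g rom (fun a => rc (e a mu)) in
  \sum_mu \sum_nu adj (p mu + Om0 mu) *m Qm mu nu *m (q nu + Om0 nu) =
  \sum_mu \sum_nu adj (p mu) *m Qm mu nu *m q nu + \sum_mu adj (p mu) *m Cl mu +
  \sum_nu adj (Cl nu) *m q nu - Wquad g rom.
Proof.
move=> Cl; have := quad_split p q 1%:M 1%:M; rewrite -/Cl adjmx1 mul1mx mulmx1 => H.
transitivity (\sum_mu \sum_nu adj (p mu + Om0 mu *m 1%:M) *m Qm mu nu *m (q nu + Om0 nu *m 1%:M)).
  by apply: eq_bigr => mu _; apply: eq_bigr => nu _; rewrite !mulmx1.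
rewrite {}H; congr (_ + _ + _ - _); apply: eq_bigr => mu _; by rewrite ?mulmx1 ?mul1mx.
Qed.

Lemma tr_Qm c d mu nu : c != d ->
  \tr (adj (G2 g c d) *m Qm mu nu) = rc (e c mu * e d nu - e d mu * e c nu) *+ N.
Proof.
case: cg => ag acg cd; have := tr_G2_clif024 ag acg 0 (fun a b => rc (e a mu * e b nu))
  (fun _ _ _ _ => 0) cd.
rewrite rmorphB => <-; congr (\tr (_ *m _)); rewrite /clif024 raddf0 add0r.
by rewrite [X in _ + X]big1 ?addr0// => a _; do 3 rewrite big1// => ? _; rewrite scale0r.
Qed.

Lemma QmE mu nu : Qm mu nu =
  \sum_a \sum_b (2^-1 * rc (e a mu * e b nu - e b mu * e a nu)) *: G2 g a b.
Proof.
case: cg => ag acg; rewrite /Qm (sum_anti acg).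
by apply: eq_bigr => a _; apply: eq_bigr => b _; rewrite rmorphB.
Qed.

End gamma.

Hypothesis anti : forall a b mu, w a b mu = - w b a mu.

(** Exchanging [a] and [b] in the second term gives the first one again, by antisymmetry; hence the
    factor 2. *)
Lemma linear_scalar mu :
  \sum_a \sum_b \sum_nu (e a mu * e b nu - e a nu * e b mu) * w a b nu =
  2 * \sum_a \sum_b e a mu * om a b b.
Proof.
transitivity (\sum_a \sum_b e a mu * om a b b - \sum_b \sum_a e b mu * om a b a).
  rewrite [X in _ - X]exchange_big -sumrB; apply: eq_bigr => a _.
  rewrite -sumrB; apply: eq_bigr => b _; rewrite /frame_om !mulr_sumr -sumrB.
  by apply: eq_bigr => nu _; rewrite mulrBl; congr (_ - _); ring.
rewrite mulr2n mulrDl mul1r; congr (_ + _); rewrite -sumrN; apply: eq_bigr => b _.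
by rewrite -sumrN; apply: eq_bigr => a _; rewrite omN// mulrN opprK.
Qed.

Lemma quadratic_scalar :
  \sum_a \sum_b \sum_c \sum_mu \sum_nu e a mu * e b nu * (w a c mu * w c b nu - w a c nu * w c b mu) =
  \sum_a \sum_b \sum_c (om a c a * om c b b - om a c b * om c b a).
Proof.
apply: eq_bigr => a _; apply: eq_bigr => b _; apply: eq_bigr => c _.
rewrite /frame_om !big_distrlr /=.
rewrite [X in _ - X]exchange_big -sumrB; apply: eq_bigr => mu _; rewrite -sumrB.
by apply: eq_bigr => nu _; rewrite mulrBr; congr (_ - _); ring.
Qed.

Lemma rc_scal_om : scal_om rom =
  rc (\sum_a \sum_b \sum_c (om a c a * om c b b - om a c b * om c b a)).
Proof.
rewrite rmorph_sum; apply: eq_bigr => a _; rewrite rmorph_sum; apply: eq_bigr => b _.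
by rewrite rmorph_sum; apply: eq_bigr => c _; rewrite rmorphB !rmorphM.
Qed.

Lemma rc_Mlin mu a b : Mlin rom (fun a => rc (e a mu)) a b =
  rc (- (\sum_d e a mu * om b d d) + \sum_d e b mu * om a d d +
      \sum_c e c mu * om c a b - \sum_c e c mu * om c b a).
Proof.
rewrite rmorphB !rmorphD rmorphN !rmorph_sum /Mlin.
by congr (- _ + _ + _ - _); apply: eq_bigr => c _; rewrite rmorphM.
Qed.

Lemma rc_Alt4 T a b c d :
  rc (@Alt4 R n T a b c d) = alt (fun a b c d => rc (T a b c d)) a b c d.
Proof.
rewrite /Alt4 /alt rmorphM fmorphV rmorph_nat rmorph_sum; congr (_ * _).
by apply: eq_bigr => s _; rewrite rmorphM rmorphXn rmorphN1.
Qed.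

Lemma altZ k (U : 'I_n -> 'I_n -> 'I_n -> 'I_n -> C) a b c f :
  alt (fun a b c f => k * U a b c f) a b c f = k * alt U a b c f.
Proof.
rewrite /alt [RHS]mulrCA [in RHS]mulr_sumr; apply: congr1; apply: eq_bigr => s _.
by rewrite mulrCA.
Qed.

Lemma alt_ext (U V : 'I_n -> 'I_n -> 'I_n -> 'I_n -> C) a b c f :
  (forall a b c f, U a b c f = V a b c f) -> alt U a b c f = alt V a b c f.
Proof. by move=> UV; rewrite /alt; apply: congr1; apply: eq_bigr => s _; rewrite UV. Qed.

Lemma clif024_ext (g : 'I_n -> 'M[C]_N) x0 y0 A B U V : x0 = y0 -> (forall a b, A a b = B a b) ->
  (forall a b c f, U a b c f = V a b c f) -> clif024 g x0 A U = clif024 g y0 B V.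
Proof.
move=> -> AB UV; rewrite /clif024; congr (_ + _ + _).
  by apply: eq_bigr => a _; apply: eq_bigr => b _; rewrite AB.
by do 4 (apply: eq_bigr => ? _); rewrite UV.
Qed.

(** The parts of C in degrees 0, 2, 4 and of W in degrees 0, 4, up to constant factors: the
    expressions (2) and (3) of the theorem. *)
Definition coefC1 mu := \sum_a \sum_b \sum_nu (e a mu * e b nu - e a nu * e b mu) * w a b nu.
Definition coefC2 mu a b := - (\sum_d e a mu * om b d d) + \sum_d e b mu * om a d d
  + \sum_c e c mu * om c a b - \sum_c e c mu * om c b a.
Definition coefC3 mu := Alt4 (fun c d f h => e c mu * om f h d).
Definition coefW1 := \sum_a \sum_b \sum_c \sum_mu \sum_nu
  e a mu * e b nu * (w a c mu * w c b nu - w a c nu * w c b mu).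
Definition coefW2 := Alt4 (fun m k p q => \sum_r
  (om m r r * om p q k - om p q r * om r k m + om m r p * om r k q)).

Lemma coefC2N mu a b : coefC2 mu b a = - coefC2 mu a b.
Proof. by rewrite /coefC2; ring. Qed.

Lemma Alt4_nuniq T a b c d : ~~ uniq [:: a; b; c; d] -> @Alt4 R n T a b c d = 0.
Proof. by move=> nu; apply: (fmorph_inj rc); rewrite rmorph0 rc_Alt4 alt_nuniq. Qed.

Section explicit.
Variable (g : 'I_n -> 'M[C]_N).
Hypothesis cg : clifford cj g.

Lemma Clin_explicit mu : Clin g rom (fun a => rc (e a mu)) =
  clif024 g (- 4^-1 * rc (coefC1 mu)) (fun a b => 4^-1 * rc (coefC2 mu a b))
    (fun a b c d => 4^-1 * rc (coefC3 mu a b c d)).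
Proof.
case: cg => _ acg; rewrite (ClinE acg) => [|a b c]; last exact: romN.
apply: clif024_ext => [|a b|a b c d].
- rewrite /coefC1 linear_scalar rmorphM rmorph_nat mulNr mulNr mulrA.
  have -> : 4^-1 * 2 = 2^-1 :> C by field.
  congr (- (_ * _)); rewrite rmorph_sum; apply: eq_bigr => a _; rewrite rmorph_sum.
  by apply: eq_bigr => b _; rewrite rmorphM.
- by rewrite rc_Mlin.
- rewrite altZ rc_Alt4; apply: congr1; apply: alt_ext => *; by rewrite rmorphM.
Qed.

Lemma Wquad_explicit : Wquad g rom =
  clif024 g (4^-1 * rc coefW1) (fun _ _ => 0) (fun a b c d => 4^-1 * rc (coefW2 a b c d)).
Proof.
case: cg => ag acg; rewrite (Wquad_clif ag acg) => [|a b c|a b c]; [|exact: romN|exact: cj_rc].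
apply: clif024_ext => [|//|a b c d]; first by rewrite rc_scal_om -quadratic_scalar.
rewrite [in RHS]rc_Alt4; apply: congr1; apply: alt_ext => m k p q; rewrite [RHS]rmorph_sum.
by apply: eq_bigr => r _; rewrite rmorphD rmorphB !rmorphM.
Qed.

Lemma tr_Clin mu : \tr (Clin g rom (fun a => rc (e a mu))) = rc (coefC1 mu) * (- 4^-1 * N%:R).
Proof. by case: (cg) => _ acg; rewrite Clin_explicit (tr_clif024 acg) -mulr_natr; move: (rc _) => X; ring. Qed.

Lemma tr_G2_Clin mu a b : a != b ->
  \tr (adj (G2 g a b) *m Clin g rom (fun a => rc (e a mu))) = rc (coefC2 mu a b) * (2^-1 * N%:R).
Proof.
move=> ab; case: (cg) => ag acg; rewrite Clin_explicit (tr_G2_clif024 ag acg)//.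
by rewrite (coefC2N mu a b) rmorphN -mulr_natr; move: (rc _) => X; field.
Qed.

Lemma tr_G4_Clin mu a b c d : uniq [:: a; b; c; d] ->
  \tr (adj (G4 g a b c d) *m Clin g rom (fun a => rc (e a mu))) =
  rc (coefC3 mu a b c d) * (4`!%:R * 4^-1 * N%:R).
Proof.
move=> u; case: (cg) => ag acg; rewrite Clin_explicit.
rewrite (_ : clif024 _ _ _ _ = clif024 g (- 4^-1 * rc (coefC1 mu))
    (fun a b => 4^-1 * rc (coefC2 mu a b)) (fun a b c d => 4^-1 * (rc (e a mu) * rom c d b))).
  rewrite (alt_tr cjK ag acg)// altZ -mulr_natr rc_Alt4.
  rewrite (@alt_ext _ (fun a b c d => rc (e a mu * om c d b))) => [|*]; last by rewrite rmorphM.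
  by move: (alt _ _ _ _ _) (4`!%:R) => X f; ring.
rewrite /clif024; apply: congr1; rewrite [RHS](sum_alt acg).
do 4 (apply: eq_bigr => ? _); rewrite altZ rc_Alt4; apply: (congr1 ( *:%R^~ _)); apply: congr1.
by apply: alt_ext => *; rewrite rmorphM.
Qed.

Lemma tr_Wquad_om : \tr (Wquad g rom) = rc coefW1 * (4^-1 * N%:R).
Proof. by case: (cg) => _ acg; rewrite Wquad_explicit (tr_clif024 acg) -mulr_natr; move: (rc _) => X; ring. Qed.

Lemma tr_G4_Wquad_om a b c d : uniq [:: a; b; c; d] ->
  \tr (adj (G4 g a b c d) *m Wquad g rom) = rc (coefW2 a b c d) * (4`!%:R * 4^-1 * N%:R).
Proof.
move=> u; case: (cg) => ag acg; rewrite (tr_G4_Wquad cjK ag acg) => [|? ? ?|//]; last exact: romN.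
rewrite -mulr_natr [in RHS]rc_Alt4 [X in _ = X * _](@alt_ext _ (fun m k p q => \sum_r (rc (om m r r) * rc (om p q k)
    - rc (om p q r) * rc (om r k m) + rc (om m r p) * rc (om r k q)))) => [|m k p q].
  by move: (alt _ _ _ _ _) (4`!%:R) => X f; ring.
by rewrite [LHS]rmorph_sum; apply: eq_bigr => r _; rewrite rmorphD rmorphB !rmorphM.
Qed.

End explicit.
End frame_contraction.

Section coefficient_integrability.
Variables (d : measure_display) (T : measurableType d) (R : realType).
Variables (mu : {measure set T -> \bar R}) (D : set T) (mD : measurable D).
Variables (n N : nat) (e : T -> 'I_n -> 'I_n -> R) (w : T -> 'I_n -> 'I_n -> 'I_n -> R).
Hypothesis anti : forall x a b al, w x a b al = - w x b a al.
Local Notation rC := (rc R).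
Local Notation om x := (frame_om (e x) (w x)).
Local Notation rom x := (fun a b c => rC (om x a b c)).
Local Notation adj := (adjmx (cj R)).
Local Notation rint := (rint mu D).
Local Notation cint := (cint mu D).
Local Notation mcint := (mcint mu D).

Definition coef_Q := forall c d al be, rint (fun x => e x c al * e x d be - e x d al * e x c be).
Definition coef_C := [/\ forall al, rint (fun x => coefC1 (e x) (w x) al),
  forall a b al, rint (fun x => coefC2 (e x) (w x) al a b) &
  forall a b c f al, rint (fun x => coefC3 (e x) (w x) al a b c f)].
Definition coef_W := rint (fun x => coefW1 (e x) (w x)) /\
  forall a b c f, rint (fun x => coefW2 (e x) (w x) a b c f).

Let E x al a := rC (e x a al).

Section from_coefficients.
Variables (g : 'I_n -> 'M[R[i]]_N) (cg : clifford (cj R) g).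

Lemma mcint_clif024 x0 A U : cint x0 -> (forall a b, cint (fun x => A x a b)) ->
  (forall a b c f, cint (fun x => U x a b c f)) ->
  mcint (fun x => clif024 g (x0 x) (A x) (U x)).
Proof.
move=> ix iA iU; apply: mcintD => //; first apply: mcintD => //.
- apply: (@mcint_ext _ _ _ _ _ mD _ _ (fun x => x0 x *: 1%:M)) => [x _|]; first by rewrite scalemx1.
  by apply: mcint_scale => //; exact: mcbd_cst.
- by do 2 (apply: mcint_sum => // ?); apply: mcint_scale => //; exact: mcbd_cst.
- by do 4 (apply: mcint_sum => // ?); apply: mcint_scale => //; exact: mcbd_cst.
Qed.

Lemma mcint_Qm al be : coef_Q -> mcint (fun x => Qm (rc R) (e x) g al be).
Proof.
move=> iQ.
apply: (@mcint_ext _ _ _ _ _ mD _ _ (fun x => \sum_a \sum_b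
  (2^-1 * rC (e x a al * e x b be - e x b al * e x a be)) *: G2 g a b)) => [x _|].
  by rewrite (QmE (rc R) (e x) cg).
do 2 (apply: mcint_sum => // ?); apply: mcint_scale => //; last exact: mcbd_cst.
by apply: cintZ => //; apply: cint_real => //; exact: iQ.
Qed.

Lemma mcint_Clin al : coef_C -> mcint (fun x => Clin g (rom x) (E x al)).
Proof.
move=> [i1 i2 i3]; apply: mcint_ext (mcint_clif024 (x0 := fun x => - 4^-1 * rC (coefC1 (e x) (w x) al))
  (A := fun x a b => 4^-1 * rC (coefC2 (e x) (w x) al a b))
  (U := fun x a b c f => 4^-1 * rC (coefC3 (e x) (w x) al a b c f)) _ _ _) => // [x _|||];
  last by move=> *; apply: cintZ => //; apply: cint_real.
- by rewrite (Clin_explicit (rc R) (e x) (anti x) cg).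
- by apply: cintZ => //; apply: cint_real.
- by move=> *; apply: cintZ => //; apply: cint_real.
Qed.

Lemma mcint_Wquad : coef_W -> mcint (fun x => Wquad g (rom x)).
Proof.
move=> [i1 i2]; apply: mcint_ext (mcint_clif024 (x0 := fun x => 4^-1 * rC (coefW1 (e x) (w x)))
  (A := fun _ _ _ => 0) (U := fun x a b c f => 4^-1 * rC (coefW2 (e x) (w x) a b c f)) _ _ _) => // [x _|||].
- by rewrite (Wquad_explicit (rc := rc R) (@conjc_rc R) (e x) (anti x) cg).
- by apply: cintZ => //; apply: cint_real.
- by move=> *; exact: cint0.
- by move=> *; apply: cintZ => //; apply: cint_real.
Qed.

End from_coefficients.

Section to_coefficients.
Variables (g : T -> 'I_n -> 'M[R[i]]_N).
Hypothesis cg : forall x, clifford (cj R) (g x).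
Hypothesis N0 : (0 < N)%N.
Hypothesis G2b : forall a b, mcbd D (fun x => adj (G2 (g x) a b)).
Hypothesis G4b : forall a b c f, mcbd D (fun x => adj (G4 (g x) a b c f)).

(** How coefficients are read off: a trace is an integrable combination of entries, and the nonzero
    constant is divided out. *)
Lemma rint_tr (k : R[i]) (F : T -> 'M[R[i]]_N) f : k != 0 -> mcint F ->
  (forall x, D x -> \tr (F x) = rC (f x) * k) -> rint f.
Proof.
move=> k0 /cint_tr iF Ff; apply: (cint_real_scale mD k0); exact: cint_ext (iF mD).
Qed.

Let Nk (k : R[i]) : k != 0 -> k * N%:R != 0.
Proof. by move=> k0; rewrite mulf_neq0// pnatr_eq0 -lt0n. Qed.

Lemma rint_zero f : (forall x, D x -> f x = 0) -> rint f.
Proof. by move=> f0; apply: (@rint_ext _ _ _ _ _ mD _ _ _ (rint0 mu D)) => x /f0. Qed.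

Lemma coef_of_Q : (forall al be, mcint (fun x => Qm (rc R) (e x) (g x) al be)) -> coef_Q.
Proof.
move=> iQ c f al be; have [->|cf] := eqVneq c f; first by apply: rint_zero => x _; ring.
apply: (rint_tr (Nk (oner_neq0 _)) (mcintMl mD (G2b c f) (iQ al be))) => x _.
by rewrite (tr_Qm (cj := cj R) _ _ (cg x)) //= mul1r mulr_natr.
Qed.

Let inv2 : (2^-1 : R[i]) != 0. Proof. by rewrite invr_eq0 pnatr_eq0. Qed.
Let inv4 : (4^-1 : R[i]) != 0. Proof. by rewrite invr_eq0 pnatr_eq0. Qed.
Let fact4 : (4`!%:R * 4^-1 : R[i]) != 0. Proof. by rewrite mulf_neq0// pnatr_eq0. Qed.

Lemma coef_of_C : (forall al, mcint (fun x => Clin (g x) (rom x) (E x al))) -> coef_C.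
Proof.
move=> iC; split=> [al|a b al|a b c f al].
- have k0 : (- 4^-1 : R[i]) != 0 by rewrite oppr_eq0.
  apply: (rint_tr (Nk k0) (iC al)) => x _; exact: (tr_Clin (rc R) (e x) (anti x) (cg x)).
- have [->|ab] := eqVneq a b; first by apply: rint_zero => x _; rewrite /coefC2; ring.
  apply: (rint_tr (Nk inv2) (mcintMl mD (G2b a b) (iC al))) => x _.
  exact: (tr_G2_Clin (rc R) (e x) (anti x) (cg x) al ab).
- have [uabcf|nu] := boolP (uniq [:: a; b; c; f]); last first.
    by apply: rint_zero => x _; exact: (Alt4_nuniq (rc R)).
  apply: (rint_tr (Nk fact4) (mcintMl mD (G4b a b c f) (iC al))) => x _.
  exact: (tr_G4_Clin (@conjcK R) (rc R) (e x) (anti x) (cg x) al uabcf).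
Qed.

Lemma coef_of_W : mcint (fun x => Wquad (g x) (rom x)) -> coef_W.
Proof.
move=> iW; split=> [|a b c f].
  by apply: (rint_tr (Nk inv4) iW) => x _; exact: (tr_Wquad_om (rc := rc R) (@conjc_rc R) (e x) (anti x) (cg x)).
have [uabcf|nu] := boolP (uniq [:: a; b; c; f]); last first.
  by apply: rint_zero => x _; exact: (Alt4_nuniq (rc R)).
apply: (rint_tr (Nk fact4) (mcintMl mD (G4b a b c f) iW)) => x _.
exact: (tr_G4_Wquad_om (@conjcK R) (rc R) (e x) (anti x) (cg x) uabcf).
Qed.

End to_coefficients.
End coefficient_integrability.

Section connection_coefficients.
Variables (d : measure_display) (T : measurableType d) (R : realType).
Variables (mu : {measure set T -> \bar R}) (D : set T) (mD : measurable D).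
Variables (n N : nat) (e : T -> 'I_n -> 'I_n -> R) (w : T -> 'I_n -> 'I_n -> 'I_n -> R).
Hypothesis anti : forall x a b al, w x a b al = - w x b a al.
Local Notation rC := (rc R).
Local Notation adj := (adjmx (cj R)).
Local Notation mcint := (mcint mu D).
Variables (g : T -> 'I_n -> 'M[R[i]]_N) (B : 'I_n -> T -> 'M[R[i]]_N).
Hypothesis cg : forall x, clifford (cj R) (g x).
Hypothesis Bb : forall al, mcbd D (B al).
Hypothesis adjBb : forall al, mcbd D (fun x => adj (B al x)).
Local Notation Q x := (Qm (rc R) (e x) (g x)).
Local Notation Om x := (Om0 (rc R) (w x) (g x)).
Local Notation Cl x al := (Clin (g x) (fun a b c => rC (frame_om (e x) (w x) a b c)) (fun a => rC (e x a al))).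
Local Notation Wq x := (Wquad (g x) (fun a b c => rC (frame_om (e x) (w x) a b c))).
Hypothesis iQ : forall al be, mcint (fun x => Q x al be).

(** [B] is the bounded difference between the connection of a lifted frame and that of the given
    one; its contribution is controlled by Q alone. *)
Lemma mcint_Clin_of al : mcint (fun x => \sum_be Q x al be *m (B be x + Om x be)) ->
  mcint (fun x => Cl x al).
Proof.
move=> iP.
have iQB : mcint (fun x => \sum_be Q x al be *m B be x).
  by apply: mcint_sum => // be; exact: mcintMr.
apply: (mcint_ext mD _ (mcintB mD iP iQB)) => x _.
rewrite -sumrB -Clin_contract; apply: eq_bigr => be _.
by rewrite mulmxDr addrAC subrr add0r.
Qed.

Lemma mcint_Wquad_of :
  (forall al, mcint (fun x => Cl x al)) ->
  mcint (fun x => \sum_al \sum_be adj (B al x + Om x al) *m Q x al be *m (B be x + Om x be)) ->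
  mcint (fun x => Wq x).
Proof.
move=> iC iZ.
have i1 : mcint (fun x => \sum_al \sum_be adj (B al x) *m Q x al be *m B be x).
  do 2 (apply: mcint_sum => // ?); apply: mcintMr => //; exact: mcintMl.
have i2 : mcint (fun x => \sum_al adj (B al x) *m Cl x al).
  by apply: mcint_sum => // al; exact: mcintMl.
have i3 : mcint (fun x => \sum_be adj (Cl x be) *m B be x).
  by apply: mcint_sum => // be; apply: mcintMr => //; exact: mcint_adj.
apply: (mcint_ext mD _ (mcintB mD (mcintD mD (mcintD mD i1 i2) i3) iZ)) => x _.
have -> := quad_split1 (rc := rc R) (@conjc_rc R) (e x) (cg x) (anti x) (fun al => B al x)
  (fun al => B al x).
by rewrite opprB addrC subrK.
Qed.

End connection_coefficients.

Lemma act1 (R : realType) n (M : manifold R n) (K : pzRingType) m (G : set 'M[K]_m) sK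
  (P : principal_bundle (M := M) G sK) (p : P) : act p 1%:M = p.
Proof. by case: P p. Qed.

(** * Test spinors and polarization *)

Section test_spinors.
Variables (R : realType) (n : nat) (gamma : 'I_n -> 'M[R[i]]_(spinor_dim n)).
Hypothesis hgamma : is_clifford gamma.
Variables (M : manifold R n) (P : SO_reduction M) (S : spin_structure gamma P).
Local Notation adj := (adjmx (@conjc R)).
Local Notation rC := (real_complex R).

Lemma Spin1 : Spin gamma 1%:M.
Proof. by exists [::]; split=> //; rewrite big_nil. Qed.

Variables (c : chart R n M) (V1 : set M) (s1 : M -> S).
Hypotheses (ac : atlas c) (ss1 : smooth_section V1 s1) (V1c : V1 `<=` dom c).

(** The fibre coordinate of [p] relative to the section [s1], with default 1 off its domain. *)
Definition spin_coord (p : S) : 'M[R[i]]_(spinor_dim n) :=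
  xget 1%:M [set t | Spin gamma t /\ p = act (s1 (proj p)) t].

Lemma spin_coordP p : V1 (proj p) ->
  Spin gamma (spin_coord p) /\ p = act (s1 (proj p)) (spin_coord p).
Proof.
move=> Vp; have [t [tP _]] := act_unique (bundle_proj ss1 Vp : proj (s1 (proj p)) = proj p).
by apply: (@xgetPex _ 1%:M [set t | Spin gamma t /\ p = act (s1 (proj p)) t]); exists t.
Qed.

Lemma spin_coord_eq x t : V1 x -> Spin gamma t -> spin_coord (act (s1 x) t) = t.
Proof.
move=> Vx st; have xE : proj (act (s1 x) t) = x by rewrite act_proj// (bundle_proj ss1).
have := spin_coordP (p := act (s1 x) t); rewrite xE => /(_ Vx)[st' e].
have [u [_ uu]] := act_unique (esym (act_proj (s1 x) st)).
by rewrite -(uu _ (conj st' e)) (uu t).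
Qed.

(** The equivariant extension of the spinor that equals [phi u] along [s1], and 0 outside. *)
Definition test_spinor (phi : 'rV[R]_n -> R) u (p : S) : 'cV[R[i]]_(spinor_dim n) :=
  if pselect (V1 (proj p)) then rC (phi (coord c (proj p))) *: (adj (spin_coord p) *m u) else 0.

Lemma test_spinorE phi u x t : V1 x -> Spin gamma t ->
  test_spinor phi u (act (s1 x) t) = rC (phi (coord c x)) *: (adj t *m u).
Proof.
move=> Vx st; have xE : proj (act (s1 x) t) = x by rewrite act_proj// (bundle_proj ss1).
by rewrite /test_spinor spin_coord_eq// xE; case: pselect.
Qed.

Lemma test_spinor_section phi u x : V1 x -> test_spinor phi u (s1 x) = rC (phi (coord c x)) *: u.
Proof.
by move=> Vx; rewrite -[s1 x]act1 test_spinorE//; [rewrite adjmx1 mul1mx|exact: Spin1].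
Qed.

(** In any other section the spinor is [phi] times the smooth [adj t] applied to [u]. Off the
    compact set [L] it vanishes, which gives smoothness across the boundary of [V1] and compact
    support. *)
Lemma test_spinor_compact phi u : test_function (coord c @` V1) phi ->
  compact_spinor (test_spinor phi u).
Proof.
move=> [sphi [K [cK KV K0]]].
pose L := icoord c @` K.
have Kc : K `<=` coord c @` dom c by move=> y /KV[z Vz <-]; exists z => //; exact: V1c.
have cL : compact L by exact: compact_icoord.
have clL : closed L by apply: compact_closed => //; exact: manifold_hausdorff.
have LV z : L z -> V1 z by move=> [y /KV[z' Vz' <-] <-]; rewrite icoordK//; exact: V1c.
have off p : ~ L (proj p) -> test_spinor phi u p = 0.
  move=> nL; rewrite /test_spinor; case: pselect => // Vp; rewrite K0 ?scale0r// => Kp.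
  by apply: nL; exists (coord c (proj p)) => //; rewrite icoordK//; exact: V1c.
split.
- move=> p t st; have [Vp|nVp] := pselect (V1 (proj p)); last first.
    by rewrite !off ?mulmx0// ?act_proj// => /LV.
  have [sp pE] := spin_coordP Vp.
  rewrite {1}pE actM// !test_spinorE//; last exact: Spin_mul.
  rewrite [in RHS]pE test_spinorE//.
  rewrite -scalemxAr adjmxM !mulmxA.
  by rewrite (_ : t *m adj t = 1%:M) ?mul1mx//; apply: mulmx1C; exact: (Spin_inv hgamma st).
- move=> V' s' ss' k; apply: smooth_cfun_local => x V'x.
  have oV' := bundle_open ss'.
  have [V1x|nV1x] := pselect (V1 x); last first.
    exists (~` L); split; [exact: closed_openC|by move/LV|].
    apply: (smooth_cfun_ext _ _ (smooth_cfun_cst _ 0)).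
      by apply: openI => //; exact: closed_openC.
    move=> z [V'z nLz]; rewrite off ?mxE//.
    by rewrite (bundle_proj ss' V'z).
  exists V1; split => //; first exact: bundle_open ss1.
  have [t [tP ts]] := spin_compare hgamma ss1 ss'.
  have oI : open (V1 `&` V') by apply: openI => //; exact: bundle_open ss1.
  rewrite setIC.
  apply: (@smooth_cfun_ext _ _ _ _ (fun z => rC (phi (coord c z)) * (adj (t z) *m u) k ord0)) => //.
    by move=> z [V1z V'z]; have [st ->] := tP _ V1z V'z; rewrite test_spinorE// [RHS]mxE.
  apply: smooth_cfunM => //.
    apply: smooth_cfun_real; apply: (smooth_fun_chart ac) => //; first by move=> z [/V1c].
    move=> j; apply: (@Ck_on_ext _ _ _ _ phi).
    - by apply: coord_open => // z [/V1c].
    - by move=> y [z [Vz _] <-]; rewrite /= icoordK//; exact: V1c.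
    - by apply: Ck_on_sub (sphi j).
  apply: (smooth_cfun_mulmx oI) => [i j|i j]; last exact: smooth_cfun_cst.
  by apply: (smooth_mx_adj oI ts).
- apply: (subclosed_compact _ cL); first exact: closed_closure.
  rewrite [X in _ `<=` X]((closure_id L).1 clL); apply: closureS => x [p <- np].
  by apply: contrapT => nL; apply: np; exact: off.
Qed.

Section on_plateau.
Variables (W : set M) (chi : 'rV[R]_n -> R).
Hypotheses (oW : open W) (WV : W `<=` V1) (chi1 : forall z, W z -> chi (coord c z) = 1).

Lemma test_spinor_const u x al : W x ->
  test_spinor chi u (s1 x) = u /\ dmx c x al (fun z => test_spinor chi u (s1 z)) = 0.
Proof.
have E z : W z -> test_spinor chi u (s1 z) = u.
  by move=> Wz; rewrite test_spinor_section ?chi1 ?rmorph1 ?scale1r//; exact: WV.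
move=> Wx; split; first exact: E.
have Wc : W `<=` dom c by exact: subset_trans WV V1c.
rewrite -(dmx_cst c x al u).
exact: (dmx_ext al oW Wc Wx E).
Qed.

Lemma test_spinor_linear u x be al : W x -> let phi (y : 'rV[R]_n) := y ord0 be * chi y in
  test_spinor phi u (s1 x) = rC (coord c x ord0 be) *: u /\
  dmx c x al (fun z => test_spinor phi u (s1 z)) = (be == al)%:R *: u.
Proof.
move=> Wx phi.
have E z : W z -> test_spinor phi u (s1 z) = rC (coord c z ord0 be) *: u.
  by move=> Wz; rewrite test_spinor_section /phi ?chi1 ?mulr1//; exact: WV.
split; first exact: E.
have Wc : W `<=` dom c by exact: subset_trans WV V1c.
rewrite (dmx_ext al oW Wc Wx E); apply/matrixP => i j; rewrite !mxE.
have sy : smooth_fun W (fun z => coord c z ord0 be).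
  apply: (smooth_fun_chart ac) => // k; apply: (@Ck_on_ext _ _ _ _ (fun y => y ord0 be)).
  - exact: coord_open.
  - by move=> y [z Wz <-]; rewrite /= icoordK//; exact: Wc.
  - exact: Ck_on_coord.
have -> : (fun z => (rC (coord c z ord0 be) *: u) i j) = (fun z => rC (coord c z ord0 be) * u i j).
  by apply/funext => z; rewrite mxE.
rewrite (cpartialM al ac oW Wc Wx (smooth_cfun_real sy) (smooth_cfun_cst W (u i j))).
rewrite cpartial_real cpartial_cst mulr0 addr0; apply: (congr1 ( *%R^~ _)).
have -> : dpart c al (fun z => coord c z ord0 be) x = (be == al)%:R; last by rewrite rmorph_nat.
rewrite /dpart (@partial_ext _ _ (coord c @` W) _ (fun y => y ord0 be)).
- rewrite /partial; have [_ ->] := is_derive_coord be (delta_mx ord0 al) (coord c x).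
  by rewrite mxE eqxx.
- exact: coord_open.
- by move=> y [z Wz <-]; rewrite /= icoordK//; exact: Wc.
- by exists x.
Qed.

End on_plateau.
End test_spinors.

(** * Polarization of the sesquilinear form *)

Section polarization.
Variables (C : numFieldType) (cj : {rmorphism C -> C}) (n N : nat).
Variables (Q : 'I_n -> 'I_n -> 'M[C]_N) (X : 'I_n -> 'M[C]_N).
Local Notation adj := (adjmx cj).
Hypothesis adjQ : forall al be, adj (Q al be) = Q be al.

Definition sesq (p q : 'I_n -> 'cV[C]_N) : 'M[C]_1 :=
  \sum_mu \sum_nu adj (p mu) *m Q mu nu *m q nu.

Let Z := \sum_mu \sum_nu adj (X mu) *m Q mu nu *m X nu.
Let L al := \sum_nu Q al nu *m X nu.

Lemma sesq_ext p p' q q' : (forall mu, p mu = p' mu) -> (forall mu, q mu = q' mu) ->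
  sesq p q = sesq p' q'.
Proof.
by move=> pp qq; apply: eq_bigr => mu _; apply: eq_bigr => nu _; rewrite pp qq.
Qed.

Lemma sesq_const u v : sesq (fun mu => X mu *m u) (fun nu => X nu *m v) = adj u *m Z *m v.
Proof.
rewrite /Z mulmx_sumr mulmx_suml; apply: eq_bigr => mu _.
rewrite mulmx_sumr mulmx_suml; apply: eq_bigr => nu _.
by rewrite adjmxM !mulmxA.
Qed.

Lemma sesqDl p p' q : sesq (fun mu => p mu + p' mu) q = sesq p q + sesq p' q.
Proof.
rewrite -big_split; apply: eq_bigr => mu _; rewrite -big_split; apply: eq_bigr => nu _ /=.
by rewrite adjmxD !mulmxDl.
Qed.

Lemma sesqDr p q q' : sesq p (fun mu => q mu + q' mu) = sesq p q + sesq p q'.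
Proof.
rewrite -big_split; apply: eq_bigr => mu _; rewrite -big_split; apply: eq_bigr => nu _ /=.
by rewrite mulmxDr.
Qed.

Lemma sesq_deltal al u q : sesq (fun mu => (al == mu)%:R *: u) q = adj u *m \sum_nu Q al nu *m q nu.
Proof.
rewrite /sesq (bigD1 al)//= [X in _ + X]big1 => [|mu /negbTE amu]; last first.
  apply: big1 => nu _; rewrite eq_sym amu scale0r adjmx0.
  by rewrite !mul0mx.
rewrite addr0 eqxx scale1r mulmx_sumr; apply: eq_bigr => nu _; by rewrite mulmxA.
Qed.

Lemma sesq_deltar be v p : sesq p (fun nu => (be == nu)%:R *: v) = (\sum_mu adj (p mu) *m Q mu be) *m v.
Proof.
rewrite /sesq mulmx_suml; apply: eq_bigr => mu _.
rewrite (bigD1 be)//= [X in _ + X]big1 => [|nu /negbTE amu]; last first.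
  by rewrite eq_sym amu scale0r mulmx0.
by rewrite addr0 eqxx scale1r.
Qed.

Lemma sesq_linear_const al y u v : cj y = y ->
  sesq (fun mu => (al == mu)%:R *: u + X mu *m (y *: u)) (fun nu => X nu *m v) =
  adj u *m L al *m v + y *: (adj u *m Z *m v).
Proof.
move=> yr; rewrite sesqDl sesq_deltal sesq_const adjmxZ yr -!scalemxAl; congr (_ + _).
by rewrite -mulmxA /L mulmx_suml; congr (_ *m _); apply: eq_bigr => nu _; rewrite mulmxA.
Qed.

Lemma sesq_linear_linear al be y z u v : cj y = y ->
  sesq (fun mu => (al == mu)%:R *: u + X mu *m (y *: u)) (fun nu => (be == nu)%:R *: v + X nu *m (z *: v)) =
  adj u *m Q al be *m v + y *: (adj u *m adj (L be) *m v) +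
  z *: (adj u *m L al *m v + y *: (adj u *m Z *m v)).
Proof.
move=> yr; rewrite sesqDr; congr (_ + _); last first.
  by rewrite sesq_linear_const// -!scalemxAr scalerA mulrC -scalerA scalerDr.
rewrite sesqDl sesq_deltal sesq_deltar; congr (_ + _).
  rewrite (bigD1 be)//= big1 => [|nu /negbTE amu]; last by rewrite eq_sym amu scale0r mulmx0.
  by rewrite addr0 eqxx scale1r mulmxA.
rewrite /L adjmx_sum mulmx_sumr !mulmx_suml scaler_sumr; apply: eq_bigr => mu _.
by rewrite !adjmxM adjmxZ yr adjQ -!scalemxAl mulmxA.
Qed.

End polarization.

Section sesquilinear_integrability.
Variables (d : measure_display) (T : measurableType d) (R : realType).
Variables (mu : {measure set T -> \bar R}) (D : set T) (mD : measurable D).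
Variables (n N : nat) (Q : T -> 'I_n -> 'I_n -> 'M[R[i]]_N) (X : T -> 'I_n -> 'M[R[i]]_N).
Variable y : 'I_n -> T -> R.
Local Notation rC := (rc R).
Local Notation adj := (adjmx (cj R)).
Local Notation cint := (cint mu D).
Local Notation mcint := (mcint mu D).
Hypothesis adjQ : forall x al be, adj (Q x al be) = Q x be al.
Hypothesis yb : forall al, rbd D (y al).
Local Notation const x u := (fun al => X x al *m u).
Local Notation lin x al u := (fun be => (al == be)%:R *: u + X x be *m (rC (y al x) *: u)).
Local Notation form x p q := (sesq (cj R) (Q x) p q ord0 ord0).

Lemma cint_entry F (u v : 'cV[R[i]]_N) : mcint F -> cint (fun x => (adj u *m F x *m v) ord0 ord0).
Proof. by move=> iF; apply: mcintMr => //; [exact: mcbd_cst|apply: mcintMl => //; exact: mcbd_cst]. Qed.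

Lemma mcint_entries F :
  (forall u v : 'cV[R[i]]_N, cint (fun x => (adj u *m F x *m v) ord0 ord0)) -> mcint F.
Proof.
move=> iF i j; apply: cint_ext (iF (delta_mx i ord0) (delta_mx j ord0)) => // x _.
rewrite -mulmxA -colE mxE (bigD1 i)//= big1 => [|k ki].
  by rewrite !mxE !eqxx rmorph1 mul1r addr0.
by rewrite !mxE (negbTE ki) rmorph0 mul0r.
Qed.

Let mul_real al f : cint f -> cint (fun x => rC (y al x) * f x).
Proof. by move=> fi; apply: cintM => //; apply: cbd_real. Qed.

(** Constant spinors give the quadratic term; a linear one against a constant adds the linear term;
    two linear ones add Q. Each is isolated by subtracting the earlier ones, multiplied by the
    bounded coordinates [y]. *)
Lemma sesq_integrable :
  (forall u v, cint (fun x => form x (const x u) (const x v))) ->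
  (forall al u v, cint (fun x => form x (lin x al u) (const x v))) ->
  (forall al be u v, cint (fun x => form x (lin x al u) (lin x be v))) ->
  [/\ mcint (fun x => \sum_al \sum_be adj (X x al) *m Q x al be *m X x be),
      forall al, mcint (fun x => \sum_be Q x al be *m X x be) &
      forall al be, mcint (fun x => Q x al be)].
Proof.
move=> i0 i1 i2.
pose Z x := \sum_al \sum_be adj (X x al) *m Q x al be *m X x be.
pose L al x := \sum_be Q x al be *m X x be.
have iZ : mcint Z.
  apply: mcint_entries => u v; apply: cint_ext (i0 u v) => // x _.
  by rewrite sesq_const.
have iL al : mcint (L al).
  apply: mcint_entries => u v.
  apply: (cint_ext mD _ (cintB mD (i1 al u v) (mul_real al (cint_entry u v iZ)))) => x _.
  rewrite (sesq_linear_const _ _ _ _ _ (conjc_rc (y al x))) mxE [X in _ + X - _]mxE addrK.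
  by [].
split=> // al be; apply: mcint_entries => u v.
have iA := mcint_adj mD (iL be).
apply: (cint_ext mD _ (cintB mD (cintB mD (i2 al be u v) (mul_real al (cint_entry u v iA)))
  (mul_real be (cintD mD (cint_entry u v (iL al)) (mul_real al (cint_entry u v iZ)))))) => x _.
have -> := @sesq_linear_linear _ (cj R) _ _ (Q x) (X x) (adjQ x) al be (rC (y al x)) (rC (y be x)) u v
  (conjc_rc _).
move: (adj u *m Q x al be *m v) => m1.
rewrite -/(L be x) -/(L al x) -/(Z x).
move: (adj u *m adj (L be x) *m v) (adj u *m L al x *m v) (adj u *m Z x *m v) => m2 m3 m4.
by rewrite !mxE addrAC addrK addrK.
Qed.

End sesquilinear_integrability.

(** * Integrability of the coefficients is necessary *)

Section forward.
Variables (R : realType) (n : nat) (gamma : 'I_n -> 'M[R[i]]_(spinor_dim n)).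
Hypothesis hgamma : is_clifford gamma.
Variables (M : manifold R n) (P : SO_reduction M) (S : spin_structure gamma P).
Variables (g : singular_metric P).
Variables (dvol : {measure set (mleb M) -> \bar R}) (hdvol : is_dvol g dvol).
Local Notation covs s := (@cov _ _ _ _ _ S \o s).

Lemma jac_id (f : P) c : atlas c -> dom c (proj f) -> jac c c (proj f) = 1%:M.
Proof.
move=> ac cf; have e := tau_trans g ac ac cf cf; have u := tau_unit g ac cf.
by rewrite -(mulmxK u (jac c c (proj f))) -e mulmxV.
Qed.

Lemma smooth_trmx W (A : M -> 'M[R]_n) : (forall i j, smooth_fun W (fun z => A z i j)) ->
  forall i j, smooth_fun W (fun z => (A z)^T i j).
Proof.
move=> sA i j; rewrite (_ : (fun z => _) = fun z => A z j i) //.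
by apply/funext => z; rewrite mxE.
Qed.

Lemma dpart_trmx c mu (A : M -> 'M[R]_n) x :
  (\matrix_(k, l) dpart c mu (fun z => (A z)^T k l) x) =
  (\matrix_(k, l) dpart c mu (fun z => A z k l) x)^T.
Proof.
by apply/matrixP => k l; rewrite !mxE; apply: dpart_ext => z; rewrite mxE.
Qed.

(** A frame need not lift to PSpin(M), but near each point it differs by a smooth rotation [A] from
    one that does; the connection of the latter is the gauge transform by [A^T]. *)
Lemma adapted_spin_section c V (s : M -> P) w x0 : atlas c -> smooth_section V s -> V `<=` dom c ->
  V x0 -> connection_forms g c V s w -> (forall x, wanti w x) ->
  exists V1 s1 A, [/\ V1 x0 /\ V1 `<=` V, smooth_section V1 (s1 : M -> S),
    (forall x, SO (A x)) /\ (forall x, V1 x -> s x = act (cov (s1 x)) (A x)),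
    (forall i j, smooth_fun V1 (fun x => A x i j)) &
    exists w1, [/\ connection_forms g c V1 (covs s1) w1, forall x, V1 x -> wanti w1 x &
      forall x, V1 x -> forall mu, wmx w1 x mu = A x *m wmx w x mu *m (A x)^T +
        A x *m (\matrix_(k, l) dpart c mu (fun z => A z k l) x)^T]].
Proof.
move=> ac ss Vc Vx cw aw.
have [V1 [s1 [oV1 V1x V1V ss1]]] := @local_section _ _ _ _ _ _ _ S (@smooth_cfun_sub R n M) _ _ (section_open ss) Vx.
have sc := cov_section ss1.
have [A0 [AP sA]] := so_compare sc ss.
(* The default 1 makes [A] orthogonal, and the rotated gammas Clifford, at every point of M. *)
pose A x := if pselect (V1 x) then A0 x else 1%:M.
have AE x : V1 x -> A x = A0 x by rewrite /A; case: pselect.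
have V1A x : V1 x -> s x = act (cov (s1 x)) (A x).
  by move=> V1x'; rewrite AE//; apply: (AP x V1x' (V1V _ V1x')).2.
have SOA x : SO (A x).
  rewrite /A; case: (pselect (V1 x)) => /= [V1x'|_]; first exact: (AP x V1x' (V1V _ V1x')).1.
  by split; rewrite ?trmx1 ?mulmx1 ?det1.
have sA1 i j : smooth_fun V1 (fun x => A x i j).
  apply: (@smooth_fun_ext _ _ _ _ (fun x => A0 x i j)) => // [x V1x'|]; first by rewrite AE.
  by apply: smooth_fun_sub (sA i j) => x Vx'; split=> //; exact: V1V.
have V1c := subset_trans V1V Vc.
have wE x : V1 x -> forall mu, wmx (wchange c c (fun z => (A z)^T) w) x mu =
    A x *m wmx w x mu *m (A x)^T + A x *m (\matrix_(k, l) dpart c mu (fun z => A z k l) x)^T.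
  move=> V1x' mu; apply/matrixP => i j.
  have e : jac c c x = 1%:M.
    by rewrite -(section_proj ss (V1V _ V1x')); apply: jac_id => //; rewrite (section_proj ss (V1V _ V1x')); exact: V1c.
  have sum1 : \sum_al jac c c x mu al *: wmx w x al = wmx w x mu.
    rewrite e (bigD1 mu)//= big1 ?addr0 => [|al /negbTE ne]; first by rewrite mxE eqxx scale1r.
    by rewrite mxE eq_sym ne scale0r.
  by rewrite mxE /wchange trmxK dpart_trmx sum1.
exists V1, s1, A; split=> //; exists (wchange c c (fun z => (A z)^T) w); split=> //.
- apply: (connection_change hdvol ac ac ss Vc sc V1V V1c _ _ cw); last exact: smooth_trmx.
  move=> x V1x'; rewrite V1A//; split; first exact/SO_trmx/SOA.
  by rewrite actM//; [have [-> _] := SOA x; rewrite act1|exact/SO_trmx/SOA].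
- move=> x V1x' mu; rewrite (wE _ V1x') linearD /= !trmx_mul !trmxK aw mulNmx mulmxN.
  have SA z : V1 z -> SO (A z)^T by move=> _; exact/SO_trmx/SOA.
  have := dpart_orth mu ac oV1 V1c V1x' SA (smooth_trmx sA1).
  rewrite /= trmxK dpart_trmx trmx_mul trmxK => ->.
  by rewrite opprD mulmxA.
Qed.

Lemma smooth_rot W (A : M -> 'M[R]_n) k : open W -> (forall i j, smooth_fun W (fun z => A z i j)) ->
  smooth_mx W (fun z => rot (rc R) gamma (A z) k).
Proof.
move=> oW sA i j.
have H : smooth_cfun W (fun z => \sum_l rc R (A z l k) * gamma l i j).
  apply: smooth_cfun_sum => // l; apply: smooth_cfunM => //; last exact: smooth_cfun_cst.
  exact: smooth_cfun_real.
apply: smooth_cfun_ext H => // z _; rewrite /rot summxE.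
by apply: eq_bigr => l _; rewrite [RHS]mxE.
Qed.

Lemma smooth_gprod W (ga : M -> 'I_n -> 'M[R[i]]_(spinor_dim n)) s : open W ->
  (forall k, smooth_mx W (fun z => ga z k)) -> smooth_mx W (fun z => gprod (ga z) s).
Proof.
move=> oW sg; elim: s => [|k s IH]; first exact: smooth_mx_cst.
exact: (smooth_mxM oW (sg k) IH).
Qed.

Lemma smooth_G2 W (ga : M -> 'I_n -> 'M[R[i]]_(spinor_dim n)) a b : open W ->
  (forall k, smooth_mx W (fun z => ga z k)) -> smooth_mx W (fun z => G2 (ga z) a b).
Proof.
by move=> oW sg; rewrite /G2; case: (a == b); [exact: smooth_mx_cst|exact: smooth_gprod].
Qed.

Lemma smooth_G4 W (ga : M -> 'I_n -> 'M[R[i]]_(spinor_dim n)) a b c d : open W ->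
  (forall k, smooth_mx W (fun z => ga z k)) -> smooth_mx W (fun z => G4 (ga z) a b c d).
Proof.
by move=> oW sg; rewrite /G4; case: (uniq [:: a; b; c; d]); [exact: smooth_gprod|exact: smooth_mx_cst].
Qed.

Lemma gg2_bounded (D : set M) (X : M -> 'M[R]_n) :
  (forall a b, rbd (D : set (mleb M)) (fun x => X x a b)) ->
  mcbd (D : set (mleb M)) (fun x => gg2 (rc R) gamma (X x)).
Proof.
move=> bX.
rewrite (_ : (fun x => _) = fun x => \sum_(ab : 'I_n * 'I_n)
    rc R (X x ab.1 ab.2) *: (4^-1 *: (gamma ab.1 *m gamma ab.2))).
  by apply: (@mcbd_sum_real _ (mleb M) R) => ab; exact: bX.
apply/funext => x; rewrite /gg2 pair_bigA scaler_sumr; apply: eq_bigr => ab _.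
by rewrite !scalerA mulrC.
Qed.

Lemma well_defined_integrable eta psi c V s (W : set M) w : well_defined g dvol eta psi ->
  atlas c -> smooth_section V (s : M -> S) -> V `<=` dom c -> W `<=` V -> measurable (W : set (mleb M)) ->
  connection_forms g c V (covs s) w ->
  cint dvol (W : set (mleb M)) (integrand g c s w eta psi).
Proof.
move=> [F [Fae Fr Fi]] ac ss Vc WV mW cw.
apply: (cint_ae (f := F) hdvol ac (cov_section ss) Vc WV mW).
  exact: (ae_on_sub WV (Fae _ _ _ _ ac ss Vc cw)).
by split; apply: (@rint_sub _ _ _ _ _ setT).
Qed.

Lemma integrand_sesq c W (sP : M -> P) s A w w1 (eta psi : S -> 'cV[R[i]]_(spinor_dim n)) x :
  atlas c -> W `<=` dom c -> W x ->
  smooth_section W s -> SO (A x) -> sP x = act (cov (s x)) (A x) -> wanti w x -> wanti w1 x ->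
  (forall mu, wmx w1 x mu = A x *m wmx w x mu *m (A x)^T +
    A x *m (\matrix_(k, l) dpart c mu (fun z => A z k l) x)^T) ->
  let ga := rot (rc R) gamma (A x) in
  let nc (psi : S -> 'cV[R[i]]_(spinor_dim n)) mu := dmx c x mu (fun z => psi (s z)) +
    (gg2 (rc R) gamma (A x *m (\matrix_(k, l) dpart c mu (fun z => A z k l) x)^T) +
     Om0 (rc R) (w x) ga mu) *m psi (s x) in
  integrand g c s w1 eta psi x =
  sesq (cj R) (Qm (rc R) (dual_frame g c sP x) ga) (nc eta) (nc psi) ord0 ord0.
Proof.
move=> ac Wc Wx ss SA sPE aw aw1 w1E ga nc.
pose nc' (psi : S -> 'cV[R[i]]_(spinor_dim n)) mu := dmx c x mu (fun z => psi (s z)) +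
  (gg2 (rc R) ga (wmx w x mu) +
   gg2 (rc R) gamma (A x *m (\matrix_(k, l) dpart c mu (fun z => A z k l) x)^T)) *m psi (s x).
have E phi mu : nc' phi mu = nc phi mu.
  rewrite /nc' /nc; apply: (congr1 (fun m => _ + m *m _)); exact: addrC.
have H : integrand g c s w1 eta psi x =
    sesq (cj R) (Qm (rc R) (dual_frame g c sP x) ga) (nc' eta) (nc' psi) ord0 ord0.
  exact: (integrand_frame hgamma g eta psi ac Wc Wx ss SA sPE aw aw1 w1E).
apply: (etrans H); apply: (congr1 (fun m : 'M[R[i]]_1 => m ord0 ord0)).
exact: (@sesq_ext _ (cj R) _ _ (Qm (rc R) (dual_frame g c sP x) ga) (nc' eta) (nc eta) (nc' psi) (nc psi)).
Qed.

End forward.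

Section forward_local.
Variables (R : realType) (n : nat) (gamma : 'I_n -> 'M[R[i]]_(spinor_dim n)).
Hypothesis hgamma : is_clifford gamma.
Variables (M : manifold R n) (P : SO_reduction M) (S : spin_structure gamma P).
Variables (g : singular_metric P).
Variables (dvol : {measure set (mleb M) -> \bar R}) (hdvol : is_dvol g dvol).
Hypothesis WD : forall eta psi : S -> 'cV[R[i]]_(spinor_dim n),
  compact_spinor eta -> compact_spinor psi -> well_defined g dvol eta psi.

(** Test spinors on a plateau neighbourhood give Q and the connection terms for the lifted frame;
    the bounded correction [B] is then removed, and traces against the rotated, still bounded,
    gammas yield the scalar coefficients. *)
Lemma forward_local c V (s : M -> P) w x0 : atlas c -> smooth_section V s -> V `<=` dom c ->
  V x0 -> connection_forms g c V s w -> (forall x, wanti w x) ->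
  exists W, [/\ open W /\ W x0, W `<=` V, measurable (W : set (mleb M)) &
    let e := dual_frame g c s in
    let D := (W : set (mleb M)) in
    [/\ coef_Q dvol D e, coef_C dvol D e w & coef_W dvol D e w]].
Proof.
move=> ac ss Vc Vx cw aw.
have [V1 [s1 [A [[V1x V1V] ss1 [SOA AP] sA [w1 [cw1 aw1 w1E]]]]]] :=
  adapted_spin_section S hdvol ac ss Vc Vx cw aw.
have oV1 := bundle_open ss1; have V1c := subset_trans V1V Vc.
have [W [K [chi [[oW Wx] [WK KV1] cK tchi chi1]]]] := local_box oV1 V1c V1x.
have WV1 := subset_trans WK KV1; have Wc := subset_trans WV1 V1c.
have mcW : measurable (coord c @` W : set (Rn_leb R n)) by apply: measurable_open; exact: coord_open.
have mW : measurable (W : set (mleb M)) by exact: measurable_open_chart ac Wc oW.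
exists W; split=> //; first exact: subset_trans WV1 V1V.
move=> e D.
have anti x a b al : w x a b al = - w x b a al.
  by have /matrixP/(_ b a) := aw x al; rewrite !mxE.
pose ga x := rot (rc R) gamma (A x).
have cga x : clifford (cj R) (ga x).
  exact: (rot_clifford (@conjc_rc R) (cliffordE hgamma) (SO_inv (SOA x))).
have sga k : smooth_mx V1 (fun x => ga x k) by exact: smooth_rot.
have N0 : (0 < spinor_dim n)%N by rewrite expn_gt0.
have G2b a b : mcbd D (fun x => adjmx (cj R) (G2 (ga x) a b)).
  apply: (mcbd_smooth ac oV1 V1c cK KV1 WK mcW); exact/(smooth_mx_adj oV1)/smooth_G2.
have G4b a b a' b' : mcbd D (fun x => adjmx (cj R) (G4 (ga x) a b a' b')).
  apply: (mcbd_smooth ac oV1 V1c cK KV1 WK mcW); exact/(smooth_mx_adj oV1)/smooth_G4.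
pose dA mu x := \matrix_(k, l) dpart c mu (fun z => A z k l) x.
pose B mu x := gg2 (rc R) gamma (A x *m (dA mu x)^T).
have Bb mu : mcbd D (B mu).
  apply: gg2_bounded => // a b.
  rewrite (_ : (fun x => _) = fun x => \sum_k A x a k * dpart c mu (fun z => A z b k) x); last first.
    by apply/funext => x; rewrite mxE; apply: eq_bigr => k _; rewrite !mxE.
  apply: (@rbd_sum _ (mleb M) R) => k; apply: (@rbdM _ (mleb M) R); first exact: (rbd_smooth ac oV1 V1c cK KV1 WK mcW (sA a k)).
  exact: (rbd_dpart ac oV1 V1c cK KV1 WK mcW mu (sA b k)).
have aBb mu : mcbd D (fun x => adjmx (cj R) (B mu x)) by exact: mcbd_adj.
pose Q x := Qm (rc R) (e x) (ga x).
have adjQ x al be : adjmx (cj R) (Q x al be) = Q x be al.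
  exact: (adj_Qm (rc := rc R) (@conjc_rc R) (e x) (cga x) al be).
pose X x mu := B mu x + Om0 (rc R) (w x) (ga x) mu.
pose nc (psi : S -> 'cV[R[i]]_(spinor_dim n)) x mu := dmx c x mu (fun z => psi (s1 z)) + X x mu *m psi (s1 x).
have form eta psi : compact_spinor eta -> compact_spinor psi ->
    cint dvol D (fun x => sesq (cj R) (Q x) (nc eta x) (nc psi x) ord0 ord0).
  move=> ce cp; have := well_defined_integrable hdvol (WD ce cp) ac ss1 V1c WV1 mW cw1.
  apply: cint_ext => // x Dx; have V1x' := WV1 _ Dx.
  exact: (integrand_sesq hgamma g eta psi ac V1c V1x' ss1 (SOA x) (AP _ V1x') (aw x) (aw1 _ V1x') (w1E _ V1x')).
pose y al (x : M) := coord c x ord0 al.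
have yb al : rbd D (y al) by exact: (rbd_coord ac oV1 V1c cK KV1 WK mcW).
pose cs u := test_spinor c V1 s1 chi u.
pose ls al u := test_spinor c V1 s1 (fun y => y ord0 al * chi y) u.
have ccs u : compact_spinor (cs u) by exact: (test_spinor_compact hgamma ac ss1 V1c).
have cls al u : compact_spinor (ls al u).
  apply: (test_spinor_compact hgamma ac ss1 V1c); apply: test_mul => //; first exact: coord_open.
  by move=> k; exact: Ck_on_coord.
have ncs u x mu : D x -> nc (cs u) x mu = X x mu *m u.
  move=> Dx; have [e1 e2] : cs u (s1 x) = u /\ dmx c x mu (fun z => cs u (s1 z)) = 0 := test_spinor_const ss1 V1c oW WV1 chi1 u mu Dx.
  by rewrite /nc e1 e2 add0r.
have nls al u x mu : D x -> nc (ls al u) x mu = (al == mu)%:R *: u + X x mu *m (rc R (y al x) *: u).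
  move=> Dx; have [e1 e2] : ls al u (s1 x) = rc R (y al x) *: u /\
      dmx c x mu (fun z => ls al u (s1 z)) = (al == mu)%:R *: u := test_spinor_linear ac ss1 V1c oW WV1 chi1 u al mu Dx.
  by rewrite /nc e1 e2.
have [iZ iL iQ] : [/\ mcint dvol D (fun x => \sum_al \sum_be adjmx (cj R) (X x al) *m Q x al be *m X x be),
      forall al, mcint dvol D (fun x => \sum_be Q x al be *m X x be) &
      forall al be, mcint dvol D (fun x => Q x al be)].
  apply: (sesq_integrable mW adjQ yb) => [u v|al u v|al be u v].
  - apply: cint_ext (form _ _ (ccs u) (ccs v)) => // x Dx; apply: (congr1 (fun m : 'M[R[i]]_1 => m ord0 ord0)).
    by apply: sesq_ext => mu; exact: ncs.
  - apply: cint_ext (form _ _ (cls al u) (ccs v)) => // x Dx; apply: (congr1 (fun m : 'M[R[i]]_1 => m ord0 ord0)).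
    by apply: sesq_ext => mu; [exact: nls|exact: ncs].
  - apply: cint_ext (form _ _ (cls al u) (cls be v)) => // x Dx; apply: (congr1 (fun m : 'M[R[i]]_1 => m ord0 ord0)).
    by apply: sesq_ext => mu; exact: nls.
have iC al := mcint_Clin_of mW Bb iQ (iL al).
split; first exact: (coef_of_Q mW cga N0 G2b iQ).
  exact: (coef_of_C mW anti cga N0 G2b G4b iC).
apply: (coef_of_W mW anti cga N0 G4b); exact: (mcint_Wquad_of mW anti cga Bb aBb iQ iC iZ).
Qed.

End forward_local.

Section coefficients_on.
Variables (R : realType) (n : nat) (M : manifold R n) (P : SO_reduction M) (g : singular_metric P).
Variables (dvol : {measure set (mleb M) -> \bar R}) (hdvol : is_dvol g dvol).
Implicit Types (e : M -> 'I_n -> 'I_n -> R) (w : M -> 'I_n -> 'I_n -> 'I_n -> R).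

Definition coefs_on (D : set (mleb M)) e w :=
  [/\ coef_Q dvol D e, coef_C dvol D e w & coef_W dvol D e w].

(** All coefficients are functions [F] of the values of the frame and connection at a point, so an
    operation on integrable functions that is valid for every [F] carries the whole list along. *)
Lemma coefs_lift (D E G : set (mleb M)) e w w' :
  (forall F : ('I_n -> 'I_n -> R) -> ('I_n -> 'I_n -> 'I_n -> R) -> R,
    rint dvol D (fun x => F (e x) (w x)) -> rint dvol E (fun x => F (e x) (w x)) ->
    rint dvol G (fun x => F (e x) (w' x))) ->
  coefs_on D e w -> coefs_on E e w -> coefs_on G e w'.
Proof.
move=> H [q [c1 c2 c3] [w1 w2]] [q' [c1' c2' c3'] [w1' w2']]; split.
- move=> c d al be.
  exact: (H (fun f _ => f c al * f d be - f d al * f c be) (q c d al be) (q' c d al be)).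
- split=> [al|a b al|a b c d al].
  + exact: (H (fun f v => coefC1 f v al) (c1 al) (c1' al)).
  + exact: (H (fun f v => coefC2 f v al a b) (c2 a b al) (c2' a b al)).
  + exact: (H (fun f v => coefC3 f v al a b c d) (c3 a b c d al) (c3' a b c d al)).
- split=> [|a b c d]; first exact: (H (fun f v => coefW1 f v) w1 w1').
  exact: (H (fun f v => coefW2 f v a b c d) (w2 a b c d) (w2' a b c d)).
Qed.

Lemma coefs_local c V (e : M -> 'I_n -> 'I_n -> R) w (K : set M) : atlas c -> V `<=` dom c ->
  compact K -> K `<=` V ->
  (forall x, V x -> exists W : set M, [/\ open W, W x, measurable (W : set (mleb M)) &
    coefs_on W e w]) -> coefs_on K e w.
Proof.
move=> ac Vc cK KV loc.
pose Q (U : set M) := measurable (U : set (mleb M)) /\ coefs_on U e w.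
have [||x /KV/loc[W [oW Wx mW cW]]|U KU [mU cU]] := compact_union_ind (Q := Q) cK.
- split; first exact: measurable0.
  have r0 f : rint dvol set0 f by exact: integrable_set0.
  by split; [move=> *|split=> *|split=> *]; exact: r0.
- move=> U V' [mU cU] [mV' cV']; split; first exact: measurableU.
  by apply: coefs_lift cU cV' => F; exact: rint_union.
- by exists W.
have mK : measurable (K : set (mleb M)) by exact: (measurable_compact_chart ac (subset_trans KV Vc)).
by apply: coefs_lift (cU) (cU) => F fU _; exact: rint_sub fU.
Qed.

Lemma coefs_ae c V (s : M -> P) (K : set M) e w w' : atlas c -> smooth_section V s -> V `<=` dom c ->
  K `<=` V -> measurable (K : set (mleb M)) ->
  ae_on V (fun x => forall i j mu, w x i j mu = w' x i j mu) ->
  coefs_on K e w -> coefs_on K e w'.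
Proof.
move=> ac ss Vc KV mK ww' cK; apply: coefs_lift (cK) (cK) => F fK _.
apply: (integrable_ae_eq hdvol ac ss Vc KV mK _ fK).
apply: ae_on_impl (ae_on_sub KV ww') => x _ h; congr (F _ _).
by apply/funext => i; apply/funext => j; apply/funext => mu.
Qed.

End coefficients_on.

Section forward_global.
Variables (R : realType) (n : nat) (gamma : 'I_n -> 'M[R[i]]_(spinor_dim n)).
Hypothesis hgamma : is_clifford gamma.
Variables (M : manifold R n) (P : SO_reduction M) (S : spin_structure gamma P).
Variables (g : singular_metric P).
Variables (dvol : {measure set (mleb M) -> \bar R}) (hdvol : is_dvol g dvol).

Lemma coefs_of_well_defined :
  (forall eta psi : S -> 'cV[R[i]]_(spinor_dim n), compact_spinor eta -> compact_spinor psi ->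
    well_defined g dvol eta psi) ->
  forall c V (s : M -> P) w K, atlas c -> smooth_section V s -> V `<=` dom c ->
  connection_forms g c V s w -> compact K -> K `<=` V ->
  coefs_on dvol K (dual_frame g c s) w.
Proof.
move=> WD c V s w K ac ss Vc cw cK KV.
have [w' [cw' aw' ww']] := connection_anti cw.
have mK : measurable (K : set (mleb M)) by exact: (measurable_compact_chart ac (subset_trans KV Vc)).
apply: (coefs_ae hdvol ac ss Vc KV mK ww').
apply: (coefs_local ac Vc cK KV) => x Vx.
have [W [[oW Wx] WV mW cW]] := forward_local hgamma hdvol WD ac ss Vc Vx cw' aw'.
by exists W.
Qed.

End forward_global.

(** * Integrability of the coefficients is sufficient *)

Section backward.
Variables (R : realType) (n : nat) (gamma : 'I_n -> 'M[R[i]]_(spinor_dim n)).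
Hypothesis hgamma : is_clifford gamma.
Variables (M : manifold R n) (P : SO_reduction M) (S : spin_structure gamma P).
Variables (g : singular_metric P).
Variables (dvol : {measure set (mleb M) -> \bar R}) (hdvol : is_dvol g dvol).
Local Notation covs s := (@cov _ _ _ _ _ S \o s).
Local Notation spinor := (S -> 'cV[R[i]]_(spinor_dim n)).

(** [quad_split] for actual spinors: each term is a coefficient matrix between smooth factors. *)
Lemma integrand_split c s w (eta psi : spinor) x : wanti w x ->
  let e := dual_frame g c (covs s) x in
  let Cl mu := Clin gamma (fun a b d => rc R (frame_om e (w x) a b d)) (fun a => rc R (e a mu)) in
  let p mu := dmx c x mu (fun z => eta (s z)) in
  let q mu := dmx c x mu (fun z => psi (s z)) in
  integrand g c s w eta psi x =
  (\sum_mu \sum_nu adjmx (cj R) (p mu) *m Qm (rc R) e gamma mu nu *m q nu +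
   \sum_mu adjmx (cj R) (p mu) *m Cl mu *m psi (s x) +
   \sum_nu adjmx (cj R) (eta (s x)) *m adjmx (cj R) (Cl nu) *m q nu -
   adjmx (cj R) (eta (s x)) *m Wquad gamma (fun a b d => rc R (frame_om e (w x) a b d)) *m psi (s x))
   ord0 ord0.
Proof.
move=> aw e Cl p q; apply: (etrans (integrandE g c s w eta psi x)).
have anti a b al : w x a b al = - w x b a al by have /matrixP/(_ b a) := aw al; rewrite !mxE.
have nE phi a : nabla g c s w phi a x = \sum_mu rc R (e a mu) *:
    (dmx c x mu (fun z => phi (s z)) + Om0 (rc R) (w x) gamma mu *m phi (s x)).
  by apply: eq_bigr => mu _; rewrite nabla_coordE.
apply: (congr1 (fun m : 'M[R[i]]_1 => m ord0 ord0)).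
apply: etrans (quad_split (rc := rc R) (@conjc_rc R) e (cliffordE hgamma) anti p q (eta (s x)) (psi (s x))).
pose nc (phi : spinor) mu := dmx c x mu (fun z => phi (s z)) + Om0 (rc R) (w x) gamma mu *m phi (s x).
have H : quad (cj R) gamma (nabla g c s w eta ^~ x) (nabla g c s w psi ^~ x) =
    quad (cj R) gamma (fun a => \sum_mu rc R (e a mu) *: nc eta mu) (fun a => \sum_mu rc R (e a mu) *: nc psi mu).
  by apply: quad_ext => a; exact: nE.
apply: (etrans H).
exact: (quad_frame (rc := rc R) (@conjc_rc R) (invmx (tau g (covs s x) c)) (nc eta) (nc psi) (cliffordE hgamma)).
Qed.

(** The complement of the closed support is open, so both [psi] and its derivatives vanish at
    [x]. *)
Lemma integrand_off c V s w (eta psi : spinor) x : smooth_section V s -> V `<=` dom c ->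
  V x -> ~ closure [set x | exists2 p, proj p = x & psi p <> 0] x ->
  integrand g c s w eta psi x = 0.
Proof.
move=> ss Vc Vx nKx; set K := closure _ in nKx.
have oV := bundle_open ss.
pose W := V `&` ~` K; have oW : open W.
  by apply: openI => //; apply: closed_openC; exact: closed_closure.
have Wx : W x by [].
have Wc : W `<=` dom c by move=> z [/Vc].
have z0 z : W z -> psi (s z) = 0.
  move=> [Vz nKz]; apply: contrapT => nz; apply: nKz; apply: subset_closure.
  by exists (s z) => //; exact: bundle_proj ss Vz.
have nc0 mu : nabla_coord c s w psi mu x = 0.
  rewrite /nabla_coord z0//; under eq_bigr do under eq_bigr do rewrite mulmx0 scaler0.
  rewrite big1 => [|? _]; last by rewrite big1.
  rewrite scaler0 addr0; apply/matrixP => k j; rewrite !mxE.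
  rewrite (cpartial_ext (v := cst 0) mu oW Wc Wx) ?cpartial_cst// => z Wz.
  by rewrite z0// mxE.
have n0 i : nabla g c s w psi i x = 0.
  by rewrite /nabla big1// => mu _; rewrite nc0 scaler0.
have h0 u : herm u (0 : 'cV[R[i]]_(spinor_dim n)) = 0.
  by rewrite /herm big1// => k _; rewrite mxE mulr0.
have d0 : dirac g c s w psi x = 0.
  by rewrite /dirac big1 ?scaler0// => i _; rewrite n0 mulmx0.
rewrite /integrand d0 h0 sub0r.
by rewrite big1 ?oppr0// => i _; rewrite n0 h0.
Qed.

Hypothesis coefs : forall c V (s : M -> P) w K, atlas c -> smooth_section V s -> V `<=` dom c ->
  connection_forms g c V s w -> compact K -> K `<=` V -> coefs_on dvol K (dual_frame g c s) w.

Variables (eta psi : spinor).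
Hypotheses (ceta : compact_spinor eta) (cpsi : compact_spinor psi).

(** The local form of the first clause of [well_defined], so that representatives can be glued. *)
Definition represents (U : set M) (F : M -> R[i]) := forall c V s w, atlas c -> smooth_section V s ->
  V `<=` dom c -> connection_forms g c V (covs s) w ->
  ae_on (V `&` U) (fun x => F x = integrand g c s w eta psi x).

(** In other data the connection is a.e. the transformed one, by [connection_change] and
    [connection_unique]; there [integrand_change] equates the two integrands. *)
Lemma integrand_represents c V s w W : atlas c -> smooth_section V s -> V `<=` dom c ->
  connection_forms g c V (covs s) w -> (forall x, wanti w x) -> open W -> W `<=` V ->
  represents W (integrand g c s w eta psi).
Proof.
move=> ac ss Vc cw aw oW WV d V' s' w' ad ss' Vd' cw'; set O := V' `&` W.
have oO : open O by apply: openI => //; exact: bundle_open ss'.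
have OV : O `<=` V by move=> x [_ /WV].
have OV' : O `<=` V' by move=> x [].
have [t [A [tP st sA]]] := spin_compare_cov hgamma ss ss'.
have sO : smooth_section O s := section_sub (@smooth_cfun_sub R n M) oO OV ss.
have sO' : smooth_section O (covs s') := section_sub (@smooth_fun_sub R n M) oO OV' (cov_section ss').
have OVV' : O `<=` V `&` V' by move=> x Ox; split; [exact: OV|exact: OV'].
have Od : O `<=` dom d by exact: subset_trans OV' Vd'.
have sAO i j : smooth_fun O (fun x => A x i j) by apply: smooth_fun_sub OVV' (sA i j).
have tO z : O z -> [/\ Spin gamma (t z), s' z = act (s z) (t z), SO (A z) &
      spin_covers gamma (t z) (A z)].
  by move=> Oz; have [] := tP _ (OV _ Oz) (OV' _ Oz).
have sc : spin_change O s s' t A.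
  by split=> // i j; apply: smooth_cfun_sub OVV' (st i j).
have AO x : O x -> SO (A x) /\ (covs s') x = act ((covs s) x) (A x).
  by move=> Ox; have [] := tP _ (OV _ Ox) (OV' _ Ox).
have cO := connection_change hdvol ac ad (cov_section ss) Vc sO' OV Od AO sAO cw.
have cO' := connection_sub ad (cov_section ss') Vd' oO OV' cw'.
have eqw := connection_unique hdvol ad sO' Od cO' cO.
apply: ae_on_impl (ae_onI eqw (connection_wanti cO')) => x Ox [wE aw'].
apply/esym; apply: (integrand_change hgamma g ac ad _ Ox sO sc ceta cpsi (aw x) aw').
  by move=> z Oz; split; [apply: Vc; exact: OV|exact: Od].
by move=> mu; apply/matrixP => i j; rewrite mxE wE.
Qed.

Lemma backward_local x0 : exists W : set M, [/\ open W, W x0 &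
  exists F, [/\ measurable (W : set (mleb M)), cint dvol (W : set (mleb M)) F & represents W F]].
Proof.
have [c ac cx] := atlas_cover x0.
have [V1 [s1 [oV1 V1x V1c ss1]]] := local_section S (@smooth_cfun_sub R n M) (dom_open c) cx.
have [w0 cw0] := connection_exists g ac (cov_section ss1) V1c.
have [w [cw aw _]] := connection_anti cw0.
have [W [K [chi [[oW Wx] [WK KV1] cK _ _]]]] := local_box oV1 V1c V1x.
have WV1 := subset_trans WK KV1; have Wc := subset_trans WV1 V1c.
have mcW : measurable (coord c @` W : set (Rn_leb R n)) by apply: measurable_open; exact: coord_open.
have mW : measurable (W : set (mleb M)) by exact: measurable_open_chart ac Wc oW.
have mK : measurable (K : set (mleb M)) by exact: (measurable_compact_chart ac (subset_trans KV1 V1c)).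
exists W; split=> //; exists (integrand g c s1 w eta psi); split=> //; last first.
  exact: (integrand_represents ac ss1 V1c cw aw oW WV1).
have [iq ic iw] : coefs_on dvol W (dual_frame g c (covs s1)) w.
  have cK' := coefs ac (cov_section ss1) V1c cw cK KV1.
  by apply: coefs_lift (cK') (cK') => F fK _; exact: rint_sub fK.
have anti x a b al : w x a b al = - w x b a al by have /matrixP/(_ b a) := aw x al; rewrite !mxE.
have cg := cliffordE hgamma.
have sm (phi : spinor) : compact_spinor phi -> smooth_mx V1 (fun z => phi (s1 z)).
  by move=> cphi; exact: compact_spinor_smooth.
have b0 (phi : spinor) (cphi : compact_spinor phi) := mcbd_smooth ac oV1 V1c cK KV1 WK mcW (sm _ cphi).
have b1 (phi : spinor) mu (cphi : compact_spinor phi) := mcbd_dmx ac oV1 V1c cK KV1 WK mcW mu (sm _ cphi).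
have iC al := mcint_Clin mW anti cg al ic.
have H := mcintB mW (mcintD mW (mcintD mW
  (mcint_sum mW (fun al => mcint_sum mW (fun be =>
    mcintMr mW (b1 _ be cpsi) (mcintMl mW (mcbd_adj (b1 _ al ceta)) (mcint_Qm mW cg al be iq)))))
  (mcint_sum mW (fun al => mcintMr mW (b0 _ cpsi) (mcintMl mW (mcbd_adj (b1 _ al ceta)) (iC al)))))
  (mcint_sum mW (fun be => mcintMr mW (b1 _ be cpsi)
    (mcintMl mW (mcbd_adj (b0 _ ceta)) (mcint_adj mW (iC be))))))
  (mcintMr mW (b0 _ cpsi) (mcintMl mW (mcbd_adj (b0 _ ceta)) (mcint_Wquad mW anti cg iw))).
apply: (cint_ext mW _ (H ord0 ord0)) => x _.
exact/esym/integrand_split.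
Qed.

(** Local representatives are glued over a finite cover of the compact support of [psi]; on overlaps
    any choice is right a.e. Outside the cover the integrand is 0. *)
Lemma well_defined_of_coefs : well_defined g dvol eta psi.
Proof.
set K := closure [set x | exists2 p, proj p = x & psi p <> 0].
have cK : compact K by case: cpsi.
pose Q (U : set M) := exists F,
  [/\ measurable (U : set (mleb M)), cint dvol (U : set (mleb M)) F & represents U F].
have [||x _|U KU [F [mU iF rF]]] := compact_union_ind (Q := Q) cK.
- exists (fun=> 0); split; [exact: measurable0|by split; exact: integrable_set0|].
  by move=> c V s w *; rewrite setI0 => d ad; rewrite (_ : _ `&` _ = set0) ?image_set0 ?lebesgue_outer0//; apply/seteqP; split => // x [[]].
- move=> U U' [F [mU iF rF]] [F' [mU' iF' rF']].
  exists (fun x => if pselect (U x) then F x else F' x); split.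
  + exact: measurableU.
  + exact: cint_glue.
  + move=> c V s w ac ss Vc cw.
    apply: null_set_sub (null_set_union (rF _ _ _ _ ac ss Vc cw) (rF' _ _ _ _ ac ss Vc cw)).
    move=> x [[Vx UUx]] /=; case: pselect => [Ux ne|nUx ne]; first by left.
    by right; split=> //; split=> //; case: UUx.
- exact: backward_local.
exists (fun x => if pselect (U x) then F x else 0); split.
- move=> c V s w ac ss Vc cw; apply: null_set_sub (rF _ _ _ _ ac ss Vc cw).
  move=> x [Vx] /=; case: pselect => [Ux ne|nUx ne]; first by split.
  by exfalso; apply: ne; rewrite (integrand_off _ _ ss Vc Vx)// => /KU.
- by have [+ _] := cint_glue mU measurableT iF (cint0 dvol setT); rewrite setUT.
- by have [_ +] := cint_glue mU measurableT iF (cint0 dvol setT); rewrite setUT.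
Qed.

End backward.

Theorem theorem2 (R : realType) (n : nat)
    (gamma : 'I_n -> 'M[R[i]]_(spinor_dim n)) (hgamma : is_clifford gamma)
    (M : manifold R n) (P : SO_reduction M) (S : spin_structure gamma P)
    (g : singular_metric P)
    (dvol : {measure set (mleb M) -> \bar R}) (hdvol : is_dvol g dvol) :
  (forall eta psi : S -> 'cV[R[i]]_(spinor_dim n),
     compact_spinor eta -> compact_spinor psi ->
     well_defined g dvol eta psi)
  <->
  (forall (c : chart R n M) (V : set M) (s : M -> P)
      (w : M -> 'I_n -> 'I_n -> 'I_n -> R),
     atlas c -> smooth_section V s -> V `<=` dom c ->
     connection_forms g c V s w ->
     let L1 := L1loc dvol V in
     let e := dual_frame g c s in
     let om := omega_fr g c s w in
     (forall c d mu nu : 'I_n,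
        L1 (fun x => e x c mu * e x d nu - e x d mu * e x c nu))
     /\
     ((forall mu : 'I_n,
         L1 (fun x => \sum_a \sum_b \sum_nu
               (e x a mu * e x b nu - e x a nu * e x b mu) * w x a b nu)) /\
      (forall a b mu : 'I_n,
         L1 (fun x => - (\sum_d e x a mu * om x b d d)
                      + \sum_d e x b mu * om x a d d
                      + \sum_c e x c mu * om x c a b
                      - \sum_c e x c mu * om x c b a)) /\
      (forall c d f h mu : 'I_n,
         L1 (fun x =>
               Alt4 (fun c d f h => e x c mu * om x f h d) c d f h)))
     /\
     (L1 (fun x => \sum_a \sum_b \sum_c \sum_mu \sum_nu
            e x a mu * e x b nu *
            (w x a c mu * w x c b nu - w x a c nu * w x c b mu)) /\
      (forall m k p q : 'I_n,
         L1 (fun x =>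
               Alt4 (fun m k p q => \sum_r
                       (om x m r r * om x p q k - om x p q r * om x r k m
                        + om x m r p * om x r k q)) m k p q)))).
Proof.
split=> [WD c V s w ac ss Vc cw L1 e om|H eta psi ceta cpsi].
  have co K : compact K -> K `<=` V -> coefs_on dvol K e w.
    exact: (coefs_of_well_defined hgamma hdvol WD ac ss Vc cw).
  split; last split.
  - by move=> c' d mu nu K cK KV; have [q _ _] := co K cK KV; exact: q.
  - split; last split.
    + by move=> mu K cK KV; have [_ [i1 _ _] _] := co K cK KV; exact: i1.
    + by move=> a b mu K cK KV; have [_ [_ i2 _] _] := co K cK KV; exact: i2.
    + by move=> a b a' b' mu K cK KV; have [_ [_ _ i3] _] := co K cK KV; exact: i3.
  - split; first by move=> K cK KV; have [_ _ [i1 _]] := co K cK KV; exact: i1.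
    by move=> a b a' b' K cK KV; have [_ _ [_ i2]] := co K cK KV; exact: i2.
apply: (well_defined_of_coefs hgamma hdvol _ ceta cpsi) => c V s w K ac ss Vc cw cK KV.
have [q [[i1 [i2 i3]] [j1 j2]]] := H c V s w ac ss Vc cw.
split; [|split|split].
- by move=> a b mu nu; exact: (q a b mu nu K cK KV).
- by move=> mu; exact: (i1 mu K cK KV).
- by move=> a b mu; exact: (i2 a b mu K cK KV).
- by move=> a b a' b' mu; exact: (i3 a b a' b' mu K cK KV).
- exact: (j1 K cK KV).
- by move=> a b a' b'; exact: (j2 a b a' b' K cK KV).
Qed.
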